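(* Let $n\ge 3$ and $2\le p<n$. Then there exists $q_{loc}=q_{loc}(n,p)>p$ such that for each $q\in(p,q_{loc})$ and for all sufficiently large $\alpha$ we have $D^2\mathcal{Q}_{p,q,\alpha}(\mathbf{v}_\alpha;g,g)>0$ for any non-zero $g\in\mathcal{W}$.
   Context: $\Omega$ is the unit ball in $\mathbb{R}^n$, $S=\partial\Omega$ is the unit sphere, $(r,\theta)$ are spherical coordinates. $W^1_p(\Omega)$ is the Sobolev space of real-valued functions with $\|u\|^p_{W^1_p(\Omega)}=\int_\Omega(|\nabla u|^p+|u|^p)\,dx$; $W^1_{p,rad}(\Omega)$ is its subspace of radially symmetric functions. For $1<p<n$ put $p^*=\frac{np}{n-p}$. For $\alpha>0$, $$\mathcal{Q}_{p,q,\alpha}(u)=\frac{\int_\Omega(|\nabla u|^p+|u|^p)\,dx}{\left(\int_\Omega|x|^\alpha|u|^q\,dx\right)^{p/q}}.$$ For $q\in\left(p,p^*+\frac{p\alpha}{n-p}\right)$ this functional attains a positive minimum on $W^1_{p,rad}(\Omega)\setminus\{0\}$; $\mathbf{v}_\alpha$ denotes a positive minimizer, normalized by $\|\mathbf{v}_\alpha\|_{W^1_p(\Omega)}=1$ (a positive multiple of $\mathbf{v}_\alpha$ is a weak radial solution of $-\Delta_pu+u^{p-1}=|x|^\alpha u^{q-1}$ in $\Omega$, $\partial u/\partial\mathbf{n}=0$ on $S$). ``For all sufficiently large $\alpha$'' means for all $\alpha$ larger than some constant depending on $n,p,q$. $$\mathcal{W}=\left\{g\in W^1_2(\Omega):\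 \int_S g(r,\theta)\,dS=0\ \text{ for a.e. } r\in(0,1)\right\}.$$ The second variation $D^2\mathcal{Q}_{p,q,\alpha}(\mathbf{v}_\alpha;h,h)$ is the second differential $\frac{d^2}{dt^2}\mathcal{Q}_{p,q,\alpha}(\mathbf{v}_\alpha+th)\big|_{t=0}$, which, since $\mathbf{v}_\alpha$ is a critical point, is given with $A=\int_\Omega|x|^\alpha\mathbf{v}_\alpha^q\,dx$ by $$\frac1p D^2\mathcal{Q}_{p,q,\alpha}(\mathbf{v}_\alpha;h,h)=A^{-\frac pq}\int_\Omega\Bigl((p-2)|\nabla\mathbf{v}_\alpha|^{p-4}\langle\nabla\mathbf{v}_\alpha,\nabla h\rangle^2+|\nabla\mathbf{v}_\alpha|^{p-2}|\nabla h|^2+(p-1)\mathbf{v}_\alpha^{p-2}h^2\Bigr)dx$$ $$+(q-p)A^{-\frac pq-2}\left(\int_\Omega|x|^\alpha\mathbf{v}_\alpha^{q-1}h\,dx\right)^2-(q-1)A^{-\frac pq-1}\int_\Omega|x|^\alpha\mathbf{v}_\alpha^{q-2}h^2\,dx .$$ (The term with $|\nabla\mathbf{v}_\alpha|^{p-4}$ is understood as $0$ where $\nabla\mathbf{v}_\alpha=0$ and is absent for $p=2$.) This formula is used as the definition for all $h\in W^1_2(\Omega)$, in particular for $g\in\mathcal{W}$; for $g\in\mathcal W$ the term with the factor $(q-p)$ vanishes. *)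

(* Defs.v *)
From HB Require Import structures.
From mathcomp Require Import all_boot all_order all_algebra.
From mathcomp Require Import all_classical all_reals all_analysis.
From mathcomp Require Import measurable_realfun.
Set Implicit Arguments.
Unset Strict Implicit.
Unset Printing Implicit Defensive.
Import Order.TTheory GRing.Theory Num.Theory.
Import numFieldNormedType.Exports.
Local Open Scope classical_set_scope.
Local Open Scope ring_scope.

Definition rV_display : measure_display.
Proof. exact: default_measure_display. Qed.

Section rV_measurable.
Context (R : realType) (n : nat).

(* The sigma-algebra generated by the coordinates: the Borel sets of R^n. *)
Let coords : 'I_n -> 'rV[R]_n -> R := fun i x => x ord0 i.

Let rV_set0 : g_sigma_preimage coords set0.
Proof. exact: sigma_algebra0. Qed.

Let rV_setC A : g_sigma_preimage coords A -> g_sigma_preimage coords (~` A).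
Proof. exact: sigma_algebraC. Qed.

Let rV_bigcup (F : _^nat) : (forall i, g_sigma_preimage coords (F i)) ->
  g_sigma_preimage coords (\bigcup_i (F i)).
Proof. exact: sigma_algebra_bigcup. Qed.

HB.instance Definition _ := @isMeasurable.Build rV_display
  'rV[R]_n (g_sigma_preimage coords) rV_set0 rV_setC rV_bigcup.

Lemma measurable_coord (i : 'I_n) :
  measurable_fun [set: 'rV[R]_n] (fun x => x ord0 i).
Proof.
move=> _ Y mY; rewrite setTI; apply: sub_sigma_algebra => /=.
rewrite -bigcup_seq/=; exists i => /=; first by rewrite mem_index_enum.
by exists Y => //; rewrite setTI.
Qed.

Lemma measurable_fun_rV d (T : measurableType d) (D : set T)
    (f : T -> 'rV[R]_n) :
  (forall i, measurable_fun D (fun x => f x ord0 i)) -> measurable_fun D f.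
Proof.
move=> mf mD; move: (mD); apply: (measurability
  (\big[setU/set0]_(i < n) preimage_set_system setT (coords i) measurable)) => //.
move=> _ [B + <-]; rewrite -bigcup_seq => -[i _ [C mC <-]].
by rewrite setTI; exact: mf.
Qed.

End rV_measurable.

Section lebesgue_rV.
Context (R : realType).

Definition rV_cons n (x : measurableTypeR R * 'rV[R]_n) : 'rV[R]_n.+1 :=
  \row_i oapp (x.2 ord0) x.1 (unlift ord0 i).

Definition rV_uncons n (x : 'rV[R]_n.+1) : measurableTypeR R * 'rV[R]_n :=
  (x ord0 ord0, \row_i x ord0 (lift ord0 i)).

Lemma rV_consK n : cancel (@rV_cons n) (@rV_uncons n).
Proof.
case=> a y; rewrite /rV_uncons/rV_cons mxE unlift_none/=; congr pair.
by apply/rowP => i; rewrite !mxE liftK.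
Qed.

Lemma measurable_rV_cons n : measurable_fun setT (@rV_cons n).
Proof.
apply: measurable_fun_rV => i.
case: (unliftP ord0 i) => [j|] ->.
- rewrite [X in measurable_fun _ X](_ : _ = (fun y : 'rV[R]_n => y ord0 j) \o snd); last first.
    by apply/funext => x /=; rewrite mxE liftK.
  by apply: measurableT_comp => //; exact: measurable_coord.
- rewrite [X in measurable_fun _ X](_ : _ = fst)//.
  by apply/funext => x /=; rewrite mxE unlift_none.
Qed.

Lemma measurable_rV_uncons n : measurable_fun setT (@rV_uncons n).
Proof.
apply/measurable_fun_pairP; split; first exact: measurable_coord.
apply: measurable_fun_rV => i.
rewrite [X in measurable_fun _ X](_ : _ = (fun y : 'rV[R]_n.+1 => y ord0 (lift ord0 i))).
  exact: measurable_coord.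
by apply/funext => x /=; rewrite mxE.
Qed.

Section step.
Context n (m : {sigma_finite_measure set 'rV[R]_n -> \bar R}).
Local Open Scope ereal_scope.

Definition lebesgue_rV_step :=
  pushforward (@lebesgue_measure R \x m) (@rV_cons n).

Let step0 : lebesgue_rV_step set0 = 0.
Proof. by apply: measure0; exact: measurable_rV_cons. Qed.

Let step_ge0 A : 0 <= lebesgue_rV_step A.
Proof. by apply: measure_ge0; exact: measurable_rV_cons. Qed.

Let step_sigma_additive : semi_sigma_additive lebesgue_rV_step.
Proof.
by apply: measure_semi_sigma_additive; exact: measurable_rV_cons.
Qed.

HB.instance Definition _ := isMeasure.Build _ _ _ lebesgue_rV_step
  step0 step_ge0 step_sigma_additive.

Let step_sigma_finite : sigma_finite setT lebesgue_rV_step.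
Proof.
have /sigma_finiteP[F [TF ndF Foo]] := sigma_finiteT (@lebesgue_measure R).
have /sigma_finiteP[G [TG ndG Goo]] := sigma_finiteT m.
exists (fun k => @rV_uncons n @^-1` (F k `*` G k)).
  rewrite predeqE => x; split=> // _.
  have : setT (rV_uncons x).1 by [].
  have : setT (rV_uncons x).2 by [].
  rewrite TF TG => -[k _ Gk] [l _ Fl]; exists (maxn k l) => //; split.
  - by move: Fl; exact/subsetPset/ndF/leq_maxr.
  - by move: Gk; exact/subsetPset/ndG/leq_maxl.
move=> k; have [mF Fk] := Foo k; have [mG Gk] := Goo k; split.
  rewrite -[X in measurable X]setTI; apply: measurable_rV_uncons => //.
  exact: measurableX.
rewrite /lebesgue_rV_step /pushforward -comp_preimage.
rewrite [X in X @^-1` _](_ : _ = id); last first.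
  by apply/funext => x; exact: rV_consK.
by rewrite preimage_id product_measure1E// lte_mul_pinfty// ge0_fin_numE.
Qed.

HB.instance Definition _ :=
  Measure_isSigmaFinite.Build _ _ _ lebesgue_rV_step step_sigma_finite.
End step.

Fixpoint lebesgue_rV n : {sigma_finite_measure set 'rV[R]_n -> \bar R} :=
  match n with
  | 0 => \d_(0 : 'rV[R]_0)
  | n'.+1 => lebesgue_rV_step (lebesgue_rV n')
  end.

Lemma lebesgue_rV_box n (A : 'I_n -> set R) : (forall i, measurable (A i)) ->
  lebesgue_rV n [set x | forall i, A i (x ord0 i)] =
  \big[mule/1%E]_(i < n) lebesgue_measure (A i).
Proof.
elim: n A => [|n IH] A mA.
  by rewrite big_ord0 /= /dirac indicE mem_set//; case.
rewrite big_ord_recl /= /lebesgue_rV_step /pushforward.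
set B := [set x : 'rV[R]_n | forall i, A (lift ord0 i) (x ord0 i)].
have mB : measurable B.
  rewrite (_ : B = \bigcap_(i in [set: 'I_n])
      ((fun x : 'rV[R]_n => x ord0 i) @^-1` A (lift ord0 i))); last first.
    by apply/seteqP; split => x /= H i; [move=> _|]; exact: H.
  apply: fin_bigcap_measurable => [|i _]; first exact: finite_finset.
  by rewrite -[X in measurable X]setTI; exact: measurable_coord.
rewrite (_ : _ @^-1` _ = A ord0 `*` B); last first.
  apply/seteqP; split => [[a y] /= H|[a y] /= [H1 H2] i].
    split; first by have := H ord0; rewrite mxE unlift_none.
    by move=> i; have := H (lift ord0 i); rewrite mxE liftK.
  by rewrite mxE; case: (unliftP ord0 i) => [j|] -> /=; [exact: H2|exact: H1].
have -> : (lebesgue_measure \x lebesgue_rV n)%E (A ord0 `*` B) =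
    (lebesgue_measure (A ord0) * lebesgue_rV n B)%E.
  by apply: product_measure1E => //; exact: mA.
by rewrite (IH (fun i => A (lift ord0 i))).
Qed.

End lebesgue_rV.

Section euclidean.
Context (R : realType) (n : nat).
Implicit Types x y : 'rV[R]_n.

Definition dotp x y : R := \sum_i x ord0 i * y ord0 i.

(* The library norm on 'rV[R]_n is the maximum norm, hence this one. *)
Definition enorm x : R := Num.sqrt (dotp x x).

Definition unit_ball : set 'rV[R]_n := [set x | enorm x < 1].

Definition unit_sphere : set 'rV[R]_n := [set x | enorm x = 1].

Lemma dotp_ge0 x : 0 <= dotp x x.
Proof. by apply: sumr_ge0 => i _; rewrite -expr2 sqr_ge0. Qed.

Lemma measurable_enorm : measurable_fun setT enorm.
Proof.
rewrite (_ : enorm = fun x => dotp x x `^ 2^-1).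
  apply: (@measurableT_comp _ _ _ _ _ _ (fun a : R => a `^ 2^-1)).
    exact: measurable_powR.
  apply: measurable_sum => i.
  by apply: measurable_funM; exact: measurable_coord.
by apply/funext => x; rewrite powR12_sqrt// dotp_ge0.
Qed.

Definition normalize x : 'rV[R]_n := (enorm x)^-1 *: x.

Lemma measurable_normalize : measurable_fun setT normalize.
Proof.
apply: measurable_fun_rV => i.
rewrite (_ : (fun x => _) = fun x => enorm x `^ (-1) * x ord0 i).
  apply: measurable_funM; last exact: measurable_coord.
  apply: (@measurableT_comp _ _ _ _ _ _ (fun a : R => a `^ (-1))).
    exact: measurable_powR.
  exact: measurable_enorm.
by apply/funext => x; rewrite mxE powR_inv1// sqrtr_ge0.
Qed.

Lemma measurable_unit_ball : measurable unit_ball.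
Proof.
rewrite (_ : unit_ball = setT `&` enorm @^-1` `]-oo, 1[%classic).
  exact: measurable_enorm.
by rewrite setTI; apply/seteqP; split=> x; rewrite /unit_ball/= in_itv.
Qed.

(* The surface measure of the unit sphere, extended by 0 to R^n (for n > 0):
   a subset A of the sphere has measure n times the volume of the cone
   {r x | 0 < r < 1, x in A} over A. *)
Definition surface_measure (A : set 'rV[R]_n) : \bar R :=
  (n%:R%:E * lebesgue_rV R n (unit_ball `&` normalize @^-1` A))%E.

Let mcone A : measurable A -> measurable (unit_ball `&` normalize @^-1` A).
Proof.
move=> mA; apply: measurableI; first exact: measurable_unit_ball.
by rewrite -[X in measurable X]setTI; exact: measurable_normalize.
Qed.

Let surface_measure0 : surface_measure set0 = 0%E.
Proof. by rewrite /surface_measure preimage_set0 setI0 measure0 mule0. Qed.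

Let surface_measure_ge0 A : (0 <= surface_measure A)%E.
Proof. by rewrite /surface_measure mule_ge0// lee_fin. Qed.

Let surface_measure_sigma_additive : semi_sigma_additive surface_measure.
Proof.
move=> F mF tF mUF; rewrite /surface_measure.
rewrite [X in X @ _ --> _](_ : _ = (fun k => n%:R%:E *
    \sum_(0 <= i < k) lebesgue_rV R n (unit_ball `&` normalize @^-1` F i))%E);
    last first.
  by apply/funext => k; rewrite ge0_sume_distrr.
apply: cvgeZl => //; rewrite preimage_bigcup setI_bigcupr.
apply: measure_semi_sigma_additive.
- by move=> k; exact: mcone.
- apply/trivIsetP => i j _ _ ij; move/trivIsetP : tF => /(_ _ _ I I ij) Fij.
  by rewrite setIACA setIid -preimage_setI Fij preimage_set0 setI0.
- by rewrite -setI_bigcupr -preimage_bigcup; exact: mcone.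
Qed.

HB.instance Definition _ := isMeasure.Build _ _ _ surface_measure
  surface_measure0 surface_measure_ge0 surface_measure_sigma_additive.

End euclidean.

Section sobolev.
Context (R : realType) (n : nat).
Implicit Types (p q alpha : R) (u v h g : 'rV[R]_n -> R).

Local Notation Omega := (@unit_ball R n).
Local Notation S := (@unit_sphere R n).
Local Notation leb := (lebesgue_rV R n).
Local Notation "'e_ i" := (delta_mx ord0 i : 'rV[R]_n) (at level 8, i at level 2).

Fixpoint class_C (k : nat) (phi : 'rV[R]_n -> R) : Prop :=
  continuous phi /\
  if k is k'.+1 then
    forall i, (forall x, derivable phi x 'e_i) /\
              class_C k' (fun x => 'D_'e_i phi x)
  else True.

Definition test_function (phi : 'rV[R]_n -> R) : Prop :=
  (forall k, class_C k phi) /\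
  exists K, [/\ compact K, K `<=` Omega & forall x, ~ K x -> phi x = 0].

(* Functions are defined on all of R^n, but only their values in Omega are
   ever used. *)
Definition weak_gradient u (G : 'rV[R]_n -> 'rV[R]_n) : Prop :=
  [/\ forall i, measurable_fun Omega (fun x => G x ord0 i),
      forall i K, compact K -> K `<=` Omega ->
        leb.-integrable K (fun x => (G x ord0 i)%:E) &
      forall i phi, test_function phi ->
        \int[leb]_(x in Omega) (u x * 'D_'e_i phi x) =
        - \int[leb]_(x in Omega) (G x ord0 i * phi x)].

(* Unique up to a null set if it exists. *)
Definition grad u : 'rV[R]_n -> 'rV[R]_n :=
  xget (fun=> 0) [set G | weak_gradient u G].

Definition W1 p u : Prop :=
  [/\ measurable_fun Omega u,
      (\int[leb]_(x in Omega) (`|u x| `^ p)%:E < +oo)%E &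
      exists2 G, weak_gradient u G &
        (\int[leb]_(x in Omega) (enorm (G x) `^ p)%:E < +oo)%E].

Definition W1_energy p u : R :=
  \int[leb]_(x in Omega) (enorm (grad u x) `^ p + `|u x| `^ p).

Definition W1_norm p u : R := W1_energy p u `^ p^-1.

Definition nonzero u : Prop :=
  ~ {ae leb, forall x, Omega x -> u x = 0}.

Definition W1_rad p u : Prop :=
  W1 p u /\
  exists f : R -> R, {ae leb, forall x, Omega x -> u x = f (enorm x)}.

Definition Q p q alpha u : R :=
  W1_energy p u /
  (\int[leb]_(x in Omega) (enorm x `^ alpha * `|u x| `^ q)) `^ (p / q).

Definition radial_minimizer p q alpha v : Prop :=
  [/\ W1_rad p v, nonzero v &
      forall u, W1_rad p u -> nonzero u -> Q p q alpha v <= Q p q alpha u].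

Definition normalized_positive_minimizer p q alpha v : Prop :=
  [/\ radial_minimizer p q alpha v,
      {ae leb, forall x, Omega x -> 0 < v x} &
      W1_norm p v = 1].

(* The second differential of Q at v, for v a positive critical point of Q with
   W1_norm p v = 1.  As 0 `^ a = 0 for a <> 0, and dotp 0 _ = 0, the first
   integrand below is 0 where grad v = 0. *)
Definition D2Q p q alpha v h : R :=
  let A := \int[leb]_(x in Omega) (enorm x `^ alpha * v x `^ q) in
  p * (A `^ (- (p / q)) *
       \int[leb]_(x in Omega)
         ((p - 2) * enorm (grad v x) `^ (p - 4) * dotp (grad v x) (grad h x) ^+ 2
          + enorm (grad v x) `^ (p - 2) * enorm (grad h x) ^+ 2
          + (p - 1) * v x `^ (p - 2) * h x ^+ 2)
     + (q - p) * A `^ (- (p / q) - 2) *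
       (\int[leb]_(x in Omega) (enorm x `^ alpha * v x `^ (q - 1) * h x)) ^+ 2
     - (q - 1) * A `^ (- (p / q) - 1) *
       \int[leb]_(x in Omega) (enorm x `^ alpha * v x `^ (q - 2) * h x ^+ 2)).

Definition space_W g : Prop :=
  W1 2 g /\
  {ae @lebesgue_measure R, forall r, 0 < r < 1 ->
    (\int[@surface_measure R n]_(theta in S) (g (r *: theta))%:E = 0)%E}.

End sobolev.

(* Main.v *)
Require Import Defs.
From HB Require Import structures.
From mathcomp Require Import all_boot all_order all_algebra.
From mathcomp Require Import all_classical all_reals all_analysis.
From mathcomp Require Import measurable_realfun.
From mathcomp Require Import ring lra.
Set Implicit Arguments.
Unset Strict Implicit.
Unset Printing Implicit Defensive.
Import Order.TTheory GRing.Theory Num.Theory.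
Import numFieldNormedType.Exports.
Local Open Scope classical_set_scope.
Local Open Scope ring_scope.

(** Write a minimizer as v = F(|x|). Its Euler-Lagrange equation is an ODE for F;
for large alpha the weight |x|^alpha is negligible on |x| <= 1/2, hence F is
increasing, 0 <= F' <= F, and F' is bounded below by a power of r (1 - r).
For g with vanishing spherical means put g = F phi. A radial integration by
parts turns the terms of D2Q without gradients into J, and
  D2Q >= p A^(-p/q) (T - (q - p) J),  T = int F'^(p-2) F^2 |grad phi|^2.
A Poincare inequality with weight (r (1 - r))^((p-2)/(p-1)) for functions of zero
spherical mean gives J <= C T with C depending only on n and p, so that
q_loc = p + 1 / C works. *)

(** The bound on q must not depend on [alpha], so no final constant may see the minimizer. Two facts
    ensure this: [0 <= F' <= F] confines F between two values of ratio e^2, so that its unknown size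
    cancels from J / T, and the lower bound on F' / F involves only n and p. Monotonicity is
    delicate because the right side F^(p-1) (1 - lam r^alpha F^(q-p)) of the equation changes sign.
    It does so only once: r^alpha F^(q-p) is the power q - p of r^mu F with mu = alpha / (q - p),
    which increases on r >= 1/2 for large alpha. The flux vanishes at both ends, hence is
    nonnegative. The factor q - p appears because the equation tested with F phi^2 turns the
    gradient-free and cross terms into (p - 1) J, against -(q - 1) J. The exponent (p-2)/(p-1) of
    the weight is below 1, so its inverse is integrable along coordinate lines, which gives the
    Poincare inequality near the origin. Sobolev functions are handled through [line_ftc], the
    fundamental theorem of calculus on coordinate segments; it is stable under products and avoids
    mollification. *)

Local Notation "'e_ i" := (@delta_mx _ 1 _ ord0 i) (at level 8, i at level 2).
Local Notation borel R f := (measurable_fun setT (f : measurableTypeR R -> R)).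
Local Notation int_ball R n f := ((lebesgue_rV R n).-integrable (@unit_ball R n) (EFin \o f)).
Local Notation mfunM := measurable_funM.
Local Notation mcompT := measurableT_comp.
Local Notation mfunTS := measurable_funTS.

(** * Measurability of real expressions *)

Lemma integrable_mfun d (T : measurableType d) (R : realType) (m : {measure set T -> \bar R})
 (D : set T) (f : T -> R) : m.-integrable D (EFin \o f) -> measurable_fun D f.
by move=> /measurable_int/measurable_EFinP. Qed.

(** The inverse of 0 is 0, so 1 / f equals f times the power -1 of f^2 everywhere, including the
    zeros of f, and real powers are measurable. *)
Lemma measurable_funVr d (T : measurableType d) (R : realType) (D : set T) (f : T -> R) :
 measurable_fun D f -> measurable_fun D (fun x => (f x)^-1).
move=> mf; rewrite (_ : (fun x => _) = fun x => f x * (f x ^+ 2) `^ (-1)).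
 apply: mfunM => //; apply: (mcompT (measurable_powR _)).
 exact: measurable_funX.
apply/funext => x; rewrite powR_inv1 ?sqr_ge0//.
by have [->|f0] := eqVneq (f x) 0; [rewrite invr0 mul0r|field].
Qed.

Lemma mfun_normalize (R : realType) (n : nat) (i : 'I_n) :
 measurable_fun setT (fun x : 'rV[R]_n => normalize x ord0 i).
exact: (mcompT (measurable_coord i) (@measurable_normalize R n)). Qed.

Ltac mfun :=
 first
 [ assumption
 | solve [exact: measurable_cst | exact: measurable_id | exact: measurable_coord | exact: measurable_enorm
 | exact: mfun_normalize
 | exact: mfunTS | apply: mfunTS; first [exact: measurable_coord | exact: measurable_enorm | exact: mfun_normalize] ]
 | match goal with
 | H : is_true (integrable _ _ (EFin \o ?f)) |- measurable_fun _ ?f => exact: (integrable_mfun H)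
 | H : forall _, measurable_fun _ _ |- _ => solve [exact: H]
 end
 | lazymatch goal with
 | |- measurable_fun _ (fun x => GRing.mul _ _) => apply: mfunM; mfun
 | |- measurable_fun _ (fun x => GRing.add _ (GRing.opp _)) => apply: measurable_funB; mfun
 | |- measurable_fun _ (fun x => GRing.add _ _) => apply: measurable_funD; mfun
 | |- measurable_fun _ (fun x => GRing.opp _) => apply: measurable_funN; mfun
 | |- measurable_fun _ (fun x => GRing.inv _) => apply: measurable_funVr; mfun
 | |- measurable_fun _ (fun x => GRing.exp _ _) => apply: measurable_funX; mfun
 | |- measurable_fun _ (fun x => powR _ _) => apply: (mcompT (measurable_powR _)); mfun
 | |- measurable_fun _ (fun x => EFin _) => apply/measurable_EFinP; mfun
 | |- measurable_fun _ (EFin \o _) => apply/measurable_EFinP; mfun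
 | H : measurable_fun setT ?f |- measurable_fun _ (fun x => ?f _) => apply: (mcompT H); mfun
 | H : forall _, measurable_fun setT _ |- measurable_fun _ (fun x => _ (_ x)) => apply: (mcompT (H _)); mfun
 end ].

(** * Fubini theorems for real-valued integrals *)

Section real_fubini.
Context d1 d2 (T1 : measurableType d1) (T2 : measurableType d2) (R : realType).
Context (m1 : {sigma_finite_measure set T1 -> \bar R})
 (m2 : {sigma_finite_measure set T2 -> \bar R}).

(** Tonelli applies to the positive and the negative part separately, and [fine] is measurable;
    sections without a finite integral just receive a default value. *)
Lemma mfun_Rintegral1 (f : T1 * T2 -> R) : measurable_fun setT f ->
 measurable_fun setT (fun x => \int[m2]_y f (x, y)).
move=> mf; rewrite /Rintegral; apply: mcompT => //.
under eq_fun do rewrite integralE.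
have mEf : measurable_fun setT (EFin \o f) by exact/measurable_EFinP.
apply: emeasurable_funB.
- rewrite (_ : (fun x => _) = fubini_F m2 (EFin \o f)^\+%E).
 apply: measurable_fun_fubini_tonelli_F; first exact: measurable_funepos.
 by move=> x; exact: funepos_ge0.
 by apply/funext => x; apply: eq_integral => y _; rewrite !funeposE.
- rewrite (_ : (fun x => _) = fubini_F m2 (EFin \o f)^\-%E).
 apply: measurable_fun_fubini_tonelli_F; first exact: measurable_funeneg.
 by move=> x; exact: funeneg_ge0.
 by apply/funext => x; apply: eq_integral => y _; rewrite !funenegE.
Qed.

(** The inner real integral agrees with the extended one only where the section is integrable, that
    is for almost every x; elsewhere [fine] returns a default. Hence the detour through
    almost-everywhere equality. *)
Lemma Rfubini1 (f : T1 * T2 -> R) :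
 (m1 \x m2)%E.-integrable setT (EFin \o f) ->
 \int[(m1 \x m2)%E]_z f z = \int[m1]_x \int[m2]_y f (x, y).
move=> fi; rewrite /Rintegral -integral12_prod_meas1//.
congr fine; apply: ae_eq_integral => //.
- exact: (measurable_fubini_F fi).
- apply/measurable_EFinP; apply: mfun_Rintegral1.
 by apply/measurable_EFinP; exact: (measurable_int _ fi).
- have := ae_integrable1 fi; apply: filterS => x /= ix _.
 by rewrite /fubini_F/= fineK//; exact: integrable_fin_num.
Qed.

Lemma measurable_Rintegral2 (f : T1 * T2 -> R) : measurable_fun setT f ->
 measurable_fun setT (fun y => \int[m1]_x f (x, y)).
move=> mf; rewrite /Rintegral; apply: mcompT => //.
under eq_fun do rewrite integralE.
have mEf : measurable_fun setT (EFin \o f) by exact/measurable_EFinP.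
apply: emeasurable_funB.
- rewrite (_ : (fun x => _) = fubini_G m1 (EFin \o f)^\+%E).
 apply: measurable_fun_fubini_tonelli_G; first exact: measurable_funepos.
 by move=> x; exact: funepos_ge0.
 by apply/funext => x; apply: eq_integral => y _; rewrite !funeposE.
- rewrite (_ : (fun x => _) = fubini_G m1 (EFin \o f)^\-%E).
 apply: measurable_fun_fubini_tonelli_G; first exact: measurable_funeneg.
 by move=> x; exact: funeneg_ge0.
 by apply/funext => x; apply: eq_integral => y _; rewrite !funenegE.
Qed.

Lemma Rfubini2 (f : T1 * T2 -> R) :
 (m1 \x m2)%E.-integrable setT (EFin \o f) ->
 \int[(m1 \x m2)%E]_z f z = \int[m2]_y \int[m1]_x f (x, y).
move=> fi; rewrite /Rintegral -integral21_prod_meas1//.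
congr fine; apply: ae_eq_integral => //.
- exact: (measurable_fubini_G fi).
- apply/measurable_EFinP; apply: measurable_Rintegral2.
 by apply/measurable_EFinP; exact: (measurable_int _ fi).
- have := ae_integrable2 fi; apply: filterS => x /= ix _.
 by rewrite /fubini_G/= fineK//; exact: integrable_fin_num.
Qed.

Lemma Rfubini (f : T1 * T2 -> R) :
 (m1 \x m2)%E.-integrable setT (EFin \o f) ->
 \int[m1]_x \int[m2]_y f (x, y) = \int[m2]_y \int[m1]_x f (x, y).
by move=> fi; rewrite -Rfubini1// Rfubini2. Qed.

Lemma integrable_Rintegral1 (f : T1 * T2 -> R) :
 (m1 \x m2)%E.-integrable setT (EFin \o f) ->
 m1.-integrable setT (EFin \o (fun x => \int[m2]_y f (x, y))).
move=> fi; have Fi := integrable_fubini_F fi.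
have mR := mfun_Rintegral1 (integrable_mfun fi).
apply/integrableP; split; first exact/measurable_EFinP.
have /integrableP[mF] := Fi; apply: le_lt_trans.
apply: ae_ge0_le_integral => //.
- by apply: mcompT => //; exact/measurable_EFinP.
- exact: mcompT.
have := ae_integrable1 fi; apply: filterS => x /= ix _.
by rewrite /fubini_F -[X in (_ <= `|X|)%E]fineK//; exact: integrable_fin_num.
Qed.

(** Tonelli for the indicator of Z exchanges null sections in one variable for null sections in the
    other. It later upgrades [line_ftc], which has an exceptional set for each step, to a statement
    along whole lines. *)
Lemma ae_prod (Z : set (T1 * T2)) : measurable Z ->
 (forall y, m1 [set x | Z (x, y)] = 0%E) ->
 {ae m1, forall x, {ae m2, forall y, ~ Z (x, y)}}.
move=> mZ Z0.
have mI : measurable_fun setT (EFin \o \1_Z : T1 * T2 -> \bar R).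
 exact/measurable_EFinP.
have I0 z : (0 <= (EFin \o (\1_Z : T1 * T2 -> R)) z)%E by rewrite lee_fin.
have : (\int[m1]_x \int[m2]_y (\1_Z (x, y))%:E = 0)%E.
 rewrite -[LHS](@fubini_tonelli1 _ _ _ _ _ m1 m2 _ mI)// fubini_tonelli2//.
 apply: integral0_eq => y _; rewrite /fubini_G/=.
 have mZy : measurable [set x | Z (x, y)].
 have -> : [set x | Z (x, y)] = ysection Z y.
 by apply/seteqP; split => x; rewrite /ysection/= inE.
 exact: measurable_ysection.
 rewrite (eq_integral (EFin \o \1_[set x | Z (x, y)])); last first.
 by move=> x _ /=; rewrite !indicE.
 by rewrite integral_indic// setIT; exact: Z0.
move=> h.
have mF := @measurable_fun_fubini_tonelli_F _ _ _ _ _ m2 _ mI I0.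
have : (\int[m1]_x `|fubini_F m2 (EFin \o \1_Z) x| = 0)%E.
 rewrite -[RHS]h; apply: eq_integral => x _; rewrite gee0_abs//.
 by apply: integral_ge0 => y _; rewrite lee_fin.
move/(ae_eq_integral_abs _ measurableT mF); apply: filterS => x /= /(_ I).
rewrite /fubini_F => hx.
have mZx : measurable [set y | Z (x, y)].
 have -> : [set y | Z (x, y)] = xsection Z x.
 by apply/seteqP; split => y; rewrite /xsection/= inE.
 exact: measurable_xsection.
exists [set y | Z (x, y)]; split => //.
 move: hx; rewrite (eq_integral (EFin \o \1_[set y | Z (x, y)])); last first.
 by move=> y _ /=; rewrite !indicE.
 by rewrite integral_indic// setIT.
by move=> y /= /contrapT.
Qed.

Lemma integrable_prod_mul (f : T1 -> R) (g : T2 -> R) :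
 m1.-integrable setT (EFin \o f) -> m2.-integrable setT (EFin \o g) ->
 (m1 \x m2)%E.-integrable setT (EFin \o (fun z => f z.1 * g z.2)).
move=> fi gi.
have mf := integrable_mfun fi.
have mg := integrable_mfun gi.
apply/integrable12ltyP => /=.
 apply/measurable_EFinP; apply: mfunM.
 by apply: (mcompT mf); exact: measurable_fst.
 by apply: (mcompT mg); exact: measurable_snd.
have E x : (\int[m2]_y `|(f x * g y)%:E| = `|(f x)%:E| * \int[m2]_y `|(g y)%:E|)%E.
 rewrite -ge0_integralZl//; last by do 2 apply: mcompT => //.
 by apply: eq_integral => y _; rewrite EFinM abseM.
under eq_integral do rewrite E.
rewrite ge0_integralZr ?integral_ge0//; last by do 2 apply: mcompT => //.
have /integrableP[_ fl] := fi; have /integrableP[_ gl] := gi.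
by apply: lte_mul_pinfty => //; rewrite ?integral_ge0// ge0_fin_numE// integral_ge0.
Qed.

End real_fubini.

(** * Boxes, uniqueness of Lebesgue measure, affine maps *)

Section rV_boxes.
Context (R : realType) (n : nat).
Implicit Types (a b : 'I_n -> R).

Definition box a b : set 'rV[R]_n := [set x | forall i, x ord0 i \in `]a i, b i[].

Definition boxes : set (set 'rV[R]_n) := [set B | exists a b, B = box a b].

Lemma setI_closed_boxes : setI_closed boxes.
move=> _ _ [a [b ->]] [c [d ->]].
exists (fun i => Num.max (a i) (c i)), (fun i => Num.min (b i) (d i)).
apply/seteqP; split => x /=.
 move=> [ab cd] i; move: (ab i) (cd i); rewrite !in_itv/= => /andP[? ?] /andP[? ?].
 by rewrite gt_max lt_min; apply/andP; split; apply/andP.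
move=> abcd; split=> i; move: (abcd i); rewrite !in_itv/= gt_max lt_min.
 by move=> /andP[/andP[-> _] /andP[-> _]].
by move=> /andP[/andP[_ ->] /andP[_ ->]].
Qed.

Lemma measurable_box a b : measurable (box a b).
rewrite (_ : box a b = \bigcap_(i in [set: 'I_n])
 ((fun x : 'rV[R]_n => x ord0 i) @^-1` `]a i, b i[%classic)).
 apply: fin_bigcap_measurable => [|i _]; first exact: finite_finset.
 by rewrite -[X in measurable X]setTI; exact: measurable_coord.
by apply/seteqP; split => x /= H i; [move=> _|]; exact: H.
Qed.

Lemma rV_norm_lt (x : 'rV[R]_n) : exists N : nat, forall i, `|x ord0 i| < N%:R.
pose M := \sum_i `|x ord0 i|; exists (Num.truncn M).+1 => i.
have xM : `|x ord0 i| <= M by rewrite /M (bigD1 i)//= lerDl sumr_ge0.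
rewrite (le_lt_trans xM)//; apply: truncnS_gt.
Qed.

Lemma bigcup_boxes : \bigcup_k box (fun=> - k%:R) (fun=> k%:R) = setT.
apply/seteqP; split=> // x _; have [N xN] := rV_norm_lt x.
by exists N => // i; rewrite /= in_itv/= -ltr_norml.
Qed.

(** Boxes form a pi-system; with this identity, measures and integrals of a fixed function can be
    compared on boxes alone. *)
Lemma rV_measurableE : @measurable _ 'rV[R]_n = <<s boxes>>.
apply/seteqP; split; last first.
 apply: smallest_sub; first exact: sigma_algebra_measurable.
 by move=> _ [a [b ->]]; exact: measurable_box.
apply: smallest_sub; first exact: smallest_sigma_algebra.
move=> A; rewrite -bigcup_seq/= => -[i _ [B mB <-]].
suff : measurable_fun [set: g_sigma_algebraType boxes]
 ((fun x : 'rV[R]_n => x ord0 i) : g_sigma_algebraType boxes -> measurableTypeR R).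
 by move=> /(_ measurableT _ mB).
apply: (measurability _ (RGenOpens.measurableE R)).
move=> _ [_ [x [y ->]] <-]; rewrite setTI.
(* The preimage of an interval under one coordinate is a strip, exhausted by boxes whose other sides
   grow to the whole line. *)
rewrite (_ : _ @^-1` _ = \bigcup_k box (fun j => if j == i then x else - k%:R)
 (fun j => if j == i then y else k%:R)).
 apply: bigcup_measurable => k _; apply: sub_sigma_algebra; red.
 by do 2 eexists; reflexivity.
apply/seteqP; split=> z /=.
 move=> zi; have [N zN] := rV_norm_lt z; exists N => // j.
 case: eqP => [->//|_]; first by rewrite /= in_itv/= -ltr_norml.
by move=> [k _ /(_ i)]; rewrite eqxx.
Qed.

Lemma lebesgue_box a b :
 lebesgue_rV R n (box a b) = (\prod_i Num.max 0 (b i - a i))%:E.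
transitivity (\big[mule/1%E]_(i < n) lebesgue_measure (`]a i, b i[%classic : set R)).
 by apply: (@lebesgue_rV_box R n (fun i => `]a i, b i[%classic)) => i; exact: measurable_itv.
rewrite -prodEFin; apply: eq_bigr => i _.
rewrite lebesgue_measure_itv/= lte_fin; case: ltP => ab.
 by rewrite -EFinB max_r// subr_ge0 ltW.
by rewrite max_l// subr_le0.
Qed.

Lemma lebesgue_box_lty a b : (lebesgue_rV R n (box a b) < +oo)%E.
by rewrite lebesgue_box ltry. Qed.

Lemma rV_measure_unique (m1 m2 : {measure set 'rV[R]_n -> \bar R}) :
 (forall a b, m1 (box a b) = m2 (box a b)) -> (forall a b, (m1 (box a b) < +oo)%E) ->
 forall A, measurable A -> m1 A = m2 A.
move=> m12 fin A mA.
apply: (measure_unique boxes (fun k => box (fun=> - k%:R) (fun=> k%:R))) => //.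
- exact: rV_measurableE.
- exact: setI_closed_boxes.
- by move=> k; do 2 eexists; reflexivity.
- exact: bigcup_boxes.
- by move=> _ [a [b ->]].
Qed.

Definition affine (c : R) (h x : 'rV[R]_n) := c *: x + h.

Lemma measurable_affine c h : measurable_fun setT (affine c h).
apply: measurable_fun_rV => i; rewrite /affine.
under eq_fun do rewrite !mxE.
apply: measurable_funD => //; apply: mfunM => //.
exact: measurable_coord.
Qed.
Hint Resolve measurable_affine : core.

(** Both sides are measures in A that are finite and equal on boxes, so uniqueness extends the
    factor c^n to all measurable sets. *)
Lemma lebesgue_affine c h A : 0 < c -> measurable A ->
 lebesgue_rV R n A = ((c ^+ n)%:E * lebesgue_rV R n (affine c h @^-1` A))%E.
move=> c0 mA.
have cn0 : 0 <= c ^+ n by rewrite exprn_ge0// ltW.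
pose k : {nonneg R} := NngNum cn0.
rewrite (_ : (_ * _)%E =
 mscale k (pushforward (lebesgue_rV R n) (affine c h)) A)//.
apply: rV_measure_unique => // [a b|a b]; last exact: lebesgue_box_lty.
rewrite -[RHS]/((c ^+ n)%:E * lebesgue_rV R n (affine c h @^-1` box a b))%E.
rewrite (_ : _ @^-1` _ = box (fun i => (a i - h ord0 i) / c)
 (fun i => (b i - h ord0 i) / c)).
 rewrite lebesgue_box -EFinM; etransitivity; first exact: lebesgue_box.
 congr EFin.
 have -> : c ^+ n = \prod_(i < n) c by rewrite prodr_const card_ord.
 rewrite -big_split/=; apply: eq_bigr => i _.
 by rewrite -mulrBl maxr_pMr ?ltW// mulr0 mulrC divfK ?gt_eqF// opprB addrA subrK.
apply/seteqP; split=> x /= H i; move: (H i); rewrite /affine !mxE !in_itv/=.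
 by rewrite ltr_pdivrMr// ltr_pdivlMr// ltrBlDr ltrBrDr mulrC.
by rewrite ltr_pdivrMr// ltr_pdivlMr// ltrBlDr ltrBrDr mulrC.
Qed.

Lemma ge0_integral_affine c h (f : 'rV[R]_n -> \bar R) : 0 < c ->
 measurable_fun setT f -> (forall x, 0 <= f x)%E ->
 (\int[lebesgue_rV R n]_x f x =
 (c ^+ n)%:E * \int[lebesgue_rV R n]_x f (affine c h x))%E.
move=> c0 mf f0.
have cn0 : 0 <= c ^+ n by rewrite exprn_ge0// ltW.
pose k : {nonneg R} := NngNum cn0.
rewrite (eq_measure_integral
 (mscale k (pushforward (lebesgue_rV R n) (affine c h)))); last first.
 by move=> A mA _; exact: lebesgue_affine.
by rewrite ge0_integral_mscale// ge0_integral_pushforward.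
Qed.

End rV_boxes.

(** * Dominated convergence and a vanishing criterion *)

Section general_measure.
Context d (T : measurableType d) (R : realType) (mu : {measure set T -> \bar R}).

Lemma Rdominated_cvg (D : set T) (f_ : nat -> T -> R) (f g : T -> R) :
 measurable D -> (forall k, measurable_fun D (f_ k)) -> measurable_fun D f ->
 {ae mu, forall x, D x -> f_ ^~ x @ \oo --> f x} ->
 mu.-integrable D (EFin \o g) ->
 {ae mu, forall x k, D x -> `|f_ k x| <= g x} ->
 (fun k => \int[mu]_(x in D) f_ k x) @ \oo --> \int[mu]_(x in D) f x.
move=> mD mf_ mf f_f ig f_g.
have [|||||fi _ h] := @dominated_convergence _ _ _ mu D mD (fun k => EFin \o f_ k)
 (EFin \o f) (EFin \o g).
- by move=> k; exact/measurable_EFinP.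
- exact/measurable_EFinP.
- apply: filterS f_f => x /= H Dx; apply: cvg_EFin; first exact: nearW.
 exact: H.
- by [].
- by apply: filterS f_g => x /= H k Dx; rewrite lee_fin H.
by apply: fine_cvg; rewrite fineK//; exact: integrable_fin_num.
Qed.

(** The sets over which k has integral zero form a Dynkin system, so the condition on a generating
    pi-system spreads to every measurable set. *)
Lemma ae_eq0_pi_system (G : set (set T)) (D : set T) (k : T -> R) :
 @measurable _ T = <<s G >> -> setI_closed G -> measurable D ->
 mu.-integrable D (EFin \o k) ->
 (\int[mu]_(x in D) (k x)%:E = 0)%E ->
 (forall A, G A -> (\int[mu]_(x in D `&` A) (k x)%:E = 0)%E) ->
 {ae mu, forall x, D x -> k x = 0}.
move=> GE GI mD ki kD kG.
have mk := measurable_int _ ki.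
have kA A : measurable A -> (\int[mu]_(x in D `&` A) (k x)%:E = 0)%E.
 move=> mA; move: (mA); rewrite GE.
 move: A {mA}.
 apply: (dynkin_induction (P := fun A => (\int[mu]_(x in D `&` A) (k x)%:E = 0)%E)) => //.
 - by rewrite setIT.
 - move=> S mS kS.
 have : (\int[mu]_(x in D) (k x)%:E = \int[mu]_(x in D `&` S) (k x)%:E +
 \int[mu]_(x in D `&` ~` S) (k x)%:E)%E.
 rewrite -integral_setU//; first by rewrite -setIUr setUv setIT.
 + exact: measurableI.
 + by apply: measurableI => //; exact: measurableC.
 + by rewrite -setIUr setUv setIT.
 + by apply/disj_setPS => x [[_ ?] [_ ?]].
 by rewrite kD kS add0e => /esym.
 - move=> F mF tF kF; rewrite setI_bigcupr integral_bigcup//.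
 + by rewrite eseries0// => i _ _; exact: kF.
 + exact: trivIset_setIl.
 + by move=> i; exact: measurableI.
 + rewrite -setI_bigcupr; apply: integrableS ki => //.
 by apply: measurableI => //; exact: bigcupT_measurable.
have := @integral_ae_eq _ _ _ mu D mD (cst 0%E) (EFin \o k) ki (measurable_cst _).
move=> h; apply: filterS (h _) => [x /= H Dx|E ED mE]; first by have [] := H Dx.
by rewrite integral0 -(setIidr ED) kA.
Qed.

Lemma ae_eq_Rint (D : set T) (f g : T -> R) : measurable D ->
 measurable_fun D f -> measurable_fun D g ->
 {ae mu, forall x, D x -> f x = g x} ->
 \int[mu]_(x in D) f x = \int[mu]_(x in D) g x.
move=> mD mf mg fg; congr fine; apply: ae_eq_integral => //.
- exact/measurable_EFinP.
- exact/measurable_EFinP.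
- by apply: filterS fg => x /= H Dx; rewrite H.
Qed.

Lemma intg_le (D : set T) (f g : T -> R) : measurable D ->
 measurable_fun D f -> mu.-integrable D (EFin \o g) ->
 (forall x, D x -> `|f x| <= g x) -> mu.-integrable D (EFin \o f).
move=> mD mf ig fg; apply: (le_integrable mD _ _ ig); first exact/measurable_EFinP.
by move=> x Dx /=; rewrite lee_fin (le_trans (fg x Dx))// ler_norm.
Qed.

End general_measure.

(** * Translation invariance *)

Section shift.
Context (R : realType) (n : nat).
Local Notation leb := (lebesgue_rV R n).
Implicit Types (h x : 'rV[R]_n) (f : 'rV[R]_n -> R).

Lemma measurable_shift h : measurable_fun setT (fun x : 'rV[R]_n => x + h).
have := measurable_affine 1 h; rewrite /affine.
by under eq_fun do rewrite scale1r.
Qed.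

Lemma ge0_integral_shift h (f : 'rV[R]_n -> \bar R) :
 measurable_fun setT f -> (forall x, 0 <= f x)%E ->
 (\int[leb]_x f (x + h)%R = \int[leb]_x f x)%E.
move=> mf f0; rewrite [RHS](ge0_integral_affine h (@ltr01 R))// expr1n mul1e.
by apply: eq_integral => x _; rewrite /affine scale1r.
Qed.

Lemma mfun_shift d (T : measurableType d) h (f : 'rV[R]_n -> T) :
 measurable_fun setT f -> measurable_fun setT (fun x => f (x + h)).
by move=> mf; exact: (mcompT mf (measurable_shift h)). Qed.

Lemma integrable_shift h f : leb.-integrable setT (EFin \o f) ->
 leb.-integrable setT (EFin \o (fun x => f (x + h))).
move=> /integrableP[mf fi]; apply/integrableP; split.
 exact: (mfun_shift h mf).
rewrite (@ge0_integral_shift h (fun x => `|(EFin \o f) x|%E))//.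
exact: mcompT.
Qed.

(** Treating the positive and negative parts separately makes this available for f that is merely
    measurable. *)
Lemma Rintegral_shift h f : measurable_fun setT f ->
 \int[leb]_x f (x + h) = \int[leb]_x f x.
move=> mf; congr fine; rewrite integralE [in RHS]integralE.
have mEf : measurable_fun setT (EFin \o f) by exact/measurable_EFinP.
congr (_ - _)%E.
- rewrite -(@ge0_integral_shift h (EFin \o f)^\+%E)//; last first.
 exact: measurable_funepos.
 by apply: eq_integral => x _; rewrite !funeposE.
- rewrite -(@ge0_integral_shift h (EFin \o f)^\-%E)//; last first.
 exact: measurable_funeneg.
 by apply: eq_integral => x _; rewrite !funenegE.
Qed.

End shift.

Lemma scalerE (R : nzRingType) (a b : R) : a *: (b : R^o) = a * b.
by []. Qed.

(** * Smooth functions of one variable and bumps *)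

Section smooth.
Context (R : realType).
Implicit Types f g : R -> R.

(** The derivative is supplied as a witness instead of being computed, so closure under sums,
    products and affine substitutions is a direct use of the differentiation rules. *)
Fixpoint smoothk (k : nat) f : Prop :=
 continuous f /\
 if k is k'.+1 then
 exists f' : R -> R, (forall t : R, is_derive t (1 : R) f (f' t)) /\ smoothk k' f'
 else True.

Definition smooth f := forall k, smoothk k f.

Lemma smoothk_continuous k f : smoothk k f -> continuous f.
by case: k => [|k] []. Qed.

Lemma derive_continuous f (x l : R) : is_derive x 1 f l -> {for x, continuous f}.
by case=> df _; exact/differentiable_continuous/derivable1_diffP. Qed.

Lemma smoothkW k f : smoothk k.+1 f -> smoothk k f.
elim: k f => [|k IH] f; first by move=> [].
by move=> [cf [f' [df sf']]]; split => //; exists f'; split => //; exact: IH.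
Qed.

Lemma smoothk_cst k (c : R) : smoothk k (cst c).
elim: k c => [|k IH] c; first by split => //; exact: cst_continuous.
split; first exact: cst_continuous.
by exists (cst 0); split => [t|]; [exact: is_derive_cst|exact: IH].
Qed.

Lemma smoothkD k f g : smoothk k f -> smoothk k g -> smoothk k (fun t => f t + g t).
elim: k f g => [|k IH] f g.
 by move=> [cf _] [cg _]; split => // x; apply: cvgD; [exact: cf|exact: cg].
move=> [cf [f' [df sf']]] [cg [g' [dg sg']]]; split.
 by move=> x; apply: cvgD; [exact: cf|exact: cg].
exists (fun t => f' t + g' t); split; last exact: IH.
by move=> t; exact: is_deriveD.
Qed.

Lemma smoothkM k f g : smoothk k f -> smoothk k g -> smoothk k (fun t => f t * g t).
elim: k f g => [|k IH] f g.
 by move=> [cf _] [cg _]; split => // x; apply: cvgM; [exact: cf|exact: cg].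
move=> sf sg; case: (sf) => cf [f' [df sf']]; case: (sg) => cg [g' [dg sg']]; split.
 by move=> x; apply: cvgM; [exact: cf|exact: cg].
exists (fun t => f t * g' t + g t * f' t); split.
 by move=> t; exact: is_deriveM.
by apply: smoothkD; apply: IH => //; exact: smoothkW.
Qed.

Lemma is_derive_affine (c h t : R) : is_derive t 1 (fun s : R => c * s + h) c.
apply: (is_derive_eq (is_deriveD (is_deriveZ c (is_derive_id t 1)) (is_derive_cst h t 1))).
by rewrite addr0 scalerE mulr1.
Qed.

Lemma smoothk_affine k f (c h : R) : smoothk k f -> smoothk k (fun t => f (c * t + h)).
have ca : continuous (fun t : R => c * t + h).
 by move=> t; exact: (derive_continuous (is_derive_affine c h t)).
elim: k f => [|k IH] f.
 by move=> [cf _]; split => // x; apply: (@continuous_comp _ _ _ (fun t => c * t + h) f); [exact: ca|exact: cf].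
move=> [cf [f' [df sf']]]; split.
 by move=> x; apply: (@continuous_comp _ _ _ (fun t => c * t + h) f); [exact: ca|exact: cf].
exists (fun t => c * f' (c * t + h)); split; last first.
 by apply: smoothkM; [exact: smoothk_cst|exact: IH].
move=> t; rewrite mulrC.
by apply: (@is_derive1_comp _ f (fun s => c * s + h)) => //; exact: is_derive_affine.
Qed.

Section flat.
Variable eps : R.
Hypothesis eps0 : 0 < eps.

(** The classical flat function e^(-eps/t), with a power of 1 / t in front so that the family is
    closed under differentiation. The parameter [eps] is sent to 0 to turn bumps into indicators. *)
Definition flat k (t : R) := if 0 < t then t^-1 ^+ k * expR (- (eps / t)) else 0.

(** The exponential e^(eps/t) exceeds the term of degree k + 1 of its series. This absorbs t^(-k)
    and leaves one factor t, which is what differentiability at 0 requires. *)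
Lemma flat_bound k : exists C : R, forall t, `|flat k t| <= C * `|t|.
exists ((k.+1)`!%:R / eps ^+ k.+1) => t; rewrite /flat.
case: ltP => t0; last first.
 by rewrite normr0 mulr_ge0// divr_ge0// exprn_ge0// ltW.
have y0 : 0 <= eps / t by rewrite divr_ge0// ltW.
rewrite !gtr0_norm//; last by rewrite mulr_gt0 ?expR_gt0// exprn_gt0// invr_gt0.
have := expR_ge1Dxn k y0 => h.
rewrite expRN ler_pdivrMr ?expR_gt0//.
have {}h : (eps / t) ^+ k.+1 / (k.+1)`!%:R <= expR (eps / t).
 by apply: le_trans h; rewrite lerDr.
have E : t^-1 ^+ k = (k.+1)`!%:R / eps ^+ k.+1 * t * ((eps / t) ^+ k.+1 / (k.+1)`!%:R).
 rewrite exprMn [t^-1 ^+ k.+1]exprSr; field.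
 by rewrite pnatr_eq0 -lt0n fact_gt0 !gt_eqF ?exprn_gt0.
rewrite {1}E ler_wpM2l// mulr_ge0 ?(ltW t0)//.
by rewrite divr_ge0// exprn_ge0// ltW.
Qed.

Lemma flat0 k (t : R) : t <= 0 -> flat k t = 0.
by rewrite /flat ltNge => ->. Qed.

Lemma is_derive_flat k (t : R) : is_derive t 1 (flat k)
 (- k%:R * flat k.+1 t + eps * flat k.+2 t).
have [t0|t0|t0] := ltgtP t 0.
- rewrite !flat0 ?ltW// !mulr0 addr0.
 apply: (@near_eq_is_derive _ _ _ (cst 0)).
 by near=> s; rewrite flat0//; apply: ltW; near: s; exact: lt_nbhsl.
- have : is_derive t 1 (fun s : R => s^-1 ^+ k * expR (- (eps / s)))
 (- k%:R * flat k.+1 t + eps * flat k.+2 t).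
 have dV : is_derive t 1 (fun s : R => s^-1) (- t ^- 2 *: 1).
 by apply: is_deriveV => //; rewrite gt_eqF.
 have dX := is_deriveX k dV.
 have dE : is_derive t 1 (fun s : R => expR (- (eps / s)))
 (expR (- (eps / t)) * (eps * t ^- 2)).
 apply: (@is_derive1_comp _ expR (fun s => - (eps / s))).
 have := is_deriveN (is_deriveZ eps dV); rewrite /= => /is_derive_eq; apply.
 by rewrite !scalerE; field; rewrite gt_eqF.
 rewrite (_ : (fun s : R => s^-1 ^+ k * expR (- (eps / s))) =
 (fun s : R => s^-1) ^+ k * (fun s : R => expR (- (eps / s)))); last first.
 by apply/funext => s; rewrite !fctE.
 apply: (is_derive_eq (is_deriveM dX dE)).
 rewrite /flat t0 !fctE /= !scalerE -!exprVn.
 case: k dX => [|k] dX; rewrite ?expr0 /= ?exprS ?expr0; ring.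
 apply: near_eq_is_derive.
 by near=> s; rewrite /flat ifT//; near: s; exact: lt_nbhsr.
- subst t; rewrite !flat0// !mulr0 addr0.
 (* At 0 the difference quotient of [flat k] is exactly [flat k.+1], and the linear bound makes it
    tend to 0. *)
 apply/is_derive1_caratheodory; exists (flat k.+1); split.
 + move=> z; rewrite (flat0 k (lexx 0)) !subr0 /flat; case: ifPn => z0.
 by rewrite exprS; field; rewrite gt_eqF.
 by rewrite mul0r.
 + have [C hC] := flat_bound k.+1.
 suff h : flat k.+1 z @[z --> (0 : R)] --> (0 : R).
 by move: h; rewrite -{2}(@flat0 k.+1 0).
 apply/cvgr0Pnorm_lt => e e0.
 have C1 : 0 < `|C| + 1 by rewrite ltr_wpDl.
 have eC : 0 < e / (`|C| + 1) by rewrite divr_gt0.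
 near=> z; rewrite (le_lt_trans (hC z))//.
 rewrite (@le_lt_trans _ _ ((`|C| + 1) * `|z|))//.
 by rewrite ler_wpM2r// (le_trans (ler_norm C))// lerDl.
 by rewrite mulrC -ltr_pdivlMr.
 + by rewrite flat0.
Unshelve. all: by end_near. Qed.

Lemma smoothk_flat m k : smoothk m (flat k).
have cE l : continuous (flat l).
 by move=> t; exact: derive_continuous (is_derive_flat l t).
elim: m k => [|m IH] k; split => //.
eexists; split; first exact: is_derive_flat.
by apply: smoothkD; apply: smoothkM => //; exact: smoothk_cst.
Qed.

Definition bump (a b t : R) := flat 0 (t - a) * flat 0 (b - t).

Lemma smooth_bump a b : smooth (bump a b).
move=> k; rewrite /bump; apply: smoothkM.
 have := smoothk_affine 1 (- a) (smoothk_flat k 0).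
 by under eq_fun do rewrite mul1r.
have := smoothk_affine (-1) b (smoothk_flat k 0).
by under eq_fun do rewrite mulN1r addrC.
Qed.

Lemma flat_ge0 t : 0 <= flat 0 t.
by rewrite /flat; case: ifP => // _; rewrite expr0 mul1r expR_ge0. Qed.

Lemma flat_le1 t : flat 0 t <= 1.
rewrite /flat; case: ifP => // t0; rewrite expr0 mul1r expR_le1 oppr_le0.
by rewrite divr_ge0// ltW.
Qed.

Lemma bump_ge0 a b t : 0 <= bump a b t.
by rewrite mulr_ge0// flat_ge0. Qed.

Lemma bump_le1 a b t : bump a b t <= 1.
by rewrite mulr_ile1// ?flat_ge0 ?flat_le1. Qed.

Lemma bump_eq0 a b t : t \notin `]a, b[ -> bump a b t = 0.
rewrite in_itv/= negb_and -!leNgt /bump => /orP[ta|bt].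
 by rewrite flat0 ?mul0r// subr_le0.
by rewrite [flat 0 (b - t)]flat0 ?mulr0// subr_le0.
Qed.

Lemma bump_continuous a b : continuous (bump a b).
exact: smoothk_continuous (smooth_bump a b 0). Qed.

End flat.

Lemma cvg_flat (t : R) : flat (k.+1%:R^-1) 0 t @[k --> \oo] --> (((0 < t)%R)%:R : R).
rewrite /flat; case: ltP => t0; last exact: cvg_cst.
rewrite -[1%:R]expR0.
under eq_fun do rewrite expr0 mul1r.
apply: (@continuous_cvg _ _ _ _ _ (fun k : nat => - (k.+1%:R^-1 / t)) expR).
 exact: continuous_expR.
rewrite -[X in _ --> X]oppr0; apply: cvgN; rewrite -[X in _ --> X](mul0r t^-1).
by apply: cvgMl; exact: cvg_harmonic.
Qed.

(** Bumps converge pointwise and boundedly to the indicator of the open interval: tests against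
    smooth functions thus become integrals over boxes. *)
Lemma cvg_bump (a b t : R) :
 bump (k.+1%:R^-1) a b t @[k --> \oo] --> (\1_(`]a, b[%classic : set R) t : R).
rewrite /bump indicE (_ : (t \in _)%:R = ((0 < t - a)%R)%:R * ((0 < b - t)%R)%:R :> R).
 by apply: cvgM; exact: cvg_flat.
by rewrite mem_setE in_itv/= -natrM mulnb !subr_gt0.
Qed.

(** Integration starts at minus infinity, so the primitive of a bump is 0 to the left of its support
    and constant to the right. *)
Definition primitive f (t : R) := \int[lebesgue_measure]_(y in `]-oo, t]) f y.

Lemma bump_integrable eps a b : 0 < eps ->
 lebesgue_measure.-integrable [set: R] (EFin \o bump eps a b).
move=> eps0; have h := @integrable_indic_itv R a b false true.
apply: (intg_le _ _ h) => //.
- by apply: continuous_measurable_fun; exact: bump_continuous.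
- move=> t _; rewrite ger0_norm ?bump_ge0// indicE mem_setE.
 by have [|/(bump_eq0 eps)->//] := boolP (t \in _); rewrite bump_le1.
Qed.

Lemma is_derive_primitive f (t : R) :
 lebesgue_measure.-integrable [set: R] (EFin \o f) -> continuous f ->
 is_derive t 1 (primitive f) (f t).
move=> fi cf.
have [||||df Ef] := @continuous_FTC1 R f -oo%O t (t + 1).
- by rewrite ltrDl.
- by apply: integrableS fi.
- by rewrite ltNyr.
- exact: cf.
by apply: DeriveDef; [exact: df|rewrite -derive1E].
Qed.

Lemma smooth_primitive f : lebesgue_measure.-integrable [set: R] (EFin \o f) ->
 smooth f -> smooth (primitive f).
move=> fi sf k; have cf := smoothk_continuous (sf 0).
have dP t := is_derive_primitive t fi cf.
have cP : continuous (primitive f) by move=> t; exact: derive_continuous (dP t).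
by case: k => [|k]; split => //; exists f; split => //; exact: sf.
Qed.

End smooth.

(** * Directional derivatives and tensor test functions *)

Section line_derivative.
Context (R : realType) (n : nat).
Implicit Types (f g : 'rV[R]_n -> R) (x v : 'rV[R]_n).

(** Reduces directional derivatives to one variable, where the chain rule is available. *)
Lemma is_derive_line f x v (l : R) :
 is_derive (0 : R) 1 (fun h : R => f (h *: v + x)) l <-> is_derive x v f l.
have E : (fun h : R => h^-1 *: ((f \o shift x) (h *: v) - f x)) =
 (fun h : R => h^-1 *: (((fun h : R => f (h *: v + x)) \o shift 0) (h *: 1)
 - (fun h : R => f (h *: v + x)) 0)).
 by apply/funext => h /=; rewrite addr0 scale0r add0r [_%:A]mulr1.
split => -[d dl]; apply: DeriveDef.
- exact: ((derivable1P f x v).2 d).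
- by rewrite -dl /derive E.
- exact: ((derivable1P f x v).1 d).
- by rewrite -dl /derive E.
Qed.

Lemma is_derive_coord (b : R -> R) (i j : 'I_n) x (l : R) :
 is_derive (x ord0 j) 1 b l ->
 is_derive x 'e_i (fun y => b (y ord0 j)) (l * (i == j)%:R).
move=> db; apply/is_derive_line.
have E : (fun h : R => b ((h *: 'e_i + x) ord0 j)) =
 b \o (fun h : R => (i == j)%:R * h + x ord0 j).
 by apply/funext => h /=; rewrite !mxE eqxx/= mulrC eq_sym.
rewrite E; apply: is_derive1_comp; last exact: is_derive_affine.
by rewrite mulr0 add0r.
Qed.

Lemma class_CW k f : class_C k.+1 f -> class_C k f.
elim: k f => [|k IH] f; first by case.
by move=> [cf df]; split => // i; have [di ci] := df i; split => //; exact: IH.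
Qed.

Lemma class_C_cst k (c : R) : class_C k (fun _ : 'rV[R]_n => c).
elim: k c => [|k IH] c; first by split => //; exact: cst_continuous.
split; first exact: cst_continuous.
move=> i; split; first by move=> x; exact: derivable_cst.
rewrite [X in class_C _ X](_ : _ = cst 0); first exact: IH.
by apply/funext => x; exact: derive_cst.
Qed.

Lemma class_CD k f g : class_C k f -> class_C k g -> class_C k (fun x => f x + g x).
elim: k f g => [|k IH] f g.
 by move=> [cf _] [cg _]; split => // x; apply: continuousD; [exact: cf|exact: cg].
move=> [cf df] [cg dg]; split.
 by move=> x; apply: continuousD; [exact: cf|exact: cg].
move=> i; have [dfi cfi] := df i; have [dgi cgi] := dg i; split.
 by move=> x; exact: derivableD.
rewrite [X in class_C _ X](_ : _ = (fun x => 'D_'e_i f x + 'D_'e_i g x)); first exact: IH.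
by apply/funext => x; exact: deriveD.
Qed.

Lemma class_CM k f g : class_C k f -> class_C k g -> class_C k (fun x => f x * g x).
elim: k f g => [|k IH] f g.
 by move=> [cf _] [cg _]; split => // x; apply: continuousM; [exact: cf|exact: cg].
move=> hf hg; have [cf df] := hf; have [cg dg] := hg; split.
 by move=> x; apply: continuousM; [exact: cf|exact: cg].
move=> i; have [dfi cfi] := df i; have [dgi cgi] := dg i; split.
 by move=> x; exact: derivableM.
rewrite [X in class_C _ X](_ : _ = (fun x => f x * 'D_'e_i g x + g x * 'D_'e_i f x)).
 by apply: class_CD; apply: IH => //; exact: class_CW.
by apply/funext => x; exact: deriveM.
Qed.

Lemma class_C_coord k (b : R -> R) (j : 'I_n) :
 smoothk k b -> class_C k (fun x : 'rV[R]_n => b (x ord0 j)).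
have cj : continuous (fun x : 'rV[R]_n => x ord0 j) by exact: coord_continuous.
elim: k b => [|k IH] b [cb]; [move=> _; split => //|move=> [b' [db sb']]; split].
- by move=> x; apply: (@continuous_comp _ _ _ (fun x : 'rV[R]_n => x ord0 j) b);
 [exact: cj|exact: cb].
- by move=> x; apply: (@continuous_comp _ _ _ (fun x : 'rV[R]_n => x ord0 j) b);
 [exact: cj|exact: cb].
- move=> i; have H x := is_derive_coord i (db (x ord0 j)); split.
 by move=> x; have [] := H x.
 rewrite [X in class_C _ X](_ : _ = (fun x => b' (x ord0 j) * (i == j)%:R)).
 by apply: class_CM; [exact: IH|exact: class_C_cst].
 by apply/funext => x; have [_ ->] := H x.
Qed.

Lemma class_C_prod k (I : Type) (s : seq I) (P : pred I) (f : I -> 'rV[R]_n -> R) :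
 (forall i, class_C k (f i)) -> class_C k (fun x => \prod_(i <- s | P i) f i x).
move=> cf; elim: s => [|i s IH].
 rewrite [X in class_C _ X](_ : _ = cst 1); first exact: class_C_cst.
 by apply/funext => x; rewrite big_nil.
case Pi : (P i); last first.
 rewrite [X in class_C _ X](_ : _ = (fun x => \prod_(i <- s | P i) f i x)) //.
 by apply/funext => x; rewrite big_cons Pi.
rewrite [X in class_C _ X](_ : _ = (fun x => f i x * \prod_(i <- s | P i) f i x)).
 exact: class_CM.
by apply/funext => x; rewrite big_cons Pi.
Qed.

Lemma compact_box (a b : 'I_n -> R) :
 compact [set x : 'rV[R]_n | forall i, x ord0 i \in `[a i, b i]].
have := @rV_compact R^o n (fun i => `[a i, b i]%classic).
apply => i; exact: segment_compact.
Qed.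

(** Every concrete test function built below has this product form; a partial derivative affects a
    single factor. *)
Definition tensor (b : 'I_n -> R -> R) (x : 'rV[R]_n) := \prod_j b j (x ord0 j).

Lemma is_derive_tensor (b : 'I_n -> R -> R) (i : 'I_n) x (l : R) :
 is_derive (x ord0 i) 1 (b i) l ->
 is_derive x 'e_i (tensor b) (l * \prod_(j | j != i) b j (x ord0 j)).
move=> db; apply/is_derive_line; rewrite /tensor.
set c := \prod_(j | j != i) b j (x ord0 j).
have E : (fun h : R => \prod_j b j ((h *: 'e_i + x) ord0 j)) =
 (fun h : R => c * b i (1 * h + x ord0 i)).
 apply/funext => h /=; rewrite (bigD1 i)//= mulrC; congr (_ * _).
 apply: eq_bigr => j /negPf ji; rewrite !mxE eqxx/= ji.
 by rewrite mulr0 add0r.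
 by rewrite !mxE !eqxx/= mulr1 mul1r.
rewrite E mulrC.
have dc : is_derive (0 : R) 1 (b i \o (fun h : R => 1 * h + x ord0 i)) l.
 rewrite -[l]mulr1; apply: is_derive1_comp; last exact: is_derive_affine.
 by rewrite mulr0 add0r.
exact: (is_deriveZ c dc).
Qed.

Lemma test_tensor (b : 'I_n -> R -> R) (a c : 'I_n -> R) :
 (forall j, smooth (b j)) ->
 (forall j t, t \notin `[a j, c j] -> b j t = 0) ->
 [set x : 'rV[R]_n | forall i, x ord0 i \in `[a i, c i]] `<=` unit_ball (n:=n) ->
 test_function (tensor b).
move=> sb b0 sub; split.
 by move=> k; apply: class_C_prod => j; exact/class_C_coord/sb.
exists [set x : 'rV[R]_n | forall i, x ord0 i \in `[a i, c i]]; split => //.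
 exact: compact_box.
by move=> x /existsNP[i /negP xi]; rewrite /tensor (bigD1 i)//= b0// mul0r.
Qed.

End line_derivative.

(** * Euclidean norm and scalar product *)

Section euclidean_norm.
Context (R : realType) (n : nat).
Implicit Types x y : 'rV[R]_n.

Lemma enorm_ge0 x : 0 <= enorm x. Proof. exact: sqrtr_ge0. Qed.

Lemma sqr_enorm x : enorm x ^+ 2 = dotp x x.
by rewrite /enorm sqr_sqrtr// dotp_ge0. Qed.

Lemma dotpC x y : dotp x y = dotp y x.
by apply: eq_bigr => i _; rewrite mulrC. Qed.

Lemma dotpDl x y z : dotp (x + y) z = dotp x z + dotp y z.
by rewrite /dotp -big_split; apply: eq_bigr => i _; rewrite mxE mulrDl. Qed.

Lemma dotpZl c x y : dotp (c *: x) y = c * dotp x y.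
by rewrite /dotp mulr_sumr; apply: eq_bigr => i _; rewrite mxE mulrA. Qed.

Lemma dotpDr x y z : dotp z (x + y) = dotp z x + dotp z y.
by rewrite dotpC dotpDl !(dotpC z). Qed.

Lemma dotpZr c x y : dotp y (c *: x) = c * dotp y x.
by rewrite dotpC dotpZl (dotpC y). Qed.

Lemma enorm0 : enorm (0 : 'rV[R]_n) = 0.
by apply/eqP; rewrite -sqrf_eq0 sqr_enorm -(scale0r (0 : 'rV_n)) dotpZl mul0r.
Qed.

Lemma enormZ c x : enorm (c *: x) = `|c| * enorm x.
apply/eqP; rewrite -(@eqrXn2 _ 2) ?mulr_ge0 ?enorm_ge0// exprMn !sqr_enorm.
by rewrite dotpZl dotpZr mulrA -expr2 real_normK ?num_real.
Qed.

Lemma enorm_eq0 x : (enorm x == 0) = (x == 0).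
apply/eqP/eqP => [|->]; last exact: enorm0.
move/eqP; rewrite -sqrf_eq0 sqr_enorm /dotp psumr_eq0; last first.
 by move=> i _; rewrite -expr2 sqr_ge0.
move=> /allP x0; apply/rowP => i; rewrite mxE.
have := x0 i (mem_index_enum _); rewrite /= mulf_eq0 orbb => /eqP.
by rewrite (_ : 0 = ord0)// ord1.
Qed.

Lemma enorm_gt0 x : (0 < enorm x) = (x != 0).
by rewrite lt0r enorm_eq0 enorm_ge0 andbT. Qed.

(** Expand the nonnegative square norm of |x|^2 y - (x.y) x and divide by |x|^2. *)
Lemma dotp_le x y : `|dotp x y| <= enorm x * enorm y.
have [->|x0] := eqVneq x 0.
 by rewrite enorm0 mul0r -(scale0r (0 : 'rV_n)) dotpZl mul0r normr0.
rewrite -(@ler_pXn2r _ 2)// ?nnegrE ?mulr_ge0 ?enorm_ge0//.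
rewrite real_normK ?num_real// exprMn !sqr_enorm.
have xx : 0 < dotp x x by rewrite -sqr_enorm exprn_gt0// enorm_gt0.
have := dotp_ge0 (dotp x x *: y - dotp x y *: x).
rewrite -scaleNr dotpDl !dotpDr !dotpZl !dotpZr (dotpC y x).
rewrite (_ : _ + _ = dotp x x * (dotp x x * dotp y y - dotp x y ^+ 2)); last by ring.
by rewrite pmulr_rge0// subr_ge0.
Qed.

Lemma enormD x y : enorm (x + y) <= enorm x + enorm y.
rewrite -(@ler_pXn2r _ 2)// ?nnegrE ?addr_ge0 ?enorm_ge0//.
rewrite sqr_enorm dotpDl !dotpDr (dotpC y x) -!sqr_enorm.
have := le_trans (ler_norm _) (dotp_le x y); lra.
Qed.

Lemma coord_le_enorm x i : `|x ord0 i| <= enorm x.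
rewrite -(@ler_pXn2r _ 2)// ?nnegrE ?enorm_ge0// real_normK ?num_real//.
rewrite sqr_enorm /dotp (bigD1 i)//= -expr2 lerDl sumr_ge0// => j _.
by rewrite -expr2 sqr_ge0.
Qed.

Lemma enorm_delta (i : 'I_n) : @enorm R n 'e_i = 1.
apply/eqP; rewrite -(@eqrXn2 _ 2)// ?enorm_ge0// sqr_enorm /dotp (bigD1 i)//=.
rewrite big1 => [|j /negPf ji]; last by rewrite !mxE eqxx/= ji mul0r.
by rewrite !mxE !eqxx mulr1 addr0 expr1n.
Qed.

Lemma dotp_delta x (i : 'I_n) : dotp x 'e_i = x ord0 i.
rewrite /dotp (bigD1 i)//= big1 => [|j /negPf ji].
 by rewrite !mxE !eqxx mulr1 addr0.
by rewrite !mxE eqxx/= ji mulr0.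
Qed.

Lemma sqr_enorm_shift x t (i : 'I_n) :
 enorm (x + t *: 'e_i) ^+ 2 = enorm x ^+ 2 + 2 * t * x ord0 i + t ^+ 2.
rewrite !sqr_enorm dotpDl !dotpDr !dotpZl !dotpZr (dotpC _ x) dotp_delta.
by rewrite -[dotp 'e_i 'e_i]sqr_enorm enorm_delta; ring.
Qed.

Lemma unit_ball_segment x s t (i : 'I_n) : 0 <= t <= s ->
 unit_ball x -> unit_ball (x + s *: 'e_i) -> unit_ball (x + t *: 'e_i).
move=> /andP[t0 ts]; rewrite /unit_ball/= => x1 xs1.
have [s0|s0] := leP s 0.
 by rewrite (_ : t = 0) ?scale0r ?addr0//; lra.
rewrite (_ : x + _ = (1 - t / s) *: x + (t / s) *: (x + s *: 'e_i)); last first.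
 by rewrite scalerDr addrA -scalerDl subrK scale1r scalerA divfK// gt_eqF.
have t1 : t / s <= 1 by rewrite ler_pdivrMr// mul1r.
have t2 : 0 <= t / s by rewrite divr_ge0// ltW.
apply: le_lt_trans (enormD _ _) _; rewrite !enormZ !ger0_norm ?subr_ge0//.
have [->|t3] := eqVneq (t / s) 1; first by rewrite subrr mul0r add0r mul1r.
rewrite [ltRHS](_ : 1 = (1 - t / s) * 1 + (t / s) * 1); last by rewrite !mulr1 subrK.
rewrite ltr_leD// ?ler_wpM2l ?(ltW xs1)// ltr_pM2l// subr_gt0 lt_neqAle t3//.
Qed.

Lemma enorm_continuous : continuous (@enorm R n).
move=> x; rewrite /enorm /continuous_at.
apply: (@continuous_comp _ _ _ (fun x : 'rV[R]_n => dotp x x) Num.sqrt); last first.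
 exact: sqrt_continuous.
apply: continuous_big => [|i _ y]; first exact: add_continuous.
by apply: continuousM; exact: coord_continuous.
Qed.

Lemma open_unit_ball : open (@unit_ball R n).
rewrite (_ : unit_ball (n:=n) = @enorm R n @^-1` [set r | r < 1])//.
by apply: open_comp; [move=> x _; exact: enorm_continuous|exact: open_lt].
Qed.

Lemma ball_lty : (lebesgue_rV R n (unit_ball (n:=n)) < +oo)%E.
apply: le_lt_trans (lebesgue_box_lty (fun _ : 'I_n => -1) (fun _ : 'I_n => 1)).
apply: le_measure; rewrite ?inE; [exact: measurable_unit_ball|exact: measurable_box|].
move=> x; rewrite /unit_ball/= => x1 i; rewrite in_itv/= -ltr_norml.
exact: le_lt_trans (coord_le_enorm _ _) x1.
Qed.

End euclidean_norm.

(** * The du Bois-Reymond lemma on open sets *)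

Section du_bois_reymond.
Context (R : realType) (n : nat).
Local Notation leb := (lebesgue_rV R n).

Definition cbox (a c : 'I_n -> R) : set 'rV[R]_n :=
 [set x | forall i, x ord0 i \in `[a i, c i]].

Lemma box_cbox a c : box a c `<=` cbox a c.
by move=> x xac i; move: (xac i); apply: subset_itv_oo_cc. Qed.

Lemma measurable_cbox a c : measurable (cbox a c).
rewrite (_ : cbox a c = \bigcap_(i in [set: 'I_n])
 ((fun x : 'rV[R]_n => x ord0 i) @^-1` `[a i, c i]%classic)).
 apply: fin_bigcap_measurable => [|i _]; first exact: finite_finset.
 by rewrite -[X in measurable X]setTI; exact: measurable_coord.
by apply/seteqP; split => x /= H i; [move=> _|]; exact: H.
Qed.

Lemma ae_eq0_box (a c : 'I_n -> R) (k : 'rV[R]_n -> R) :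
 leb.-integrable (cbox a c) (EFin \o k) ->
 (forall a' c', (forall i, a' i < c' i) -> cbox a' c' `<=` cbox a c ->
 (\int[leb]_(x in box a' c') (k x)%:E = 0)%E) ->
 {ae leb, forall x, box a c x -> k x = 0}.
move=> ki k0.
have {}k0 a' c' : cbox a' c' `<=` cbox a c -> (\int[leb]_(x in box a' c') (k x)%:E = 0)%E.
 move=> sub; have [/forallP/=ac|/forallPn/=[i aci]] := boolP [forall i, a' i < c' i].
 exact: k0.
 rewrite (_ : box a' c' = set0) ?integral_set0//; apply/seteqP; split=> // x.
 by move=> /(_ i); rewrite in_itv/= => /andP[+ /(lt_trans _)h] => /h; apply/negP.
apply: (@ae_eq0_pi_system _ _ _ leb (boxes (n:=n)) (box a c)) => //.
- exact: rV_measurableE.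
- exact: setI_closed_boxes.
- exact: measurable_box.
- apply: integrableS ki; [exact: measurable_cbox|exact: measurable_box|exact: box_cbox].
- exact: k0.
- move=> _ [a' [c' ->]].
 have -> : box a c `&` box a' c' = box (fun i => Num.max (a i) (a' i))
 (fun i => Num.min (c i) (c' i)).
 apply/seteqP; split => x /=.
 move=> [ab cd] i; move: (ab i) (cd i); rewrite !in_itv/=.
 by move=> /andP[? ?] /andP[? ?]; rewrite gt_max lt_min; apply/andP; split; apply/andP.
 move=> abcd; split=> i; move: (abcd i); rewrite !in_itv/= gt_max lt_min.
 by move=> /andP[/andP[-> _] /andP[-> _]].
 by move=> /andP[/andP[_ ->] /andP[_ ->]].
 apply: k0 => x xac i; move: (xac i); rewrite !in_itv/= ge_max le_min.
 by move=> /andP[/andP[-> _] /andP[-> _]].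
Qed.

(** Countably many grid boxes with closure in O cover the open set O; k vanishes almost everywhere
    on each, and a countable union of null sets is null. *)
Lemma ae_eq0_open (O : set 'rV[R]_n) (k : 'rV[R]_n -> R) : open O ->
 (forall a c, cbox a c `<=` O -> leb.-integrable (cbox a c) (EFin \o k)) ->
 (forall a c, (forall i, a i < c i) -> cbox a c `<=` O ->
 (\int[leb]_(x in box a c) (k x)%:E = 0)%E) ->
 {ae leb, forall x, O x -> k x = 0}.
move=> oO ki k0.
(* The pair (z, m) encodes the box of side 2 / (m + 1) centred at the grid point z / (m + 1). *)
pose lo (zm : {ffun 'I_n -> int} * nat) i : R := ((zm.1 i)%:~R - 1) / zm.2.+1%:R.
pose hi (zm : {ffun 'I_n -> int} * nat) i : R := ((zm.1 i)%:~R + 1) / zm.2.+1%:R.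
pose B j := if unpickle j is Some zm then
 [set x | cbox (lo zm) (hi zm) `<=` O /\ box (lo zm) (hi zm) x /\ k x != 0] else set0.
have : leb.-negligible (\bigcup_j B j).
 apply: negligible_bigcup => j; rewrite /B; case: unpickle => [zm|]; last exact: negligible_set0.
 have [sub|nsub] := pselect (cbox (lo zm) (hi zm) `<=` O); last first.
 by rewrite (_ : mkset _ = set0)//; [exact: negligible_set0|apply/seteqP; split => // x []].
 have := ae_eq0_box (ki _ _ sub) (fun a' c' ac s => k0 a' c' ac (subset_trans s sub)).
 apply: negligibleS => x /= [_ [xb kx]] H; move/eqP: kx; apply; exact: H.
apply: negligibleS => x /= /not_implyP[Ox kx].
have /nbhs_ballP[e /= e0 eO] : nbhs x O by exact: open_nbhs_nbhs.
(* A mesh this fine keeps the closed grid box containing x inside the ball of radius e. *)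
have [m me] : exists m : nat, 2 / e < m.+1%:R.
 by exists (Num.truncn (2 / e)); exact: truncnS_gt.
have m0 : 0 < m.+1%:R :> R by rewrite ltr0n.
pose zm : {ffun 'I_n -> int} * nat :=
 ([ffun i => Num.floor (x ord0 i * m.+1%:R)], m).
exists (pickle zm) => //; rewrite /B pickleK.
have zx i : (zm.1 i)%:~R <= x ord0 i * m.+1%:R < (zm.1 i)%:~R + 1.
 by rewrite ffunE floor_le_tmp/= -intrD1 floorD1_gt.
split; last split; last exact/eqP.
 move=> y yB; apply: eO; split => // i j; rewrite (ord1 i).
 move: (yB j) (zx j); rewrite in_itv/= /lo /hi/= ler_pdivrMr// ler_pdivlMr//.
 move=> /andP[y1 y2] /andP[x1 x2].
 rewrite -ball_normE/= -(ltr_pM2r m0) -[X in _ * X < _](gtr0_norm m0) -normrM.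
 rewrite mulrBl ltr_norml.
 have : 2 < e * m.+1%:R by rewrite mulrC -ltr_pdivrMr.
 by lra.
move=> i; rewrite in_itv/= /lo /hi/= ltr_pdivrMr// ltr_pdivlMr//.
by have := zx i; lra.
Qed.

End du_bois_reymond.

(** * Support, restriction and bounded factors *)

Section more_integration.
Context d (T : measurableType d) (R : realType) (mu : {measure set T -> \bar R}).

Lemma Rintegral_support (D K : set T) (f : T -> R) : K `<=` D ->
 (forall x, D x -> ~ K x -> f x = 0) ->
 \int[mu]_(x in D) f x = \int[mu]_(x in K) f x.
move=> KD f0; rewrite -[in RHS](setIidr KD) Rintegral_mkcondr.
apply: eq_Rintegral => x /set_mem Dx; rewrite patchE; case: ifPn => //.
by rewrite notin_setE => /(f0 x Dx).
Qed.

Lemma measurable_prod_fun (I : Type) (s : seq I) (D : set T) (f : I -> T -> R) :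
 (forall i, measurable_fun D (f i)) -> measurable_fun D (fun x => \prod_(i <- s) f i x).
move=> mf; elim: s => [|i s IH].
 by under eq_fun do rewrite big_nil; exact: measurable_cst.
by under eq_fun do rewrite big_cons; exact: mfunM.
Qed.

Lemma Rintegral_restrict (D : set T) (f : T -> R) :
 \int[mu]_x (f \_ D) x = \int[mu]_(x in D) f x.
by rewrite [RHS]Rintegral_mkcond. Qed.

Lemma intg_restrict (D : set T) (f : T -> R) : measurable D ->
 mu.-integrable D (EFin \o f) <-> mu.-integrable setT (EFin \o (f \_ D)).
by move=> mD; rewrite -restrict_EFin; exact: integrable_mkcond. Qed.

Lemma integrableMb (D : set T) (f g : T -> R) (M : R) : measurable D ->
 mu.-integrable D (EFin \o f) -> measurable_fun D g ->
 (forall x, D x -> `|g x| <= M) -> mu.-integrable D (EFin \o (fun x => f x * g x)).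
move=> mD fi mg gM; have mf := integrable_mfun fi.
apply: (@intg_le _ _ _ _ _ _ (fun x => M * `|f x|)) => //.
- exact: mfunM.
- exact: (integrableZl mD M (integrable_norm fi)).
- by move=> x Dx; rewrite normrM mulrC ler_wpM2r// gM.
Qed.

End more_integration.

Section FTC_real.
Context (R : realType).

Lemma FTC2_everywhere (F f : R -> R) (a b : R) : a <= b ->
 (forall t : R, is_derive t 1 F (f t)) -> continuous f ->
 \int[lebesgue_measure]_(t in `[a, b]) f t = F b - F a.
rewrite le_eqVlt => /predU1P[<-|ab] dF cf.
 by rewrite set_itv1 Rintegral_set1 subrr.
have cF : continuous F by move=> t; exact: derive_continuous (dF t).
rewrite /Rintegral (@continuous_FTC2 _ f F) -?EFinB//.
- exact: continuous_subspaceT.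
- split => [x _| |].
 + by have [] := dF x.
 + exact: (cvg_at_right_filter (cF a)).
 + exact: (cvg_at_left_filter (cF b)).
- by move=> x _; rewrite derive1E; have [_ ->] := dF x.
Qed.

End FTC_real.

(** * Bump functions on boxes *)

Section bump_boxes.
Context (R : realType) (n : nat).
Local Notation leb := (lebesgue_rV R n).
Implicit Types (a c : 'I_n -> R).

Definition bbox (eps : R) a c : 'rV[R]_n -> R := tensor (fun j => bump eps (a j) (c j)).

Lemma measurable_tensor (b : 'I_n -> R -> R) : (forall j, continuous (b j)) ->
 measurable_fun setT (tensor b).
move=> cb; apply: measurable_prod_fun => j.
apply: (mcompT _ (measurable_coord j)).
exact: continuous_measurable_fun.
Qed.

Lemma measurable_bbox eps a c : 0 < eps -> measurable_fun setT (bbox eps a c).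
by move=> e0; apply: measurable_tensor => j; exact: bump_continuous. Qed.

Lemma bbox_ge0 eps a c x : 0 <= bbox eps a c x.
by apply: prodr_ge0 => j _; exact: bump_ge0. Qed.

Lemma bbox_le1 eps a c x : 0 < eps -> `|bbox eps a c x| <= 1.
move=> e0; rewrite ger0_norm ?bbox_ge0//; apply: Num.Theory.prodr_ile1 => j _.
by rewrite bump_ge0 bump_le1.
Qed.

Lemma bbox_eq0 eps a c x : ~ box a c x -> bbox eps a c x = 0.
by move=> /existsNP[j /negP xj]; rewrite /bbox /tensor (bigD1 j)//= bump_eq0// mul0r.
Qed.

Lemma cvg_bbox a c x : bbox (k.+1%:R^-1) a c x @[k --> \oo] --> (\1_(box a c) x : R).
rewrite (_ : \1_(box a c) x = \prod_j \1_(`]a j, c j[%classic : set R) (x ord0 j)).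
 apply: cvg_big => [|j _]; last exact: cvg_bump.
 exact: mul_continuous.
rewrite indicE; case: (boolP (x \in _)) => [/set_mem xac|].
 rewrite big1// => j _; rewrite indicE mem_set//; exact: xac.
rewrite notin_setE => /existsNP[j xj].
by rewrite (bigD1 j)//= indicE memNset ?mul0r.
Qed.

Lemma cvg_integral_bbox (k : 'rV[R]_n -> R) a c :
 leb.-integrable (cbox a c) (EFin \o k) ->
 (fun m : nat => \int[leb]_(x in cbox a c) (k x * bbox (m.+1%:R^-1) a c x)) @ \oo
 --> \int[leb]_(x in box a c) k x.
move=> ki; have mk := integrable_mfun ki.
have mK := measurable_cbox a c; have mB := measurable_box a c.
rewrite -(@setIidr _ (cbox a c) (box a c))//; last exact: box_cbox.
rewrite Rintegral_mkcondr.
apply: (@Rdominated_cvg _ _ _ _ _ _ _ (fun x => `|k x|)) => //.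
- by move=> m; apply: mfunM => //; apply: mfunTS; exact: measurable_bbox.
- by apply/measurable_restrict => //; apply: measurable_funS mk.
- apply: aeW => x _ /=; rewrite patchE.
 rewrite (_ : (if _ then _ else _) = k x * \1_(box a c) x); last first.
 by rewrite indicE; case: ifP => _; rewrite ?mulr1 ?mulr0.
 by apply: cvgM; [exact: cvg_cst|exact: cvg_bbox].
- exact: integrable_norm.
- apply: aeW => x m _ /=; rewrite normrM ler_piMr//; exact: bbox_le1.
Qed.

(** The form of the du Bois-Reymond lemma used throughout: smooth bumps suffice as tests because
    they converge boundedly to indicators of boxes. *)
Lemma ae_eq0_bbox (O : set 'rV[R]_n) (k : 'rV[R]_n -> R) : open O ->
 (forall a c, cbox a c `<=` O -> leb.-integrable (cbox a c) (EFin \o k)) ->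
 (forall eps a c, 0 < eps -> (forall i, a i < c i) -> cbox a c `<=` O ->
 \int[leb]_(x in cbox a c) (k x * bbox eps a c x) = 0) ->
 {ae leb, forall x, O x -> k x = 0}.
move=> oO ki k0; apply: (ae_eq0_open oO) => // a c ac sub.
have ki' := ki _ _ sub.
have := cvg_integral_bbox ki'; under eq_fun do rewrite k0//.
move=> /(cvg_lim (@Rhausdorff _)); rewrite lim_cst//.
rewrite /Rintegral => h; rewrite -[LHS]fineK -?h//.
apply: integrable_fin_num; first exact: measurable_box.
apply: integrableS ki'; [exact: measurable_cbox|exact: measurable_box|exact: box_cbox].
Qed.

Lemma test_bbox eps a c : 0 < eps -> cbox a c `<=` unit_ball (n:=n) ->
 test_function (bbox eps a c).
move=> e0 sub; apply: (@test_tensor _ _ _ a c) => //.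
 by move=> j; exact: smooth_bump.
move=> j t tac; apply: bump_eq0; apply: contra tac; exact: subset_itv_oo_cc.
Qed.

End bump_boxes.

Section restricted_integrals.
Context d (T : measurableType d) (R : realType) (mu : {measure set T -> \bar R}).

Lemma Rintegral_indicM (D : set T) (f : T -> R) :
 \int[mu]_(x in D) f x = \int[mu]_x (\1_D x * f x).
rewrite Rintegral_mkcond; apply: eq_Rintegral => x _; rewrite patchE indicE.
by case: ifP; rewrite ?mul1r ?mul0r.
Qed.

Lemma Rintegral_patchM (D : set T) (f g : T -> R) :
 \int[mu]_(x in D) (f x * g x) = \int[mu]_x ((f \_ D) x * g x).
rewrite Rintegral_mkcond; apply: eq_Rintegral => x _; rewrite !patchE.
by case: ifP; rewrite ?mul0r.
Qed.

Lemma intgD (D : set T) (f g : T -> R) : measurable D ->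
 mu.-integrable D (EFin \o f) -> mu.-integrable D (EFin \o g) ->
 mu.-integrable D (EFin \o (fun x => f x + g x)).
by move=> mD fi gi; apply: eq_integrable (integrableD mD fi gi). Qed.

Lemma intgB (D : set T) (f g : T -> R) : measurable D ->
 mu.-integrable D (EFin \o f) -> mu.-integrable D (EFin \o g) ->
 mu.-integrable D (EFin \o (fun x => f x - g x)).
by move=> mD fi gi; apply: eq_integrable (integrableB mD fi gi). Qed.

Lemma intgZ (D : set T) (c : R) (f : T -> R) : measurable D ->
 mu.-integrable D (EFin \o f) -> mu.-integrable D (EFin \o (fun x => c * f x)).
by move=> mD fi; apply: eq_integrable (integrableZl mD c fi). Qed.

End restricted_integrals.

(** * Increments along coordinate lines *)

Section line.
Context (R : realType) (n : nat).
Local Notation leb := (lebesgue_rV R n).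
Local Notation mu1 := (@lebesgue_measure R).
Local Notation Omega := (@unit_ball R n).

Lemma measurable_line i :
 measurable_fun setT (fun z : 'rV[R]_n * measurableTypeR R => z.1 + z.2 *: 'e_i).
apply: measurable_fun_rV => j; under eq_fun do rewrite !mxE.
apply: measurable_funD.
 by apply: (mcompT (measurable_coord j)); exact: measurable_fst.
by apply: mfunM => //; exact: measurable_snd.
Qed.

Lemma measurable_indic_snd (s : R) : measurable_fun setT
 (fun z : 'rV[R]_n * measurableTypeR R => \1_(`[0, s]%classic : set R) z.2 : R).
apply: (mcompT _ (@measurable_snd _ _ 'rV[R]_n (measurableTypeR R))).
exact: measurable_indic.
Qed.

(** By translation invariance the integral over x does not depend on t, so Tonelli leaves the length
    s times the norm of w. *)
Lemma integrable_line i s (w : 'rV[R]_n -> R) : 0 <= s ->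
 leb.-integrable setT (EFin \o w) ->
 (leb \x mu1)%E.-integrable setT (EFin \o
 (fun z => \1_(`[0, s]%classic : set R) z.2 * w (z.1 + z.2 *: 'e_i))).
move=> s0 wi; have mw := integrable_mfun wi.
have mf : measurable_fun setT (EFin \o
 (fun z : 'rV[R]_n * measurableTypeR R =>
 \1_(`[0, s]%classic : set R) z.2 * w (z.1 + z.2 *: 'e_i))).
 apply/measurable_EFinP; apply: mfunM; first exact: measurable_indic_snd.
 exact: (mcompT mw (measurable_line i)).
apply/integrable21ltyP => //=.
have /integrableP[mEw wlty] := wi.
have E (t : measurableTypeR R) : (\int[leb]_x
 `|(\1_(`[0, s]%classic : set R) t * w (x + t *: 'e_i))%:E| =
 (\1_(`[0, s]%classic : set R) t)%:E * \int[leb]_x `|(w x)%:E|)%E.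
 rewrite -(ge0_integral_shift (t *: 'e_i) (f := fun x => `|(w x)%:E|%E))//; last first.
 exact: mcompT.
 rewrite -ge0_integralZl//; last first.
 by apply: mcompT => //; exact: (mfun_shift _ mEw).
 by apply: eq_integral => x _; rewrite EFinM abseM gee0_abs ?lee_fin.
under eq_integral do rewrite E.
rewrite ge0_integralZr ?integral_ge0//; last first.
 by apply/measurable_EFinP; exact: measurable_indic.
rewrite integral_indic// setIT.
rewrite lte_mul_pinfty//; have := @lebesgue_measure_itv R `[0, s].
by rewrite fin_numElt => /= ->; case: ifP => _; rewrite -?EFinB ltNyr ltry.
Qed.

(** An integrated form of the statement that Ui is the i-th weak derivative of u. The step s is
    fixed before the exceptional set of x, which suits translations and Fubini, and no test function
    occurs. *)
Definition line_ftc (u Ui : 'rV[R]_n -> R) (i : 'I_n) := forall s, 0 < s ->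
 {ae leb, forall x, Omega x -> Omega (x + s *: 'e_i) ->
 u (x + s *: 'e_i) - u x = \int[mu1]_(t in `[0, s]) Ui (x + t *: 'e_i)}.

Lemma weak_gradient_unique u (G1 G2 : 'rV[R]_n -> 'rV[R]_n) i :
 weak_gradient u G1 -> weak_gradient u G2 ->
 {ae leb, forall x, Omega x -> G1 x ord0 i = G2 x ord0 i}.
move=> [mG1 iG1 wG1] [mG2 iG2 wG2].
have cK (a c : 'I_n -> R) : compact (cbox a c) by exact: compact_box.
have : {ae leb, forall x, Omega x -> G1 x ord0 i - G2 x ord0 i = 0}.
 apply: ae_eq0_bbox; first exact: open_unit_ball.
 move=> a c sub; have mK := measurable_cbox a c.
 exact: (intgB mK (iG1 i _ (cK a c) sub) (iG2 i _ (cK a c) sub)).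
 move=> eps a c eps0 ac sub; have mK := measurable_cbox a c.
 have tphi := test_bbox eps0 sub.
 under eq_Rintegral do rewrite mulrBl.
 have bb f : leb.-integrable (cbox a c) (EFin \o f) ->
 leb.-integrable (cbox a c) (EFin \o (fun x => f x * bbox eps a c x)).
 move=> fi; apply: (@integrableMb _ _ _ _ _ _ _ 1) => //.
 by apply: mfunTS; exact: measurable_bbox.
 by move=> x _; exact: bbox_le1.
 rewrite RintegralB//; last 2 first.
 by apply: (bb (fun x => G1 x ord0 i)); exact: iG1.
 by apply: (bb (fun x => G2 x ord0 i)); exact: iG2.
 have := wG1 i _ tphi; rewrite wG2// => /oppr_inj.
 rewrite (@Rintegral_support _ _ _ _ _ (cbox a c))//; last first.
 by move=> x _ /(contra_not (@box_cbox _ _ _ _ x)) xac; rewrite bbox_eq0 ?mulr0.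
 rewrite [in X in _ = X -> _](@Rintegral_support _ _ _ _ _ (cbox a c))//; last first.
 by move=> x _ /(contra_not (@box_cbox _ _ _ _ x)) xac; rewrite bbox_eq0 ?mulr0.
 by move=> ->; rewrite subrr.
by apply: filterS => x /= H /H /eqP; rewrite subr_eq0 => /eqP.
Qed.

End line.

(** * From weak gradients to increments *)

Section weak_gradient_line.
Context (R : realType) (n : nat).
Local Notation leb := (lebesgue_rV R n).
Local Notation mu1 := (@lebesgue_measure R).
Local Notation Omega := (@unit_ball R n).

Lemma Rfubini_line i s (w : 'rV[R]_n -> R) : 0 <= s ->
 leb.-integrable setT (EFin \o w) ->
 leb.-integrable setT (EFin \o (fun x => \int[mu1]_(t in `[0, s]) w (x + t *: 'e_i))).
move=> s0 wi; have := integrable_Rintegral1 (integrable_line i s0 wi).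
by apply: eq_integrable => // x _; congr EFin; rewrite [RHS]Rintegral_indicM.
Qed.

Lemma intg_segment (f : R -> R) (a b : R) : continuous f ->
 mu1.-integrable `[a, b] (EFin \o f).
move=> cf; apply: continuous_compact_integrable; first exact: segment_compact.
exact: continuous_subspaceT.
Qed.

(** B integrates the bump over its translates by [0, s]. It is the factor in direction i of the test
    function below; its derivative, a difference of two bumps, produces the increment of u. *)
Lemma bump_primitive (eps a c s : R) : 0 < eps -> 0 <= s ->
 exists B : R -> R, [/\ smooth B,
 forall t : R, is_derive t 1 B (bump eps a c t - bump eps a c (t - s)) &
 forall t, B t = \int[mu1]_(y in `[0, s]) bump eps a c (t - y)].
move=> eps0 s0; pose b := bump eps a c; pose P := primitive b.
have cb : continuous b by exact: bump_continuous.
have sb := smooth_bump eps0 a c.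
have bi := bump_integrable a c eps0.
have sP : smooth P by exact: smooth_primitive.
have dP t := is_derive_primitive t bi cb.
have dPs t : is_derive (t : R) 1 (fun t => P (t - s)) (b (t - s)).
 have -> : (fun t => P (t - s)) = P \o (fun t => 1 * t + - s).
 by apply/funext => y /=; rewrite mul1r.
 rewrite -[b _]mulr1; apply: is_derive1_comp; last exact: is_derive_affine.
 by rewrite mul1r; exact: dP.
exists (fun t => P t - P (t - s)); split.
- move=> k; have := smoothkD (sP k)
 (smoothkM (smoothk_cst k (-1)) (smoothk_affine 1 (- s) (sP k))).
 by under eq_fun do rewrite /= mulN1r mul1r.
- by move=> t; exact: (is_deriveB (dP t) (dPs t)).
- move=> t.
 have dPt (y : R) : is_derive y 1 (fun y => - P (t - y)) (b (t - y)).
 have -> : (fun y => - P (t - y)) = - (P \o (fun y => -1 * y + t)).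
 by apply/funext => z /=; rewrite fctE/= mulN1r addrC.
 have d1 : is_derive y 1 (P \o (fun y => -1 * y + t)) (b (-1 * y + t) * -1).
 by apply: is_derive1_comp; exact: is_derive_affine.
 by apply: (is_derive_eq (is_deriveN d1)); rewrite mulrN1 opprK mulN1r addrC.
 rewrite (@FTC2_everywhere _ _ _ _ _ s0 dPt).
 by rewrite subr0 opprK addrC.
 move=> y; apply: (@continuous_comp _ _ _ (fun y => t - y) b); last exact: cb.
 by apply: cvgB; [exact: cvg_cst|exact: cvg_id].
Qed.

Lemma measurable_line_sub i : measurable_fun setT
 (fun z : 'rV[R]_n * measurableTypeR R => z.1 - z.2 *: 'e_i).
apply: measurable_fun_rV => j; under eq_fun do rewrite !mxE.
apply: measurable_funB.
 by apply: (mcompT (measurable_coord j)); exact: measurable_fst.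
by apply: mfunM => //; exact: measurable_snd.
Qed.

Lemma measurable_line_mean (i : 'I_n) s (psi : 'rV[R]_n -> R) : measurable_fun setT psi ->
 measurable_fun setT (fun x : 'rV[R]_n => \int[mu1]_(t in `[0, s]) psi (x - t *: 'e_i)).
move=> mpsi; under eq_fun do rewrite Rintegral_indicM.
apply: (mfun_Rintegral1 _ (f := fun z : 'rV[R]_n * measurableTypeR R =>
 \1_(`[0, s]%classic : set R) z.2 * psi (z.1 - z.2 *: 'e_i))).
apply: mfunM; first exact: measurable_indic_snd.
exact: (mcompT mpsi (measurable_line_sub i)).
Qed.

Lemma line_mean_bounded (i : 'I_n) s (psi : 'rV[R]_n -> R) (M : R) (x : 'rV[R]_n) : measurable_fun setT psi ->
 (forall x, `|psi x| <= M) ->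
 mu1.-integrable `[0, s] (EFin \o (fun t => psi (x - t *: 'e_i))).
move=> mpsi psiM; apply: measurable_bounded_integrable => //.
- by have := @lebesgue_measure_itv R `[0, s] => /= ->; case: ifP => _; rewrite ?ltry.
- apply: mfunTS.
 exact: (mcompT mpsi (mcompT (measurable_line_sub i) (measurable_pair1 x))).
- exists M; split; first exact: num_real.
 by move=> N MN t _ /=; rewrite (le_trans (psiM _))// ltW.
Qed.

(** Integration along a segment has integration along the opposite segment as its adjoint, by Fubini
    and a translation for each t. *)
Lemma Rintegral_line_swap (i : 'I_n) s (w psi : 'rV[R]_n -> R) (M : R) : 0 <= s ->
 leb.-integrable setT (EFin \o w) -> measurable_fun setT psi ->
 (forall x, `|psi x| <= M) ->
 \int[leb]_x (\int[mu1]_(t in `[0, s]) w (x + t *: 'e_i) * psi x) =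
 \int[leb]_x (w x * \int[mu1]_(t in `[0, s]) psi (x - t *: 'e_i)).
move=> s0 wi mpsi psiM; have mw := integrable_mfun wi.
have mshift := measurable_line_sub i.
have i1 := integrable_line i s0 wi.
have i2 : (leb \x mu1)%E.-integrable setT (EFin \o (fun z =>
 (\1_(`[0, s]%classic : set R) z.2 * w (z.1 + z.2 *: 'e_i)) * psi z.1)).
 apply: (@integrableMb _ _ _ _ _ _ _ M) => //.
 by apply: (mcompT mpsi); exact: measurable_fst.
have i3 : (leb \x mu1)%E.-integrable setT (EFin \o (fun z =>
 (\1_(`[0, s]%classic : set R) z.2 * w z.1) * psi (z.1 - z.2 *: 'e_i))).
 apply: (@integrableMb _ _ _ _ _ _ _ M) => //; last first.
 exact: (mcompT mpsi).
 have := integrable_prod_mul wi (integrable_indic_itv 0 s true false).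
 by apply: eq_integrable => // z _; congr EFin; rewrite /= mulrC.
transitivity (\int[leb]_x \int[mu1]_t
 ((\1_(`[0, s]%classic : set R) t * w (x + t *: 'e_i)) * psi x)).
 apply: ae_eq_Rint => //.
 - apply: mfunM => //.
 exact: (integrable_mfun (Rfubini_line i s0 wi)).
 - exact: (mfun_Rintegral1 _ (integrable_mfun i2)).
 - have := ae_integrable1 i1; apply: filterS => x /= ix _.
 by rewrite [RHS]RintegralZr// [in LHS]Rintegral_indicM.
rewrite (Rfubini i2).
transitivity (\int[mu1]_t \int[leb]_x
 ((\1_(`[0, s]%classic : set R) t * w x) * psi (x - t *: 'e_i))).
 apply: eq_Rintegral => t _.
 rewrite -[in RHS](Rintegral_shift (t *: 'e_i)); last first.
 apply: mfunM; first exact: mfunM.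
 exact: mfun_shift.
 by apply: eq_Rintegral => x _; rewrite addrK.
rewrite -(Rfubini i3); apply: eq_Rintegral => x _.
rewrite [in RHS]Rintegral_indicM -RintegralZl//.
 by apply: eq_Rintegral => t _; ring.
have := (intg_restrict _ _ _).1 (line_mean_bounded i s x mpsi psiM).
move=> /(_ (measurable_itv _)); apply: eq_integrable => // t _.
by rewrite /= patchE indicE; case: ifP; rewrite ?mul1r ?mul0r.
Qed.

(** On the set where both end points lie in the ball, the defect of the identity is orthogonal to
    every bump chi. To see this, test the weak gradient with the integral of chi over the opposite
    segment, whose i-th derivative is chi(x) - chi(x - s e_i). *)
Theorem weak_gradient_line_ftc u (G : 'rV[R]_n -> 'rV[R]_n) i :
 int_ball R n u -> weak_gradient u G ->
 int_ball R n (fun x => G x ord0 i) ->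
 line_ftc u (fun x => G x ord0 i) i.
move=> ui [_ _ wG] Gi s s0.
have mO := @measurable_unit_ball R n.
pose u0 := u \_ Omega; pose w := (fun x => G x ord0 i) \_ Omega.
have u0i : leb.-integrable setT (EFin \o u0) := (intg_restrict _ _ mO).1 ui.
have wi : leb.-integrable setT (EFin \o w) := (intg_restrict _ _ mO).1 Gi.
have mu0 := integrable_mfun u0i.
have mw := integrable_mfun wi.
pose H x := \int[mu1]_(t in `[0, s]) w (x + t *: 'e_i).
have Hi : leb.-integrable setT (EFin \o H) by apply: Rfubini_line => //; exact: ltW.
pose O := Omega `&` [set x | Omega (x + s *: 'e_i)].
have oO : open O.
 apply: openI; first exact: open_unit_ball.
 apply: (@open_comp _ _ (fun x : 'rV[R]_n => x + s *: 'e_i)).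
 by move=> x _; exact: (cvgD cvg_id (cvg_cst _)).
 exact: open_unit_ball.
have usi : leb.-integrable setT (EFin \o (fun x => u0 (x + s *: 'e_i))).
 exact: integrable_shift.
have ki : leb.-integrable setT (EFin \o (fun x => u0 (x + s *: 'e_i) - u0 x - H x)).
 by apply: intgB => //; exact: intgB.
suff : {ae leb, forall x, O x -> u0 (x + s *: 'e_i) - u0 x - H x = 0}.
 apply: filterS => x /= Hx Ox Oxs; have /eqP := Hx (conj Ox Oxs).
 rewrite subr_eq0 /u0 !patchE !mem_set// => /eqP ->; apply: eq_Rintegral => t.
 rewrite inE/= in_itv/= => ts; rewrite /w patchE mem_set//.
 exact: unit_ball_segment ts Ox Oxs.
apply: ae_eq0_bbox oO _ _ => [a c sub|eps a c eps0 ac sub].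
 by apply: integrableS ki => //; exact: measurable_cbox.
set chi := bbox eps a c.
have mchi : measurable_fun setT chi by exact: measurable_bbox.
have chi1 x : `|chi x| <= 1 by exact: bbox_le1.
have mulchi f : leb.-integrable setT (EFin \o f) ->
 leb.-integrable setT (EFin \o (fun x => f x * chi x)).
 by move=> fi; apply: (@integrableMb _ _ _ _ _ _ _ 1).
rewrite -(@Rintegral_support _ _ _ _ setT)//; last first.
 by move=> x _ /(contra_not (@box_cbox _ _ _ _ x)) xac; rewrite /chi bbox_eq0 ?mulr0.
under eq_Rintegral do rewrite mulrBl mulrBl.
rewrite RintegralB//; [|by apply: intgB => //; exact: mulchi|exact: mulchi].
rewrite RintegralB//; [|exact: mulchi|exact: mulchi].
have [B [sB dB EB]] := bump_primitive (a i) (c i) eps0 (ltW s0).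
pose phi := tensor (fun j => if j == i then B else bump eps (a j) (c j)).
have phiE x : phi x = \int[mu1]_(t in `[0, s]) chi (x - t *: 'e_i).
 rewrite /phi /tensor (bigD1 i)//= eqxx EB mulrC -RintegralZl//; last first.
 apply: intg_segment => y.
 apply: (@continuous_comp _ _ _ (fun y => x ord0 i - y) (bump eps (a i) (c i))).
 by apply: cvgB; [exact: cvg_cst|exact: cvg_id].
 exact: bump_continuous.
 apply: eq_Rintegral => t _; rewrite /chi /bbox /tensor [RHS](bigD1 i)//= mulrC.
 rewrite !mxE !eqxx/= mulr1; congr (_ * _); apply: eq_bigr => j /negPf ji.
 by rewrite ji !mxE eqxx/= ji mulr0 subr0.
have dphi x : 'D_'e_i phi x = chi x - chi (x - s *: 'e_i).
 have dBx : is_derive (x ord0 i) 1 (if i == i then B else bump eps (a i) (c i))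
 (bump eps (a i) (c i) (x ord0 i) - bump eps (a i) (c i) (x ord0 i - s)).
 by rewrite eqxx; exact: dB.
 have [_ ->] := is_derive_tensor (b := fun j => if j == i then B else bump eps (a j) (c j)) dBx.
 rewrite /chi /bbox /tensor mulrBl; congr (_ - _).
 rewrite [RHS](bigD1 i)//=; congr (_ * _).
 by apply: eq_bigr => j /negPf ->.
 rewrite [RHS](bigD1 i)//= !mxE !eqxx/= mulr1; congr (_ * _).
 by apply: eq_bigr => j /negPf ji; rewrite ji !mxE eqxx/= ji mulr0 subr0.
have tphi : test_function phi.
 (* The support is the box stretched by s in direction i. Each of its points lies on a segment
    between two points of the ball, so convexity keeps it inside. *)
 apply: (@test_tensor _ _ _ a (fun j => if j == i then c j + s else c j)).
 - by move=> j; case: eqP => // _; exact: smooth_bump.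
 - move=> j t; case: eqP => [->|_] tac; last first.
 by apply: bump_eq0; apply: contra tac; exact: subset_itv_oo_cc.
 rewrite EB (@eq_Rintegral _ _ _ _ _ (cst 0)) ?Rintegral_cst ?mul0r// => y.
 rewrite inE/= in_itv/= => /andP[y0 ys]; apply: bump_eq0.
 apply: contra tac; rewrite !in_itv/= => /andP[? ?]; apply/andP; split; lra.
 (* The smallest shift that moves y back into the box of chi. *)
 - move=> y yac; pose t := Num.max 0 (y ord0 i - c i).
 have yi := yac i; rewrite eqxx in_itv/= in yi; case/andP: yi => y1 y2.
 have aci := ac i.
 have t0 : 0 <= t by rewrite le_max lexx.
 have ts : t <= s by rewrite ge_max; apply/andP; split; lra.
 have ct : y ord0 i - c i <= t by rewrite le_max lexx orbT.
 have at' : t <= y ord0 i - a i by rewrite ge_max; apply/andP; split; lra.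
 have : O (y - t *: 'e_i).
 apply: sub => j; have := yac j; rewrite !mxE eqxx/=; case: eqP => [->|_].
 by rewrite !in_itv/= mulr1 => _; apply/andP; split; lra.
 by rewrite mulr0 subr0.
 case=> y1O y2O; rewrite -[y](subrK (t *: 'e_i)).
 by apply: unit_ball_segment y1O y2O; rewrite t0.
have := wG i _ tphi.
under eq_Rintegral do rewrite dphi.
rewrite (@Rintegral_patchM _ _ _ leb Omega u) (@Rintegral_patchM _ _ _ leb Omega (fun x => G x ord0 i)).
under eq_Rintegral do rewrite mulrBr.
have shiftE : \int[leb]_x (u0 x * chi (x - s *: 'e_i)) =
 \int[leb]_x (u0 (x + s *: 'e_i) * chi x).
 rewrite -(Rintegral_shift (s *: 'e_i)); last first.
 by apply: mfunM => //; exact: mfun_shift.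
 by apply: eq_Rintegral => x _; rewrite addrK.
rewrite RintegralB//; last 2 first.
- exact: mulchi.
- apply: (@integrableMb _ _ _ _ _ _ _ 1) => //.
 exact: mfun_shift.
rewrite shiftE => hw.
suff -> : \int[leb]_x (H x * chi x) = \int[leb]_x (w x * phi x) by lra.
rewrite /H (Rintegral_line_swap i (ltW s0) wi mchi chi1).
by apply: eq_Rintegral => x _; rewrite phiE.
Qed.

End weak_gradient_line.

(** * Integration by parts against Lipschitz functions *)

Section line_ibp.
Context (R : realType) (n : nat).
Local Notation leb := (lebesgue_rV R n).
Local Notation mu1 := (@lebesgue_measure R).
Local Notation Omega := (@unit_ball R n).

Lemma lebesgue_segment (s : R) : 0 <= s -> fine (mu1 `[0, s]) = s.
move=> s0; have := @lebesgue_measure_itv R `[0, s] => /= ->.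
rewrite lte_fin; move: s0; rewrite le_eqVlt => /predU1P[<-|s0]; first by rewrite ltxx.
by rewrite s0/= subr0.
Qed.

(** The mean of a Lipschitz function over a short segment differs from its value by O(s). This gives
    both the pointwise limit and the domination in [line_ftc_ibp]. *)
Lemma line_mean_approx (psi : 'rV[R]_n -> R) (i : 'I_n) (s C M : R) x : 0 <= s ->
 measurable_fun setT psi -> (forall y, `|psi y| <= M) ->
 (forall t, 0 <= t -> `|psi x - psi (x - t *: 'e_i)| <= C * t) -> 0 <= C ->
 `|\int[mu1]_(t in `[0, s]) psi (x - t *: 'e_i) - s * psi x| <= C * s * s.
move=> s0 mpsi psiM psiC C0.
have sI (c : R) : mu1.-integrable `[0, s] (EFin \o cst c).
 apply: measurable_bounded_integrable => //.
 by have := @lebesgue_measure_itv R `[0, s] => /= ->; case: ifP => _; rewrite ?ltry.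
 exists `|c|; split; first exact: num_real.
 by move=> N cN t _; exact: ltW.
have mI := line_mean_bounded i s x mpsi psiM.
have -> : s * psi x = \int[mu1]_(t in `[0, s]) psi x.
 by rewrite Rintegral_cst// mulrC; congr (_ * _); rewrite lebesgue_segment.
have diffI : mu1.-integrable `[0, s] (EFin \o (fun t => psi (x - t *: 'e_i) - psi x)).
 by apply: intgB => //; exact: sI.
rewrite -RintegralB//; last exact: sI.
apply: le_trans (le_normr_Rintegral _ diffI) _ => //.
have -> : C * s * s = \int[mu1]_(t in `[0, s]) (C * s).
 by rewrite Rintegral_cst//; congr (_ * _); rewrite lebesgue_segment.
apply: le_Rintegral => //; [exact: integrable_norm|exact: sI|].
move=> t; rewrite /= in_itv/= => /andP[t0 ts]; rewrite distrC.
by rewrite (le_trans (psiC t t0))// ler_wpM2l.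
Qed.

(** A translation moves the difference quotient of psi with step 1 / (k + 1) onto u, where
    [line_ftc] turns it into a mean of Ui over a segment; both sides then converge by domination.
    The margin between rho and 1 keeps short segments in the ball. *)
Theorem line_ftc_ibp (u Ui psi dpsi : 'rV[R]_n -> R) (i : 'I_n) (rho C M : R) :
 int_ball R n u -> int_ball R n Ui ->
 line_ftc u Ui i -> rho < 1 ->
 measurable_fun setT psi -> measurable_fun setT dpsi ->
 (forall x, `|psi x| <= M) -> (forall x, rho < enorm x -> psi x = 0) ->
 (forall x s, 0 <= s -> `|psi x - psi (x - s *: 'e_i)| <= C * s) ->
 {ae leb, forall x,
 (fun k => k.+1%:R * (psi x - psi (x - k.+1%:R^-1 *: 'e_i))) @ \oo --> dpsi x} ->
 \int[leb]_(x in Omega) (u x * dpsi x) = - \int[leb]_(x in Omega) (Ui x * psi x).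
move=> ui Ui_i ftc rho1 mpsi mdpsi psiM psi0 psiC dpsiE.
have mO := @measurable_unit_ball R n.
have C0 : 0 <= C by have := le_trans (normr_ge0 _) (psiC 0 1 ler01); rewrite mulr1.
pose u0 := u \_ Omega; pose w := Ui \_ Omega.
have u0i : leb.-integrable setT (EFin \o u0) := (intg_restrict _ _ mO).1 ui.
have wi : leb.-integrable setT (EFin \o w) := (intg_restrict _ _ mO).1 Ui_i.
have mu0 := integrable_mfun u0i.
have mw := integrable_mfun wi.
rewrite (@Rintegral_patchM _ _ _ leb Omega u) (@Rintegral_patchM _ _ _ leb Omega Ui).
rewrite -/u0 -/w.
pose s k : R := k.+1%:R^-1.
have s0 k : 0 < s k by rewrite invr_gt0 ltr0n.
have sK k : k.+1%:R * s k = 1 by rewrite divff// pnatr_eq0.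
have s1 k : s k <= 1 by rewrite invf_le1 ?ltr0n// ler1n.
pose phi k x := \int[mu1]_(t in `[0, s k]) psi (x - t *: 'e_i).
have mphi k : measurable_fun setT (phi k) by exact: measurable_line_mean.
have phiE k x : `|k.+1%:R * phi k x - psi x| <= C * s k.
 have h := line_mean_approx (ltW (s0 k)) mpsi psiM (psiC x) C0.
 rewrite -(ler_pM2r (s0 k)); apply: le_trans h.
 rewrite -{1}(gtr0_norm (s0 k)) -normrM mulrBl mulrAC sK mul1r.
 by rewrite [psi x * _]mulrC.
pose a k := \int[leb]_x (u0 x * (k.+1%:R * (psi x - psi (x - s k *: 'e_i)))).
pose b k := - \int[leb]_x (w x * (k.+1%:R * phi k x)).
have mpsis k : measurable_fun setT (fun x : 'rV[R]_n => psi (x - s k *: 'e_i)).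
 exact: mfun_shift.
have ca : a @ \oo --> \int[leb]_x (u0 x * dpsi x).
 apply: (@Rdominated_cvg _ _ _ _ _ _ _ (fun x => C * `|u0 x|)) => //.
 - by move=> k; apply: mfunM => //; apply: mfunM => //; exact: measurable_funB.
 - exact: mfunM.
 - by apply: filterS dpsiE => x /= H _; apply: cvgM; [exact: cvg_cst|exact: H].
 - exact: (intgZ _ _ (integrable_norm u0i)).
 - apply: aeW => x k _ /=; rewrite normrM mulrC ler_wpM2r// normrM ger0_norm//.
 apply: (@le_trans _ _ (k.+1%:R * (C * s k))); last by rewrite mulrCA sK mulr1.
 by rewrite ler_wpM2l// psiC// ltW.
have cb : b @ \oo --> - \int[leb]_x (w x * psi x).
 apply: cvgN.
 apply: (@Rdominated_cvg _ _ _ _ _ _ _ (fun x => (M + C) * `|w x|)) => //.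
 - by move=> k; apply: mfunM => //; exact: mfunM.
 - exact: mfunM.
 - apply: aeW => x /= _; apply: cvgM; first exact: cvg_cst.
 apply/cvgrPdist_le => e e0.
 have : (fun k => C * s k) @ \oo --> C * 0 by apply: cvgM; [exact: cvg_cst|exact: cvg_harmonic].
 rewrite mulr0 => /cvgr0Pnorm_le/(_ _ e0); apply: filterS => k.
 rewrite ger0_norm ?mulr_ge0 ?(ltW (s0 k))//; apply: le_trans.
 by rewrite distrC; exact: phiE.
 - exact: (intgZ _ _ (integrable_norm wi)).
 - apply: aeW => x k _ /=; rewrite normrM mulrC ler_wpM2r//.
 rewrite -[X in `|X|](subrK (psi x)) (le_trans (ler_normD _ _))// addrC lerD//.
 by rewrite (le_trans (phiE _ _))// ler_piMr.
have [N rhoN] : exists N : nat, forall k, (N <= k)%N -> rho + s k < 1.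
 have : \forall k \near \oo, `|s k| < 1 - rho.
 by move: (@cvg_harmonic R) => /cvgr0Pnorm_lt; apply; rewrite subr_gt0.
 move=> [N _ HN]; exists N => k /HN /=; rewrite gtr0_norm//; lra.
(* Equality is proved once rho + s k < 1; for larger steps a segment starting in the support of psi
   may leave the ball. *)
have ab : \forall k \near \oo, a k = b k.
 exists N => // k /rhoN rs /=.
 rewrite /a /b.
 transitivity (k.+1%:R * \int[leb]_x (u0 x * (psi x - psi (x - s k *: 'e_i)))).
 rewrite -RintegralZl//; first by apply: eq_Rintegral => x _; rewrite mulrCA.
 apply: (@integrableMb _ _ _ _ _ _ _ (C * s k)) => //.
 exact: measurable_funB.
 by move=> x _; exact: psiC (ltW (s0 k)).
 have phiB x : `|phi k x| <= M + C.
 apply: (@le_trans _ _ `|k.+1%:R * phi k x|).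
 by rewrite normrM ler_peMl// ger0_norm// ler1n.
 rewrite -[X in `|X|](subrK (psi x)) (le_trans (ler_normD _ _))// addrC lerD//.
 by rewrite (le_trans (phiE _ _))// ler_piMr.
 transitivity (- (k.+1%:R * \int[leb]_x (w x * phi k x))); last first.
 congr (- _); rewrite -RintegralZl//; first by apply: eq_Rintegral => x _; rewrite mulrCA.
 exact: (@integrableMb _ _ _ _ _ _ _ (M + C)).
 rewrite -mulrN; congr (_ * _).
 rewrite -(Rintegral_line_swap i (ltW (s0 k)) wi mpsi psiM).
 have Mi f : leb.-integrable setT (EFin \o f) ->
 leb.-integrable setT (EFin \o (fun x => f x * psi x)).
 by move=> fi; apply: (@integrableMb _ _ _ _ _ _ _ M).
 have usi : leb.-integrable setT (EFin \o (fun x => u0 (x + s k *: 'e_i))).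
 exact: integrable_shift.
 under eq_Rintegral do rewrite mulrBr.
 rewrite RintegralB//; last 2 first.
 exact: Mi.
 by apply: (@integrableMb _ _ _ _ _ _ _ M).
 have -> : \int[leb]_x (u0 x * psi (x - s k *: 'e_i)) =
 \int[leb]_x (u0 (x + s k *: 'e_i) * psi x).
 rewrite -(Rintegral_shift (s k *: 'e_i)); last exact: mfunM.
 by apply: eq_Rintegral => x _; rewrite addrK.
 suff -> : \int[leb]_x (\int[mu1]_(t in `[0, s k]) w (x + t *: 'e_i) * psi x) =
 \int[leb]_x (u0 (x + s k *: 'e_i) * psi x) - \int[leb]_x (u0 x * psi x).
 by rewrite opprB.
 rewrite -RintegralB//; [|exact: Mi|exact: Mi].
 apply: ae_eq_Rint => //.
 - apply: mfunM => //.
 exact: (integrable_mfun (Rfubini_line i (ltW (s0 k)) wi)).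
 - apply: measurable_funB; apply: mfunM => //.
 exact: mfun_shift.
 - have := ftc (s k) (s0 k); apply: filterS => x /= Hx _; rewrite -mulrBl.
 have [xrho|xrho] := ltP rho (enorm x); first by rewrite psi0// !mulr0.
 have Ox : Omega x by exact: le_lt_trans xrho rho1.
 have Oxs : Omega (x + s k *: 'e_i).
 rewrite /unit_ball/= (le_lt_trans (enormD _ _))// enormZ enorm_delta mulr1.
 by rewrite gtr0_norm// (le_lt_trans _ rs)// lerD2r.
 congr (_ * _); rewrite /u0 !patchE !mem_set// Hx//; apply: eq_Rintegral => t.
 rewrite inE/= in_itv/= => ts; rewrite /w patchE mem_set//.
 exact: unit_ball_segment ts Ox Oxs.
apply: (@cvg_unique _ (@Rhausdorff R) _ _ _ _ ca).
apply: cvg_trans cb; apply: near_eq_cvg.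
by apply: filterS ab => k ->.
Qed.

End line_ibp.

Lemma ae_imply d (T : measurableType d) (R : realFieldType)
 (m : {measure set T -> \bar R}) (P Q : T -> Prop) : (forall x, P x -> Q x) ->
 {ae m, forall x, P x} -> {ae m, forall x, Q x}.
by move=> PQ; apply: (@filterS _ _ (ae_filter_ringOfSetsType m)). Qed.

Lemma ae_imply2 d (T : measurableType d) (R : realFieldType)
 (m : {measure set T -> \bar R}) (P Q S : T -> Prop) : (forall x, P x -> Q x -> S x) ->
 {ae m, forall x, P x} -> {ae m, forall x, Q x} -> {ae m, forall x, S x}.
by move=> PQS; apply: (@filterS2 _ _ (ae_filter_ringOfSetsType m)). Qed.

(** * The product rule along lines *)

Section line_product.
Context (R : realType) (n : nat).
Local Notation leb := (lebesgue_rV R n).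
Local Notation mu1 := (@lebesgue_measure R).
Local Notation Omega := (@unit_ball R n).

Lemma Rintegral_subset d (T : measurableType d) (m : {measure set T -> \bar R})
 (A B : set T) (f : T -> R) : measurable A -> measurable B -> A `<=` B ->
 m.-integrable B (EFin \o f) -> (forall x, B x -> 0 <= f x) ->
 \int[m]_(x in A) f x <= \int[m]_(x in B) f x.
move=> mA mB AB fi f0; have fA := integrableS mB mA AB fi.
rewrite /Rintegral fine_le//; [exact: integrable_fin_num..|].
apply: ge0_subset_integral => //; first exact: measurable_int fi.
Qed.

Lemma meas_preimage d1 d2 (T1 : measurableType d1) (T2 : measurableType d2)
 (f : T1 -> T2) (Y : set T2) :
 measurable_fun setT f -> measurable Y -> measurable (f @^-1` Y).
by move=> mf mY; rewrite -[X in measurable X]setTI; exact: mf. Qed.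

Lemma measurable_indic_le d (T : measurableType d) (f g : T -> R) :
 measurable_fun setT f -> measurable_fun setT g ->
 measurable_fun setT (fun x => \1_(`]-oo, 0]%classic : set R) (f x - g x) : R).
move=> mf mg; apply: (mcompT (measurable_indic _)); last exact: measurable_funB.
exact: measurable_itv.
Qed.

(** The upper limit t moves into an indicator; the primitive becomes a section integral, whose
    measurability in t is known. *)
Lemma primitive0E (s t : R) (f : R -> R) : t <= s ->
 \int[mu1]_(y in `[0, t]) f y =
 \int[mu1]_y (\1_(`]-oo, 0]%classic : set R) (y - t) * (f \_ `[0, s]) y).
move=> ts; rewrite Rintegral_mkcond; apply: eq_Rintegral => y _; rewrite !patchE indicE.
rewrite !mem_setE !in_itv/= subr_le0; case: leP => y0 /=; last by rewrite mulr0.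
by case: (leP y t) => yt; rewrite ?mul0r//= (le_trans yt ts) mul1r.
Qed.

Lemma mfun_primitive0 (f : R -> R) (s : R) :
 measurable_fun (`[0, s]%classic : set (measurableTypeR R)) f ->
 measurable_fun (`[0, s]%classic : set (measurableTypeR R))
 (fun t => \int[mu1]_(y in `[0, t]) f y).
move=> mf; have := @eq_measurable_fun _ _ (measurableTypeR R) R `[0, s]%classic
 (fun t => \int[mu1]_y (\1_(`]-oo, 0]%classic : set R) (y - t) * (f \_ `[0, s]) y))
 (fun t => \int[mu1]_(y in `[0, t]) f y).
apply.
 move=> t; rewrite mem_setE/= in_itv/= => /andP[_ ts]; exact/esym/primitive0E.
apply: mfunTS.
apply: (mfun_Rintegral1 _ (f := fun z : measurableTypeR R * measurableTypeR R =>
 \1_(`]-oo, 0]%classic : set R) (z.2 - z.1) * (f \_ `[0, s]) z.2)).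
apply: mfunM.
 by apply: measurable_indic_le; [exact: measurable_snd|exact: measurable_fst].
apply: (mcompT _ (@measurable_snd _ _ _ _)).
by apply/measurable_restrict => //; rewrite setTI.
Qed.

(** Integration by parts for absolutely continuous functions: the product of the integrals is an
    integral over a square, split along the diagonal by the indicator L. *)
Lemma primitive_mul (s : R) (f g : R -> R) : 0 <= s ->
 mu1.-integrable `[0, s] (EFin \o f) -> mu1.-integrable `[0, s] (EFin \o g) ->
 (\int[mu1]_(y in `[0, s]) f y) * (\int[mu1]_(y in `[0, s]) g y) =
 \int[mu1]_(t in `[0, s]) ((\int[mu1]_(y in `[0, t]) f y) * g t) +
 \int[mu1]_(t in `[0, s]) ((\int[mu1]_(y in `[0, t]) g y) * f t).
move=> s0 fi gi.
pose f0 := f \_ `[0, s]; pose g0 := g \_ `[0, s].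
have f0i : mu1.-integrable setT (EFin \o f0).
 by apply: (intg_restrict mu1 f _).1.
have g0i : mu1.-integrable setT (EFin \o g0).
 by apply: (intg_restrict mu1 g _).1.
pose L (y t : R) : R := \1_(`]-oo, 0]%classic : set R) (y - t).
have L1 y t : `|L y t| <= 1 by rewrite /L indicE; case: (_ \in _); rewrite ?normr1 ?normr0.
have fgi := integrable_prod_mul f0i g0i.
have mL : measurable_fun setT (fun z : measurableTypeR R * measurableTypeR R => L z.1 z.2).
 by apply: measurable_indic_le; [exact: measurable_fst|exact: measurable_snd].
have i1 : (mu1 \x mu1)%E.-integrable setT (EFin \o (fun z => f0 z.1 * g0 z.2 * L z.1 z.2)).
 by apply: (@integrableMb _ _ _ _ _ _ _ 1) => // z _; exact: L1.
have i2 : (mu1 \x mu1)%E.-integrable setT (EFin \o (fun z => f0 z.1 * g0 z.2 * (1 - L z.1 z.2))).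
 apply: (@integrableMb _ _ _ _ _ _ _ 2) => //.
 mfun.
 by move=> z _; rewrite (le_trans (ler_normB _ _))// normr1 -[leRHS]/(1 + 1) lerD2l L1.
transitivity (\int[(mu1 \x mu1)%E]_z (f0 z.1 * g0 z.2)).
 rewrite (Rfubini1 fgi) /=.
 rewrite [X in _ * X = _]Rintegral_mkcond -/g0 [X in X * _ = _]Rintegral_mkcond -/f0.
 rewrite mulrC -RintegralZl//; apply: eq_Rintegral => y _.
 by rewrite RintegralZl// mulrC.
transitivity (\int[(mu1 \x mu1)%E]_z (f0 z.1 * g0 z.2 * L z.1 z.2) +
 \int[(mu1 \x mu1)%E]_z (f0 z.1 * g0 z.2 * (1 - L z.1 z.2))).
 by rewrite -RintegralD//; apply: eq_Rintegral => z _; ring.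
congr (_ + _).
 rewrite (Rfubini2 i1) [RHS]Rintegral_mkcond; apply: eq_Rintegral => t _ /=.
 rewrite patchE; case: ifPn => [|ts].
 rewrite mem_setE/= in_itv/= => /andP[t0 ts].
 rewrite (primitive0E _ ts) mulrC -RintegralZl//; last first.
 have h := @integrableMb _ _ _ mu1 setT f0 (L^~ t) 1.
 apply: eq_integrable (h _ f0i _ (fun y _ => L1 y t)) => //.
 by move=> y _; congr EFin; rewrite mulrC.
 exact: (mcompT mL (measurable_pair2 t)).
 have gE : g0 t = g t by rewrite /g0 patchE mem_setE in_itv/= t0 ts.
 apply: eq_Rintegral => y _; rewrite -/f0 gE /L/=; ring.
 rewrite (@eq_Rintegral _ _ _ _ _ (cst 0)) ?Rintegral_cst ?mul0r// => y _.
 by rewrite /g0 patchE (negbTE ts) mulr0 mul0r.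
rewrite (Rfubini1 i2) [RHS]Rintegral_mkcond; apply: eq_Rintegral => t _ /=.
rewrite patchE; case: ifPn => [|ts].
 rewrite mem_setE/= in_itv/= => /andP[t0 ts].
 have giT : mu1.-integrable `[0, t] (EFin \o g).
 apply: integrableS gi => // y; rewrite /= !in_itv/= => /andP[-> yt].
 exact: le_trans yt ts.
 have giTo : mu1.-integrable `[0, t[ (EFin \o g).
 by apply: integrableS giT => // y; rewrite /= !in_itv/= => /andP[-> /ltW].
 rewrite -Rintegral_itv_bndo_bndc// mulrC -RintegralZl//.
 rewrite [RHS]Rintegral_mkcond; apply: eq_Rintegral => y _.
 rewrite /f0 /g0 /L !patchE indicE !mem_setE !in_itv/= t0 ts/= subr_le0 [t <= y]leNgt.
 case: (leP 0 y) => y0 /=; last by rewrite mulr0 mul0r.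
 case: (ltP y t) => yt /=; last by rewrite subrr mulr0.
 by rewrite (ltW (lt_le_trans yt ts)) subr0 mulr1.
rewrite (@eq_Rintegral _ _ _ _ _ (cst 0)) ?Rintegral_cst ?mul0r// => y _.
by rewrite /f0 patchE (negbTE ts) !mul0r.
Qed.

(** [line_ftc] has an exceptional set of x for each step t. The exceptional pairs form a measurable
    set Z with null t-sections, so almost every x has a null set of exceptional t. *)
Lemma ae_line_ftc (u Ui : 'rV[R]_n -> R) (i : 'I_n) (s : R) :
 measurable_fun Omega u -> measurable_fun Omega Ui -> line_ftc u Ui i ->
 {ae leb, forall x, Omega x -> Omega (x + s *: 'e_i) ->
 {ae mu1, forall t, t \in `]0, s] ->
 u (x + t *: 'e_i) = u x + \int[mu1]_(y in `[0, t]) Ui (x + y *: 'e_i)}}.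
move=> mu mUi ftc; have mO := @measurable_unit_ball R n.
pose u0 := u \_ Omega; pose w := Ui \_ Omega.
have mu0 : measurable_fun setT u0 by apply/measurable_restrict => //; rewrite setTI.
have mw : measurable_fun setT w by apply/measurable_restrict => //; rewrite setTI.
pose H (z : 'rV[R]_n * measurableTypeR R) := \int[mu1]_y
 (\1_(`]-oo, 0]%classic : set R) (y - z.2) * ((fun y => w (z.1 + y *: 'e_i)) \_ `[0, +oo[) y).
have mH : measurable_fun setT H.
 apply: (mfun_Rintegral1 _ (f := fun z : ('rV[R]_n * measurableTypeR R) * measurableTypeR R =>
 \1_(`]-oo, 0]%classic : set R) (z.2 - z.1.2) *
 ((fun y => w (z.1.1 + y *: 'e_i)) \_ `[0, +oo[) z.2)).
 apply: mfunM.
 apply: measurable_indic_le; first exact: measurable_snd.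
 by apply: (mcompT measurable_snd); exact: measurable_fst.
 rewrite (_ : (fun z => _) = (fun z : ('rV[R]_n * measurableTypeR R) * measurableTypeR R =>
 \1_(`[0, +oo[%classic : set R) z.2 * w (z.1.1 + z.2 *: 'e_i))).
 apply: mfunM.
 by apply: (mcompT (measurable_indic _)); [exact: measurable_itv|exact: measurable_snd].
 apply: (mcompT mw).
 apply: (mcompT (measurable_line i)
 (g := fun z : ('rV[R]_n * measurableTypeR R) * measurableTypeR R => (z.1.1, z.2))).
 apply/measurable_fun_pairP; split; last exact: measurable_snd.
 exact: (mcompT (@measurable_fst _ _ 'rV[R]_n (measurableTypeR R))
 (@measurable_fst _ _ ('rV[R]_n * measurableTypeR R)%type (measurableTypeR R))).
 by apply/funext => z; rewrite patchE indicE; case: ifP; rewrite ?mul1r ?mul0r.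
have HE x t : 0 < t -> H (x, t) = \int[mu1]_(y in `[0, t]) w (x + y *: 'e_i).
 move=> t0; rewrite /H [RHS]Rintegral_mkcond; apply: eq_Rintegral => y _.
 rewrite !patchE indicE !mem_setE !in_itv/= subr_le0 andbT.
 by case: leP => y0 /=; rewrite ?mulr0//; case: leP; rewrite ?mul1r ?mul0r.
pose Z : set ('rV[R]_n * measurableTypeR R) := [set z | [/\ 0 < z.2, Omega z.1,
 Omega (z.1 + z.2 *: 'e_i) & u0 (z.1 + z.2 *: 'e_i) - u0 z.1 - H z != 0]].
have mZ : measurable Z.
 pose k z := u0 (z.1 + z.2 *: 'e_i) - u0 z.1 - H z.
 have mk : measurable_fun setT k.
 apply: measurable_funB => //; apply: measurable_funB.
 exact: (mcompT mu0 (measurable_line i)).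
 by apply: (mcompT mu0); exact: measurable_fst.
 have -> : Z = (snd @^-1` `]0, +oo[%classic) `&` (fst @^-1` Omega) `&`
 ((fun z : 'rV[R]_n * measurableTypeR R => z.1 + z.2 *: 'e_i) @^-1` Omega) `&`
 (k @^-1` (~` [set 0])).
 apply/seteqP; split => z /=; rewrite in_itv/= andbT.
 by move=> [? ? ? /eqP].
 by move=> [[[? ?] ?] /eqP].
 apply: measurableI; first apply: measurableI; first apply: measurableI.
 - exact: (meas_preimage (@measurable_snd _ _ 'rV[R]_n (measurableTypeR R)) (measurable_itv _)).
 - exact: (meas_preimage (@measurable_fst _ _ 'rV[R]_n (measurableTypeR R)) mO).
 - exact: (meas_preimage (measurable_line i) mO).
 - exact: (meas_preimage mk (measurableC (measurable_set1 0))).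
have Z0 t : leb [set x | Z (x, t)] = 0%E.
 have [t0|t0] := ltP 0 t; last first.
 rewrite (_ : mkset _ = set0) ?measure0//; apply/seteqP; split => // x [].
 by rewrite ltNge t0.
 apply/negligibleP.
 have mpt : @measurable_fun _ _ 'rV[R]_n ('rV[R]_n * measurableTypeR R)%type setT (fun x => (x, t)).
 mfun.
 exact: meas_preimage mpt mZ.
 apply: negligibleS (ftc t t0) => x /= [_ Ox Oxt /eqP h] k; apply: h.
 rewrite HE// /u0 !patchE !mem_set// k//; apply/eqP; rewrite subr_eq0; apply/eqP.
 apply: eq_Rintegral => y; rewrite inE/= in_itv/= => /andP[y0 yt].
 by rewrite /w patchE mem_set//; apply: unit_ball_segment Ox Oxt; rewrite y0.
have := ae_prod mu1 mZ Z0; apply: filterS => x /= Hx Ox Oxs.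
apply: filterS Hx => t /= Zt; rewrite in_itv/= => /andP[t0 ts].
have Oxt : Omega (x + t *: 'e_i).
 by apply: unit_ball_segment Ox Oxs; rewrite (ltW t0).
have : u0 (x + t *: 'e_i) - u0 x - H (x, t) = 0.
 by apply/eqP; apply: contrapT => /negP h; apply: Zt.
rewrite HE// /u0 !patchE !mem_set// => /eqP; rewrite subr_eq0 => /eqP h.
rewrite -[LHS](subrK (u x)) addrC h; congr (_ + _); apply: eq_Rintegral => y.
rewrite inE/= in_itv/= => /andP[y0 yt]; rewrite /w patchE mem_set//.
by apply: unit_ball_segment Ox Oxt; rewrite y0.
Qed.

Lemma ae_integrable_line (w : 'rV[R]_n -> R) (i : 'I_n) (s : R) : 0 <= s ->
 int_ball R n w ->
 {ae leb, forall x, Omega x -> Omega (x + s *: 'e_i) ->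
 mu1.-integrable `[0, s] (EFin \o (fun t => w (x + t *: 'e_i)))}.
move=> s0 wi; have mO := @measurable_unit_ball R n.
have wi0 := (intg_restrict leb w mO).1 wi.
have := ae_integrable1 (integrable_line i s0 wi0).
apply: filterS => x /= h Ox Oxs.
have {}h : mu1.-integrable setT
 (EFin \o ((fun t => (w \_ Omega) (x + t *: 'e_i)) \_ `[0, s])).
 rewrite [X in mu1.-integrable _ X](_ : _ = (fun t =>
 (\1_(`[0, s]%classic : set R) t * (w \_ Omega) (x + t *: 'e_i))%:E)) //.
 apply/funext => t; rewrite /= patchE indicE; congr EFin.
 by case: ifP; rewrite ?mul1r ?mul0r.
have {}h := (intg_restrict mu1 _ (measurable_itv _)).2 h.
apply: eq_integrable h => // t; rewrite inE/= in_itv/= => ts.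
by rewrite patchE mem_set//; exact: unit_ball_segment Ox Oxs.
Qed.

(** Along almost every line each function is its initial value plus a primitive; the product of the
    two primitives is handled by [primitive_mul]. *)
Lemma line_ftc_mul (u v Ui Vi : 'rV[R]_n -> R) (i : 'I_n) :
 measurable_fun Omega u -> measurable_fun Omega v ->
 int_ball R n Ui -> int_ball R n Vi ->
 line_ftc u Ui i -> line_ftc v Vi i ->
 line_ftc (fun x => u x * v x) (fun x => u x * Vi x + v x * Ui x) i.
move=> mu mv iU iV fu fv s s0.
have mU := integrable_mfun iU.
have mV := integrable_mfun iV.
apply: filter_app (fv s s0); apply: filter_app (fu s s0).
apply: filter_app (ae_line_ftc s mu mU fu); apply: filter_app (ae_line_ftc s mv mV fv).
apply: filter_app (ae_integrable_line i (ltW s0) iU).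
apply: filter_app (ae_integrable_line i (ltW s0) iV).
apply: aeW => x jV jU gv gu hu hv Ox Oxs.
have {}jV := jV Ox Oxs; have {}jU := jU Ox Oxs; have {}hu := hu Ox Oxs; have {}hv := hv Ox Oxs.
have {}gv := gv Ox Oxs; have {}gu := gu Ox Oxs.
set fU := fun t => Ui (x + t *: 'e_i) in jU; set fV := fun t => Vi (x + t *: 'e_i) in jV.
have bprim (f g : R -> R) : mu1.-integrable `[0, s] (EFin \o f) ->
 mu1.-integrable `[0, s] (EFin \o g) ->
 mu1.-integrable `[0, s] (EFin \o (fun t => (\int[mu1]_(y in `[0, t]) f y) * g t)).
 move=> fi gi; have mf := integrable_mfun fi.
 have ab := integrable_norm fi.
 under [X in EFin \o X]eq_fun do rewrite mulrC.
 apply: (@integrableMb _ _ _ _ _ _ _ (\int[mu1]_(y in `[0, s]) `|f y|)) => //.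
 exact: mfun_primitive0.
 move=> t; rewrite /= in_itv/= => /andP[t0 ts].
 have sub : `[0, t]%classic `<=` `[0, s]%classic.
 by move=> y; rewrite /= !in_itv/= => /andP[-> /le_trans ->].
 apply: (le_trans (le_normr_Rintegral _ _)) => //.
 exact: integrableS fi.
 by apply: Rintegral_subset => // y _; rewrite normr_ge0.
(* The product of u(x) plus a primitive and v(x) plus a primitive, differentiated formally: this
   integrand equals the claimed one at almost every t. *)
transitivity (\int[mu1]_(t in `[0, s]) ((u x * fV t + v x * fU t) +
 ((\int[mu1]_(y in `[0, t]) fU y) * fV t + (\int[mu1]_(y in `[0, t]) fV y) * fU t))).
 have i1 := bprim _ _ jU jV; have i2 := bprim _ _ jV jU.
 rewrite RintegralD//; last 2 first.
 - by apply: intgD => //; exact: intgZ.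
 - exact: intgD.
 rewrite RintegralD//; last 2 first; [exact: intgZ..|].
 rewrite !RintegralZl// RintegralD//.
 rewrite -primitive_mul//; last exact: ltW.
 by rewrite -hu -hv; ring.
have sub t : `[0, s]%classic t -> Omega (x + t *: 'e_i).
 by rewrite /= in_itv/= => ts; exact: unit_ball_segment Ox Oxs.
have mline k : measurable_fun Omega k ->
 measurable_fun (`[0, s]%classic : set (measurableTypeR R)) (fun t => k (x + t *: 'e_i)).
 move=> mk; apply: (@measurable_comp _ _ _ _ _ _ Omega) => //.
 exact: measurable_unit_ball.
 by move=> _ [t ts <-]; exact: sub.
 apply: mfunTS.
 have : measurable_fun setT (fun t : measurableTypeR R => x + t *: 'e_i); last by [].
 apply: measurable_fun_rV => j.
 have -> : (fun t : R => (x + t *: 'e_i) ord0 j) = (fun t : R => x ord0 j + t * (j == i)%:R).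
 by apply/funext => t; rewrite !mxE eqxx.
 have mid : borel R id by mfun.
 mfun.
apply: ae_eq_Rint => //.
- apply: measurable_funD; apply: measurable_funD; do ?[exact: mline
 |apply: mfunM => //; exact: mline].
 + by apply: mfunM; [apply: mfun_primitive0; exact: mline|exact: mline].
 + by apply: mfunM; [apply: mfun_primitive0; exact: mline|exact: mline].
- by apply: measurable_funD; apply: mfunM; exact: mline.
suff H : {ae mu1, forall t, `[0, s]%classic t ->
 u x * fV t + v x * fU t + ((\int[mu1]_(y in `[0, t]) fU y) * fV t +
 (\int[mu1]_(y in `[0, t]) fV y) * fU t) =
 u (x + t *: 'e_i) * Vi (x + t *: 'e_i) + v (x + t *: 'e_i) * Ui (x + t *: 'e_i)} by exact: H.
apply: ae_imply2 gu gv => t gu gv.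
rewrite /= in_itv/= => /andP[]; rewrite le_eqVlt => /predU1P[<- _|t0 ts].
 by rewrite set_itv1 !Rintegral_set1 scale0r addr0 /fU /fV scale0r addr0; ring.
have ts' : t \in `]0, s] by rewrite in_itv/= t0.
by rewrite (gu ts') (gv ts') /fU /fV; ring.
Qed.

End line_product.

(** * One-dimensional scaling and a tail integral *)

Section scaling1.
Context (R : realType).
Local Notation mu1 := (@lebesgue_measure R).

Lemma ge0_integral_scale (c : R) (f : measurableTypeR R -> \bar R) : 0 < c ->
 measurable_fun setT f -> (forall x, 0 <= f x)%E ->
 (\int[mu1]_x f x = c%:E * \int[mu1]_x f (c * x)%R)%E.
move=> c0 mf f0; pose phi (x : measurableTypeR R) : measurableTypeR R := c * x.
have mphi : measurable_fun setT phi by exact: mfunM.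
pose k : {nonneg R} := NngNum (ltW c0).
rewrite (eq_measure_integral (mscale k (pushforward mu1 phi))); last first.
 move=> A mA _; apply: lebesgue_measure_unique => // X [[a b] _ <-].
 rewrite -[RHS]/(c%:E * mu1 (phi @^-1` `]a, b]%classic))%E.
 rewrite (_ : phi @^-1` _ = `](a / c), (b / c)]%classic); last first.
 by apply/seteqP; split => x; rewrite /phi /= !in_itv/= ltr_pdivrMr// ler_pdivlMr// ![_ * x]mulrC.
 rewrite !lebesgue_measure_itv/= !lte_fin ltr_pM2r ?invr_gt0//.
 case: ifP => _; last by rewrite mule0.
 by rewrite -!EFinB -EFinM; congr EFin; field; rewrite gt_eqF.
by rewrite ge0_integral_mscale// ge0_integral_pushforward.
Qed.

(** This is the integral over the scaling parameter that the polar change of variables leaves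
    behind. *)
Lemma integral_tail (n : nat) (a : R) : 0 < a -> (0 < n)%N ->
 (\int[mu1]_(s in `[a, +oo[) (n%:R * s^-1 ^+ n.+1)%:E = (a^-1 ^+ n)%:E)%E.
move=> a0 n0; pose F (s : R) := - s^-1 ^+ n.
have dF (s : R) : 0 < s -> is_derive s 1 F (n%:R * s^-1 ^+ n.+1).
 move=> s0; have s_neq0 : s != 0 by rewrite gt_eqF.
 have E : is_derive s 1 (fun s : R => s^-1) (- s ^- 2 *: 1).
 exact: (@is_deriveV _ (fun s : R => s)).
 rewrite /F; case: (n) n0 => // m _.
 have D := is_deriveN (is_deriveX m.+1 E).
 rewrite exprfctE opprfctE in D.
 apply: (is_derive_eq D); rewrite /GRing.scale/= -[s ^- 2]exprVn.
 by rewrite !exprS; ring.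
rewrite (@ge0_continuous_FTC2y _ _ F a 0).
- by rewrite sub0e /F -EFinN opprK.
- by move=> s as_; rewrite mulr_ge0// exprn_ge0// invr_ge0 (le_trans (ltW a0)).
- apply: continuous_in_subspaceT => s; rewrite inE/= in_itv/= andbT => as_.
 have s0 := lt_le_trans a0 as_.
 apply: (@continuousM R R (cst n%:R) (fun s => s^-1 ^+ n.+1)); first exact: cvg_cst.
 apply: (@continuous_comp _ _ _ (fun s : R => s^-1) (fun s => s ^+ n.+1)).
 by apply: inv_continuous; rewrite gt_eqF.
 exact: exprn_continuous.
- apply/cvgrPdist_le => e e0; near=> s.
 have s1 : 1 <= s by near: s; apply: nbhs_pinfty_ge; rewrite num_real.
 have se : (e / 2)^-1 <= s by near: s; apply: nbhs_pinfty_ge; rewrite num_real.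
 have s0 : 0 < s by rewrite (lt_le_trans ltr01).
 rewrite sub0r opprK ger0_norm ?exprn_ge0 ?invr_ge0 ?ltW//.
 case: n n0 => // n _ in F dF *; rewrite exprS.
 apply: (@le_lt_trans _ _ s^-1); last first.
 apply: (@le_lt_trans _ _ (e / 2)); last lra.
 by rewrite -[leRHS]invrK lef_pV2// posrE ?invr_gt0 ?divr_gt0.
 by rewrite ler_piMr ?invr_ge0 ?(ltW s0)// exprn_ile1// ?invr_ge0 ?invf_le1// ltW.
- by move=> s as_; have [] := dF s (lt_trans a0 as_).
- apply: cvg_at_right_filter; apply: derive_continuous; exact: dF.
- move=> s; rewrite in_itv/= andbT => as_; rewrite derive1E.
 by have [_ ->] := dF s (lt_trans a0 as_).
Unshelve. all: by end_near. Qed.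

End scaling1.

(** * Polar coordinates *)

Section polar.
Context (R : realType) (n : nat).
Hypothesis n_gt0 : (0 < n)%N.
Local Notation leb := (lebesgue_rV R n).
Local Notation mu1 := (@lebesgue_measure R).
Local Notation Omega := (@unit_ball R n).

Lemma measurable_rV0 : measurable [set 0 : 'rV[R]_n].
rewrite (_ : [set 0] = \bigcap_(i in [set: 'I_n])
 ((fun x : 'rV[R]_n => x ord0 i) @^-1` [set 0])).
 apply: fin_bigcap_measurable => [|i _]; first exact: finite_finset.
 by apply: meas_preimage => //; exact: measurable_coord.
apply/seteqP; split => x /= => [-> i _|x0]; first by rewrite /= mxE.
by apply/rowP => i; rewrite mxE; exact: x0.
Qed.

(** Scaling by 2 fixes the origin and multiplies measures by 2^n, so the finite mass of the origin
    must be 0. *)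
Lemma lebesgue_set1_0 : leb [set 0] = 0%E.
have m0 := measurable_rV0.
have := @lebesgue_affine R n 2 0 _ (ltr0Sn R 1) m0.
rewrite (_ : _ @^-1` _ = [set 0]); last first.
 apply/seteqP; split => x; rewrite /= /affine addr0; last by move=> ->; rewrite scaler0.
 by move=> /eqP; rewrite scaler_eq0 pnatr_eq0/= => /eqP.
have : (leb [set 0%R] < +oo)%E.
 apply: (le_lt_trans _ (ball_lty R n)); apply: le_measure.
 - by rewrite inE.
 - by rewrite inE; exact: measurable_unit_ball.
 - by move=> _ ->; rewrite /unit_ball/= enorm0.
have : (0 <= leb [set 0%R])%E by [].
case: (leb [set 0]) => [r|//|//]; rewrite lee_fin => r0 _ [rE].
congr EFin; apply: le_anti; rewrite r0 andbT.
have h1 : 1 <= (2 : R) ^+ n.-1 by apply: exprn_ege1; rewrite ler1n.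
have h2 : 2 <= (2 : R) ^+ n by rewrite -(prednK n_gt0) exprS; lra.
by nra.
Qed.

Lemma ae_neq0 : {ae leb, forall x, x != 0}.
exists [set 0]; split; first exact: measurable_rV0.
 exact: lebesgue_set1_0.
by move=> x /= /negP; rewrite negbK => /eqP.
Qed.

(** The surface measure is defined by cones, so the sphere is parametrized by the ball itself
    through y -> y / |y|. Substituting r = s |y| and then x = s y leaves the integral of n s^(-n-1)
    over s > |x|, equal to |x|^(-n), which cancels the remaining power of |x|. *)
Lemma ge0_polar (h : 'rV[R]_n -> \bar R) : measurable_fun setT h -> (forall x, 0 <= h x)%E ->
 (\int[leb]_(x in Omega) h x = \int[mu1]_(r in `]0%R, 1%R[)
 ((n%:R * r ^+ n.-1)%:E * \int[leb]_(y in Omega) h (r *: normalize y)%R))%E.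
move=> mh h0.
pose i1 (r : R) : R := \1_(`]0, 1[%classic : set R) r.
pose iO (y : 'rV[R]_n) : R := \1_Omega y.
have i1_ge0 r : 0 <= i1 r by rewrite /i1 indicE.
have iO_ge0 y : 0 <= iO y by rewrite /iO indicE.
have mi1 : borel R i1 by exact: measurable_indic.
have miO : measurable_fun setT iO by apply: measurable_indic; exact: measurable_unit_ball.
have men := @measurable_enorm R n.
have iOh y : ((iO y)%:E * h y = (h \_ Omega) y)%E.
 by rewrite patchE /iO indicE; case: ifP; rewrite ?mul1e ?mul0e.
(* E1, E2 and E3 are the integrand in the variables (r, y), (s, y) and (s, x), with all domains
   written as indicators. The real power -1 stands for the inverse of s because its measurability is
   at hand. *)
pose E1 (z : measurableTypeR R * 'rV[R]_n) : \bar R :=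
 ((i1 z.1 * iO z.2 * (n%:R * z.1 ^+ n.-1))%:E * h (z.1 *: normalize z.2)%R)%E.
pose E2 (z : measurableTypeR R * 'rV[R]_n) : \bar R :=
 ((enorm z.2 * (i1 (z.1 * enorm z.2) * iO z.2 * (n%:R * (z.1 * enorm z.2) ^+ n.-1)))%:E
 * h (z.1 *: z.2)%R)%E.
pose E3 (z : measurableTypeR R * 'rV[R]_n) : \bar R :=
 ((\1_(`]0, +oo[%classic : set R) z.1 * (z.1 `^ (-1)) ^+ n * (z.1 `^ (-1) * enorm z.2 *
 (i1 (enorm z.2) * iO (z.1 `^ (-1) *: z.2) * (n%:R * enorm z.2 ^+ n.-1))))%:E * h z.2)%E.
have msc (k : measurableTypeR R -> R) : measurable_fun setT k ->
 measurable_fun setT (fun z : measurableTypeR R * 'rV[R]_n => k z.1 *: z.2).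
 move=> mk; apply: measurable_fun_rV => j; under eq_fun do rewrite !mxE.
 apply: mfunM.
 by apply: (mcompT mk); exact: measurable_fst.
 by apply: (mcompT (measurable_coord j)); exact: measurable_snd.
have mf1 : measurable_fun setT (fst : measurableTypeR R * 'rV[R]_n -> R).
 exact: (@measurable_fst _ _ (measurableTypeR R) 'rV[R]_n).
have mf2 : measurable_fun setT (snd : measurableTypeR R * 'rV[R]_n -> 'rV[R]_n).
 exact: (@measurable_snd _ _ (measurableTypeR R) 'rV[R]_n).
have mfe : measurable_fun setT (fun z : measurableTypeR R * 'rV[R]_n => enorm z.2).
 exact: (mcompT men mf2).
have minv : measurable_fun setT (fun s : measurableTypeR R => s `^ (-1) : R).
 exact: measurable_powR.
have mE1 : measurable_fun setT E1.
 apply: emeasurable_funM.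
 apply/measurable_EFinP; apply: mfunM; first apply: mfunM.
 - exact: (mcompT mi1 mf1).
 - exact: (mcompT miO mf2).
 - by apply: mfunM => //; exact: measurable_funX.
 apply: (mcompT mh); apply: measurable_fun_rV => j; under eq_fun do rewrite mxE.
 apply: mfunM => //.
 by apply: (mcompT (measurable_coord j)); exact: (mcompT (@measurable_normalize R n) mf2).
have mE2 : measurable_fun setT E2.
 apply: emeasurable_funM.
 apply/measurable_EFinP; apply: mfunM => //.
 apply: mfunM; first apply: mfunM.
 - by apply: (mcompT mi1); exact: mfunM.
 - exact: (mcompT miO mf2).
 - by apply: mfunM => //; apply: measurable_funX; exact: mfunM.
 by apply: (mcompT mh); apply: (msc id); exact: measurable_id.
have mE3 : measurable_fun setT E3.
 apply: emeasurable_funM; last exact: (mcompT mh).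
 apply/measurable_EFinP; apply: mfunM; apply: mfunM.
 - by apply: (mcompT (measurable_indic _) mf1).
 - by apply: measurable_funX; exact: (mcompT minv mf1).
 - by apply: mfunM => //; exact: (mcompT minv mf1).
 - apply: mfunM; first apply: mfunM.
 + exact: (mcompT mi1 mfe).
 + by apply: (mcompT miO); apply: (msc (fun s => s `^ (-1))); exact: measurable_powR.
 + by apply: mfunM => //; exact: measurable_funX.
have i1k r k : 0 <= i1 r * iO k * (n%:R * r ^+ n.-1).
 rewrite /i1 indicE mem_setE in_itv/=; case: (boolP (0 < r < 1)) => [/andP[r0 _]|_]; last by rewrite !mul0r.
 by rewrite mul1r mulr_ge0// mulr_ge0// exprn_ge0// ltW.
have E1_ge0 z : (0 <= E1 z)%E by rewrite mule_ge0// lee_fin.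
have E2_ge0 z : (0 <= E2 z)%E.
 by rewrite mule_ge0// lee_fin mulr_ge0// sqrtr_ge0.
have E3_ge0 z : (0 <= E3 z)%E.
 rewrite mule_ge0// lee_fin indicE mem_setE in_itv/= andbT.
 case: ltP => [s0|_]; last by rewrite !mul0r.
 by rewrite mul1r !mulr_ge0// ?exprn_ge0 ?powR_ge0 ?sqrtr_ge0 ?ltW.
transitivity (\int[leb]_x \int[mu1]_s E3 (s, x))%E.
 rewrite integral_mkcond; apply: ge0_ae_eq_integral => //.
 - by apply/measurable_restrict => //; [exact: measurable_unit_ball|rewrite setTI; exact: mfunTS].
 - exact: (@measurable_fun_fubini_tonelli_G _ _ (measurableTypeR R) 'rV[R]_n R mu1 E3 mE3 E3_ge0).
 - by move=> x _; rewrite patchE; case: ifP.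
 - by move=> x _; apply: integral_ge0.
 apply: filterS ae_neq0 => x x0 _; rewrite -iOh.
 have e0 : 0 < enorm x by rewrite enorm_gt0.
 have [x1|x1] := ltP (enorm x) 1; last first.
 rewrite integral0_eq.
 by rewrite /iO indicE memNset ?mul0e// /unit_ball/= ltNge x1.
 move=> s _; rewrite /E3/= (_ : i1 (enorm x) = 0) ?(mul0r, mulr0) ?mul0e//.
 by rewrite /i1 indicE memNset//= in_itv/= => /andP[_]; rewrite ltNge x1.
 pose k (s : measurableTypeR R) := n%:R * (s `^ (-1)) ^+ n.+1.
 have mk : measurable_fun setT k.
 by apply: mfunM => //; apply: measurable_funX; exact: measurable_powR.
 have k0 s : 0 <= k s by rewrite mulr_ge0// exprn_ge0// powR_ge0.
 transitivity (h x * (enorm x ^+ n)%:E * \int[mu1]_(s in `[(enorm x), +oo[) (k s)%:E)%E.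
 have -> : (\int[mu1]_(s in `[(enorm x), +oo[) (k s)%:E = ((enorm x)^-1 ^+ n)%:E)%E.
 rewrite -(integral_tail e0 n_gt0); apply: eq_integral => s; rewrite inE/= in_itv/= andbT => es.
 by rewrite /k powR_inv1// (le_trans (ltW e0)).
 rewrite -muleA -EFinM exprVn mulfV ?expf_neq0 ?gt_eqF// mule1.
 by rewrite /iO indicE mem_set// mul1e.
 rewrite -integral_itv_obnd_cbnd; last exact/measurable_EFinP/mfunTS.
 rewrite integral_mkcond -ge0_integralZl//; last 3 first.
 - apply/measurable_restrict => //; rewrite setTI; exact/measurable_EFinP/mfunTS.
 - by move=> s _; rewrite patchE; case: ifP => // _; rewrite lee_fin.
 - by rewrite mule_ge0// lee_fin exprn_ge0// ltW.
 apply: eq_integral => s _; rewrite /E3/= patchE mem_setE in_itv/= andbT.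
 have [s0|s0] := leP s 0.
 rewrite indicE memNset ?(mul0r, mul0e)//=; last by rewrite in_itv/= ltNge s0.
 by rewrite ltNge (le_trans s0 (ltW e0))/= mule0.
 have iOs : iO (s `^ (-1) *: x) = ((enorm x < s)%R)%:R.
 rewrite /iO indicE; congr ((nat_of_bool _)%:R); apply/idP/idP; rewrite inE /unit_ball/= enormZ;
 by rewrite ger0_norm ?powR_ge0// powR_inv1 ?ltW// mulrC ltr_pdivrMr// mul1r.
 rewrite iOs indicE mem_set/=; last by rewrite in_itv/= s0.
 rewrite /i1 indicE mem_set ?mul1r/=; last by rewrite in_itv/= e0 x1.
 case: ltP => es; last by rewrite !(mul0r, mulr0) mul0e mule0.
 rewrite mul1r -muleA muleC; congr (_ * _)%E; rewrite -EFinM; congr EFin.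
 have -> : enorm x ^+ n = enorm x * enorm x ^+ n.-1 by rewrite -exprS prednK.
 by rewrite /k exprS; ring.
rewrite -fubini_tonelli//.
transitivity (\int[mu1]_s \int[leb]_y E2 (s, y))%E.
 apply: eq_integral => s _; have [s0|s0] := leP s 0.
 rewrite !integral0_eq// => x _; rewrite /E2 /E3/=.
 rewrite /i1 !indicE !mem_setE !in_itv/= [0 < s * _]ltNge mulr_le0_ge0 ?sqrtr_ge0//.
 by rewrite !(mul0r, mulr0) mul0e.
 by rewrite !indicE !mem_setE !in_itv/= ltNge s0 !mul0r mul0e.
 rewrite [RHS](ge0_integral_affine (c := s^-1) 0)//; last 2 first.
 by rewrite invr_gt0.
 exact: (measurable_fun_pair2 _ mE2).
 rewrite -ge0_integralZl//; last 2 first.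
 apply: (mcompT (measurable_fun_pair2 _ mE2)); exact: measurable_affine.
 by rewrite lee_fin exprn_ge0// invr_ge0 ltW.
 apply: eq_integral => x _; rewrite /E3 /E2 /affine/= powR_inv1 ?(ltW s0)// addr0.
 have -> : enorm (s^-1 *: x) = s^-1 * enorm x by rewrite enormZ ger0_norm ?invr_ge0 ?ltW.
 have -> : s * (s^-1 * enorm x) = enorm x by rewrite mulrA divff ?mul1r ?gt_eqF.
 rewrite scalerA divff ?gt_eqF// scale1r muleA -EFinM; congr (_%:E * _)%E.
 by rewrite indicE mem_setE in_itv/= s0 mul1r.
rewrite fubini_tonelli//.
transitivity (\int[leb]_y \int[mu1]_r E1 (r, y))%E.
 apply: ge0_ae_eq_integral => //.
 - exact: (@measurable_fun_fubini_tonelli_G _ _ (measurableTypeR R) 'rV[R]_n R mu1 E2 mE2 E2_ge0).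
 - exact: (@measurable_fun_fubini_tonelli_G _ _ (measurableTypeR R) 'rV[R]_n R mu1 E1 mE1 E1_ge0).
 - by move=> x _; apply: integral_ge0.
 - by move=> x _; apply: integral_ge0.
 apply: filterS ae_neq0 => y y0 _.
 have en0 : 0 < enorm y by rewrite enorm_gt0.
 rewrite [RHS](ge0_integral_scale en0)//; last first.
 exact: (measurable_fun_pair1 _ mE1).
 rewrite -ge0_integralZl//; last 2 first.
 by apply: (mcompT (measurable_fun_pair1 _ mE1)); exact: mfunM.
 by rewrite lee_fin ltW.
 apply: eq_integral => s _; rewrite /E1 /E2/= muleA -EFinM.
 congr (_%:E * h _)%E; first by rewrite [enorm y * s]mulrC.
 by rewrite /normalize scalerA mulrAC divff ?mul1r// gt_eqF.
rewrite -fubini_tonelli// [RHS]integral_mkcond; apply: eq_integral => r _.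
rewrite patchE; case: ifPn => r01; last first.
 rewrite integral0_eq// => y _; rewrite /E1/= /i1 indicE (negbTE r01) !mul0r mul0e.
 by [].
rewrite [in RHS]integral_mkcond -ge0_integralZl//; last 3 first.
- apply/measurable_restrict; [exact: measurable_unit_ball|exact: measurableT|rewrite setTI].
 apply: mfunTS; apply: (mcompT mh).
 apply: measurable_fun_rV => j; under eq_fun do rewrite mxE.
 apply: mfunM => //.
 exact: (mcompT (measurable_coord j) (@measurable_normalize R n)).
- by move=> y _; rewrite patchE; case: ifP.
- move: r01; rewrite inE/= in_itv/= => /andP[r0 _].
 by rewrite lee_fin mulr_ge0// exprn_ge0// ltW.
apply: eq_integral => y _; rewrite /E1/= /i1 indicE r01 mul1r.
rewrite patchE /iO indicE; case: ifP => _; last by rewrite !mul0r mule0 mul0e.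
by rewrite mul1r.
Qed.

End polar.

(** * Spherical integrals of real functions *)

Section polar_real.
Context (R : realType) (n : nat).
Hypothesis n_gt0 : (0 < n)%N.
Local Notation leb := (lebesgue_rV R n).
Local Notation mu1 := (@lebesgue_measure R).
Local Notation Omega := (@unit_ball R n).
Let mO := @measurable_unit_ball R n.

Definition polar_fun (h : 'rV[R]_n -> R) (z : measurableTypeR R * 'rV[R]_n) : R :=
 (\1_(`]0, 1[%classic : set R) z.1 * (n%:R * z.1 ^+ n.-1)) *
 (\1_Omega z.2 * (h \_ Omega) (z.1 *: normalize z.2)).

(** A spherical integral with the Jacobian included and not normalized: for 0 < r < 1 it is r^(n-1)
    times the integral of h(r theta) over the unit sphere. *)
Definition smean (h : 'rV[R]_n -> R) (r : R) : R := \int[leb]_y polar_fun h (r, y).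

Lemma unit_ball_polar (r : R) (y : 'rV[R]_n) : 0 < r < 1 -> Omega (r *: normalize y).
move=> /andP[r0 r1]; rewrite /unit_ball/= /normalize scalerA enormZ normrM (gtr0_norm r0).
rewrite ger0_norm ?invr_ge0 ?sqrtr_ge0//.
have [->|y0] := eqVneq (enorm y) 0; first by rewrite mulr0.
by rewrite -mulrA mulVf// mulr1.
Qed.

Lemma enorm_polar (r : R) (y : 'rV[R]_n) : 0 < r -> y != 0 -> enorm (r *: normalize y) = r.
move=> r0 y0; rewrite /normalize scalerA enormZ normrM (gtr0_norm r0).
by rewrite ger0_norm ?invr_ge0 ?sqrtr_ge0// -mulrA mulVf ?mulr1// gt_eqF// enorm_gt0.
Qed.

Lemma measurable_polar_map : measurable_fun setT
 (fun z : measurableTypeR R * 'rV[R]_n => z.1 *: normalize z.2).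
apply: measurable_fun_rV => j; under eq_fun do rewrite mxE.
apply: mfunM; first exact: (@measurable_fst _ _ (measurableTypeR R) 'rV[R]_n).
apply: (mcompT (measurable_coord j)).
exact: (mcompT (@measurable_normalize R n) (@measurable_snd _ _ (measurableTypeR R) 'rV[R]_n)).
Qed.

Lemma mpolar_fun h : measurable_fun Omega h -> measurable_fun setT (polar_fun h).
move=> mh; have mh0 : measurable_fun setT (h \_ Omega).
 by apply/measurable_restrict => //; rewrite setTI.
have mf1 : measurable_fun setT (fst : measurableTypeR R * 'rV[R]_n -> R).
 mfun.
have mf2 : measurable_fun setT (snd : measurableTypeR R * 'rV[R]_n -> 'rV[R]_n).
 mfun.
apply: mfunM; apply: mfunM.
- by apply: (mcompT (measurable_indic _) mf1).
- mfun.
- by apply: (mcompT (measurable_indic _) mf2).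
- exact: (mcompT mh0 measurable_polar_map).
Qed.

(** The polar formula as one integral over a product space, ready for Fubini in either order. *)
Lemma ge0_polar_prod (h : 'rV[R]_n -> R) : measurable_fun Omega h -> (forall x, Omega x -> 0 <= h x) ->
 (\int[leb]_(x in Omega) (h x)%:E = \int[mu1 \x leb]_z (polar_fun h z)%:E)%E.
move=> mh h0; pose h1 := h \_ Omega.
have h1_ge0 x : 0 <= h1 x by rewrite /h1 patchE; case: ifPn => // /set_mem; exact: h0.
have mh1 : measurable_fun setT h1 by apply/measurable_restrict => //; rewrite setTI.
have wge0 (r : R) : 0 <= \1_(`]0, 1[%classic : set R) r * (n%:R * r ^+ n.-1).
 rewrite indicE mem_setE in_itv/=; case: (boolP (0 < r < 1)) => [/andP[r0 _]|_]; last by rewrite mul0r.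
 by rewrite mul1r mulr_ge0// exprn_ge0// ltW.
rewrite (@fubini_tonelli1 _ _ (measurableTypeR R) 'rV[R]_n R mu1 leb (fun z => (polar_fun h z)%:E)); last 2 first.
- by apply/measurable_EFinP; exact: mpolar_fun.
- by move=> z; rewrite lee_fin mulr_ge0// mulr_ge0// indicE.
transitivity (\int[leb]_(x in Omega) (h1 x)%:E)%E.
 by apply: eq_integral => x xO; rewrite /h1 patchE xO.
rewrite (ge0_polar n_gt0 (h := fun x => (h1 x)%:E)); last 2 first.
- mfun.
- by move=> x; rewrite lee_fin.
rewrite integral_mkcond; apply: eq_integral => r _.
rewrite patchE /fubini_F/=; case: ifPn => r01; last first.
 by rewrite integral0_eq// => y _; rewrite /polar_fun/= indicE (negbTE r01) !mul0r.
rewrite integral_mkcond -ge0_integralZl//; last 3 first.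
- apply/measurable_restrict => //; rewrite setTI; apply: mfunTS; apply/measurable_EFinP.
 apply: (mcompT mh1).
 by have := measurable_fun_pair2 (r : measurableTypeR R) measurable_polar_map.
- by move=> y _; rewrite patchE; case: ifP => // _; rewrite lee_fin.
- by have := wge0 r; rewrite indicE r01 mul1r lee_fin.
apply: eq_integral => y _; rewrite /polar_fun/= -/h1 patchE !indicE r01 mul1r.
by case: ifP => _; rewrite ?mul1r ?mul0r ?mulr0 ?mule0.
Qed.

Lemma polar_fun_norm h z : `|polar_fun h z| = polar_fun (fun x => `|h x|) z.
rewrite /polar_fun normrM; congr (_ * _).
 rewrite ger0_norm// indicE mem_setE in_itv/=.
 case: (boolP (0 < z.1 < 1)) => [/andP[r0 _]|_]; last by rewrite mul0r.
 by rewrite mul1r mulr_ge0// exprn_ge0// ltW.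
rewrite normrM; congr (_ * _); first by rewrite ger0_norm// indicE.
by rewrite !patchE; case: ifP => // _; rewrite normr0.
Qed.

Lemma integrable_polar_fun h : int_ball R n h ->
 (mu1 \x leb)%E.-integrable setT (EFin \o polar_fun h).
move=> ih; have mh := integrable_mfun ih.
apply/integrableP; split; first by apply/measurable_EFinP; exact: mpolar_fun.
under eq_integral do rewrite /= polar_fun_norm.
rewrite -ge0_polar_prod//; last exact: mcompT.
by move/integrableP : ih => [_].
Qed.

(** The signed case follows from the nonnegative one by writing h as (|h| + h) - |h|. *)
Lemma polar_prod h : int_ball R n h ->
 \int[leb]_(x in Omega) h x = \int[(mu1 \x leb)%E]_z polar_fun h z.
move=> ih; have mh := integrable_mfun ih.
have ia := integrable_norm ih.
have isum : int_ball R n (fun x => `|h x| + h x) by exact: intgD.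
have mn : measurable_fun Omega (fun x => `|h x|) by mfun.
have E1 : \int[leb]_(x in Omega) `|h x| = \int[(mu1 \x leb)%E]_z polar_fun (fun x => `|h x|) z.
 by rewrite /Rintegral ge0_polar_prod.
have E2 : \int[leb]_(x in Omega) (`|h x| + h x) = \int[(mu1 \x leb)%E]_z polar_fun (fun x => `|h x| + h x) z.
 rewrite /Rintegral ge0_polar_prod//; first exact: measurable_funD.
 by move=> x _; have := ler_norm (- h x); rewrite normrN; lra.
transitivity (\int[leb]_(x in Omega) (`|h x| + h x) - \int[leb]_(x in Omega) `|h x|).
 by rewrite -RintegralB//; apply: eq_Rintegral => x _; ring.
rewrite E1 E2 -RintegralB//; [|exact: integrable_polar_fun..].
apply: eq_Rintegral => z _; rewrite /polar_fun -mulrBr -mulrBr !patchE.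
congr (_ * (_ * _)); case: ifP => _; last exact: subrr.
by rewrite addrC addKr.
Qed.

Lemma smean_out h r : r \notin `]0, 1[ -> smean h r = 0.
move=> r01; rewrite /smean (@eq_Rintegral _ _ _ _ _ (cst 0)) ?Rintegral_cst ?mul0r// => y _.
by rewrite /polar_fun/= indicE mem_setE (negbTE r01) !mul0r.
Qed.

Lemma polar h : int_ball R n h ->
 \int[leb]_(x in Omega) h x = \int[mu1]_(r in `]0, 1[) smean h r.
move=> ih; rewrite polar_prod// (Rfubini1 (integrable_polar_fun ih)).
rewrite [RHS]Rintegral_mkcond; apply: eq_Rintegral => r _; rewrite patchE mem_setE.
by case: ifPn => // r01; rewrite -/(smean h r) smean_out.
Qed.

Lemma integrable_smeanT h : int_ball R n h ->
 mu1.-integrable setT (EFin \o smean h).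
by move=> ih; exact: integrable_Rintegral1 (integrable_polar_fun ih). Qed.

Lemma integrable_smean h : int_ball R n h ->
 mu1.-integrable `]0, 1[ (EFin \o smean h).
by move=> ih; apply: integrableS (integrable_smeanT ih). Qed.

Lemma ae_eq0_ge0 d (T : measurableType d) (m : {measure set T -> \bar R}) (f : T -> \bar R) :
 measurable_fun setT f -> (forall x, 0 <= f x)%E -> (\int[m]_x f x = 0)%E ->
 {ae m, forall x, f x = 0%E}.
move=> mf f0 i0.
have := (ae_eq_integral_abs m measurableT mf).1.
under eq_integral do rewrite gee0_abs//.
move=> /(_ i0); move=> [N [mN N0 sub]]; exists N; split => // x /= h; apply: sub => /= k.
by apply: h; exact: k.
Qed.

(** The indicator of a null set has zero polar integral. Since the Jacobian n r^(n-1) is positive,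
    almost every sphere meets the null set in a null set of directions. *)
Lemma ae_polar (P : 'rV[R]_n -> Prop) : {ae leb, forall x, Omega x -> P x} ->
 {ae mu1, forall r, 0 < r < 1 -> {ae leb, forall y, Omega y -> P (r *: normalize y)}}.
move=> [Z [mZ Z0 sub]]; pose h : 'rV[R]_n -> R := \1_Z.
have mh : measurable_fun Omega h by apply: mfunTS; exact: measurable_indic.
have h0 x : Omega x -> 0 <= h x by rewrite /h indicE.
have p0 z : (0 <= (polar_fun h z)%:E)%E.
 have -> : polar_fun h z = `|polar_fun h z|; last by rewrite lee_fin.
 rewrite polar_fun_norm /polar_fun !patchE; congr (_ * (_ * _)); case: ifP => // /set_mem O.
 by rewrite ger0_norm ?h0.
have mp : measurable_fun setT (fun z => (polar_fun h z)%:E).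
 by apply/measurable_EFinP; exact: mpolar_fun.
have := ge0_polar_prod mh h0.
rewrite integral_indic//.
rewrite [X in X = _ -> _](_ : _ = 0%E); last first.
 by apply: (@subset_measure0 _ _ _ leb _ Z) => //; exact: measurableI.
rewrite (@fubini_tonelli1 _ _ (measurableTypeR R) 'rV[R]_n R mu1 leb _ mp p0) => /esym i0.
have mF := @measurable_fun_fubini_tonelli_F _ _ (measurableTypeR R) 'rV[R]_n R leb _ mp p0.
have F0 r : (0 <= fubini_F leb (fun z => (polar_fun h z)%:E) r)%E by exact: integral_ge0.
apply: filterS (ae_eq0_ge0 mF F0 i0) => r Fr /andP[r0 r1].
have mpr : measurable_fun setT (fun y => (polar_fun h (r, y))%:E).
 exact: (measurable_fun_pair2 (r : measurableTypeR R) mp).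
apply: filterS (ae_eq0_ge0 mpr (fun y => p0 (r, y)) Fr) => y [+] Oy.
have Or : Omega (r *: normalize y) by apply: unit_ball_polar; rewrite r0.
rewrite /polar_fun/= patchE mem_set// !indicE mem_setE in_itv/= r0 r1 mem_set// !mul1r => /eqP.
rewrite mulf_eq0 mulf_eq0 pnatr_eq0 expf_eq0 (gt_eqF r0) andbF (gtn_eqF n_gt0)/=.
rewrite /h indicE pnatr_eq0 eqb0 => /negP nZ.
by apply: contrapT => nP; apply: nZ; rewrite inE; apply: sub => /= k; exact: nP (k Or).
Qed.

Lemma ae_integrable_polar h : int_ball R n h ->
 {ae mu1, forall r, leb.-integrable setT (EFin \o (fun y => polar_fun h (r, y)))}.
by move=> ih; exact: ae_integrable1 (integrable_polar_fun ih). Qed.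

Lemma smean_radial (a : R -> R) r : 0 < r < 1 ->
 smean (fun x => a (enorm x)) r = a r * (n%:R * r ^+ n.-1 * fine (leb Omega)).
move=> r01; have /andP[r0 r1] := r01; rewrite /smean.
transitivity (\int[leb]_y (\1_Omega y * (a r * (n%:R * r ^+ n.-1)))); last first.
 by rewrite -Rintegral_indicM Rintegral_cst// -!mulrA.
have miO : measurable_fun setT (\1_Omega : 'rV[R]_n -> R) by mfun.
have mR : measurable_fun setT (fun y => \1_Omega y * (a r * (n%:R * r ^+ n.-1)) : R).
 mfun.
have H y : y != 0 -> polar_fun (fun x => a (enorm x)) (r, y) = \1_Omega y * (a r * (n%:R * r ^+ n.-1)).
 move=> y0; rewrite /polar_fun/= indicE mem_setE in_itv/= r01 patchE mem_set; last exact: unit_ball_polar.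
 by rewrite enorm_polar// (_ : true%:R = 1 :> R)//; ring.
(* Here a is an arbitrary function. Off the origin the integrand sees only the value a(r); at y = 0
   the direction is 0 and the value a(0) appears, so an explicit formula with two constants proves
   measurability. *)
have mL : measurable_fun setT (fun y => polar_fun (fun x => a (enorm x)) (r, y)).
 rewrite [X in measurable_fun _ X](_ : _ = fun y : 'rV[R]_n => \1_Omega y *
 (\1_[set 0] y * ((a 0) * (n%:R * r ^+ n.-1)) + (1 - \1_[set 0] y) * (a r * (n%:R * r ^+ n.-1)))).
 have m0 : measurable_fun setT (\1_[set 0] : 'rV[R]_n -> R).
 by apply: measurable_indic; exact: measurable_rV0.
 apply: mfunM => //; apply: measurable_funD; apply: mfunM => //.
 exact: measurable_funB.
 apply/funext => y; have [->|y0] := eqVneq y 0.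
 rewrite /polar_fun/= indicE mem_setE in_itv/= r01 patchE mem_set; last exact: unit_ball_polar.
 by rewrite /normalize enorm0 invr0 scale0r scaler0 enorm0 [\1_[set 0] _]indicE mem_set// (_ : true%:R = 1 :> R)//; ring.
 by rewrite H// [\1_[set 0] _]indicE memNset//=; [ring|exact/eqP].
apply: ae_eq_Rint => //.
by apply: filterS (ae_neq0 R n_gt0) => y y0 _; exact: H.
Qed.

Lemma polar_mul (w : 'rV[R]_n -> R) (a : R -> R) :
 int_ball R n w -> borel R a ->
 int_ball R n (fun x => w x * a (enorm x)) ->
 \int[leb]_(x in Omega) (w x * a (enorm x)) = \int[mu1]_(r in `]0, 1[) (smean w r * a r).
move=> iw ma iwa; rewrite polar//.
have m1 := integrable_mfun (integrable_smean iwa).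
have m2 := integrable_mfun (integrable_smean iw).
apply: ae_eq_Rint => //; first by apply: mfunM => //; exact: mfunTS.
apply: filterS (ae_integrable_polar iw) => r ir; rewrite /= in_itv/= => /andP[r0 r1].
rewrite mulrC /smean -RintegralZl//.
have mw := integrable_mfun iw.
have mwa := integrable_mfun iwa.
apply: ae_eq_Rint => //.
- exact: (measurable_fun_pair2 (r : measurableTypeR R) (mpolar_fun mwa)).
- mfun.
apply: filterS (ae_neq0 R n_gt0) => y y0 _; rewrite /polar_fun/= !patchE mem_set; last first.
 by apply: unit_ball_polar; rewrite r0.
by rewrite enorm_polar//; ring.
Qed.

Lemma sqr_enorm_le (c : R) (x : 'rV[R]_n) : (forall i, `|x ord0 i| <= c) ->
 enorm x ^+ 2 <= n%:R * c ^+ 2.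
move=> xc; rewrite sqr_enorm /dotp (@le_trans _ _ (\sum_(i < n) c ^+ 2))//.
 apply: ler_sum => i _; rewrite -expr2 -real_normK ?num_real//.
 by rewrite lerXn2r// nnegrE// (le_trans _ (xc i)).
by rewrite sumr_const card_ord mulr_natl.
Qed.

Lemma ball_volume_gt0 : 0 < fine (leb Omega).
have lb : (leb Omega < +oo)%E by exact: ball_lty.
have n0 : 0 < n%:R :> R by rewrite ltr0n.
have n1 : 1 <= n%:R :> R by rewrite ler1n.
(* With this half-side n c^2 = c / 2 < 1, so the cube lies in the ball and bounds its volume from
   below. *)
pose c : R := (2 * n%:R)^-1.
have c0 : 0 < c by rewrite invr_gt0 mulr_gt0.
have sub : box (fun _ : 'I_n => - c) (fun=> c) `<=` Omega.
 move=> x xc; have /(sqr_enorm_le (c := c)) : forall i, `|x ord0 i| <= c.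
 by move=> i; have := xc i; rewrite in_itv/= => /andP[? ?]; rewrite ler_norml !ltW.
 rewrite /unit_ball/= => h; rewrite -(@ltr_pXn2r _ 2) ?nnegrE ?sqrtr_ge0// expr1n.
 apply: (le_lt_trans h); have nc : n%:R * c = 2^-1 by rewrite /c; field; rewrite gt_eqF.
 have c1 : c <= 1 by nra.
 by rewrite expr2 mulrA nc; lra.
have : (leb (box (fun _ : 'I_n => - c)%R (fun=> c)%R) <= leb Omega)%E.
 by apply: le_measure => //; rewrite inE//; exact: measurable_box.
rewrite lebesgue_box; move: lb.
have : 0 < \prod_(i < n) Num.max 0 (c - - c).
 by apply: prodr_gt0 => i _; rewrite lt_max opprK addr_gt0 ?orbT.
case: (leb Omega) => [r|//|//] h _; rewrite lee_fin => h2.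
exact: lt_le_trans h h2.
Qed.

Lemma fine_ball : (fine (leb Omega))%:E = leb Omega.
by rewrite fineK// ge0_fin_numE// ball_lty. Qed.

Lemma ge0_radial (a : R -> R) : borel R a ->
 (forall r, 0 <= a r) ->
 (\int[leb]_(x in Omega) (a (enorm x))%:E =
 (n%:R * fine (leb Omega))%:E * \int[mu1]_(r in `]0%R, 1%R[) (r ^+ n.-1 * a r)%:E)%E.
move=> ma a0; have mae : measurable_fun setT (fun x : 'rV[R]_n => a (enorm x)).
 mfun.
rewrite (ge0_polar n_gt0 (h := fun x => (a (enorm x))%:E)); last 2 first.
- mfun.
- by move=> x; rewrite lee_fin.
rewrite -ge0_integralZl//; last 3 first.
- mfun.
- by move=> r; rewrite /= in_itv/= => /andP[r0 _]; rewrite lee_fin mulr_ge0// exprn_ge0// ltW.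
- by rewrite lee_fin mulr_ge0// ltW// ball_volume_gt0.
apply: eq_integral => r; rewrite inE/= in_itv/= => /andP[r0 r1].
transitivity ((n%:R * r ^+ n.-1)%:E * \int[leb]_(y in Omega) (a r)%:E)%E.
 congr (_ * _)%E; apply: ge0_ae_eq_integral => //.
 - apply: mfunTS; apply/measurable_EFinP; apply: (mcompT mae).
 by have := measurable_fun_pair2 (r : measurableTypeR R) measurable_polar_map.
 - by move=> y _; rewrite lee_fin.
 - by move=> y _; rewrite lee_fin.
 by apply: filterS (ae_neq0 R n_gt0) => y y0 _; rewrite enorm_polar.
rewrite integral_cst// [X in (_ * (_ * X))%E](_ : _ = (fine (leb Omega))%:E); last exact/esym/fine_ball.
by rewrite -!EFinM; congr (_%:E); ring.
Qed.

Lemma ae_radial (P : R -> Prop) :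
 {ae mu1, forall r, 0 < r < 1 -> P r} -> {ae leb, forall x, Omega x -> P (enorm x)}.
move=> [Z [mZ Z0 sub]].
have mZ1 : borel R (\1_Z) by mfun.
have := @ge0_radial (\1_Z : R -> R) mZ1 (fun r => ltac:(by rewrite indicE)).
rewrite (_ : (\int[mu1]_(r in _) _)%E = 0%E); last first.
 transitivity (\int[mu1]_(r in `]0%R, 1%R[) (cst 0%E) r)%E; last by rewrite integral0.
 apply: ge0_ae_eq_integral => //.
 - mfun.
 - by move=> r; rewrite /= in_itv/= => /andP[r0 _]; rewrite lee_fin indicE mulr_ge0// exprn_ge0// ltW.
 exists Z; split => // r /= /not_implyP[_ h]; apply: contrapT => nZ; apply: h.
 by rewrite indicE memNset// mulr0.
rewrite mule0 (eq_integral (fun x => (\1_((@enorm R n) @^-1` Z) x)%:E)); last first.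
 by move=> x _; rewrite !indicE; congr (_%:E); congr ((nat_of_bool _)%:R); apply/idP/idP; rewrite !inE.
have mP : measurable ((@enorm R n) @^-1` Z).
 exact: (meas_preimage (@measurable_enorm R n : measurable_fun setT (_ : _ -> measurableTypeR R))).
rewrite integral_indic// => h.
have : {ae leb, forall x, Omega x -> ~ Z (enorm x)}.
 exists ((@enorm R n) @^-1` Z `&` Omega); split => //; first exact: measurableI.
 by move=> x /= /not_implyP[Ox /contrapT Zx].
apply: filterS2 (ae_neq0 R n_gt0) => x x0 h2 Ox.
apply: contrapT => nP; apply: (h2 Ox); apply: sub => /= k; apply: nP; apply: k.
by rewrite enorm_gt0 x0.
Qed.

(** If P failed at a radius whose sphere is good in almost every direction, the whole ball would be
    null, against its positive volume. *)
Lemma ae_radial_inv (P : R -> Prop) :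
 {ae leb, forall x, Omega x -> P (enorm x)} -> {ae mu1, forall r, 0 < r < 1 -> P r}.
move=> H; apply: ae_imply (ae_polar H) => r h r01; have {}h := h r01.
apply: contrapT => nP.
have O0 : leb.-negligible Omega.
 apply: (@negligibleS _ _ _ leb (~` [set y | y != 0 /\ (Omega y -> P (enorm (r *: normalize y)))])).
 move=> y Oy /= [y0 k]; apply: nP; have := k Oy; rewrite enorm_polar//.
 by case/andP: r01.
 exact: filterI (ae_neq0 R n_gt0) h.
have := ball_volume_gt0; suff -> : leb Omega = 0%E by rewrite ltxx.
by apply/negligibleP.
Qed.

End polar_real.

(** * Derivatives from elementary bounds *)

Section derivative_bounds.
Context (R : realType).

(** A quadratic error bound replaces a limit computation. It serves for max(0, t)^2, for polynomials
    of degree two, and for |s|^p at 0. *)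
Lemma is_derive_quad (f : R -> R) (t l C : R) :
 (forall h, `|f (t + h) - f t - l * h| <= C * h ^+ 2) -> is_derive t 1 f l.
move=> fC.
have C0 : 0 <= C by have := le_trans (normr_ge0 _) (fC 1); rewrite expr1n mulr1.
have H : h^-1 *: ((f \o shift t) (h *: (1 : R)) - f t) @[h --> (0 : R)^'] --> l.
 apply/cvgrPdist_le => e e0; near=> h.
 have h0 : h != 0 by near: h; exact: nbhs_dnbhs_neq.
 have he : `|h| <= e / (C + 1).
 near: h; apply: dnbhs0_le; rewrite divr_gt0//; lra.
 have -> : l - h^-1 *: ((f \o shift t) (h *: (1 : R)) - f t) = - h^-1 * (f (t + h) - f t - l * h).
 by rewrite /= /GRing.scale/= mulr1 [h + t]addrC; field.
 rewrite normrM normrN normfV ler_pdivrMl ?normr_gt0//.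
 apply: (le_trans (fC h)); rewrite -[h ^+ 2]real_normK ?num_real// expr2 mulrCA ler_wpM2l//.
 have := mulr_ge0 C0 (normr_ge0 h); have := normr_ge0 h.
 move: he; rewrite ler_pdivlMr; last lra.
 lra.
have D : derivable f t 1 by apply/cvg_ex; exists l.
by apply: DeriveDef => //; exact/cvg_lim.
Unshelve. all: by end_near. Qed.

Lemma is_derive_pos_sqr (t : R) :
 is_derive t 1 (fun t : R => Num.max 0 t ^+ 2) (2 * Num.max 0 t).
apply: (@is_derive_quad _ _ _ 1) => h; rewrite mul1r.
by case: (leP 0 t) => t0; case: (leP 0 (t + h)) => th; rewrite ler_norml; apply/andP; split; nra.
Qed.

Lemma lipschitz_derive (f df : R -> R) (M : R) :
 (forall t : R, is_derive t 1 f (df t)) -> (forall t, `|df t| <= M) ->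
 forall a b, `|f a - f b| <= M * `|a - b|.
move=> fd dM.
have H a b : a <= b -> `|f a - f b| <= M * `|a - b|.
 move=> ab; have [|c _ E] := @MVT_segment R f df a b ab (fun x _ => fd x).
 by apply: continuous_subspaceT => x; exact: derive_continuous (fd x).
 by rewrite distrC E normrM [X in _ <= _ * X]distrC ler_wpM2r.
move=> a b; have [/H//|/ltW/H] := leP a b.
by rewrite distrC [X in _ <= _ * X]distrC.
Qed.

Lemma is_derive_near0 (f : R -> R) (t e : R) : 0 < e ->
 (forall s, `|s - t| < e -> f s = 0) -> is_derive t 1 f 0.
move=> e0 f0.
have H : h^-1 *: ((f \o shift t) (h *: (1 : R)) - f t) @[h --> (0 : R)^'] --> (0 : R).
 apply: cvg_near_cst; near=> h; apply/eqP.
 have he : `|h| < e by near: h; apply: dnbhs0_lt.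
 by rewrite /= /GRing.scale/= mulr1 !f0 ?subrr ?mulr0 ?normr0// addrK.
have D : derivable f t 1 by apply/cvg_ex; exists 0.
by apply: DeriveDef => //; exact/cvg_lim.
Unshelve. all: by end_near. Qed.

End derivative_bounds.

Lemma intg_bounded d (T : measurableType d) (R : realType) (m : {measure set T -> \bar R})
 (D : set T) (f : T -> R) (M : R) : measurable D -> (m D < +oo)%E -> measurable_fun D f ->
 (forall x, D x -> `|f x| <= M) -> m.-integrable D (EFin \o f).
move=> mD Dlty mf fM; apply: (@intg_le _ _ _ m D f (fun=> M)) => //.
apply/integrableP; split; first exact/measurable_EFinP.
by rewrite integral_cst//= lte_mul_pinfty ?abse_ge0.
Qed.

Lemma intg_bigsum d (T : measurableType d) (R : realType) (m : {measure set T -> \bar R})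
 (D : set T) (I : Type) (s : seq I) (F : I -> T -> R) : measurable D ->
 (forall i, m.-integrable D (EFin \o F i)) ->
 m.-integrable D (EFin \o (fun x => \sum_(i <- s) F i x)).
move=> mD iF; elim: s => [|i s IH].
 by under [X in EFin \o X]eq_fun do rewrite big_nil; exact: integrable0.
by under [X in EFin \o X]eq_fun do rewrite big_cons; exact: intgD.
Qed.

Lemma Rintegral_bigsum d (T : measurableType d) (R : realType) (m : {measure set T -> \bar R})
 (D : set T) (I : Type) (s : seq I) (F : I -> T -> R) : measurable D ->
 (forall i, m.-integrable D (EFin \o F i)) ->
 \int[m]_(x in D) (\sum_(i <- s) F i x) = \sum_(i <- s) \int[m]_(x in D) F i x.
move=> mD iF; elim: s => [|i s IH].
 under eq_Rintegral do rewrite big_nil.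
 by rewrite Rintegral_cst// mul0r big_nil.
rewrite big_cons -IH -RintegralD//; last exact: intg_bigsum.
by apply: eq_Rintegral => x _; rewrite big_cons.
Qed.

(** * Radial integration by parts *)

Section radial_ibp.
Context (R : realType) (n : nat).
Hypothesis n_gt0 : (0 < n)%N.
Local Notation leb := (lebesgue_rV R n).
Local Notation Omega := (@unit_ball R n).
Let mO := @measurable_unit_ball R n.

Lemma enorm_dist (x y : 'rV[R]_n) : `|enorm x - enorm y| <= enorm (x - y).
have H (a b : 'rV[R]_n) : enorm a - enorm b <= enorm (a - b).
 by rewrite lerBlDr -[X in enorm X](subrK b) enormD.
rewrite ler_norml H andbT lerNl opprB (le_trans (H y x))//.
by rewrite -opprB -scaleN1r enormZ normrN1 mul1r.
Qed.

Lemma is_derive_enorm (x : 'rV[R]_n) (i : 'I_n) : x != 0 ->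
 is_derive x 'e_i (@enorm R n) (normalize x ord0 i).
move=> x0; apply/is_derive_line.
have e0 : 0 < enorm x by rewrite enorm_gt0.
have E (h : R) : enorm (h *: 'e_i + x) = Num.sqrt (h ^+ 2 + (2 * x ord0 i) * h + enorm x ^+ 2).
 rewrite addrC -[LHS]ger0_norm ?sqrtr_ge0// -sqrtr_sqr sqr_enorm_shift.
 by congr Num.sqrt; ring.
rewrite (_ : (fun h : R => _) = Num.sqrt \o (fun h : R => h ^+ 2 + (2 * x ord0 i) * h + enorm x ^+ 2)).
 have q0 : is_derive (0 : R) 1 (fun h : R => h ^+ 2 + (2 * x ord0 i) * h + enorm x ^+ 2) (2 * x ord0 i).
 by apply: (@is_derive_quad _ _ _ _ 1) => h; rewrite !mulr0 expr0n/= !add0r ler_norml; apply/andP; split; nra.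
 have := is_derive1_comp (is_derive1_sqrt _) q0.
 move=> /(_ _)/is_derive_eq; apply.
 by rewrite mulr0 expr0n/= !add0r exprn_gt0.
 rewrite mulr0 expr0n/= !add0r sqrtr_sqr ger0_norm ?sqrtr_ge0// /normalize mxE.
 by field; rewrite gt_eqF.
by apply/funext => h; rewrite E.
Qed.

(** [line_ftc_ibp] applies to h(|x|): it is Lipschitz because the norm is, and differentiable off
    the origin, which is a null set. *)
Lemma radial_ibp_coord (w Wi : 'rV[R]_n -> R) (i : 'I_n) (h dh : R -> R) (M rho : R) :
 int_ball R n w -> int_ball R n Wi ->
 line_ftc w Wi i -> rho < 1 ->
 (forall t : R, is_derive t 1 h (dh t)) -> borel R dh ->
 (forall t, `|h t| <= M) -> (forall t, `|dh t| <= M) -> (forall t, rho < t -> h t = 0) ->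
 \int[leb]_(x in Omega) (w x * (dh (enorm x) * normalize x ord0 i)) =
 - \int[leb]_(x in Omega) (Wi x * h (enorm x)).
move=> iw iW ftc rho1 hd mdh hM dM h0.
have ch : continuous h by move=> t; exact: derive_continuous (hd t).
have mh : borel R h by exact: continuous_measurable_fun.
apply: (line_ftc_ibp (rho := rho) (M := M) (C := M) (psi := fun x => h (enorm x)) iw iW ftc rho1) => //.
- mfun.
- apply: mfunM; first exact: (mcompT mdh (@measurable_enorm R n)).
 exact: (mcompT (measurable_coord i) (@measurable_normalize R n)).
- by move=> x /h0.
- move=> x s s0; have M0 : 0 <= M := le_trans (normr_ge0 _) (hM 0).
 apply: (le_trans (lipschitz_derive hd dM _ _)); rewrite ler_wpM2l//.
 apply: (le_trans (enorm_dist _ _)).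
 by rewrite opprB addrC subrK enormZ enorm_delta mulr1 ger0_norm.
apply: filterS (ae_neq0 R n_gt0) => x x0.
have /is_derive_line D : is_derive x 'e_i (fun y => h (enorm y)) (dh (enorm x) * normalize x ord0 i).
 apply/is_derive_line; have /is_derive_line De := is_derive_enorm i x0.
 apply: (is_derive1_comp (f := h) (g := fun t : R => enorm (t *: 'e_i + x))) => //.
 by rewrite scale0r add0r; exact: hd.
pose u (k : nat) : R := - k.+1%:R^-1.
have [D1 D2] := D.
have cu : u k @[k --> \oo] --> (0 : R).
 by rewrite -[X in _ --> X]oppr0; apply: cvgN; exact: cvg_harmonic.
have := (cvgr_dnbhsP (fun t : R => t^-1 * (h (enorm (t *: 'e_i + x)) - h (enorm x))) 0
 (dh (enorm x) * normalize x ord0 i)).1.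
move=> /(_ _ u (conj _ cu)) c.
rewrite (_ : (fun k : nat => _) = fun k => (u k)^-1 * (h (enorm (u k *: 'e_i + x)) - h (enorm x))).
 apply: c => [|k]; last by rewrite /u oppr_eq0 invr_eq0 pnatr_eq0.
 rewrite -D2; apply: cvg_trans D1; apply: near_eq_cvg; apply: nearW => t.
 by rewrite /= !scalerE mulr1 addr0 scale0r add0r.
apply/funext => k; rewrite /u invrN invrK mulNr -mulrN opprB scaleNr; congr (_ * (_ - h (enorm _))).
by rewrite addrC.
Qed.

Lemma line_ftc_coord (i j : 'I_n) : line_ftc (fun x : 'rV[R]_n => x ord0 j) (fun=> (j == i)%:R) i.
move=> s s0; apply: aeW => x _ _; rewrite Rintegral_cst// lebesgue_segment ?ltW//.
by rewrite !mxE eqxx/=; ring.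
Qed.

(** The field h(|x|) x has divergence r h' + n h. The coordinate version is applied to the products
    w x_i and summed. *)
Lemma radial_ibp_cpt (w : 'rV[R]_n -> R) (W : 'rV[R]_n -> 'rV[R]_n) (h dh : R -> R) (M rho : R) :
 int_ball R n w ->
 (forall i, int_ball R n (fun x => W x ord0 i)) ->
 (forall i, line_ftc w (fun x => W x ord0 i) i) -> rho < 1 ->
 (forall t : R, is_derive t 1 h (dh t)) -> borel R dh ->
 (forall t, `|h t| <= M) -> (forall t, `|dh t| <= M) -> (forall t, rho < t -> h t = 0) ->
 \int[leb]_(x in Omega) (w x * (enorm x * dh (enorm x) + n%:R * h (enorm x))) =
 - \int[leb]_(x in Omega) (dotp (W x) x * h (enorm x)).
move=> iw iW ftc rho1 hd mdh hM dM h0.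
have mw := integrable_mfun iw.
have ch : continuous h by move=> t; exact: derive_continuous (hd t).
have mh : borel R h by exact: continuous_measurable_fun.
have mhe := mcompT mh (@measurable_enorm R n).
have mdhe := mcompT mdh (@measurable_enorm R n).
have M0 : 0 <= M := le_trans (normr_ge0 _) (hM 0).
have mc (i : 'I_n) : measurable_fun Omega (fun x : 'rV[R]_n => x ord0 i).
 mfun.
have xle1 (x : 'rV[R]_n) (i : 'I_n) : Omega x -> `|x ord0 i| <= 1.
 by move=> Ox; rewrite (le_trans (coord_le_enorm x i))// ltW.
have iwx (i : 'I_n) : int_ball R n (fun x => w x * x ord0 i).
 by apply: (integrableMb (M := 1)) => // x; exact: xle1.
have iWx (i : 'I_n) : int_ball R n (fun x => w x * (i == i)%:R + x ord0 i * W x ord0 i).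
 apply: intgD => //.
 by under [X in EFin \o X]eq_fun do rewrite eqxx mulr1.
 under [X in EFin \o X]eq_fun do rewrite mulrC.
 by apply: (integrableMb (M := 1)) => // x; exact: xle1.
have ic (i : 'I_n) : int_ball R n (fun=> (i == i)%:R : R).
 by apply: (intg_bounded (M := 1)) => // [|x _]; [exact: ball_lty|rewrite eqxx normr1].
have K (i : 'I_n) : \int[leb]_(x in Omega) (w x * x ord0 i * (dh (enorm x) * normalize x ord0 i)) =
 - \int[leb]_(x in Omega) ((w x * (i == i)%:R + x ord0 i * W x ord0 i) * h (enorm x)).
 apply: (radial_ibp_coord (M := M) (rho := rho)) => //.
 exact: line_ftc_mul mw (mc i) (iW i) (ic i) (ftc i) (line_ftc_coord i i).
have nle1 (x : 'rV[R]_n) (i : 'I_n) : `|normalize x ord0 i| <= 1.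
 rewrite (le_trans (coord_le_enorm _ i))// /normalize enormZ ger0_norm ?invr_ge0 ?sqrtr_ge0//.
 by have [->|?] := eqVneq (enorm x) 0; rewrite ?mulr0// mulVf.
have mn (i : 'I_n) : measurable_fun Omega (fun x : 'rV[R]_n => normalize x ord0 i).
 by apply: mfunTS; exact: (mcompT (measurable_coord i) (@measurable_normalize R n)).
have iL (i : 'I_n) : int_ball R n (fun x => w x * x ord0 i * (dh (enorm x) * normalize x ord0 i)).
 apply: (integrableMb (M := M)) => //.
 mfun.
 by move=> x _; rewrite normrM -[leRHS]mulr1 ler_pM.
have iR (i : 'I_n) : int_ball R n (fun x => (w x * (i == i)%:R + x ord0 i * W x ord0 i) * h (enorm x)).
 by apply: (integrableMb (M := M)) => //; exact: mfunTS.
have Rsum (F : 'I_n -> 'rV[R]_n -> R) : (forall i, int_ball R n (F i)) ->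
 \int[leb]_(x in Omega) (\sum_i F i x) = \sum_i \int[leb]_(x in Omega) F i x.
 by move=> iF; exact: Rintegral_bigsum.
have S1 : \int[leb]_(x in Omega) (w x * (enorm x * dh (enorm x))) =
 - \int[leb]_(x in Omega) (n%:R * (w x * h (enorm x)) + dotp (W x) x * h (enorm x)).
 transitivity (\sum_i \int[leb]_(x in Omega) (w x * x ord0 i * (dh (enorm x) * normalize x ord0 i))).
 rewrite -Rsum//; apply: eq_Rintegral => x _.
 transitivity (\sum_i (w x * dh (enorm x) * (enorm x)^-1) * (x ord0 i * x ord0 i)).
 rewrite -mulr_sumr -/(dotp x x) -sqr_enorm.
 have [->|e0] := eqVneq (enorm x) 0; first by ring.
 by field.
 by apply: eq_bigr => i _; rewrite /normalize mxE; ring.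
 under eq_bigr do rewrite K.
 rewrite sumrN -Rsum//; congr (- _); apply: eq_Rintegral => x _.
 under eq_bigr do rewrite eqxx mulr1 mulrDl.
 rewrite big_split/= sumr_const card_ord -[_ *+ n]mulr_natl; congr (_ + _).
 by rewrite -mulr_suml; congr (_ * _); apply: eq_bigr => i _; rewrite mulrC.
have i1 : int_ball R n (fun x => w x * (enorm x * dh (enorm x))).
 apply: (integrableMb (M := M)) => //.
 mfun.
 move=> x Ox; rewrite normrM -[leRHS]mul1r ler_pM// ger0_norm ?sqrtr_ge0//; exact: ltW.
have i2 : int_ball R n (fun x => n%:R * (w x * h (enorm x))).
 apply: intgZ => //.
 by apply: (integrableMb (M := M)) => //; exact: mfunTS.
have i3 : int_ball R n (fun x => dotp (W x) x * h (enorm x)).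
 apply: (integrableMb (M := M)) => //; last exact: mfunTS.
 apply: intg_bigsum => // i; apply: (integrableMb (M := 1)) => // x; exact: xle1.
rewrite RintegralD// in S1.
under eq_Rintegral do rewrite mulrDr.
rewrite RintegralD//; last first.
 by apply: eq_integrable i2 => // x _; rewrite /=; congr EFin; ring.
have -> : \int[leb]_(x in Omega) (w x * (n%:R * h (enorm x))) =
 \int[leb]_(x in Omega) (n%:R * (w x * h (enorm x))).
 by apply: eq_Rintegral => x _; ring.
by rewrite S1; ring.
Qed.

(** The field need not have compact support: h may merely vanish linearly at 1, and h' may be
    unbounded near 0 as long as r h' + n h is bounded. This covers the field F |grad v|^(p-2) grad
    v, controlled at 1 only by the Neumann condition. *)
Lemma radial_ibp (w : 'rV[R]_n -> R) (W : 'rV[R]_n -> 'rV[R]_n) (h dh : R -> R) (C : R) :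
 int_ball R n w ->
 (forall i, int_ball R n (fun x => W x ord0 i)) ->
 (forall i, line_ftc w (fun x => W x ord0 i) i) ->
 (forall r : R, 0 < r < 1 -> is_derive r 1 h (dh r)) ->
 borel R h ->
 borel R dh ->
 (forall r, 0 < r < 1 -> `|h r| <= C * (1 - r)) ->
 (forall r, 0 < r < 1 -> `|r * dh r + n%:R * h r| <= C) ->
 \int[leb]_(x in Omega) (w x * (enorm x * dh (enorm x) + n%:R * h (enorm x))) =
 - \int[leb]_(x in Omega) (dotp (W x) x * h (enorm x)).
move=> iw iW ftc hd mh mdh hC kC.
(* Cutoff: X_k truncates s - eps_k at 0, and h is multiplied by the square of y_k = X_k / s. The
   square makes the truncation differentiable. *)
pose s (r : R) := r * (1 - r).
pose eps (k : nat) : R := k.+1%:R^-1.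
have eps0 k : 0 < eps k by rewrite invr_gt0.
pose X k r := Num.max 0 (s r - eps k).
have X0 k r : 0 <= X k r by rewrite le_max lexx.
pose hk k r := X k r ^+ 2 * (h r / s r ^+ 2).
pose dhk k r := 2 * X k r * (1 - 2 * r) * (h r / s r ^+ 2) +
 X k r ^+ 2 * (dh r / s r ^+ 2 - 2 * h r * (1 - 2 * r) / s r ^+ 3).
have s_gt0 r : 0 < r < 1 -> 0 < s r by move=> /andP[? ?]; rewrite mulr_gt0// subr_gt0.
have s_le0 r : ~~ (0 < r < 1) -> s r <= 0.
 rewrite negb_and -!leNgt /s => /orP[?|?]; nra.
have XE k r : ~~ (0 < r < 1) -> X k r = 0.
 by move=> /s_le0 sr; apply/max_idPl; have := eps0 k; lra.
have sd (r : R) : is_derive r 1 s (1 - 2 * r).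
 by apply: (@is_derive_quad _ _ _ _ 1) => t; rewrite /s mul1r ler_norml; apply/andP; split; nra.
have Xd k (r : R) : is_derive r 1 (fun r => X k r ^+ 2) (2 * X k r * (1 - 2 * r)).
 have d1 : is_derive r 1 (fun r => s r - eps k) (1 - 2 * r).
 by apply: (is_derive_eq (is_deriveB (sd r) (is_derive_cst (eps k) r 1))); rewrite subr0.
 exact: (is_derive1_comp (is_derive_pos_sqr _) d1).
have hkd k (r : R) : is_derive r 1 (hk k) (dhk k r).
 have [r01|r01] := boolP (0 < r < 1).
 have sr := s_gt0 r r01.
 have s2 : s r ^+ 2 != 0 by rewrite expf_neq0// gt_eqF.
 have d1 : is_derive r 1 (fun r => (s r ^+ 2)^-1) (- 2 * (1 - 2 * r) / s r ^+ 3).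
 have d2 := is_deriveX 2 (sd r); rewrite exprfctE in d2.
 apply: (is_derive_eq (@is_deriveV _ (fun r : R => s r ^+ 2) _ _ _ s2 d2)); rewrite /GRing.scale/=; field.
 by rewrite gt_eqF.
 apply: (is_derive_eq (is_deriveM (Xd k r) (is_deriveM (hd r r01) d1))).
 rewrite -[(h * _) r]/(h r * s r ^- 2) /GRing.scale/= /dhk; ring.
 have -> : dhk k r = 0 by rewrite /dhk XE//; ring.
 apply: (@is_derive_near0 _ _ _ (Num.min 1 (eps k / 8))) => [|t]; first by rewrite lt_min ltr01 divr_gt0.
 rewrite lt_min => /andP[]; rewrite !ltr_norml => /andP[t1 t2] /andP[t3 t4].
 rewrite /hk (_ : X k t = 0); first by rewrite expr0n mul0r.
 apply/max_idPl; have := s_le0 r r01; rewrite /s; move: r01; rewrite negb_and -!leNgt => /orP[?|?] ?; nra.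
have C0 : 0 <= C.
 have h01 : 0 < (2^-1 : R) < 1 by apply/andP; split; lra.
 by have := le_trans (normr_ge0 _) (hC _ h01); rewrite -[1 - 2^-1](_ : 2^-1 = _); [lra|field].
pose y k r := X k r / s r.
have y01 k r : 0 < r < 1 -> 0 <= y k r <= 1.
 move=> r01; have sr := s_gt0 r r01; rewrite divr_ge0 ?(ltW sr)//= ler_pdivrMr// mul1r.
 by rewrite ge_max (ltW sr)/=; have := eps0 k; lra.
have hkE k r : 0 < r < 1 -> hk k r = y k r ^+ 2 * h r.
 by move=> r01; have sr := s_gt0 r r01; rewrite /hk /y; field; rewrite gt_eqF.
(* The cutoff contributes r (y^2)' h = 2 (h / (1 - r)) (1 - 2 r) y (1 - y). It is bounded since h =
   O(1 - r), and tends to 0 since y tends to 1. *)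
have kE k r : 0 < r < 1 -> r * dhk k r + n%:R * hk k r =
 y k r ^+ 2 * (r * dh r + n%:R * h r) + 2 * (h r / (1 - r)) * (1 - 2 * r) * (y k r * (1 - y k r)).
 move=> r01; case/andP: (r01) => r0 r1; rewrite /hk /dhk /y /s; field.
 by rewrite (gt_eqF r0)/= subr_eq0 eq_sym lt_eqF.
have hCr r : 0 < r < 1 -> `|h r / (1 - r)| <= C.
 move=> r01; case/andP: (r01) => r0 r1; have r1' : 0 < 1 - r by rewrite subr_gt0.
 by rewrite normrM normfV (gtr0_norm r1') ler_pdivrMr// hC.
have bk k r : 0 < r < 1 -> `|hk k r| <= C.
 move=> r01; case/andP: (r01) => r0 r1; rewrite hkE// normrM normrX.
 have /andP[y0 y1] := y01 k r r01; rewrite (ger0_norm y0).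
 apply: (@le_trans _ _ (1 * `|h r|)); first by rewrite ler_wpM2r// exprn_ile1.
 by rewrite mul1r (le_trans (hC r r01))//; nra.
have bd k r : 0 < r < 1 -> `|r * dhk k r + n%:R * hk k r| <= 3 * C.
 move=> r01; case/andP: (r01) => r0 r1; rewrite kE//.
 have /andP[y0 y1] := y01 k r r01.
 apply: (le_trans (ler_normD _ _)).
 have -> : 3 * C = 1 * C + 2 * C * 1 * 1 by ring.
 apply: lerD.
 rewrite normrM ler_pM// ?kC// normrX (ger0_norm y0) exprn_ile1//.
 rewrite normrM ler_pM//.
 rewrite normrM ler_pM//; last by rewrite ler_norml; apply/andP; split; lra.
 by rewrite normrM ger0_norm// ler_wpM2l// hCr.
 by rewrite ger0_norm; nra.
have cy r : 0 < r < 1 -> y k r @[k --> \oo] --> (1 : R).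
 move=> r01; have sr := s_gt0 r r01.
 apply: (@squeeze_cvgr _ _ _ _ (fun k => 1 - eps k / s r) (cst 1)).
 - apply: nearW => k; have /andP[_ ->] := y01 k r r01; rewrite andbT.
 rewrite /y ler_pdivlMr// mulrBl mul1r divfK ?gt_eqF//.
 by rewrite le_max lexx orbT.
 - rewrite -[X in _ --> X]subr0 -[X in _ - X](mul0r (s r)^-1).
 by apply: cvgB; [exact: cvg_cst|apply: cvgMl; exact: cvg_harmonic].
 - exact: cvg_cst.
have c1 r : 0 < r < 1 -> hk k r @[k --> \oo] --> h r.
 move=> r01; have -> : (fun k => hk k r) = (fun k => y k r * y k r * h r).
 by apply/funext => k; rewrite hkE// expr2.
 rewrite [X in _ --> X](_ : _ = 1 * 1 * h r); last by ring.
 apply: cvgM; last exact: cvg_cst.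
 by apply: cvgM; exact: cy.
have c2 r : 0 < r < 1 -> r * dhk k r + n%:R * hk k r @[k --> \oo] --> r * dh r + n%:R * h r.
 move=> r01; set A := r * dh r + _; set B := 2 * (h r / (1 - r)) * (1 - 2 * r).
 have -> : (fun k => r * dhk k r + n%:R * hk k r) =
 (fun k => y k r * y k r * A + B * (y k r * (1 - y k r))).
 by apply/funext => k; rewrite kE// expr2.
 rewrite [X in _ --> X](_ : _ = 1 * 1 * A + B * (1 * (1 - 1))); last by ring.
 apply: cvgD; apply: cvgM; do ?exact: cvg_cst.
 by apply: cvgM; exact: cy.
 apply: cvgM; first exact: cy.
 by apply: cvgB; [exact: cvg_cst|exact: cy].
have ms : borel R s.
 by apply: continuous_measurable_fun => r; exact: derive_continuous (sd r).
have mX k : borel R (X k).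
 by apply: measurable_maxr => //; exact: measurable_funB.
have mid : borel R id by mfun.
have mdhk k : borel R (dhk k).
 have m1 : measurable_fun setT (fun r : measurableTypeR R => 1 - 2 * r : R).
 mfun.
 have m2 : measurable_fun setT (fun r : measurableTypeR R => (s r ^+ 2)^-1 : R).
 by apply: measurable_funVr; exact: measurable_funX.
 have m3 : measurable_fun setT (fun r : measurableTypeR R => (s r ^+ 3)^-1 : R).
 by apply: measurable_funVr; exact: measurable_funX.
 apply: measurable_funD; apply: mfunM.
 - mfun.
 - mfun.
 - mfun.
 - mfun.
(* Divide the bound on r dhk + n hk by r: where the cutoff is non-zero, r exceeds eps_k. The bound
   may depend on k. *)
have bdh k r : `|dhk k r| <= (3 * C + n%:R * C) / eps k + C.
 have Ce : 0 <= (3 * C + n%:R * C) / eps k.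
 by rewrite divr_ge0 ?(ltW (eps0 k))// addr_ge0// mulr_ge0.
 have [r01|/XE Xr] := boolP (0 < r < 1); last first.
 by rewrite /dhk Xr mulr0 !mul0r expr0n/= mul0r addr0 normr0 addr_ge0.
 case/andP: (r01) => r0 r1.
 have [se|se] := leP (s r - eps k) 0.
 have Xr : X k r = 0 by exact/max_idPl.
 by rewrite /dhk Xr mulr0 !mul0r expr0n/= mul0r addr0 normr0 addr_ge0.
 have re : eps k <= r by move: se; rewrite /s; nra.
 have e0 := eps0 k.
 apply: (@le_trans _ _ ((3 * C + n%:R * C) / eps k)); last by rewrite lerDl.
 rewrite ler_pdivlMr// (@le_trans _ _ (`|dhk k r| * r))// ?ler_wpM2l//.
 have -> : `|dhk k r| * r = `|(r * dhk k r + n%:R * hk k r) - n%:R * hk k r|.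
 by rewrite addrK normrM (gtr0_norm r0) mulrC.
 apply: (le_trans (ler_normB _ _)); apply: lerD; first exact: bd.
 by rewrite normrM ger0_norm// ler_wpM2l// bk.
have lim k : \int[leb]_(x in Omega) (w x * (enorm x * dhk k (enorm x) + n%:R * hk k (enorm x))) =
 - \int[leb]_(x in Omega) (dotp (W x) x * hk k (enorm x)).
 apply: (radial_ibp_cpt (M := (3 * C + n%:R * C) / eps k + C) (rho := 1 - eps k)) => //.
 - by have := eps0 k; lra.
 - move=> t; have Ce : 0 <= (3 * C + n%:R * C) / eps k.
 by rewrite divr_ge0 ?(ltW (eps0 k))// addr_ge0// mulr_ge0.
 have [/(bk k)/le_trans->//|/XE Xr] := boolP (0 < t < 1); first by rewrite lerDr.
 by rewrite /hk Xr expr0n mul0r normr0 addr_ge0.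
 - move=> t te; have [t01|/XE Xr] := boolP (0 < t < 1); last by rewrite /hk Xr expr0n mul0r.
 rewrite /hk (_ : X k t = 0) ?expr0n ?mul0r//; apply/max_idPl; rewrite /s.
 by case/andP: t01 => ? ?; nra.
have mw := integrable_mfun iw.
have men := @measurable_enorm R n.
have mhk k : borel R (hk k).
 by apply: continuous_measurable_fun => r; exact: derive_continuous (hkd k r).
have iWd : int_ball R n (fun x => dotp (W x) x).
 apply: intg_bigsum => // i; apply: (integrableMb (M := 1)) => //.
 mfun.
 by move=> x Ox; rewrite (le_trans (coord_le_enorm x i))// ltW.
have mWd := integrable_mfun iWd.
have L1 : (fun k => \int[leb]_(x in Omega) (w x * (enorm x * dhk k (enorm x) + n%:R * hk k (enorm x)))) @ \oo -->
 \int[leb]_(x in Omega) (w x * (enorm x * dh (enorm x) + n%:R * h (enorm x))).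
 apply: (@Rdominated_cvg _ _ _ _ _ _ _ (fun x => (3 * C) * `|w x|)) => //.
 - move=> k; apply: mfunM => //; apply: mfunTS; apply: measurable_funD.
 by apply: mfunM => //; exact: (mcompT (mdhk k) men).
 by apply: mfunM => //; exact: (mcompT (mhk k) men).
 - mfun.
 - apply: filterS (ae_neq0 R n_gt0) => x x0 Ox; apply: cvgM; first exact: cvg_cst.
 by apply: c2; rewrite enorm_gt0 x0.
 - by apply: intgZ => //; exact: integrable_norm.
 - apply: filterS (ae_neq0 R n_gt0) => x x0 k Ox; rewrite normrM mulrC ler_wpM2r// bd//.
 by rewrite enorm_gt0 x0.
have L2 : (fun k => - \int[leb]_(x in Omega) (dotp (W x) x * hk k (enorm x))) @ \oo -->
 - \int[leb]_(x in Omega) (dotp (W x) x * h (enorm x)).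
 apply: cvgN; apply: (@Rdominated_cvg _ _ _ _ _ _ _ (fun x => C * `|dotp (W x) x|)) => //.
 - by move=> k; apply: mfunM => //; apply: mfunTS; exact: (mcompT (mhk k) men).
 - mfun.
 - apply: filterS (ae_neq0 R n_gt0) => x x0 Ox; apply: cvgM; first exact: cvg_cst.
 by apply: c1; rewrite enorm_gt0 x0.
 - by apply: intgZ => //; exact: integrable_norm.
 - apply: filterS (ae_neq0 R n_gt0) => x x0 k Ox; rewrite normrM mulrC ler_wpM2r// bk//.
 by rewrite enorm_gt0 x0.
apply: cvg_unique L1 _; first exact: norm_hausdorff.
by rewrite (_ : (fun k => _) = (fun k => - \int[leb]_(x in Omega) (dotp (W x) x * hk k (enorm x))))//;
 apply/funext => k; rewrite lim.
Qed.

End radial_ibp.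

(** * Weak derivatives on the interval (0, 1) *)

Section weak_derivative1.
Context (R : realType).
Local Notation mu1 := (@lebesgue_measure R).

Definition loc_int (k : R -> R) := forall a b : R, 0 < a -> b < 1 ->
 mu1.-integrable `[a, b] (EFin \o k).

Lemma Rint_itv_supp (D K : set R) (f : R -> R) : K `<=` D ->
 (forall x, D x -> ~ K x -> f x = 0) ->
 \int[mu1]_(x in D) f x = \int[mu1]_(x in K) f x.
move=> KD f0; rewrite -[in RHS](setIidr KD) Rintegral_mkcondr.
apply: eq_Rintegral => x /set_mem Dx; rewrite patchE; case: ifPn => //.
by rewrite notin_setE => /f0 ->.
Qed.

Lemma segment_bounded (y : R -> R) (a b : R) : continuous y ->
 exists M, forall x, x \in `[a, b] -> `|y x| <= M.
move=> cy; have [ab|ba] := leP a b; last first.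
 by exists 0 => x; rewrite in_itv/= => /andP[ax xb]; have := lt_le_trans ba (le_trans ax xb); rewrite ltxx.
have [|c _ h] := @EVT_max R (fun x => `|y x|) a b ab.
 by apply: continuous_subspaceT => x; apply: cvg_norm; exact: cy.
by exists `|y c|.
Qed.

Lemma loc_int_mul (h y : R -> R) (a b : R) : loc_int h -> 0 < a -> b < 1 -> continuous y ->
 mu1.-integrable `[a, b] (EFin \o (fun x => h x * y x)).
move=> hi a0 b1 cy; have [M yM] := segment_bounded a b cy.
apply: (@integrableMb _ _ _ _ _ _ _ M) => //; first exact: hi.
by apply: mfunTS; exact: continuous_measurable_fun.
Qed.

Lemma Rintegral_split (s m t : R) (f : R -> R) : s <= m -> m <= t ->
 mu1.-integrable `[s, t] (EFin \o f) ->
 \int[mu1]_(x in `[s, t]) f x = \int[mu1]_(x in `[s, m]) f x + \int[mu1]_(x in `[m, t]) f x.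
move=> sm mt fi.
have fi2 : mu1.-integrable `]m, t] (EFin \o f).
 apply: integrableS fi => //; apply: subset_itv; rewrite bnd_simp//.
rewrite -[X in _ = _ + X]Rintegral_itv_obnd_cbnd//.
by rewrite -(Rintegral_itvB fi) ?bnd_simp// addrC subrK.
Qed.

Lemma cvg_integral_bump (k : R -> R) (a b : R) : mu1.-integrable `[a, b] (EFin \o k) ->
 (fun m : nat => \int[mu1]_(x in `[a, b]) (k x * bump (m.+1%:R^-1) a b x)) @ \oo
 --> \int[mu1]_(x in `]a, b[) k x.
move=> ki; have mk := integrable_mfun ki.
have sub : (`]a, b[%classic : set R) `<=` `[a, b]%classic by exact: subset_itv_oo_cc.
rewrite -(@setIidr _ `[a, b]%classic `]a, b[%classic)// Rintegral_mkcondr.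
apply: (@Rdominated_cvg _ (measurableTypeR R) R mu1 `[a, b]%classic _ _ (fun x => `|k x|)) => //.
- move=> m; apply: mfunM => //; apply: mfunTS.
 by apply: continuous_measurable_fun; exact: bump_continuous.
- by apply/measurable_restrict => //; apply: measurable_funS mk.
- apply: aeW => x _ /=; rewrite patchE.
 rewrite (_ : (if _ then _ else _) = k x * \1_(`]a, b[%classic : set R) x); last first.
 by rewrite indicE; case: ifP => _; rewrite ?mulr1 ?mulr0.
 by apply: cvgM; [exact: cvg_cst|exact: cvg_bump].
- exact: integrable_norm.
- apply: aeW => x m _ /=; rewrite normrM ler_piMr// ger0_norm ?bump_ge0//.
 exact: bump_le1.
Qed.

Lemma ae_eq0_bump (k : R -> R) : loc_int k ->
 (forall eps a b, 0 < eps -> 0 < a -> a < b -> b < 1 ->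
 \int[mu1]_(x in `[a, b]) (k x * bump eps a b x) = 0) ->
 {ae mu1, forall r, 0 < r < 1 -> k r = 0}.
move=> ki k0.
have k1 a b : 0 < a -> b < 1 -> (\int[mu1]_(x in `]a, b[) (k x)%:E = 0)%E.
 move=> a0 b1; have [ab|ba] := ltP a b; last first.
 by rewrite set_itv_ge ?integral_set0// bnd_simp -leNgt.
 have ki2 : mu1.-integrable `]a, b[ (EFin \o k).
 by apply: integrableS (ki a b a0 b1) => //; exact: subset_itv_oo_cc.
 have : \int[mu1]_(x in `]a, b[) k x = 0.
 apply: cvg_unique (cvg_integral_bump (ki a b a0 b1)) _; first exact: norm_hausdorff.
 rewrite (_ : (fun m : nat => _) = fun=> 0); first exact: cvg_cst.
 by apply/funext => m; rewrite k0.
 by rewrite /Rintegral => h; rewrite -[LHS]fineK ?h//; exact: integrable_fin_num.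
(* Integrability is only local in (0, 1), so the pi-system argument runs on the intervals from a_m
   to 1 - a_m, which exhaust it. *)
pose a (m : nat) : R := m.+3%:R^-1.
have H m : {ae mu1, forall r, `](a m), (1 - a m)[%classic r -> k r = 0}.
 have a0 : 0 < a m by rewrite invr_gt0.
 have b1 : 1 - a m < 1 by lra.
 apply: (@ae_eq0_pi_system _ _ _ mu1 (@RGenOpens.G R)) => //.
 - exact: RGenOpens.measurableE.
 - move=> _ _ [x [y ->]] [z [t ->]]; exists (Num.max x z), (Num.min y t).
 apply/seteqP; split => u; rewrite /= !in_itv/= gt_max lt_min.
 by move=> [/andP[-> ->] /andP[-> ->]].
 by move=> /andP[/andP[-> ->] /andP[-> ->]].
 - by apply: integrableS (ki _ _ a0 b1) => //; exact: subset_itv_oo_cc.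
 - exact: k1.
 - move=> _ [x [y ->]].
 have -> : `](a m), (1 - a m)[%classic `&` `]x, y[%classic =
 `](Num.max (a m) x), (Num.min (1 - a m) y)[%classic :> set R.
 apply/seteqP; split => u; rewrite /= !in_itv/= gt_max lt_min.
 by move=> [/andP[-> ->] /andP[-> ->]].
 by move=> /andP[/andP[-> ->] /andP[-> ->]].
 by apply: k1; [rewrite lt_max a0|rewrite gt_min b1].
apply: ae_imply (ae_foralln H) => r kr /andP[r0 r1].
pose m := Num.truncn ((Num.min r (1 - r))^-1).
have mn : 0 < Num.min r (1 - r) by rewrite lt_min r0 subr_gt0.
apply: (kr m); rewrite /= in_itv/=.
have : a m < Num.min r (1 - r).
 rewrite /a -[ltRHS]invrK ltf_pV2 ?posrE ?invr_gt0//.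
 by apply: (lt_trans (truncnS_gt _)); rewrite ltr_nat.
rewrite lt_min => /andP[-> ?]; lra.
Qed.

(** An oriented integral based at 1/2, a point of the interval where g is locally integrable; g need
    not be integrable near 0 or 1. *)
Definition prim (g : R -> R) (t : R) : R :=
 if 2^-1 <= t then \int[mu1]_(x in `[2^-1, t]) g x else - \int[mu1]_(x in `[t, 2^-1]) g x.

Lemma prim_sub (g : R -> R) (s t : R) : loc_int g -> 0 < s -> s <= t -> t < 1 ->
 prim g t - prim g s = \int[mu1]_(x in `[s, t]) g x.
move=> gi s0 st t1; rewrite /prim.
have h0 : 0 < 2^-1 :> R by rewrite invr_gt0.
have h1 : 2^-1 < 1 :> R by rewrite invf_lt1// ltr1n.
have [hs|hs] := leP 2^-1 s; have [ht|ht] := leP 2^-1 t.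
- by rewrite (Rintegral_split hs st (gi _ _ h0 t1)); ring.
- by have := lt_le_trans ht (le_trans hs st); rewrite ltxx.
- by rewrite (Rintegral_split (ltW hs) ht (gi _ _ s0 t1)); ring.
- by rewrite (Rintegral_split st (ltW ht) (gi _ _ s0 h1)); ring.
Qed.

Definition test1 (z dz : R -> R) (a b : R) := [/\ 0 < a, a <= b, b < 1 &
 [/\ forall t : R, is_derive t 1 z (dz t), continuous dz &
 forall t, t \notin `[a, b] -> z t = 0 /\ dz t = 0]].

(** On a compact interval the primitive is an integral from 0 of a truncated function, the form that
    [primitive_mul] requires. *)
Lemma prim_local (g : R -> R) (a b t : R) : loc_int g -> 0 < a -> b < 1 -> t \in `[a, b] ->
 prim g t = prim g a + \int[mu1]_(x in `[0, t]) (g \_ `[a, b]) x.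
move=> gi a0 b1; rewrite in_itv/= => /andP[at_ tb].
have -> : \int[mu1]_(x in `[0, t]) (g \_ `[a, b]) x = \int[mu1]_(x in `[a, t]) g x.
 rewrite (@Rint_itv_supp _ `[a, t]%classic).
 - apply: eq_Rintegral => x; rewrite inE/= in_itv/= => /andP[ax xt].
 by rewrite patchE mem_set//= in_itv/= ax (le_trans xt tb).
 - by move=> x; rewrite /= !in_itv/= => /andP[ax ->]; rewrite (le_trans (ltW a0)).
 - move=> x; rewrite /= !in_itv/= => /andP[x0 xt] /negP; rewrite xt andbT -ltNge => xa.
 by rewrite patchE memNset//= in_itv/= leNgt xa.
by rewrite -(prim_sub gi a0 at_ (le_lt_trans tb b1)); ring.
Qed.

Lemma loc_int_restrict (g : R -> R) (a b : R) : loc_int g -> 0 < a -> b < 1 ->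
 mu1.-integrable setT (EFin \o (g \_ `[a, b])).
by move=> gi a0 b1; apply: (intg_restrict mu1 g _).1 => //; exact: gi. Qed.

Lemma loc_int_prim (g : R -> R) : loc_int g -> loc_int (prim g).
move=> gi a b a0 b1.
pose P t := prim g a + \int[mu1]_(x in `[0, t]) (g \_ `[a, b]) x.
have gT := loc_int_restrict gi a0 b1.
have g01 : mu1.-integrable `[0, 1] (EFin \o (g \_ `[a, b])) by apply: integrableS gT.
have mg := integrable_mfun g01.
have sub : (`[a, b]%classic : set R) `<=` `[0, 1]%classic.
 by apply: subset_itv; rewrite bnd_simp ltW.
suff : mu1.-integrable `[a, b] (EFin \o P).
 by apply: eq_integrable => // t; rewrite inE/= => tab; rewrite /= /P (prim_local gi a0 b1 tab).
have mP : measurable_fun (`[a, b]%classic : set (measurableTypeR R)) P.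
 apply: measurable_funD => //; apply: measurable_funS (mfun_primitive0 mg) => //.
apply: (intg_bounded (M := `|prim g a| + \int[mu1]_(x in `[0, 1]) `|(g \_ `[a, b]) x|)) => //.
 by have := @lebesgue_measure_itv R `[a, b] => /= ->; case: ifP => _; rewrite ?ltry.
move=> t /sub; rewrite /= in_itv/= => /andP[t0 t1]; rewrite /P.
have sub2 : (`[0, t]%classic : set R) `<=` `[0, 1]%classic.
 by apply: subset_itv; rewrite bnd_simp.
apply: (le_trans (ler_normD _ _)); rewrite lerD2l.
apply: (le_trans (le_normr_Rintegral _ _)) => //; first exact: integrableS g01.
by apply: Rintegral_subset => //; exact: integrable_norm.
Qed.

Lemma test1_supp (z dz : R -> R) (a b : R) (k : R -> R) : test1 z dz a b ->
 \int[mu1]_(x in `[0, 1]) ((k \_ `[a, b]) x * z x) = \int[mu1]_(x in `[a, b]) (k x * z x) /\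
 \int[mu1]_(x in `[0, 1]) ((k \_ `[a, b]) x * dz x) = \int[mu1]_(x in `[a, b]) (k x * dz x).
move=> [a0 ab b1 [zd cdz z0]].
have sub : (`[a, b]%classic : set R) `<=` `[0, 1]%classic.
 by apply: subset_itv; rewrite bnd_simp ltW.
have S (y : R -> R) : \int[mu1]_(x in `[0, 1]) ((k \_ `[a, b]) x * y x) = \int[mu1]_(x in `[a, b]) (k x * y x).
 rewrite (@Rint_itv_supp _ `[a, b]%classic)//.
 by apply: eq_Rintegral => x xab; rewrite patchE xab.
 by move=> x _ nx; rewrite patchE memNset// mul0r.
by split.
Qed.

(** [primitive_mul] for the truncated g and for z', whose primitive from 0 is z and vanishes at
    1. *)
Lemma prim_ibp (g z dz : R -> R) (a b : R) : loc_int g -> test1 z dz a b ->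
 \int[mu1]_(x in `[a, b]) (prim g x * dz x) = - \int[mu1]_(x in `[a, b]) (g x * z x).
move=> gi tz; have [a0 ab b1 [zd cdz z0]] := tz.
have gT := loc_int_restrict gi a0 b1.
have g01 : mu1.-integrable `[0, 1] (EFin \o (g \_ `[a, b])) by apply: integrableS gT.
have mg := integrable_mfun g01.
have d01 : mu1.-integrable `[0, 1] (EFin \o dz) by exact: intg_segment.
have zE t : 0 <= t -> \int[mu1]_(x in `[0, t]) dz x = z t.
 move=> t0; rewrite (FTC2_everywhere t0 zd cdz).
 have [|-> _] := z0 0; last by rewrite subr0.
 by rewrite in_itv/= leNgt a0.
have := primitive_mul (@ler01 R) g01 d01.
have z1 : z 1 = 0 by have [] // := z0 1; rewrite in_itv/= [1 <= b]leNgt b1 andbF.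
rewrite zE// z1 mulr0.
have -> : \int[mu1]_(t in `[0, 1]) (\int[mu1]_(y in `[0, t]) dz y * (g \_ `[a, b]) t) =
 \int[mu1]_(x in `[a, b]) (g x * z x).
 rewrite -(test1_supp g tz).1; apply: eq_Rintegral => t; rewrite inE/= in_itv/= => /andP[t0 _].
 by rewrite zE// mulrC.
have sub : (`[a, b]%classic : set R) `<=` `[0, 1]%classic.
 by apply: subset_itv; rewrite bnd_simp ltW.
rewrite (@Rint_itv_supp _ `[a, b]%classic)//; last first.
 by move=> x _ nx; have [|_ ->] := z0 x; rewrite ?mulr0//; exact/negP.
move=> /eqP; rewrite eq_sym addr_eq0 => /eqP <-.
have d0 : \int[mu1]_(x in `[a, b]) dz x = 0.
 rewrite -(@Rint_itv_supp `[0, 1]%classic)// ?zE// => x _ nx.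
 by have [] // := z0 x; exact/negP.
have dab : mu1.-integrable `[a, b] (EFin \o dz) by exact: intg_segment.
have iP : mu1.-integrable `[a, b] (EFin \o (fun t => \int[mu1]_(y in `[0, t]) (g \_ `[a, b]) y * dz t)).
 suff : mu1.-integrable `[a, b] (EFin \o (fun t => prim g t * dz t - prim g a * dz t)).
 apply: eq_integrable => // t; rewrite inE/= => tab.
 by rewrite /= (prim_local gi a0 b1 tab); congr EFin; ring.
 apply: intgB => //; last exact: intgZ.
 by apply: loc_int_mul => //; exact: loc_int_prim.
transitivity (\int[mu1]_(x in `[a, b]) (prim g a * dz x + \int[mu1]_(y in `[0, x]) (g \_ `[a, b]) y * dz x)).
 by apply: eq_Rintegral => x; rewrite inE/= => xab; rewrite (prim_local gi a0 b1 xab) mulrDl.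
by rewrite RintegralD ?RintegralZl ?d0 ?mulr0 ?add0r//; exact: intgZ.
Qed.

Lemma bump_gt0 (eps a b : R) : 0 < eps -> a < b -> 0 < \int[mu1]_x bump eps a b x.
move=> e0 ab; pose d := (b - a) / 4; have d0 : 0 < d by rewrite divr_gt0// subr_gt0.
pose m := expR (- (eps / d)).
have m0 : 0 < m by exact: expR_gt0.
have bi := @bump_integrable R eps a b e0.
have D : b = a + 4 * d by rewrite /d; field.
apply: (@lt_le_trans _ _ (\int[mu1]_(x in `[a + d, a + 3 * d]) (m * m))).
 rewrite Rintegral_cst//=.
 have := @lebesgue_measure_itv R `[a + d, a + 3 * d] => /= ->.
 rewrite lte_fin ifT; last by lra.
 by rewrite -EFinB/= !mulr_gt0//; lra.
apply: (@le_trans _ _ (\int[mu1]_(x in `[a + d, a + 3 * d]) bump eps a b x)).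
 apply: le_Rintegral => //; first exact: intg_segment (fun=> cvg_cst _).
 by apply: integrableS bi.
 move=> x; rewrite /= in_itv/= => /andP[x1 x2].
 have fl t : d <= t -> m <= flat eps 0 t.
 move=> dt; have t0 := lt_le_trans d0 dt.
 by rewrite /flat t0 expr0 mul1r ler_expR lerN2 ler_pM2l// lef_pV2.
 by rewrite /bump ler_pM// ?(ltW m0)//; apply: fl; lra.
apply: Rintegral_subset => // x _; exact: bump_ge0.
Qed.

Lemma primitive_bump (eps a b t : R) : 0 < eps ->
 (t <= a -> primitive (bump eps a b) t = 0) /\
 (b <= t -> primitive (bump eps a b) t = \int[mu1]_x bump eps a b x).
move=> e0; split => h; rewrite /primitive.
 rewrite (@eq_Rintegral _ _ _ _ _ (cst 0)) ?Rintegral_cst ?mul0r// => x; rewrite inE/= in_itv/= => xt.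
 by rewrite /= bump_eq0// in_itv/= ltNge (le_trans xt h).
apply/esym; apply: Rint_itv_supp => // x _; rewrite /= in_itv/= => /negP; rewrite -ltNge => tx.
by rewrite bump_eq0// in_itv/= [x < b]ltNge (ltW (le_lt_trans h tx)) andbF.
Qed.

(** The difference k of f and a primitive of g has weak derivative zero. Testing it with primitives
    of zero-mean combinations of two bumps shows that k minus a constant is orthogonal to every
    bump. *)
Lemma weak_derivative1 (f g : R -> R) : loc_int f -> loc_int g ->
 (forall z dz a b, test1 z dz a b ->
 \int[mu1]_(x in `[a, b]) (f x * dz x) = - \int[mu1]_(x in `[a, b]) (g x * z x)) ->
 exists c, {ae mu1, forall r, 0 < r < 1 -> f r = c + prim g r}.
move=> fi gi fg; pose k r := f r - prim g r.
have ki : loc_int k by move=> a b a0 b1; apply: intgB => //; [exact: fi|exact: loc_int_prim].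
have k0 z dz a b : test1 z dz a b -> \int[mu1]_(x in `[a, b]) (k x * dz x) = 0.
 move=> tz; have [a0 ab b1 [zd cdz z0]] := tz.
 under eq_Rintegral do rewrite mulrBl.
 rewrite RintegralB//; last 2 first.
 - exact: loc_int_mul.
 - by apply: loc_int_mul => //; exact: loc_int_prim.
 by rewrite (fg _ _ _ _ tz) (prim_ibp gi tz) subrr.
(* A fixed reference bump; the constant c is the mean of k with respect to it. *)
pose be := bump (1 : R) 4^-1 (3 / 4).
pose B := \int[mu1]_x be x.
have B0 : 0 < B by apply: bump_gt0 => //; lra.
pose c := (\int[mu1]_(x in `[4^-1, 3 / 4]) (k x * be x)) / B.
exists c.
suff : {ae mu1, forall r, 0 < r < 1 -> k r - c = 0}.
 by apply: ae_imply => r kr /kr; rewrite /k; lra.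
have ci : loc_int (fun r => k r - c).
 move=> a b a0 b1; apply: intgB => //; first exact: ki.
 exact: intg_segment (fun=> cvg_cst _).
apply: ae_eq0_bump => // eps a b e0 a0 ab b1.
pose I := \int[mu1]_x bump eps a b x.
(* The weights B and I are the masses of the two bumps, exchanged, so dz has integral zero and z has
   compact support in (0, 1). *)
pose z t := B * primitive (bump eps a b) t - I * primitive be t.
pose dz t := B * bump eps a b t - I * be t.
pose m := Num.min a 4^-1; pose M := Num.max b (3 / 4).
have [ma m4] : m <= a /\ m <= 4^-1 by rewrite /m !ge_min !lexx orbT.
have [bM M4] : b <= M /\ 3 / 4 <= M by rewrite /M !le_max !lexx orbT.
have m0 : 0 < m by rewrite /m lt_min a0 invr_gt0/=.
have M1 : M < 1 by rewrite /M gt_max b1/=; lra.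
have cb := @bump_continuous R eps e0 a b.
have cbe := @bump_continuous R 1 ltr01 4^-1 (3 / 4).
have cdz : continuous dz by move=> t; apply: cvgB; apply: cvgM; do ?exact: cvg_cst; [exact: cb|exact: cbe].
have tz : test1 z dz m M.
 split => //; first by lra.
 split => //.
 move=> t; have d1 := is_derive_primitive t (bump_integrable a b e0) cb.
 have d2 := is_derive_primitive t (bump_integrable 4^-1 (3 / 4) ltr01) cbe.
 by apply: (is_derive_eq (is_deriveB (is_deriveZ B d1) (is_deriveZ I d2))).
 move=> t; rewrite in_itv/= negb_and -!ltNge => /orP[tm|Mt].
 rewrite /z /dz (primitive_bump a b t e0).1; last lra.
 rewrite (primitive_bump _ _ t ltr01).1; last lra.
 have -> : bump eps a b t = 0 by apply: bump_eq0; rewrite in_itv/=; apply/negP => /andP[]; lra.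
 have -> : be t = 0 by apply: bump_eq0; rewrite in_itv/=; apply/negP => /andP[]; lra.
 by rewrite 2!mulr0 subrr.
 rewrite /z /dz (primitive_bump a b t e0).2; last lra.
 rewrite (primitive_bump _ _ t ltr01).2; last lra.
 have -> : bump eps a b t = 0 by apply: bump_eq0; rewrite in_itv/=; apply/negP => /andP[]; lra.
 have -> : be t = 0 by apply: bump_eq0; rewrite in_itv/=; apply/negP => /andP[]; lra.
 by rewrite 2!mulr0 subrr -/I -/be -/B mulrC subrr.
have := k0 _ _ _ _ tz; rewrite /dz.
under eq_Rintegral do rewrite mulrBr [k _ * (B * _)]mulrCA [k _ * (I * _)]mulrCA.
have i1 : mu1.-integrable `[m, M] (EFin \o (fun x => k x * bump eps a b x)) by exact: loc_int_mul.
have i2 : mu1.-integrable `[m, M] (EFin \o (fun x => k x * be x)) by exact: loc_int_mul.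
rewrite RintegralB//; [|exact: intgZ..].
rewrite !RintegralZl//.
rewrite (@Rint_itv_supp _ `[a, b]%classic); last 2 first.
- by apply: subset_itv; rewrite bnd_simp.
- by move=> x _ /negP h; rewrite bump_eq0 ?mulr0//; apply: contra h; exact: subset_itv_oo_cc.
rewrite [X in _ - _ * X](@Rint_itv_supp _ `[4^-1, 3 / 4]%classic); last 2 first.
- by apply: subset_itv; rewrite bnd_simp.
- by move=> x _ /negP h; rewrite /be bump_eq0 ?mulr0//; apply: contra h; exact: subset_itv_oo_cc.
move=> E.
under eq_Rintegral do rewrite mulrBl.
rewrite RintegralB//; last 2 first.
- exact: loc_int_mul.
- by apply: intgZ => //; exact: intg_segment.
rewrite RintegralZl//; last exact: intg_segment.
have -> : \int[mu1]_(x in `[a, b]) bump eps a b x = I.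
 apply/esym; apply: Rint_itv_supp => // x _ /negP h; rewrite bump_eq0//.
 by apply: contra h; exact: subset_itv_oo_cc.
move: E; rewrite /c; set u := \int[mu1]_(x in `[a, b]) _; set w := \int[mu1]_(x in `[4^-1, 3/4]) _ => E.
have : B * (u - w / B * I) = 0 by rewrite mulrBr mulrCA mulrA divfK ?gt_eqF// -E; ring.
by move=> /eqP; rewrite mulf_eq0 gt_eqF//= => /eqP.
Qed.

End weak_derivative1.

(** * Radial Sobolev functions *)

Section radial_function.
Context (R : realType) (n : nat).
Hypothesis n_gt0 : (0 < n)%N.
Local Notation leb := (lebesgue_rV R n).
Local Notation mu1 := (@lebesgue_measure R).
Local Notation Omega := (@unit_ball R n).
Let mO := @measurable_unit_ball R n.

Lemma ae_itv_exists (P : R -> Prop) (a b : R) : 0 <= a -> a < b -> b <= 1 ->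
 {ae mu1, forall r, 0 < r < 1 -> P r} -> exists2 r, a < r < b & P r.
move=> a0 ab b1 H; apply: contrapT => h.
have : mu1.-negligible (`]a, b[%classic : set R).
 apply: negligibleS H => r; rewrite /= in_itv/= => /andP[ar rb] k; apply: h; exists r.
 by rewrite ar.
 by apply: k; rewrite (le_lt_trans a0 ar) (lt_le_trans rb b1).
move=> /negligibleP; move=> /(_ (measurable_itv _)).
have := @lebesgue_measure_itv R `]a, b[ => /= ->; rewrite lte_fin ab -EFinB => -[].
by move=> /eqP; rewrite subr_eq0 gt_eqF.
Qed.

Lemma is_derive_line_at (f : 'rV[R]_n -> R) (x : 'rV[R]_n) (i : 'I_n) (t l : R) :
 is_derive (x + t *: 'e_i) 'e_i f l -> is_derive t 1 (fun s : R => f (x + s *: 'e_i)) l.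
move=> /is_derive_line d.
rewrite (_ : (fun s : R => _) = (fun h : R => f (h *: 'e_i + (x + t *: 'e_i))) \o (fun s : R => 1 * s + - t)).
 have := is_derive_affine 1 (- t) t => da.
 rewrite -[l]mulr1; apply: (is_derive1_comp _ da).
 by rewrite mul1r subrr.
apply/funext => s /=; congr f; rewrite mul1r scalerBl; apply/rowP => j; rewrite !mxE; ring.
Qed.

Lemma class_C_line_ftc (f : 'rV[R]_n -> R) (i : 'I_n) : class_C 1 f ->
 line_ftc f (fun x => 'D_'e_i f x) i.
move=> [_ /(_ i)[df cdf]] s s0; apply: aeW => x _ _.
have d (t : R) : is_derive t 1 (fun s : R => f (x + s *: 'e_i)) ('D_'e_i f (x + t *: 'e_i)).
 by apply: is_derive_line_at; apply: DeriveDef; [exact: df|].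
have c : continuous (fun t : R => 'D_'e_i f (x + t *: 'e_i)).
 move=> t; have [cd _] := cdf.
 apply: (@continuous_comp _ _ _ (fun t : R => x + t *: 'e_i) ('D_'e_i f)); last exact: cd.
 by apply: cvgD; [exact: cvg_cst|apply: cvgZr_tmp; exact: cvg_id].
by rewrite (FTC2_everywhere (ltW s0) d c) scale0r addr0.
Qed.

Lemma continuous_ball_bounded (f : 'rV[R]_n -> R) : continuous f ->
 exists M, forall x, Omega x -> `|f x| <= M.
move=> cf; pose K : set 'rV[R]_n := cbox (fun=> -1) (fun=> 1).
have cK : compact K by exact: compact_box.
have [|M [_ HM]] := @compact_bounded _ _ (f @` K).
 by apply: continuous_compact => //; exact: continuous_subspaceT.
exists (M + 1) => x Ox; apply: (HM (M + 1)); first by rewrite ltrDl.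
exists x => // i; rewrite in_itv/= -ler_norml (le_trans (coord_le_enorm x i))// ltW//.
Qed.

(** The sigma-algebra is generated by coordinates; open sets belong to it as countable unions of
    grid boxes. *)
Lemma measurable_open_rV (O : set 'rV[R]_n) : open O -> measurable O.
move=> oO.
pose lo (zm : {ffun 'I_n -> int} * nat) i : R := ((zm.1 i)%:~R - 1) / zm.2.+1%:R.
pose hi (zm : {ffun 'I_n -> int} * nat) i : R := ((zm.1 i)%:~R + 1) / zm.2.+1%:R.
pose B j := if unpickle j is Some zm then
 (if `[< cbox (lo zm) (hi zm) `<=` O >] then box (lo zm) (hi zm) else set0) else set0.
rewrite (_ : O = \bigcup_j B j).
 apply: bigcup_measurable => j _; rewrite /B; case: unpickle => [zm|//].
 by case: ifP => // _; exact: measurable_box.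
apply/seteqP; split => [x Ox|x [j _]]; last first.
 rewrite /B; case: unpickle => [zm|//]; case: ifPn => // /asboolP sub xb.
 by apply: sub; exact: box_cbox.
have /nbhs_ballP[e /= e0 eO] : nbhs x O by exact: open_nbhs_nbhs.
have [m me] : exists m : nat, 2 / e < m.+1%:R.
 by exists (Num.truncn (2 / e)); exact: truncnS_gt.
have m0 : 0 < m.+1%:R :> R by rewrite ltr0n.
pose zm : {ffun 'I_n -> int} * nat := ([ffun i => Num.floor (x ord0 i * m.+1%:R)], m).
have zx i : (zm.1 i)%:~R <= x ord0 i * m.+1%:R < (zm.1 i)%:~R + 1.
 by rewrite ffunE floor_le_tmp/= -intrD1 floorD1_gt.
exists (pickle zm) => //; rewrite /B pickleK ifT.
 by move=> i; rewrite in_itv/= /lo /hi/= ltr_pdivrMr// ltr_pdivlMr//; have := zx i; lra.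
apply/asboolP => y yB; apply: eO; split => // i j; rewrite (ord1 i).
move: (yB j) (zx j); rewrite in_itv/= /lo /hi/= ler_pdivrMr// ler_pdivlMr//.
move=> /andP[y1 y2] /andP[x1 x2].
rewrite -ball_normE/= -(ltr_pM2r m0) -[X in _ * X < _](gtr0_norm m0) -normrM.
rewrite mulrBl ltr_norml.
have : 2 < e * m.+1%:R by rewrite mulrC -ltr_pdivrMr.
by lra.
Qed.

Lemma measurable_continuous_rV (f : 'rV[R]_n -> R) : continuous f -> measurable_fun setT f.
move=> cf; apply: (measurability _ (RGenOpens.measurableE R)) => //.
move=> _ [_ [x [y ->]] <-]; rewrite setTI; apply: measurable_open_rV.
by move/continuousP: cf; apply; exact: itv_open.
Qed.

Lemma intg_ball (f : 'rV[R]_n -> R) : continuous f ->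
 int_ball R n f.
move=> cf; have [M fM] := continuous_ball_bounded cf.
apply: (intg_bounded (M := M)) => //; first exact: ball_lty.
by apply: mfunTS; exact: measurable_continuous_rV.
Qed.

Lemma normalize_le1 (x : 'rV[R]_n) (i : 'I_n) : `|normalize x ord0 i| <= 1.
rewrite (le_trans (coord_le_enorm _ i))// /normalize enormZ ger0_norm ?invr_ge0 ?sqrtr_ge0//.
by have [->|?] := eqVneq (enorm x) 0; rewrite ?mulr0// mulVf.
Qed.

Lemma smean_loc_int (w : 'rV[R]_n -> R) : int_ball R n w -> loc_int (smean w).
by move=> iw a b a0 b1; apply: integrableS (integrable_smeanT n_gt0 iw). Qed.

Lemma polar_test (w : 'rV[R]_n -> R) (y : R -> R) (a b : R) : 0 < a -> b < 1 ->
 int_ball R n w -> continuous y -> (forall t, t \notin `[a, b] -> y t = 0) ->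
 \int[leb]_(x in Omega) (w x * y (enorm x)) = \int[mu1]_(r in `[a, b]) (smean w r * y r).
move=> a0 b1 iw cy y0.
have my : borel R y by exact: continuous_measurable_fun.
have [M yM] := segment_bounded 0 1 cy.
rewrite polar_mul//.
 apply: Rint_itv_supp; first by apply: subset_itv; rewrite bnd_simp.
 by move=> x _ /negP xab; rewrite y0 ?mulr0.
apply: (integrableMb (M := M)) => //.
 mfun.
by move=> x Ox; apply: yM; rewrite in_itv/= sqrtr_ge0/= ltW.
Qed.

Lemma test1_bounded (z dz : R -> R) (a b : R) : test1 z dz a b ->
 exists M, forall t, `|z t| <= M /\ `|dz t| <= M.
move=> [a0 ab b1 [zd cdz z0]].
have cz : continuous z by move=> t; exact: derive_continuous (zd t).
have [M1 h1] := segment_bounded a b cz.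
have [M2 h2] := segment_bounded a b cdz.
exists (Num.max `|M1| `|M2|) => t; have [tab|/z0[-> ->]] := boolP (t \in `[a, b]).
 by rewrite !le_max (le_trans (h1 t tab) (ler_norm _)) (le_trans (h2 t tab) (ler_norm _)) orbT.
by rewrite normr0 le_max normr_ge0.
Qed.

(** The spherical integral of psi x_i / |x| has the spherical integral of the i-th derivative of psi
    as weak derivative: the divergence theorem on shells, obtained from [radial_ibp_coord]. *)
Lemma radial_dual (psi : 'rV[R]_n -> R) (i : 'I_n) (z dz : R -> R) (a b : R) :
 class_C 1 psi -> test1 z dz a b ->
 \int[mu1]_(r in `[a, b]) (smean (fun x => psi x * normalize x ord0 i) r * dz r) =
 - \int[mu1]_(r in `[a, b]) (smean (fun x => 'D_'e_i psi x) r * z r).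
move=> cpsi tz; have [a0 ab b1 [zd cdz z0]] := tz.
have [M zM] := test1_bounded tz.
have cz : continuous z by move=> t; exact: derive_continuous (zd t).
have ip : int_ball R n psi by apply: intg_ball; case: cpsi.
have iD : int_ball R n (fun x => 'D_'e_i psi x).
 by apply: intg_ball; case: cpsi => _ /(_ i)[_ []].
have ipN : int_ball R n (fun x => psi x * normalize x ord0 i).
 apply: (integrableMb (M := 1)) => // [|x _]; last exact: normalize_le1.
 by apply: mfunTS; exact: mfun_normalize.
rewrite -(polar_test a0 b1 ipN cdz) => [|t /z0[]//].
rewrite -(polar_test a0 b1 iD cz) => [|t /z0[]//].
etransitivity; last apply: (radial_ibp_coord n_gt0 (i := i) (h := z) (dh := dz) (M := M) (rho := b) ip iD) => //.
- by apply: eq_Rintegral => x _; ring.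
- exact: class_C_line_ftc.
- exact: continuous_measurable_fun.
- by move=> t; have [] := zM t.
- by move=> t; have [] := zM t.
- by move=> t bt; have [] // := z0 t; rewrite in_itv/= [t <= b]leNgt bt andbF.
Qed.

(** For h = z r^(-n) the combination r h' + n h is z' r^(1-n), so this test function removes the
    Jacobian from the divergence formula. *)
Lemma test1_pow (z dz : R -> R) (a b : R) : test1 z dz a b ->
 test1 (fun t => z t * t^-1 ^+ n) (fun t => dz t * t^-1 ^+ n - n%:R * z t * t^-1 ^+ n.+1) a b.
move=> tz; have [a0 ab b1 [zd cdz z0]] := tz.
have cz : continuous z by move=> t; exact: derive_continuous (zd t).
have far t : t < a -> \forall s \near t, s < a by exact: lt_nbhsl.
split => //; split.
- move=> t; have [t0|t0] := ltP 0 t.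
 have t_neq0 : t != 0 by rewrite gt_eqF.
 have E : is_derive t 1 (fun s : R => s^-1) (- t ^- 2 *: (1 : R)) by exact: (@is_deriveV _ (fun s : R => s)).
 have D := is_deriveX n E; rewrite exprfctE in D.
 apply: (is_derive_eq (is_deriveM (zd t) D)); rewrite /GRing.scale/=.
 have -> : n%:R * z t * t^-1 ^+ n.+1 = n%:R * z t * (t^-1 ^+ n.-1 * t^-1 * t^-1).
 by rewrite -!exprSr prednK.
 by rewrite -[t ^- 2]exprVn expr2; ring.
 have ta := le_lt_trans t0 a0.
 have [|-> ->] := z0 t; first by rewrite in_itv/= leNgt ta.
 rewrite mul0r mulr0 mul0r subrr.
 apply: (@is_derive_near0 _ _ _ (a - t)) => [|s]; first by rewrite subr_gt0.
 rewrite ltr_norml => /andP[_ sa]; have [|-> _] := z0 s; last by rewrite mul0r.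
 by rewrite in_itv/= negb_and -ltNge; apply/orP; left; lra.
- move=> t; have [t0|t0] := ltP 0 t.
 have cV : {for t, continuous (fun s : R => s^-1)} by apply: inv_continuous; rewrite gt_eqF.
 have cVn k : {for t, continuous (fun s : R => s^-1 ^+ k)}.
 by apply: (@continuous_comp _ _ _ (fun s : R => s^-1) (fun s => s ^+ k)) => //; exact: exprn_continuous.
 apply: cvgB; apply: cvgM; [exact: cdz|exact: cVn| |exact: cVn].
 by apply: cvgM; [exact: cvg_cst|exact: cz].
 have ta := le_lt_trans t0 a0.
 apply: cvg_near_cst; near=> s.
 have sa : s < a by near: s; exact: far.
 have [|-> ->] := z0 s; first by rewrite in_itv/= leNgt sa.
 have [|-> ->] := z0 t; first by rewrite in_itv/= leNgt ta.
 by rewrite !(mul0r, mulr0).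
- by move=> t /z0[-> ->]; rewrite mul0r mulr0 mul0r subrr.
Unshelve. all: by end_near. Qed.

Lemma smean_ae_radial (v : 'rV[R]_n -> R) (f : R -> R) : int_ball R n v ->
 {ae leb, forall x, Omega x -> v x = f (enorm x)} ->
 {ae mu1, forall r, 0 < r < 1 -> smean v r = f r * (n%:R * r ^+ n.-1 * fine (leb Omega))}.
move=> iv vf; have mv := integrable_mfun iv.
apply: ae_imply (ae_polar n_gt0 vf) => r h r01; have {}h := h r01.
have /andP[r0 r1] := r01; rewrite /smean.
transitivity (\int[leb]_y (\1_Omega y * (f r * (n%:R * r ^+ n.-1)))); last first.
 by rewrite -Rintegral_indicM Rintegral_cst// -!mulrA.
have miO : measurable_fun setT (\1_Omega : 'rV[R]_n -> R) by mfun.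
apply: ae_eq_Rint => //.
- exact: (measurable_fun_pair2 (r : measurableTypeR R) (mpolar_fun mv)).
- mfun.
apply: filterS2 h (ae_neq0 R n_gt0) => y hy y0 _.
rewrite /polar_fun/= [X in X * _ * _]indicE mem_setE in_itv/= r01 (_ : true%:R = 1 :> R)// mul1r.
rewrite patchE mem_set; last exact: unit_ball_polar.
rewrite indicE; case: (boolP (y \in Omega)) => [/set_mem Oy|_]; last by rewrite !mul0r mulr0.
by rewrite (hy Oy) enorm_polar//; ring.
Qed.

(** Spherical integrals of v give f0, and those of the radial component of the gradient give its
    weak derivative g0. The arbitrary function f is thereby replaced by a primitive on (0, 1). *)
Theorem radial_representative (v : 'rV[R]_n -> R) (G : 'rV[R]_n -> 'rV[R]_n) (f : R -> R) :
 int_ball R n v ->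
 (forall i, int_ball R n (fun x => G x ord0 i)) ->
 weak_gradient v G ->
 {ae leb, forall x, Omega x -> v x = f (enorm x)} ->
 exists F g : R -> R, [/\ loc_int g, borel R g,
 forall s t, 0 < s -> s <= t -> t < 1 -> F t - F s = \int[mu1]_(r in `[s, t]) g r &
 {ae leb, forall x, Omega x -> v x = F (enorm x)}].
move=> iv iG wG vf.
(* The area of the unit sphere: the spherical integral of v is k r^(n-1) f(r). *)
pose k := n%:R * fine (leb Omega).
have k0 : 0 < k by rewrite mulr_gt0 ?ltr0n// ball_volume_gt0.
have iGx : int_ball R n (fun x => dotp (G x) x).
 apply: intg_bigsum => // i; apply: (integrableMb (M := 1)) => //.
 mfun.
 by move=> x Ox; rewrite (le_trans (coord_le_enorm x i))// ltW.
have lV := smean_loc_int iv; have lG := smean_loc_int iGx.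
pose f0 r := smean v r * r^-1 ^+ n.-1.
pose g0 r := smean (fun x => dotp (G x) x) r * r^-1 ^+ n.
have mpow m : measurable_fun setT (fun r : measurableTypeR R => r^-1 ^+ m : R).
 by apply: measurable_funX; apply: measurable_funVr; exact: measurable_id.
have lpow (y : R -> R) m : loc_int y -> loc_int (fun r => y r * r^-1 ^+ m).
 move=> ly a b a0 b1; apply: (integrableMb (M := a^-1 ^+ m)) => //; first exact: ly.
 mfun.
 move=> r; rewrite /= in_itv/= => /andP[ar _]; have r0 := lt_le_trans a0 ar.
 rewrite ger0_norm ?exprn_ge0 ?invr_ge0 ?(ltW r0)//.
 by rewrite lerXn2r ?nnegrE ?invr_ge0 ?(ltW r0) ?(ltW a0)// lef_pV2.
have [|||c Fc] := @weak_derivative1 R f0 g0.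
- exact: lpow.
- exact: lpow.
- move=> z dz a b tz; have tz' := test1_pow tz; have [a0 ab b1 [zd' cdz' z0']] := tz'.
 have [_ _ _ [_ cdz z0]] := tz.
 have [M zM] := test1_bounded tz'.
 have cz' : continuous (fun t => z t * t^-1 ^+ n) by move=> t; exact: derive_continuous (zd' t).
 have ftc i : line_ftc v (fun x => G x ord0 i) i by exact: weak_gradient_line_ftc.
 have := radial_ibp_cpt n_gt0 iv iG ftc b1 zd' (continuous_measurable_fun cdz')
 (fun t => (zM t).1) (fun t => (zM t).2).
 move=> /(_ _)E; have {}E := E (fun t bt => (z0' t (ltac:(by rewrite in_itv/= [t <= b]leNgt bt andbF))).1).
 rewrite (polar_test a0 b1 iGx cz') in E; last by move=> t /z0'[].
 have cq : continuous (fun t : R => t * (dz t * t^-1 ^+ n - n%:R * z t * t^-1 ^+ n.+1) + n%:R * (z t * t^-1 ^+ n)).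
 move=> t; apply: cvgD; first by apply: cvgM; [exact: cvg_id|exact: cdz'].
 by apply: cvgM; [exact: cvg_cst|exact: cz'].
 rewrite (polar_test a0 b1 iv cq) in E; last first.
 by move=> t /z0[-> ->]; rewrite !(mul0r, mulr0) subrr mulr0 addr0.
 transitivity (\int[mu1]_(r in `[a, b]) (smean v r * (r * (dz r * r^-1 ^+ n - n%:R * z r * r^-1 ^+ n.+1)
 + n%:R * (z r * r^-1 ^+ n)))).
 apply: eq_Rintegral => r; rewrite inE/= in_itv/= => /andP[ar _].
 have r0 : r != 0 by rewrite gt_eqF// (lt_le_trans a0 ar).
 have en : r^-1 ^+ n = r^-1 * r^-1 ^+ n.-1 by rewrite -exprS prednK.
 by rewrite /f0 exprS en; set p := r^-1 ^+ n.-1; field.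
 by rewrite E; congr (- _); apply: eq_Rintegral => r _; rewrite /g0; ring.
exists (fun r => (c + prim g0 r) / k), (fun r => g0 r / k).
have lg0 : loc_int g0 by exact: lpow.
split.
- by move=> a b a0 b1; under [X in EFin \o X]eq_fun do rewrite mulrC; apply: intgZ => //; exact: lg0.
- have m1 := integrable_mfun (integrable_smeanT n_gt0 iGx).
 by apply: mfunM => //; apply: mfunM.
- move=> s t s0 st t1; under eq_Rintegral do rewrite mulrC.
 rewrite RintegralZl//; last exact: lg0.
 by rewrite -(prim_sub lg0 s0 st t1); field; rewrite gt_eqF.
suff : {ae mu1, forall r, 0 < r < 1 -> f r = (c + prim g0 r) / k}.
 by move=> /(ae_radial n_gt0); apply: filterS2 vf => x h1 h2 Ox; rewrite h1// h2.
apply: ae_imply2 Fc (smean_ae_radial iv vf) => r h1 h2 r01.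
rewrite -(h1 r01) /f0 h2// /k; have /andP[r0 _] := r01.
have v0 := ball_volume_gt0 R n_gt0.
rewrite exprVn; field; rewrite gt_eqF//= gt_eqF ?ltr0n//= expf_neq0// gt_eqF//.
Qed.

Lemma measurable_prim (g : R -> R) (F : R -> R) (a b : R) : loc_int g -> 0 < a -> a < b -> b < 1 ->
 (forall s t, 0 < s -> s <= t -> t < 1 -> F t - F s = \int[mu1]_(r in `[s, t]) g r) ->
 borel R (F \_ `[a, b]) /\
 exists M, forall r, `|(F \_ `[a, b]) r| <= M.
move=> lg a0 ab b1 FE.
have gi := loc_int_restrict lg a0 b1.
have E r : r \in `[a, b] -> F r = F a + \int[mu1]_(x in `[0, r]) (g \_ `[a, b]) x.
 move=> rab; have := prim_local lg a0 b1 rab; move: rab; rewrite in_itv/= => /andP[ar rb].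
 have := FE a r a0 ar (le_lt_trans rb b1); rewrite -(prim_sub lg a0 ar (le_lt_trans rb b1)); lra.
have g01 : mu1.-integrable `[0, 1] (EFin \o (g \_ `[a, b])) by apply: integrableS gi.
have mg := integrable_mfun g01.
have sub : (`[a, b]%classic : set R) `<=` `[0, 1]%classic.
 by apply: subset_itv; rewrite bnd_simp ltW.
split.
 apply/(measurable_restrict (F : measurableTypeR R -> R)) => //; rewrite setTI.
 apply: (@eq_measurable_fun _ _ (measurableTypeR R) R `[a, b]%classic (fun r => F a + \int[mu1]_(x in `[0, r]) (g \_ `[a, b]) x)).
 by move=> r; rewrite inE/= => rab; rewrite (E r).
 by apply: measurable_funD => //; apply: measurable_funS (mfun_primitive0 mg).
exists (`|F a| + \int[mu1]_(x in `[0, 1]) `|(g \_ `[a, b]) x|) => r.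
have M0 : 0 <= \int[mu1]_(x in `[0, 1]) `|(g \_ `[a, b]) x| by apply: Rintegral_ge0.
rewrite patchE; case: ifPn => [|_]; last by rewrite normr0 addr_ge0.
rewrite inE/= => rab; rewrite E//; have /sub := rab; rewrite /= in_itv/= => /andP[r0 r1].
have sub2 : (`[0, r]%classic : set R) `<=` `[0, 1]%classic by apply: subset_itv; rewrite bnd_simp.
apply: (le_trans (ler_normD _ _)); rewrite lerD2l.
apply: (le_trans (le_normr_Rintegral _ _)) => //; first exact: integrableS g01.
by apply: Rintegral_subset => //; exact: integrable_norm.
Qed.

Lemma integrable_radial (g : R -> R) (a b : R) : loc_int g -> 0 < a -> b < 1 ->
 int_ball R n (fun x => (g \_ `[a, b]) (enorm x)).
move=> lg a0 b1; have gi := loc_int_restrict lg a0 b1.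
have mg := integrable_mfun gi.
apply/integrableP; split.
 mfun.
have mag : measurable_fun setT (fun r => `|(g \_ `[a, b]) r| : R) by exact: mcompT.
rewrite (ge0_radial n_gt0 (a := fun r => `|(g \_ `[a, b]) r|))//.
rewrite lte_mul_pinfty ?lee_fin//; first by rewrite mulr_ge0// ltW// ball_volume_gt0.
have : mu1.-integrable `]0, 1[ (EFin \o (fun r => `|(g \_ `[a, b]) r| * r ^+ n.-1)).
 apply: (integrableMb (M := 1)) => //.
 by apply: integrableS (integrable_norm gi).
 move=> r; rewrite /= in_itv/= => /andP[r0 r1].
 by rewrite ger0_norm ?exprn_ge0 ?exprn_ile1 ?(ltW r0) ?(ltW r1).
move=> /integrableP[_]; rewrite [X in (X < _)%E -> _](_ : _ =
 (\int[mu1]_(r in `]0%R, 1%R[) (r ^+ n.-1 * `|(g \_ `[a, b]) r|)%:E)%E)//.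
apply: eq_integral => r; rewrite inE/= in_itv/= => /andP[r0 r1].
by rewrite /= ger0_norm mulrC// mulr_ge0// exprn_ge0// ltW.
Qed.

(** Compare both sides on boxes that avoid the origin. In polar coordinates the claim is an
    integration by parts on (0, 1) between F and the spherical integral B of psi x_i / |x|, whose
    weak derivative A comes from [radial_dual]. *)
Theorem radial_gradient (v : 'rV[R]_n -> R) (G : 'rV[R]_n -> 'rV[R]_n) (F g : R -> R) (i : 'I_n) :
 int_ball R n v ->
 (forall i, int_ball R n (fun x => G x ord0 i)) ->
 weak_gradient v G -> loc_int g ->
 (forall s t, 0 < s -> s <= t -> t < 1 -> F t - F s = \int[mu1]_(r in `[s, t]) g r) ->
 {ae leb, forall x, Omega x -> v x = F (enorm x)} ->
 {ae leb, forall x, Omega x -> G x ord0 i = g (enorm x) * normalize x ord0 i}.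
move=> iv iG [_ _ wG] lg FE vF.
pose O : set 'rV[R]_n := [set x | 0 < enorm x < 1].
have cen := @enorm_continuous R n.
have oO : open O.
 rewrite (_ : O = (@enorm R n) @^-1` `]0, 1[%classic); last by apply/seteqP; split => x; rewrite /O/= in_itv.
 by move/continuousP: cen; apply; exact: itv_open.
have OO : O `<=` Omega by move=> x /andP[].
suff : {ae leb, forall x, O x -> G x ord0 i - g (enorm x) * normalize x ord0 i = 0}.
 apply: filterS2 (ae_neq0 R n_gt0) => x x0 h Ox.
 by apply/eqP; rewrite -subr_eq0; apply/eqP/h; rewrite /O/= enorm_gt0 x0.
(* By compactness a closed box in the punctured ball stays at a positive distance from the origin
   and from the sphere, so g is integrated over a compact subinterval. *)
have range (a c : 'I_n -> R) : cbox a c `<=` O -> cbox a c !=set0 ->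
 exists r0 r1, [/\ 0 < r0, r0 < r1, r1 < 1 & forall x, cbox a c x -> enorm x \in `[r0, r1]].
 move=> sub ne; have cK : compact (cbox a c) by exact: compact_box.
 have cs : {within cbox a c, continuous (@enorm R n)} by exact: continuous_subspaceT.
 have [y yK ymin] := compact_EVT_min ne cK cs; have [z zK zmax] := compact_EVT_max ne cK cs.
 have /andP[y0 _] := sub _ (set_mem yK); have /andP[_ z1] := sub _ (set_mem zK).
 have yz := ymin z zK.
 exists (enorm y / 2), ((enorm z + 1) / 2); split; try lra.
 move=> x xK; have := ymin x (mem_set xK); have := zmax x (mem_set xK).
 by rewrite in_itv/= => h1 h2; apply/andP; split; lra.
have iGN (a c : 'I_n -> R) : cbox a c `<=` O ->
 leb.-integrable (cbox a c) (EFin \o (fun x => g (enorm x) * normalize x ord0 i)).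
 move=> sub; have [K0|/set0P ne] := eqVneq (cbox a c) set0; first by rewrite K0; exact: integrable_set0.
 have [r0 [r1 [r00 r01 r11 H]]] := range a c sub ne.
 have := integrableS mO (measurable_cbox a c) (subset_trans sub OO) (integrable_radial lg r00 r11).
 move=> h; have {}h : leb.-integrable (cbox a c) (EFin \o (fun x => g (enorm x))).
 apply: eq_integrable h => //; first exact: measurable_cbox.
 by move=> x /set_mem /H xr; rewrite /= patchE mem_set.
 apply: (integrableMb (M := 1)) => //; first exact: measurable_cbox.
 by apply: mfunTS; exact: mfun_normalize.
 by move=> x _; exact: normalize_le1.
have iGc (a c : 'I_n -> R) : cbox a c `<=` O -> leb.-integrable (cbox a c) (EFin \o (fun x => G x ord0 i)).
 by move=> sub; apply: integrableS (iG i) => //; [exact: measurable_cbox|exact: subset_trans sub OO].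
apply: ae_eq0_bbox => //.
 by move=> a c sub; apply: intgB; [exact: measurable_cbox|exact: iGc|exact: iGN].
move=> eps a c e0 ac sub.
pose psi := bbox eps a c.
have tpsi : test_function psi by apply: test_bbox => //; exact: subset_trans sub OO.
have mK := measurable_cbox a c.
have ne : cbox a c !=set0.
 by exists (\row_j a j) => j; rewrite mxE in_itv/= lexx ltW.
have [r0 [r1 [r00 r01 r11 H]]] := range a c sub ne.
have psi0 x : enorm x \notin `[r0, r1] -> psi x = 0.
 by move=> xr; apply: bbox_eq0 => /(@box_cbox R n a c x) /H; apply/negP.
pose dpsi x := 'D_'e_i psi x.
have D0 x : enorm x \notin `[r0, r1] -> dpsi x = 0.
 move=> xr; have [e e00 He] : exists2 e, 0 < e & forall y : R, `|y - enorm x| < e -> y \notin `[r0, r1].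
 move: xr; rewrite in_itv/= negb_and -!ltNge => /orP[xr|xr].
 exists (r0 - enorm x) => [|y]; first by rewrite subr_gt0.
 by rewrite ltr_norml => /andP[_ h]; rewrite in_itv/= negb_and -!ltNge; apply/orP; left; lra.
 exists (enorm x - r1) => [|y]; first by rewrite subr_gt0.
 by rewrite ltr_norml => /andP[h _]; rewrite in_itv/= negb_and -!ltNge; apply/orP; right; lra.
 suff : is_derive x 'e_i psi 0 by move=> [_].
 apply/is_derive_line; apply: (is_derive_near0 e00) => h; rewrite subr0 => he.
 apply: psi0; apply: He; apply: le_lt_trans he.
 by apply: (le_trans (enorm_dist _ _)); rewrite addrK enormZ enorm_delta mulr1.
have [Ck _] := tpsi; have [cpsi /(_ i)[dpsiE [cdpsi _]]] := Ck 1%N.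
pose A := smean dpsi; pose B := smean (fun x => psi x * normalize x ord0 i).
have ip : int_ball R n psi by exact: intg_ball.
have iD : int_ball R n dpsi by exact: intg_ball.
have mN : measurable_fun Omega (fun x : 'rV[R]_n => normalize x ord0 i).
 by apply: mfunTS; exact: mfun_normalize.
have ipN : int_ball R n (fun x => psi x * normalize x ord0 i).
 by apply: (integrableMb (M := 1)) => // x _; exact: normalize_le1.
have smean0 (w : 'rV[R]_n -> R) r : (forall x, enorm x \notin `[r0, r1] -> w x = 0) ->
 r \notin `[r0, r1] -> smean w r = 0.
 move=> w0 rr; have [/[!in_itv]/= r01'|/smean_out->//] := boolP (r \in `]0, 1[).
 rewrite /smean (@eq_Rintegral _ _ _ _ _ (cst 0)) ?Rintegral_cst ?mul0r// => y _.
 rewrite /polar_fun/= patchE mem_set; last exact: unit_ball_polar.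
 rewrite w0 ?mulr0 ?mulr0//; have [->|y0] := eqVneq y 0; last by rewrite enorm_polar//; case/andP: r01'.
 by rewrite /normalize enorm0 invr0 scale0r scaler0 enorm0 in_itv/= leNgt r00.
have A0 r : r \notin `[r0, r1] -> A r = 0 by exact: smean0.
have B0 r : r \notin `[r0, r1] -> B r = 0.
 by apply: smean0 => x xr; rewrite psi0// mul0r.
have lA : loc_int A by exact: smean_loc_int.
have lB : loc_int B by exact: smean_loc_int.
have [|c' Bc] := weak_derivative1 lB lA.
 by move=> z dz a' b' tz; exact: radial_dual (Ck 1%N) tz.
(* B equals a constant plus a primitive of A only almost everywhere. Good points left of r0 and
   right of r1, where B vanishes, fix the constant and give A total integral zero. *)
have [s0 /andP[s00 s0r] Bs0] := ae_itv_exists (lexx 0) r00 (ltW (lt_trans r01 r11)) Bc.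
have [s1 /andP[s1r s11] Bs1] := ae_itv_exists (ltW (lt_trans r00 r01)) r11 (lexx 1) Bc.
rewrite B0 in Bs0; last by rewrite in_itv/= leNgt s0r.
rewrite B0 in Bs1; last by rewrite in_itv/= [s1 <= r1]leNgt s1r andbF.
have AT : mu1.-integrable setT (EFin \o A) by exact: integrable_smeanT.
have A01 : mu1.-integrable `[0, 1] (EFin \o A) by apply: integrableS AT.
have PA t : s0 <= t -> t < 1 -> \int[mu1]_(y in `[0, t]) A y = prim A t - prim A s0.
 move=> s0t t1; rewrite (prim_sub lA s00 s0t t1); apply: Rint_itv_supp.
 by apply: subset_itv; rewrite bnd_simp// ltW.
 move=> y; rewrite /= !in_itv/= => /andP[y0 yt] /negP; rewrite yt andbT -ltNge => ys.
 by apply: A0; rewrite in_itv/= leNgt (lt_trans ys s0r).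
have A1 : \int[mu1]_(y in `[0, 1]) A y = 0.
 transitivity (\int[mu1]_(y in `[0, s1]) A y).
 apply: Rint_itv_supp; first by apply: subset_itv; rewrite bnd_simp// ltW.
 move=> y; rewrite /= !in_itv/= => /andP[y0 y1] /negP; rewrite y0/= -ltNge => ys.
 by apply: A0; rewrite in_itv/= [y <= r1]leNgt (lt_trans s1r ys) andbF.
 by rewrite PA//; lra.
have g1T := loc_int_restrict lg r00 r11.
have g101 : mu1.-integrable `[0, 1] (EFin \o (g \_ `[r0, r1])) by apply: integrableS g1T.
have sub01 : (`[r0, r1]%classic : set R) `<=` `[0, 1]%classic.
 by apply: subset_itv; rewrite bnd_simp ltW.
have sub01o : (`[r0, r1]%classic : set R) `<=` `]0, 1[%classic.
 by apply: subset_itv; rewrite bnd_simp.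
have mg := integrable_mfun (lg r0 r1 r00 r11).
have mA := integrable_mfun (lA r0 r1 r00 r11).
have mB := integrable_mfun (lB r0 r1 r00 r11).
have [mF1 [MF F1M]] := measurable_prim lg r00 r01 r11 FE.
have mF : measurable_fun (`[r0, r1]%classic : set (measurableTypeR R)) F.
 by apply: (@eq_measurable_fun _ _ (measurableTypeR R) R `[r0, r1]%classic (F \_ `[r0, r1]));
 [move=> r rr; rewrite patchE rr|exact: mfunTS].
have EAF : \int[mu1]_(r in `[r0, r1]) (A r * F r) = - \int[mu1]_(r in `[r0, r1]) (B r * g r).
 have := primitive_mul (@ler01 R) A01 g101; rewrite A1 mul0r.
 have -> : \int[mu1]_(t in `[0, 1]) (\int[mu1]_(y in `[0, t]) A y * (g \_ `[r0, r1]) t) =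
 \int[mu1]_(r in `[r0, r1]) (B r * g r).
 rewrite (@Rint_itv_supp R _ `[r0, r1]%classic)//; last first.
 by move=> x _ xr; rewrite patchE memNset// mulr0.
 apply: ae_eq_Rint => //.
 - apply: mfunM; first apply: measurable_funS (mfun_primitive0 (integrable_mfun A01)) => //.
 exact: measurable_funS (integrable_mfun g101).
 - mfun.
 apply: ae_imply Bc => r Br rr; rewrite patchE mem_set//.
 move: (rr); rewrite /= in_itv/= => /andP[h1 h2].
 have r1' : r < 1 by exact: le_lt_trans h2 r11.
 rewrite PA//; last by rewrite (le_trans (ltW s0r)).
 by rewrite Br ?(lt_le_trans r00 h1)//; congr (_ * _); lra.
 have -> : \int[mu1]_(t in `[0, 1]) (\int[mu1]_(y in `[0, t]) (g \_ `[r0, r1]) y * A t) =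
 \int[mu1]_(r in `[r0, r1]) (A r * F r).
 rewrite (@Rint_itv_supp R _ `[r0, r1]%classic)//; last first.
 by move=> x _ /negP xr; rewrite A0// mulr0.
 transitivity (\int[mu1]_(r in `[r0, r1]) (A r * F r - F r0 * A r)).
 apply: eq_Rintegral => t; rewrite inE/= => tr.
 have := prim_local lg r00 r11 tr; move: tr; rewrite in_itv/= => /andP[h1 h2].
 have := FE r0 t r00 h1 (le_lt_trans h2 r11).
 rewrite -(prim_sub lg r00 h1 (le_lt_trans h2 r11)) => h3 h4.
 have -> : \int[mu1]_(y in `[0, t]) (g \_ `[r0, r1]) y = F t - F r0 by lra.
 by ring.
 rewrite RintegralB//; last 2 first.
 - apply: (integrableMb (M := MF)) => //; first exact: lA.
 by move=> r rr; have := F1M r; rewrite patchE mem_set.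
 - by apply: intgZ => //; exact: lA.
 rewrite RintegralZl//; last exact: lA.
 rewrite -[X in _ - _ * X](@Rint_itv_supp R `[0, 1]%classic)//.
 by rewrite A1 mulr0 subr0.
 by move=> x _ /negP xr; rewrite A0.
 by move=> /eqP; rewrite eq_sym addr_eq0 => /eqP ->; rewrite opprK.
have mv := integrable_mfun iv.
have mD := integrable_mfun iD.
have men := @measurable_enorm R n.
have EV : \int[leb]_(x in Omega) (v x * dpsi x) = \int[mu1]_(r in `[r0, r1]) (A r * F r).
 have mF1e : measurable_fun Omega (fun x => (F \_ `[r0, r1]) (enorm x)).
 mfun.
 transitivity (\int[leb]_(x in Omega) (dpsi x * (F \_ `[r0, r1]) (enorm x))).
 apply: ae_eq_Rint => //; [exact: mfunM..|].
 apply: filterS vF => x vF Ox; rewrite patchE; case: ifPn => [_|xr].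
 by rewrite vF// mulrC.
 by rewrite D0 ?mulr0 ?mul0r//; apply: contra xr; rewrite inE.
 rewrite polar_mul//; last first.
 by apply: (integrableMb (M := MF)).
 rewrite (@Rint_itv_supp R _ `[r0, r1]%classic)//; last first.
 by move=> x _ xr; rewrite patchE memNset// mulr0.
 by apply: eq_Rintegral => r rr; rewrite patchE rr.
have EG : \int[leb]_(x in cbox a c) (g (enorm x) * normalize x ord0 i * psi x) = \int[mu1]_(r in `[r0, r1]) (B r * g r).
 have [Mp pM] := continuous_ball_bounded cpsi.
 have ig1 := integrable_radial lg r00 r11.
 have mg1 := integrable_mfun g1T.
 transitivity (\int[leb]_(x in Omega) (psi x * normalize x ord0 i * (g \_ `[r0, r1]) (enorm x))).
 rewrite [RHS](@Rintegral_support _ _ _ leb Omega (cbox a c)); last 2 first.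
 - exact: subset_trans sub OO.
 - by move=> x _ xK; rewrite /psi bbox_eq0 ?mul0r// => /box_cbox.
 by apply: eq_Rintegral => x /set_mem /H xr; rewrite patchE mem_set//; ring.
 rewrite polar_mul//; last first.
 under [X in EFin \o X]eq_fun do rewrite mulrC.
 apply: (integrableMb (M := Mp)) => //.
 mfun.
 by move=> x Ox; rewrite normrM -[leRHS]mulr1 ler_pM ?pM ?normalize_le1.
 rewrite (@Rint_itv_supp R _ `[r0, r1]%classic)//; last first.
 by move=> x _ xr; rewrite patchE memNset// mulr0.
 by apply: eq_Rintegral => r rr; rewrite patchE rr.
have bb f : leb.-integrable (cbox a c) (EFin \o f) ->
 leb.-integrable (cbox a c) (EFin \o (fun x => f x * psi x)).
 move=> fi; apply: (@integrableMb _ _ _ _ _ _ _ 1) => //.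
 by apply: mfunTS; exact: measurable_bbox.
 by move=> x _; exact: bbox_le1.
under eq_Rintegral do rewrite mulrBl.
rewrite RintegralB//; last 2 first.
- by apply: bb; exact: iGc.
- by apply: bb; exact: iGN.
rewrite EG; have := wG i psi tpsi; rewrite EV EAF => /oppr_inj ->.
rewrite (@Rintegral_support _ _ _ leb Omega (cbox a c)) ?subrr//; first exact: subset_trans sub OO.
by move=> x _ xK; rewrite /psi bbox_eq0 ?mulr0// => /box_cbox.
Qed.

End radial_function.

(** * Powers and their derivatives *)

Section power_derivatives.
Context (R : realType).
Implicit Types (p q : R).

(** A sequential form of the derivative, to match dominated convergence. *)
Lemma is_derive0P (f : R -> R) (l : R) : is_derive (0 : R) 1 f l <->
 forall u : nat -> R, (forall k, u k != 0) -> u @ \oo --> (0 : R) ->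
 (fun k => (u k)^-1 * (f (u k) - f 0)) @ \oo --> l.
have E : (fun h : R => h^-1 *: ((f \o shift 0) (h *: (1 : R)) - f 0)) = (fun h : R => h^-1 * (f h - f 0)).
 by apply/funext => h; rewrite /= /GRing.scale/= mulr1 addr0.
split.
 move=> [D1 D2] u u0 cu.
 have c : (fun h : R => h^-1 * (f h - f 0)) @ (0 : R)^' --> l.
 by rewrite -D2 -E; exact: D1.
 by move/cvgr_dnbhsP : c; apply; split.
move=> H.
have c : (fun h : R => h^-1 * (f h - f 0)) @ (0 : R)^' --> l.
 by apply/cvgr_dnbhsP => u [u0 cu]; exact: H.
rewrite -E in c.
have D : derivable f 0 1 by apply/cvg_ex; exists l.
by apply: DeriveDef => //; exact/cvg_lim.
Qed.

Lemma is_derive_near_eq (f g : R -> R) (t l e : R) : 0 < e ->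
 (forall s, `|s - t| < e -> f s = g s) -> is_derive t 1 f l -> is_derive t 1 g l.
move=> e0 fg df.
have d0 : is_derive t 1 (fun s => g s - f s) 0.
 by apply: (is_derive_near0 e0) => s /fg ->; rewrite subrr.
rewrite (_ : g = (fun s => f s + (g s - f s))).
 by apply: (is_derive_eq (is_deriveD df d0)); rewrite addr0.
by apply/funext => s; rewrite addrC subrK.
Qed.

Lemma derive_min0 (f : R -> R) (l : R) : is_derive (0 : R) 1 f l -> f 0 = 0 ->
 (forall t, 0 <= f t) -> l = 0.
move=> /is_derive0P H f0 fge; apply: le_anti; apply/andP; split.
 have c : (fun k : nat => - (k.+1%:R^-1) : R) @ \oo --> (0 : R).
 by rewrite -[X in _ --> X]oppr0; apply: cvgN; exact: cvg_harmonic.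
 have /(_ (fun k => ltac:(by rewrite oppr_eq0 invr_eq0 pnatr_eq0)) c) L := H (fun k : nat => - (k.+1%:R^-1)).
 apply: (ler_cvg_to L (cvg_cst (0 : R))); apply: nearW => k; rewrite f0 subr0 mulr_le0_ge0//.
have /(_ (fun k => ltac:(by rewrite invr_eq0 pnatr_eq0)) cvg_harmonic) L := H (fun k : nat => k.+1%:R^-1).
apply: (ler_cvg_to (cvg_cst (0 : R)) L); apply: nearW => k; rewrite f0 subr0 mulr_ge0//.
Qed.

Lemma powR_le_one (a c : R) : 0 <= c -> 0 <= a -> a <= 1 -> a `^ c <= 1.
move=> c0 a0 a1; have -> : 1 = 1 `^ c :> R by rewrite powR1.
by apply: ge0_ler_powR; rewrite ?nnegrE.
Qed.

Lemma powR_le2 p (s : R) : 2 <= p -> `|s| <= 1 -> `|s| `^ p <= s ^+ 2.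
move=> p2 s1; have [->|s0] := eqVneq s 0.
 by rewrite normr0 powR0 ?expr0n//= gt_eqF// (lt_le_trans _ p2).
rewrite -[s ^+ 2]real_normK ?num_real// -powR_mulrn//.
have s0' : 0 < `|s| by rewrite normr_gt0.
by rewrite /powR gt_eqF// ler_expR ler_wnM2r// ln_le0.
Qed.

(** The odd power |s|^(p-2) s: the derivative of |s|^p / p and the nonlinearity of the
    p-Laplacian. *)
Definition spow p (s : R) := `|s| `^ (p - 2) * s.

Lemma spowE p (s : R) : 2 <= p -> 0 <= s -> spow p s = s `^ (p - 1).
move=> p2 s0; rewrite /spow ger0_norm//; move: s0; rewrite le_eqVlt => /predU1P[<-|s0].
 by rewrite mulr0 powR0// gt_eqF//; lra.
rewrite -[X in _ * X]powRr1 ?(ltW s0)// -powRD; last by rewrite (gt_eqF s0) implybT.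
by congr (_ `^ _); ring.
Qed.

Lemma spowN p (s : R) : spow p (- s) = - spow p s.
by rewrite /spow normrN mulrN. Qed.

Lemma norm_spow p (s : R) : 2 <= p -> `|spow p s| = `|s| `^ (p - 1).
move=> p2; rewrite -spowE// /spow normrM normr_id; congr (_ * _).
by rewrite ger0_norm ?powR_ge0.
Qed.

Lemma is_derive_norm_powR p (s : R) : 2 <= p ->
 is_derive s 1 (fun s : R => `|s| `^ p) (p * spow p s).
move=> p2; have [s0|s0|<-] := ltgtP 0 s.
- apply: (@is_derive_near_eq (fun s => s `^ p) _ _ _ s) => //.
 move=> t; rewrite ltr_norml => /andP[t0 _]; rewrite gtr0_norm//; lra.
 apply: (is_derive_eq (is_derive1_powR p s0)).
 by rewrite spowE// ltW.
- have s0' : 0 < - s by rewrite oppr_gt0.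
 apply: (@is_derive_near_eq ((fun s => s `^ p) \o (fun s => -1 * s + 0)) _ _ _ (- s)) => //.
 move=> t; rewrite ltr_norml => /andP[_ t0]; rewrite /= addr0 mulN1r ltr0_norm//; lra.
 have d := is_derive_affine (-1) 0 s.
 have d2 : is_derive (-1 * s + 0) 1 (fun s => s `^ p) (p * (-1 * s + 0) `^ (p - 1)).
 by apply: is_derive1_powR; rewrite mulN1r addr0.
 apply: (is_derive_eq (is_derive1_comp (f := fun s : R => s `^ p) (g := fun s : R => -1 * s + 0) d2 d)).
 have -> : spow p s = - (- s) `^ (p - 1) by rewrite -{1}[s]opprK spowN (spowE p2) ?(ltW s0').
 have -> : -1 * s + 0 = - s by ring.
 by ring.
(* At 0 the bound |s|^p <= s^2 on |s| <= 1, valid as p >= 2, gives derivative 0; taking the minimum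
   with s^2 makes the quadratic bound global. *)
- apply: (@is_derive_near_eq (fun s => Num.min (`|s| `^ p) (s ^+ 2)) _ _ _ 1) => //.
 move=> t; rewrite subr0 => /ltW t1; apply/min_idPl; exact: powR_le2.
 rewrite /spow mulr0 mulr0; apply: (@is_derive_quad _ _ _ _ 1) => h.
 rewrite mul0r subr0 add0r mul1r normr0 powR0 ?expr0n/=; last by rewrite gt_eqF// (lt_le_trans _ p2).
 rewrite minxx subr0 ger0_norm; first by rewrite ge_min lexx orbT.
 by rewrite le_min powR_ge0 sqr_ge0.
Qed.

Lemma mvt_any (f df : R -> R) (a b : R) : (forall t : R, is_derive t 1 f (df t)) ->
 exists2 c, `|c| <= Num.max `|a| `|b| & f b - f a = df c * (b - a).
move=> fd.
have H x y : x <= y -> exists2 c, c \in `[x, y] & f y - f x = df c * (y - x).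
 move=> xy; apply: MVT_segment => //.
 by apply: continuous_subspaceT => t; exact: derive_continuous (fd t).
have [/H[c]|/ltW/H[c]] := leP a b; rewrite in_itv/= => /andP[c1 c2] E; exists c => //.
- rewrite ler_norml le_max; apply/andP; split; last by rewrite (le_trans c2 (ler_norm _)) orbT.
 by apply: le_trans c1; rewrite lerNl le_max -[`|a|]normrN ler_norm.
- rewrite ler_norml le_max; apply/andP; split; last by rewrite (le_trans c2 (ler_norm _)).
 by apply: le_trans c1; rewrite lerNl le_max -[`|b|]normrN ler_norm orbT.
- by rewrite -opprB E; ring.
Qed.

Lemma powR_add_le p (a b : R) : 0 <= p -> 0 <= a -> 0 <= b ->
 (a + b) `^ p <= 2 `^ p * (a `^ p + b `^ p).
move=> p0 a0 b0; have m0 : 0 <= Num.max a b by rewrite le_max a0.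
apply: (@le_trans _ _ ((2 * Num.max a b) `^ p)).
 apply: ge0_ler_powR; rewrite ?nnegrE ?addr_ge0 ?mulr_ge0//.
 by rewrite -[2]/(1 + 1) mulrDl mul1r lerD// le_max lexx ?orbT.
rewrite powRM// ler_wpM2l ?powR_ge0//.
by have [_|_] := leP a b; rewrite ?lerDl ?lerDr powR_ge0.
Qed.

End power_derivatives.

(** * Differentiation of power integrals *)

Section power_integral.
Context d (T : measurableType d) (R : realType) (mu : {measure set T -> \bar R}).
Variables (D : set T) (rho a b : T -> R) (p M : R).
Hypotheses (mD : measurable D) (mrho : measurable_fun D rho) (ma : measurable_fun D a)
 (mb : measurable_fun D b) (rho0 : forall x, D x -> 0 <= rho x) (p2 : 2 <= p)
 (bM : forall x, D x -> `|b x| <= M)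
 (ia : mu.-integrable D (EFin \o (fun x => rho x * `|a x| `^ p)))
 (ir : mu.-integrable D (EFin \o rho)).
Let mpow (q : R) (f : T -> R) : measurable_fun D f -> measurable_fun D (fun x => `|f x| `^ q).
move=> mf; apply: (mcompT (measurable_powR _)).
exact: mcompT.
Qed.
Let dom K : mu.-integrable D (EFin \o (fun x => rho x * (2 `^ p * (`|a x| `^ p + K)))).
under [X in EFin \o X]eq_fun do rewrite mulrCA mulrDr.
apply: intgZ => //; apply: intgD => //.
by under [X in EFin \o X]eq_fun do rewrite mulrC; exact: intgZ.
Qed.

Lemma integrable_power (t : R) : mu.-integrable D (EFin \o (fun x => rho x * `|a x + t * b x| `^ p)).
apply: (intg_le mD _ (dom ((`|t| * M) `^ p))).
 apply: mfunM => //; apply: mpow; apply: measurable_funD => //; exact: mfunM.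
move=> x Dx; rewrite ger0_norm ?mulr_ge0 ?powR_ge0 ?rho0//; apply: ler_wpM2l; first exact: rho0.
have M0 : 0 <= M := le_trans (normr_ge0 _) (bM Dx).
have p0 : 0 <= p := le_trans (ler0n R 2) p2.
apply: (@le_trans _ _ ((`|a x| + `|t| * M) `^ p)).
 apply: ge0_ler_powR; rewrite ?nnegrE ?addr_ge0 ?mulr_ge0//.
 by apply: (le_trans (ler_normD _ _)); rewrite lerD2l normrM ler_wpM2l// bM.
by apply: powR_add_le; rewrite ?mulr_ge0.
Qed.

(** Difference quotients along a bounded sequence are dominated by the mean value theorem: the
    intermediate point is at most |a| + 1 + B M in size, and raising a base at least 1 to the power
    p instead of p - 1 only increases it. *)
Lemma is_derive_power_integral :
 is_derive (0 : R) 1 (fun t : R => \int[mu]_(x in D) (rho x * `|a x + t * b x| `^ p))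
 (\int[mu]_(x in D) (p * (rho x * (spow p (a x) * b x)))).
apply/is_derive0P => u u0 cu.
have [B uB] : exists B, forall k, `|u k| <= B.
 have /cvg_seq_bounded[B [_ HB]] : cvgn u by apply/cvg_ex; exists 0.
 by exists (B + 1) => k; apply: (HB (B + 1)) => //; rewrite ltrDl.
have E k : (u k)^-1 * (\int[mu]_(x in D) (rho x * `|a x + u k * b x| `^ p) -
 \int[mu]_(x in D) (rho x * `|a x + 0 * b x| `^ p)) =
 \int[mu]_(x in D) ((u k)^-1 * (rho x * `|a x + u k * b x| `^ p - rho x * `|a x + 0 * b x| `^ p)).
 have i1 := integrable_power (u k); have i2 := integrable_power 0.
 by rewrite RintegralZl ?RintegralB//; exact: intgB.
rewrite (_ : (fun k => _) = (fun k => \int[mu]_(x in D) ((u k)^-1 *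
 (rho x * `|a x + u k * b x| `^ p - rho x * `|a x + 0 * b x| `^ p)))); last exact/funext.
have msp : measurable_fun D (fun x => spow p (a x)).
 by apply: mfunM => //; exact: mpow.
apply: (@Rdominated_cvg _ _ _ _ _ _ _ (fun x => p * M * (rho x * (2 `^ p * (`|a x| `^ p + (1 + B * M) `^ p))))) => //.
- move=> k; apply: mfunM => //; apply: measurable_funB; apply: mfunM => //;
 by apply: mpow; apply: measurable_funD => //; exact: mfunM.
- by apply: mfunM => //; apply: mfunM => //; exact: mfunM.
- apply: aeW => x Dx.
 have da := is_derive_affine (b x) (a x) 0.
 have d0 : is_derive (b x * 0 + a x) 1 (fun s : R => `|s| `^ p) (p * spow p (b x * 0 + a x)).
 exact: is_derive_norm_powR.
 have /is_derive0P/(_ u u0 cu) := is_derive1_comp (f := fun s : R => `|s| `^ p) (g := fun s : R => b x * s + a x) d0 da.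
 rewrite mulr0 add0r => c.
 have : (fun k => rho x * ((u k)^-1 * (`|b x * u k + a x| `^ p - `|b x * 0 + a x| `^ p))) @ \oo -->
 rho x * (p * spow p (a x) * b x) by apply: cvgM => //; exact: cvg_cst.
 rewrite [X in _ --> X -> _](_ : _ = p * (rho x * (spow p (a x) * b x))); last by ring.
 move=> c2; apply: cvg_trans c2; apply: near_eq_cvg; apply: nearW => k /=.
 by rewrite ![b x * _]mulrC ![_ + a x]addrC; ring.
- exact: intgZ (dom _).
apply: aeW => x k Dx; rewrite mul0r addr0 -mulrBr mulrCA normrM (ger0_norm (rho0 Dx)) [leRHS]mulrCA.
apply: ler_wpM2l; first exact: rho0.
have M0 : 0 <= M := le_trans (normr_ge0 _) (bM Dx).
have p0 : 0 <= p := le_trans (ler0n R 2) p2.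
have B0 : 0 <= B := le_trans (normr_ge0 _) (uB 0%N).
have [c cm ->] := mvt_any (a x) (a x + u k * b x) (fun t => is_derive_norm_powR t p2).
have uk0 := u0 k.
have -> : (u k)^-1 * (p * spow p c * (a x + u k * b x - a x)) = p * b x * spow p c by field.
rewrite normrM normrM norm_spow// (ger0_norm (_ : 0 <= p)); last lra.
apply: ler_pM; rewrite ?mulr_ge0 ?powR_ge0//.
 by apply: ler_wpM2l => //; exact: bM.
have BM0 : 0 <= B * M by rewrite mulr_ge0.
have cB : `|c| <= `|a x| + (1 + B * M).
 apply: (le_trans cm); rewrite ge_max; apply/andP; split.
 by rewrite lerDl addr_ge0// mulr_ge0.
 apply: (le_trans (ler_normD _ _)); rewrite lerD2l normrM.
 by apply: (@le_trans _ _ (B * M)); [exact: ler_pM (uB k) (bM Dx)|rewrite lerDr].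
apply: (@le_trans _ _ ((`|a x| + (1 + B * M)) `^ p)).
 apply: (@le_trans _ _ ((`|a x| + (1 + B * M)) `^ (p - 1))).
 have aB : 0 <= `|a x| + (1 + B * M) by have := normr_ge0 (a x); lra.
 have p10 : 0 <= p - 1 by rewrite subr_ge0 (le_trans _ p2)// ler1n.
 by apply: ge0_ler_powR; rewrite ?nnegrE.
 apply: ler_powR; last lra.
 by rewrite addrCA lerDl addr_ge0// mulr_ge0.
by apply: powR_add_le; rewrite ?addr_ge0 ?mulr_ge0.
Qed.

End power_integral.

(** * Monotonicity tools *)

Section profile_tools.
Context (R : realType).

Lemma derive_mono (f df : R -> R) (r s : R) :
 (forall t : R, r <= t <= s -> is_derive t 1 f (df t)) -> (forall t, r < t < s -> 0 <= df t) ->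
 r <= s -> f r <= f s.
move=> D D0; rewrite le_eqVlt => /orP[/eqP->//|rs].
have Drs x : x \in `]r, s[ -> is_derive x 1 f (df x).
 by rewrite in_itv/= => /andP[rx xs]; apply: D; rewrite !ltW.
have cf : {within `[r, s], continuous f}.
 apply: continuous_in_subspaceT => x; rewrite inE/= in_itv/= => rxs.
 exact: (derive_continuous (D x rxs)).
have [c crs E] := MVT rs Drs cf.
by rewrite -subr_ge0 E mulr_ge0 ?subr_ge0 ?(ltW rs)//; apply: D0; move: crs; rewrite in_itv.
Qed.

(* Differentiating the square of the negative part of f avoids a continuity argument. *)
Lemma derive_stay (f df : R -> R) (r s : R) :
 (forall t : R, r <= t <= s -> is_derive t 1 f (df t)) ->
 (forall t, r <= t <= s -> f t < 0 -> df t <= 0) ->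
 r <= s -> f r < 0 -> f s <= f r.
move=> D D0 rs fr.
have : Num.max 0 (- f r) ^+ 2 <= Num.max 0 (- f s) ^+ 2.
 apply: (@derive_mono (fun t => Num.max 0 (- f t) ^+ 2) (fun t => 2 * Num.max 0 (- f t) * - df t)) => // t tab.
 exact: (is_derive1_comp (f := fun y : R => Num.max 0 y ^+ 2) (g := fun t => - f t) (is_derive_pos_sqr (- f t)) (is_deriveN (D t tab))).
 have [ft|ft] := ltP (f t) 0.
 rewrite mulr_ge0 ?oppr_ge0//; last by apply: D0 => //; case/andP: tab => ? ?; rewrite !ltW.
 by rewrite mulr_ge0// le_max lexx.
 by rewrite (max_idPl _) ?mulr0 ?mul0r// oppr_le0.
have r0 : 0 < - f r by rewrite oppr_gt0.
rewrite ler_sqr ?nnegrE ?le_max ?lexx// (max_idPr (ltW r0)).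
by move=> /orP[|]; [rewrite leNgt r0|rewrite lerN2].
Qed.

Lemma is_derive_powR_comp (f : R -> R) (r df c : R) : 0 < f r -> is_derive r 1 f df ->
 is_derive r 1 (fun t => f t `^ c) (c * f r `^ (c - 1) * df).
move=> fr D.
exact: (is_derive1_comp (f := fun s => s `^ c) (g := f) (is_derive1_powR c fr) D).
Qed.

Lemma powR_le_inv (a b c : R) : 0 < c -> 0 <= a -> 0 <= b -> a `^ c <= b `^ c -> a <= b.
move=> c0 a0 b0 h; rewrite leNgt; apply/negP => ba.
by have := gt0_ltr_powR c0 b0 a0 ba; rewrite ltNge h.
Qed.

(** The bound is known for s < 1 and is passed to s = 1: if it failed there, the midpoint of r + L /
    k and 1 would violate it. *)
Lemma le_linear_sup (k L r : R) : 0 <= L -> r < 1 -> (forall s, r <= s -> s < 1 -> k * (s - r) <= L) ->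
 k * (1 - r) <= L.
move=> L0 r1 h; rewrite leNgt; apply/negP => H.
have r1' : 0 < 1 - r by rewrite subr_gt0.
have k0 : 0 < k by rewrite -(pmulr_lgt0 _ r1') (le_lt_trans L0).
have : L / k < 1 - r by rewrite ltr_pdivrMr// mulrC.
have Lk : 0 <= L / k by rewrite divr_ge0// ltW.
move=> H'; pose s := (r + L / k + 1) / 2.
have rs : r <= s by rewrite /s; lra.
have s1 : s < 1 by rewrite /s; lra.
have := h s rs s1; rewrite mulrC -ler_pdivlMr// /s; lra.
Qed.

Lemma is_derive_expn_div (n : nat) (t : R) : (0 < n)%N ->
 is_derive t 1 (fun s => s ^+ n / n%:R) (t ^+ n.-1).
move=> n_gt0; have D := is_deriveX n (is_derive_id t (1 : R)).
have := is_deriveZ (n%:R^-1) D => D'.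
rewrite (_ : (fun s => _) = n%:R^-1 *: ((@id R) ^+ n)); last first.
 by apply/funext => s; rewrite scalrfctE/= exprfctE scalerE mulrC.
by apply: (is_derive_eq D'); rewrite !scalerE mulr1 mulrA mulVf ?mul1r// pnatr_eq0 -lt0n.
Qed.

End profile_tools.

(** * Qualitative analysis of the radial equation *)

Section profile.
Context (R : realType).
Variables (n : nat) (p q alpha lam : R) (F g : R -> R).
Hypotheses (n_gt0 : (0 < n)%N) (p2 : 2 <= p) (pq : p < q) (al0 : 0 < alpha) (lam0 : 0 <= lam).
(** Lam is the flux r^(n-1) |F'|^(p-2) F', and N is its derivative according to the equation. The
    flux is differentiated rather than F', because F' need not be differentiable where it
    vanishes. *)
Let N (r : R) := r ^+ n.-1 * (F r `^ (p - 1) - lam * (r `^ alpha * F r `^ (q - 1))).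
Let Lam (r : R) := r ^+ n.-1 * spow p (g r).
Hypothesis DF : forall r : R, 0 < r < 1 -> is_derive r 1 F (g r).
Hypothesis DL : forall r : R, 0 < r < 1 -> is_derive r 1 Lam (N r).
Hypothesis F0 : forall r : R, 0 < r < 1 -> 0 <= F r.
Hypothesis Fpos : forall r : R, 0 < r < 1 -> exists2 s : R, 0 < s < r & 0 < F s.
(** The flux tends to 0 at both ends, at r = 1 by the Neumann condition. *)
Hypothesis L0 : forall e : R, 0 < e -> exists2 d : R, 0 < d < 1 & forall r : R, 0 < r < d -> `|Lam r| <= e.
Hypothesis L1 : forall e : R, 0 < e -> exists2 d : R, 0 < d < 1 & forall r : R, d < r < 1 -> `|Lam r| <= e.
(** This and [large] are the places where alpha must be large. *)
Hypothesis small : forall r : R, 0 < r <= 2^-1 -> lam * (r `^ alpha * F r `^ (q - p)) <= 2^-1.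
Hypothesis large : 2 ^+ n.-1 * (q - p) <= alpha.
(** N is theta times a nonnegative factor, so theta carries the sign of the right side. *)
Let theta (r : R) := 1 - lam * (r `^ alpha * F r `^ (q - p)).
Let NE (r : R) : N r = r ^+ n.-1 * (F r `^ (p - 1) * theta r).
rewrite /N /theta; have -> : q - 1 = (q - p) + (p - 1) by ring.
rewrite (@powRD _ (F r) (q - p) (p - 1)); first by ring.
by apply/implyP => /eqP; have := p2; have := pq; lra.
Qed.
Let rn (r : R) : 0 < r -> 0 < r ^+ n.-1. Proof. exact: exprn_gt0. Qed.
Let rn1 (r : R) : 0 < r < 1 -> r ^+ n.-1 <= 1.
by move=> /andP[r0 r1]; rewrite exprn_ile1// ltW. Qed.
Let in01 (r s t : R) : 0 < r -> s < 1 -> r <= t <= s -> 0 < t < 1.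
by move=> r0 s1 /andP[rt ts]; rewrite (lt_le_trans r0 rt) (le_lt_trans ts s1). Qed.
(** Closes most contradictions below: a wrong sign of the flux is propagated by monotonicity to an
    end, where the flux has to vanish. *)
Let tail1 (r c : R) : 0 < r < 1 -> 0 < c -> (forall s, r <= s -> s < 1 -> c <= `|Lam s|) -> False.
move=> /andP[r0 r1] c0 h; have [d /andP[d0 d1] hd] := L1 (divr_gt0 c0 (ltr0n R 2)).
pose s := (Num.max r d + 1) / 2.
have m1 : Num.max r d < 1 by rewrite gt_max r1.
have rm : r <= Num.max r d by rewrite le_max lexx.
have dm : d <= Num.max r d by rewrite le_max lexx orbT.
have h1 : c <= `|Lam s| by apply: h; rewrite /s; lra.
have : `|Lam s| <= c / 2 by apply: hd; rewrite /s; apply/andP; split; lra.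
lra.
Qed.
Let tail0 (r c : R) : 0 < r < 1 -> 0 < c -> (forall s, 0 < s -> s <= r -> c <= `|Lam s|) -> False.
move=> /andP[r0 r1] c0 h; have [d /andP[d0 d1] hd] := L0 (divr_gt0 c0 (ltr0n R 2)).
pose s := Num.min r d / 2.
have m1 : 0 < Num.min r d by rewrite lt_min r0.
have rm : Num.min r d <= r by rewrite ge_min lexx.
have dm : Num.min r d <= d by rewrite ge_min lexx orbT.
have h1 : c <= `|Lam s| by apply: h; rewrite /s; lra.
have : `|Lam s| <= c / 2 by apply: hd; rewrite /s; apply/andP; split; lra.
lra.
Qed.
Let g_ge0 (r : R) : 0 < r -> 0 <= Lam r -> 0 <= g r.
move=> r0; rewrite pmulr_rge0 ?rn// => h; rewrite leNgt; apply/negP => g0.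
by move: h; rewrite /spow nmulr_lge0// leNgt powR_gt0// normr_gt0 lt_eqF.
Qed.
Let Lam_ge0 (r : R) : 0 < r -> 0 <= g r -> 0 <= Lam r.
by move=> r0 g0; rewrite mulr_ge0 ?(ltW (rn r0))// mulr_ge0 ?powR_ge0. Qed.
Let half1 : 0 < (2^-1 : R) < 1. Proof. by apply/andP; split; lra. Qed.
Let N_half (r : R) : 0 < r <= 2^-1 -> 2^-1 * (r ^+ n.-1 * F r `^ (p - 1)) <= N r.
move=> r12; have /andP[r0 r1] := r12; rewrite NE mulrA [leLHS]mulrC.
by apply: ler_wpM2l; [rewrite mulr_ge0 ?powR_ge0 ?(ltW (rn r0))|rewrite /theta; have := small r12; lra].
Qed.
Let N_half0 (r : R) : 0 < r <= 2^-1 -> 0 <= N r.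
move=> r12; have /andP[r0 r1] := r12; apply: le_trans (N_half r12).
by rewrite mulr_ge0 ?invr_ge0// mulr_ge0 ?powR_ge0 ?(ltW (rn r0)).
Qed.
(** Since N >= 0 on (0, 1/2], a negative flux would be at least as negative at all smaller radii,
    although it tends to 0 there. *)
Let Lam_half (r : R) : 0 < r <= 2^-1 -> 0 <= Lam r.
move=> /andP[r0 r1]; rewrite leNgt; apply/negP => h.
have r1' : r < 1 by lra.
apply: (@tail0 r (- Lam r)); rewrite ?oppr_gt0 ?r0// => s s0 sr.
rewrite ler_normr; apply/orP; right; rewrite lerN2.
apply: (derive_mono (f := Lam) (df := N)) => // t; first by move/(in01 s0 r1')/DL.
by move=> /andP[st tr]; apply: N_half0; apply/andP; split; lra.
Qed.
Let N_le (r : R) : 0 < r < 1 -> N r <= r ^+ n.-1 * F r `^ (p - 1).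
move=> /andP[r0 r1]; apply: ler_wpM2l; first exact/ltW/rn.
by rewrite gerBl !mulr_ge0 ?powR_ge0.
Qed.
Let p10 : 0 < p - 1. Proof. have := p2; lra. Qed.
(** A one-sided bound available before the sign of the flux is known. Where the expression is
    negative, F' < 0 and N <= (F + e)^(p-1), so it cannot increase; it would stay negative up to 1,
    where the flux vanishes. The shift e keeps the power differentiable while F may still be 0. *)
Let barrier (e r : R) : 0 < e -> 0 < r < 1 -> 0 <= Lam r + (F r + e) `^ (p - 1) * (1 - r).
move=> e0 r01; have /andP[r0 r1] := r01; rewrite leNgt; apply/negP => h.
apply: (@tail1 r (- (Lam r + (F r + e) `^ (p - 1) * (1 - r)))) => //; first by rewrite oppr_gt0.
move=> s rs s1; rewrite ler_normr; apply/orP; right; rewrite lerN2.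
apply: (@le_trans _ _ (Lam s + (F s + e) `^ (p - 1) * (1 - s))).
 by rewrite lerDl mulr_ge0 ?powR_ge0 ?subr_ge0 ?(ltW s1).
apply: (derive_stay (f := fun t => Lam t + (F t + e) `^ (p - 1) * (1 - t))
 (df := fun t => N t + ((p - 1) * (F t + e) `^ (p - 1 - 1) * g t * (1 - t) - (F t + e) `^ (p - 1)))) => // t /(in01 r0 s1) t01.
 have Fe : 0 < F t + e by rewrite ltr_wpDl// F0.
 have D1 := is_derive_powR_comp (f := fun t => F t + e) (p - 1) Fe (is_deriveD (DF t01) (is_derive_cst e t 1)).
 have D2 : is_derive t 1 (fun t : R => 1 - t) (- 1).
 by apply: (is_derive_eq (is_deriveB (is_derive_cst (1 : R) t 1) (is_derive_id t (1 : R)))); rewrite sub0r.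
 apply: (is_derive_eq (is_deriveD (DL t01) (is_deriveM D1 D2))).
 by rewrite !scalerE /=; ring.
move=> ht; have /andP[t0 t1] := t01.
have Lt : Lam t < 0.
 by apply: le_lt_trans ht; rewrite lerDl mulr_ge0 ?powR_ge0 ?subr_ge0 ?(ltW t1).
have gt : g t < 0 by rewrite ltNge; apply/negP => /(Lam_ge0 t0); rewrite leNgt Lt.
have Nt : N t <= (F t + e) `^ (p - 1).
 apply: le_trans (N_le t01) _; rewrite -[leRHS]mul1r; apply: ler_pM; rewrite ?powR_ge0 ?rn1 ?(ltW (rn t0))//.
 apply: ge0_ler_powR; [exact: ltW p10|by rewrite nnegrE F0|by rewrite nnegrE addr_ge0 ?F0 ?(ltW e0)|by rewrite lerDl ltW].
have h0 : 0 <= (p - 1) * (F t + e) `^ (p - 1 - 1) * (1 - t).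
 by apply: mulr_ge0; [apply: mulr_ge0; [exact: ltW p10|exact: powR_ge0]|lra].
have : (p - 1) * (F t + e) `^ (p - 1 - 1) * (1 - t) * g t <= 0 by rewrite mulr_ge0_le0 ?(ltW gt).
by rewrite [_ * g t]mulrAC; lra.
Qed.
(** On [1/2, 1) the function F can decrease at relative rate at most 2^(n-1). This number bounds
    r^(1-n), and it is below its own power p - 1 because p - 1 >= 1. *)
Let gneg (r : R) : 2^-1 <= r -> r < 1 -> - g r <= 2 ^+ n.-1 * F r.
move=> r2 r1; have r0 : 0 < r by lra.
have r01 : 0 < r < 1 by rewrite r0.
have [g0|g0] := leP 0 (g r).
 by rewrite (@le_trans _ _ 0) ?oppr_le0// mulr_ge0 ?F0// exprn_ge0.
apply/ler_addgt0Pr => e e0; have K0 : 0 < 2 ^+ n.-1 :> R by rewrite exprn_gt0.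
have K1 : 1 <= 2 ^+ n.-1 :> R by rewrite exprn_ege1// ler1n.
have e'0 : 0 < e / 2 ^+ n.-1 by rewrite divr_gt0.
have Fe : 0 <= F r + e / 2 ^+ n.-1 by rewrite addr_ge0 ?F0 ?(ltW e'0).
have -> : 2 ^+ n.-1 * F r + e = 2 ^+ n.-1 * (F r + e / 2 ^+ n.-1) by field; rewrite gt_eqF.
apply: (powR_le_inv p10); rewrite ?oppr_ge0 ?(ltW g0)// ?mulr_ge0 ?(ltW K0)//.
rewrite powRM ?(ltW K0)//.
apply: (@le_trans _ _ (2 ^+ n.-1 * (F r + e / 2 ^+ n.-1) `^ (p - 1))); last first.
 by apply: ler_wpM2r; rewrite ?powR_ge0// -[leLHS]powRr1 ?(ltW K0)// ler_powR//; have := p2; lra.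
have LE : Lam r = - (r ^+ n.-1 * (- g r) `^ (p - 1)).
 have gn : 0 <= - g r by rewrite oppr_ge0 ltW.
 have := spowN p (- g r); rewrite opprK (spowE p2 gn) => spg.
 by rewrite /Lam spg mulrN.
have h : r ^+ n.-1 * (- g r) `^ (p - 1) <= (F r + e / 2 ^+ n.-1) `^ (p - 1).
 have := barrier e'0 r01; rewrite LE addrC subr_ge0 => /le_trans; apply.
 by rewrite ler_piMr ?powR_ge0//; lra.
rewrite -ler_pdivrMl//; apply: le_trans h; apply: ler_wpM2r; first exact: powR_ge0.
by rewrite -exprVn lerXn2r// nnegrE; lra.
Qed.
(** The exponent for which r^alpha F^(q-p) = (r^mu F)^(q-p). *)
Let mu := alpha / (q - p).
Let qp0 : 0 < q - p. Proof. have := pq; lra. Qed.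
Let mu_large : 2 ^+ n.-1 <= mu. Proof. rewrite /mu ler_pdivlMr; [exact: large|exact: qp0]. Qed.
(** The derivative has the sign of r F' + mu F, and mu is at least the rate of decrease allowed by
    [gneg]. *)
Let rmu_mono (r s : R) : 2^-1 <= r -> r <= s -> s < 1 -> r `^ mu * F r <= s `^ mu * F s.
move=> r2 rs s1; have r0 : 0 < r by lra.
apply: (derive_mono (f := fun t => t `^ mu * F t) (df := fun t => t `^ mu * g t + F t * (mu * t `^ (mu - 1)))) => // t.
 move=> rts; have t01 := in01 r0 s1 rts; have /andP[t0 t1] := t01.
 by apply: (is_derive_eq (is_deriveM (is_derive1_powR mu t0) (DF t01))); rewrite !scalerE.
move=> /andP[rt ts]; have t0 : 0 < t by lra.
have t1 : t < 1 by lra.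
have t01 : 0 < t < 1 by rewrite t0.
have -> : t `^ mu = t * t `^ (mu - 1).
 rewrite -{2}(powRr1 (ltW t0)) -powRD; first by congr powR; ring.
 by rewrite (gt_eqF t0) implybT.
have -> : t * t `^ (mu - 1) * g t + F t * (mu * t `^ (mu - 1)) = t `^ (mu - 1) * (t * g t + mu * F t) by ring.
rewrite mulr_ge0 ?powR_ge0//.
have h1 : - g t <= 2 ^+ n.-1 * F t by apply: gneg => //; lra.
have h2 : 2 ^+ n.-1 * F t <= mu * F t by rewrite ler_wpM2r ?F0 ?mu_large.
have h3 : 0 <= mu * F t by rewrite mulr_ge0 ?F0// (le_trans _ mu_large)// exprn_ge0.
have [g0|g0] := leP 0 (g t); first by rewrite addr_ge0// mulr_ge0// ltW.
have : g t <= t * g t by rewrite ler_niMl ?(ltW t1)// ltW.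
lra.
Qed.
Let F_half (r s : R) : 0 < r -> r <= s -> s <= 2^-1 -> F r <= F s.
move=> r0 rs s2; have s1 : s < 1 by lra.
apply: (derive_mono (f := F) (df := g)) => // t; first by move/(in01 r0 s1)/DF.
move=> /andP[rt ts]; have t0 : 0 < t by lra.
by apply: g_ge0 => //; apply: Lam_half; apply/andP; split; lra.
Qed.
(** F is positive at points arbitrarily close to 0. Monotonicity of F on (0, 1/2], and of r^mu F
    beyond, carries positivity to the right. *)
Let Fgt0 (r : R) : 0 < r < 1 -> 0 < F r.
have H (s : R) : 0 < s <= 2^-1 -> 0 < F s.
 move=> /andP[s0 s2]; have [|t /andP[t0 ts] Ft] := Fpos (r := s); first by rewrite s0; lra.
 by apply: lt_le_trans Ft _; apply: F_half => //; exact: ltW.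
move=> /andP[r0 r1]; have [r2|r2] := leP r 2^-1; first by apply: H; rewrite r0.
have := rmu_mono (lexx _) (ltW r2) r1.
have h : 0 < (2^-1 : R) `^ mu * F 2^-1.
 by rewrite mulr_gt0 ?powR_gt0//; apply: H; apply/andP; split; lra.
by move=> /(lt_le_trans h); rewrite pmulr_rgt0// powR_gt0.
Qed.
Let theta_mono (r s : R) : 2^-1 <= r -> r <= s -> s < 1 -> theta s <= theta r.
move=> r2 rs s1; have r0 : 0 < r by lra.
have s0 : 0 < s by lra.
have E (t : R) : 0 < t < 1 -> t `^ alpha * F t `^ (q - p) = (t `^ mu * F t) `^ (q - p).
 move=> t01; rewrite powRM ?powR_ge0 ?F0// -powRrM /mu divfK// gt_eqF//.
have r1 : r < 1 by lra.
rewrite /theta; apply: lerB => //; apply: ler_wpM2l; first exact: lam0.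
rewrite !E ?r0 ?s0//; apply: ge0_ler_powR; rewrite ?nnegrE ?(ltW qp0)//.
- by rewrite mulr_ge0 ?powR_ge0 ?F0// r0.
- by rewrite mulr_ge0 ?powR_ge0 ?F0// s0.
- exact: rmu_mono.
Qed.
Let N_ge0 (r : R) : 0 < r -> 0 <= theta r -> 0 <= N r.
by move=> r0 t0; rewrite NE !mulr_ge0 ?powR_ge0// ltW// rn. Qed.
(** On [1/2, 1) theta is nonincreasing, so the flux first rises and then falls. A negative value can
    occur only on the falling stretch and would persist up to 1, where the flux vanishes. *)
Let Lam_pos (r : R) : 0 < r < 1 -> 0 <= Lam r.
move=> r01; have /andP[r0 r1] := r01; have [r2|r2] := leP r 2^-1; first by apply: Lam_half; rewrite r0.
rewrite leNgt; apply/negP => h.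
have half0 : 0 < (2^-1 : R) by lra.
have tr : theta r < 0.
 rewrite ltNge; apply/negP => tr.
 have : Lam 2^-1 <= Lam r.
 apply: (derive_mono (f := Lam) (df := N)) => // [t /(in01 half0 r1)/DL//|t /andP[t2 tr'] |]; last exact: ltW.
 apply: N_ge0; first lra.
 by apply: le_trans tr _; apply: theta_mono; rewrite ?ltW.
 have : 0 <= Lam 2^-1 by apply: Lam_half; rewrite half0 lexx.
 lra.
apply: (@tail1 r (- Lam r)) => //; first by rewrite oppr_gt0.
move=> s rs s1; rewrite ler_normr; apply/orP; right.
apply: (derive_mono (f := fun t => - Lam t) (df := fun t => - N t)) => // t.
 by move/(in01 r0 s1)/DL => D; exact: is_deriveN.
move=> /andP[rt ts]; have t0 : 0 < t by lra.
have tt : theta t < 0 by apply: le_lt_trans tr; apply: theta_mono; lra.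
rewrite NE mulrA -mulrN; apply: mulr_ge0; last by rewrite oppr_ge0 ltW.
by apply: mulr_ge0; [exact: ltW (rn t0)|exact: powR_ge0].
Qed.
Let gpos (r : R) : 0 < r < 1 -> 0 <= g r.
by move=> r01; apply: g_ge0; [case/andP: r01|exact: Lam_pos]. Qed.
Let LamE (r : R) : 0 < r < 1 -> Lam r = r ^+ n.-1 * g r `^ (p - 1).
by move=> r01; rewrite /Lam spowE// gpos. Qed.
Let F_mono (r s : R) : 0 < r -> r <= s -> s < 1 -> F r <= F s.
move=> r0 rs s1; apply: (derive_mono (f := F) (df := g)) => // t; first by move/(in01 r0 s1)/DF.
by move=> /andP[rt ts]; apply: gpos; apply/andP; split; lra.
Qed.
Let n0 : 0 < n%:R :> R. Proof. by rewrite ltr0n. Qed.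
Let n1 : 1 <= n%:R :> R. Proof. by rewrite ler1n. Qed.
(** F is increasing, so integrating N <= r^(n-1) F^(p-1) from 0 gives the bound. In derivative form,
    the difference of the two sides is nondecreasing. *)
Let Lam_le (r : R) : 0 < r < 1 -> Lam r <= F r `^ (p - 1) * (r ^+ n / n%:R).
move=> r01; have /andP[r0 r1] := r01; rewrite -subr_ge0 leNgt; apply/negP => h.
set c := (X in X < 0) in h.
apply: (@tail0 r (- c)); rewrite ?oppr_gt0// => s s0 sr.
rewrite ler_normr; apply/orP; left.
have : F s `^ (p - 1) * (s ^+ n / n%:R) - Lam s <= c.
 apply: (derive_mono (f := fun t => F t `^ (p - 1) * (t ^+ n / n%:R) - Lam t)
 (df := fun t => F t `^ (p - 1) * t ^+ n.-1 + t ^+ n / n%:R * ((p - 1) * F t `^ (p - 1 - 1) * g t) - N t)) => // t.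
 move=> /(in01 s0 r1) t01; have D1 := is_derive_powR_comp (p - 1) (Fgt0 t01) (DF t01).
 apply: (is_derive_eq (is_deriveB (is_deriveM D1 (is_derive_expn_div t n_gt0)) (DL t01))).
 by rewrite !scalerE.
 move=> /andP[st tr]; have t01 : 0 < t < 1 by apply/andP; split; lra.
 have t0 : 0 < t by lra.
 have := N_le t01; rewrite mulrC.
 have : 0 <= t ^+ n / n%:R * ((p - 1) * F t `^ (p - 1 - 1) * g t).
 apply: mulr_ge0; first by rewrite divr_ge0 ?exprn_ge0 ?(ltW t0).
 apply: mulr_ge0; last exact: gpos.
 by apply: mulr_ge0; [exact: ltW p10|exact: powR_ge0].
 lra.
have : 0 <= F s `^ (p - 1) * (s ^+ n / n%:R).
 by rewrite mulr_ge0 ?powR_ge0// divr_ge0 ?exprn_ge0 ?(ltW s0).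
lra.
Qed.
Let g_le_F (r : R) : 0 < r < 1 -> g r <= F r.
move=> r01; have /andP[r0 r1] := r01; apply: (powR_le_inv p10); rewrite ?gpos ?F0//.
rewrite -(ler_pM2l (rn r0)) -LamE// (le_trans (Lam_le r01))// mulrC ler_wpM2r ?powR_ge0//.
rewrite ler_pdivrMr// -[in X in r ^+ X](prednK n_gt0) exprS mulrC ler_pM2l ?rn//.
by rewrite (le_trans (ltW r1))// n1.
Qed.
Let e1 : R := expR 1.
(** F' <= F makes F e^(-r) nonincreasing, so over an interval of length 1 the values of F differ by
    at most a factor e. *)
Let F_osc (r s : R) : 0 < r < 1 -> 0 < s < 1 -> F r <= e1 * F s.
have H : forall r s : R, 0 < r -> r <= s -> s < 1 -> F s <= e1 * F r.
 move=> {}r {}s r0 rs s1; have : - (F r * expR (- r)) <= - (F s * expR (- s)).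
 apply: (derive_mono (f := fun t => - (F t * expR (- t)))
 (df := fun t => - (F t * (expR (- t) * -1) + expR (- t) * g t))) => // t.
 move/(in01 r0 s1) => t01.
 have D := is_derive1_comp (f := expR) (g := fun t : R => - t) (is_derive_expR (- t)) (is_deriveN (is_derive_id t (1 : R))).
 by apply: (is_derive_eq (is_deriveN (is_deriveM (DF t01) D))); rewrite !scalerE.
 move=> /andP[rt ts]; have t01 : 0 < t < 1 by apply/andP; split; lra.
 have -> : - (F t * (expR (- t) * -1) + expR (- t) * g t) = expR (- t) * (F t - g t) by ring.
 by rewrite mulr_ge0 ?expR_ge0// subr_ge0 g_le_F.
 rewrite lerN2 expRN ler_pdivrMr ?expR_gt0// => /le_trans; apply.
 rewrite -mulrA -expRD mulrC ler_wpM2r ?F0 ?r0 ?(le_lt_trans rs)// /e1 ler_expR; lra.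
move=> /andP[r0 r1] /andP[s0 s1]; have [rs|sr] := leP r s; last exact: H (ltW sr) r1.
rewrite (le_trans (F_mono r0 rs s1))// ler_peMl ?F0 ?s0// /e1 -expR0 ler_expR//.
Qed.
Let m := F 2^-1.
(** C2 bounds F^(p-1) from above and E C2 from below, since F lies between e^(-1) F(1/2) and e
    F(1/2). *)
Let C2 := (e1 * m) `^ (p - 1).
Let E := expR (- 2) `^ (p - 1) : R.
Let E01 : 0 < E <= 1.
rewrite /E powR_gt0 ?expR_gt0//= powR_le_one ?expR_ge0 ?(ltW p10)// -expR0 ler_expR; lra.
Qed.
Let F_le_C2 (r : R) : 0 < r < 1 -> F r `^ (p - 1) <= C2.
move=> r01; apply: ge0_ler_powR; rewrite ?nnegrE ?F0 ?(ltW p10)//; last exact: F_osc.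
by rewrite mulr_ge0 ?expR_ge0// F0.
Qed.
Let F_ge_C2 (r : R) : 0 < r < 1 -> E * C2 <= F r `^ (p - 1).
move=> r01; rewrite /E /C2 -powRM ?expR_ge0 ?mulr_ge0 ?expR_ge0 ?F0//.
apply: ge0_ler_powR; rewrite ?nnegrE ?F0 ?(ltW p10) ?mulr_ge0 ?expR_ge0 ?F0//.
have := F_osc half1 r01; rewrite mulrA /e1 -expRD (_ : -2 + 1 = -1 :> R); last by ring.
by rewrite expRN -ler_pdivrMl ?expR_gt0.
Qed.
Let C20 : 0 < C2. Proof. by rewrite powR_gt0// mulr_gt0 ?expR_gt0// Fgt0. Qed.
(** On (0, 1/2] the derivative N is at least half of r^(n-1) E C2; integrate from 0. *)
Let Lam_lower0 (r : R) : 0 < r <= 2^-1 -> 2^-1 * (E * C2) * (r ^+ n / n%:R) <= Lam r.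
move=> /andP[r0 r2]; have r1 : r < 1 by lra.
set c1 := 2^-1 * (E * C2); rewrite -subr_ge0 leNgt; apply/negP => h.
have c10 : 0 < c1 by have /andP[E0 _] := E01; rewrite /c1 !mulr_gt0// invr_gt0.
set c := (X in X < 0) in h.
(* So close to 0 that c1 s^n / n <= -c / 2; together with Lam s >= 0 this contradicts the value c
   carried down from r. *)
pose s := Num.min r (- c / (2 * c1)).
have s0 : 0 < s by rewrite lt_min r0 divr_gt0 ?oppr_gt0// mulr_gt0.
have sr : s <= r by rewrite ge_min lexx.
have sc : s <= - c / (2 * c1) by rewrite ge_min lexx orbT.
have s1 : s < 1 by lra.
have : Lam s - c1 * (s ^+ n / n%:R) <= c.
 apply: (derive_mono (f := fun t => Lam t - c1 * (t ^+ n / n%:R)) (df := fun t => N t - c1 * t ^+ n.-1)) => // t.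
 move=> /(in01 s0 r1) t01.
 by apply: (is_derive_eq (is_deriveB (DL t01) (is_deriveZ c1 (is_derive_expn_div t n_gt0)))); rewrite scalerE.
 move=> /andP[st tr]; have t01 : 0 < t < 1 by apply/andP; split; lra.
 have t0 : 0 < t by lra.
 rewrite subr_ge0; apply: le_trans (N_half _); last by apply/andP; split; lra.
 rewrite /c1 -mulrA ler_wpM2l ?invr_ge0// mulrC ler_wpM2l ?(ltW (rn t0))// F_ge_C2//.
have : c1 * (s ^+ n / n%:R) <= c1 * s.
 rewrite ler_wpM2l ?(ltW c10)// ler_pdivrMr// -[in leLHS](prednK n_gt0) exprS ler_wpM2l ?(ltW s0)//.
 by rewrite (le_trans (rn1 _))// s0.
have : c1 * s <= - c / 2.
 have := ler_wpM2l (ltW c10) sc; rewrite (_ : c1 * (- c / (2 * c1)) = - c / 2)//.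
 by field; rewrite gt_eqF.
have : 0 <= Lam s by apply: Lam_pos; rewrite s0.
lra.
Qed.
Let K := Lam 2^-1.
(** If theta(r) >= 0, the flux has been rising and exceeds K = Lam(1/2). Otherwise put T =
    -theta(r): since 1/2 the flux has lost at most C2 T (r - 1/2), and it still falls to 0 at a rate
    of at least a C2 T. The first bound suffices when C2 T <= K, the second otherwise. *)
Let Lam_lower1 (r : R) : 2^-1 <= r -> r < 1 -> (2^-1 ^+ n.-1 * E) * K * (1 - r) <= Lam r.
move=> r2 r1; have r0 : 0 < r by lra.
have half0 : 0 < (2^-1 : R) by lra.
have /andP[E0 E1] := E01; have K0 : 0 <= K by exact: Lam_pos.
set a := 2^-1 ^+ n.-1 * E; have a0 : 0 <= a by rewrite mulr_ge0 ?(ltW E0)// exprn_ge0// ltW.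
have a1 : a <= 1 by rewrite mulr_ile1 ?(ltW E0)// ?exprn_ge0 ?exprn_ile1//; lra.
have aK : a * K <= K by rewrite ler_piMl.
have aK0 : 0 <= a * K by rewrite mulr_ge0.
have [tr|tr] := leP 0 (theta r).
 have : K <= Lam r.
 apply: (derive_mono (f := Lam) (df := N)) => // [t /(in01 half0 r1)/DL//|t /andP[t2 tr']].
 apply: N_ge0; first lra.
 by apply: le_trans tr _; apply: theta_mono; rewrite ?ltW.
 have : a * K * (1 - r) <= a * K by rewrite ler_piMr//; lra.
 lra.
pose T := - theta r; have T0 : 0 < T by rewrite oppr_gt0.
have h1 : K + C2 * T * 2^-1 <= Lam r + C2 * T * r.
 apply: (derive_mono (f := fun t => Lam t + C2 * T * t) (df := fun t => N t + C2 * T)) => // t.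
 move=> /(in01 half0 r1) t01.
 by apply: (is_derive_eq (is_deriveD (DL t01) (is_deriveZ (C2 * T) (is_derive_id t (1 : R))))); rewrite scalerE mulr1.
 move=> /andP[t2 tr']; have t0 : 0 < t by lra.
 have t01 : 0 < t < 1 by apply/andP; split; lra.
 have h : - T <= theta t by rewrite opprK; apply: theta_mono; rewrite ?ltW.
 rewrite NE mulrA; set b := t ^+ n.-1 * _.
 have b0 : 0 <= b by rewrite mulr_ge0 ?powR_ge0// ltW// rn.
 have bC : b <= C2.
 by rewrite -[leRHS]mul1r ler_pM ?powR_ge0 ?(ltW (rn t0)) ?rn1 ?F_le_C2.
 have : b * - T <= b * theta t by rewrite ler_wpM2l.
 have : b * T <= C2 * T by rewrite ler_wpM2r// ltW.
 lra.
have h2 : (a * C2 * T) * (1 - r) <= Lam r.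
 apply: le_linear_sup => //; first by apply: Lam_pos; rewrite r0.
 move=> s rs s1.
 have : - (Lam r + a * C2 * T * r) <= - (Lam s + a * C2 * T * s).
 apply: (derive_mono (f := fun t => - (Lam t + a * C2 * T * t)) (df := fun t => - (N t + a * C2 * T))) => // t.
 move=> /(in01 r0 s1) t01.
 by apply: (is_derive_eq (is_deriveN (is_deriveD (DL t01) (is_deriveZ (a * C2 * T) (is_derive_id t (1 : R)))))); rewrite scalerE mulr1.
 move=> /andP[rt ts]; have t0 : 0 < t by lra.
 have t01 : 0 < t < 1 by apply/andP; split; lra.
 have h : theta t <= - T by rewrite opprK; apply: theta_mono; lra.
 rewrite NE mulrA; set b := t ^+ n.-1 * _.
 have b0 : 0 <= b by rewrite mulr_ge0 ?powR_ge0// ltW// rn.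
 have bC : a * C2 <= b.
 rewrite /a -mulrA; apply: ler_pM; last exact: F_ge_C2.
 - by rewrite exprn_ge0//; lra.
 - by rewrite mulr_ge0 ?(ltW E0) ?(ltW C20).
 - by rewrite lerXn2r ?nnegrE//; lra.
 have : b * theta t <= b * - T by rewrite ler_wpM2l.
 have : a * C2 * T <= b * T by rewrite ler_wpM2r// ltW.
 lra.
 have : 0 <= Lam s by apply: Lam_pos; apply/andP; split; lra.
 lra.
have [TK|TK] := leP (C2 * T) K.
 have : C2 * T * (r - 2^-1) <= K * 2^-1.
 by apply: ler_pM => //; rewrite ?mulr_ge0 ?(ltW C20) ?(ltW T0)//; lra.
 have : a * K * (1 - r) <= K * 2^-1.
 by apply: ler_pM => //; lra.
 lra.
apply: le_trans h2; rewrite ler_wpM2r; [by []|lra|].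
by rewrite -mulrA ler_wpM2l// ltW.
Qed.

(** E^2 4^(-n) / n with E = e^(-2 (p-1)): small enough for the lower bounds on both halves of (0,
    1), and independent of alpha, q and the solution. *)
Definition profile_constant : R := expR (- 2) `^ (p - 1) ^+ 2 * (2^-1 ^+ n * 2^-1 ^+ n) / n%:R.
Let lower (r : R) : 0 < r < 1 -> profile_constant * (r * (1 - r)) * F r `^ (p - 1) <= g r `^ (p - 1).
move=> r01; have /andP[r0 r1] := r01; have /andP[E0 E1] := E01.
have hn0 : 0 < (2^-1 : R) ^+ n by rewrite exprn_gt0.
have hn1 : (2^-1 : R) ^+ n <= 2^-1.
 by rewrite -[in leLHS](prednK n_gt0) exprS ler_piMr// exprn_ile1//; lra.
have c0 : 0 < profile_constant by rewrite /profile_constant divr_gt0// !mulr_gt0// exprn_gt0.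
apply: (@le_trans _ _ (profile_constant * (r * (1 - r)) * C2)).
 by rewrite ler_wpM2l ?F_le_C2// !mulr_ge0 ?(ltW c0) ?(ltW r0)//; lra.
have [r2|r2] := leP r 2^-1.
 have := Lam_lower0 (r := r); rewrite r0 r2 => /(_ isT).
 rewrite LamE// -[in r ^+ n](prednK n_gt0) exprSr -!mulrA mulrCA ![_ * (r ^+ n.-1 * _)]mulrCA => h.
 have {h} : 2^-1 * (E * (C2 * (r / n%:R))) <= g r `^ (p - 1).
 by rewrite -(ler_pM2l (rn r0)); apply: le_trans h; rewrite le_eqVlt; apply/orP; left; apply/eqP; ring.
 apply: le_trans; rewrite /profile_constant -/E.
 rewrite [leLHS](_ : _ = (E * (2^-1 ^+ n * 2^-1 ^+ n) * (1 - r)) * (E * (C2 * (r / n%:R)))); last first.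
 by rewrite /E; ring.
 rewrite ler_wpM2r ?mulr_ge0 ?(ltW E0) ?(ltW C20) ?divr_ge0 ?(ltW r0)//.
 have h1 : E * (2^-1 ^+ n * 2^-1 ^+ n) <= 2^-1.
 rewrite -[leRHS]mul1r ler_pM ?mulr_ge0 ?(ltW E0) ?(ltW hn0)// (le_trans (ler_piMr _ _) hn1) ?(ltW hn0)//; lra.
 by rewrite (le_trans _ h1)// ler_piMr ?mulr_ge0 ?(ltW E0) ?(ltW hn0)//; lra.
have := Lam_lower1 (ltW r2) r1; rewrite LamE// => h.
have {h} h : (2^-1 ^+ n.-1 * E) * K * (1 - r) <= g r `^ (p - 1).
 by apply: le_trans h _; rewrite ler_piMl ?powR_ge0// rn1.
apply: le_trans h; have := Lam_lower0 (r := 2^-1); rewrite -/K.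
have -> : 0 < (2^-1 : R) <= 2^-1 by rewrite lexx andbT; lra.
move=> /(_ isT) hK.
apply: (@le_trans _ _ (2^-1 ^+ n.-1 * E * (2^-1 * (E * C2) * (2^-1 ^+ n / n%:R)) * (1 - r))); last first.
 by rewrite ler_wpM2r ?ler_wpM2l ?mulr_ge0 ?(ltW E0) ?exprn_ge0//; lra.
have -> : 2^-1 ^+ n.-1 * E * (2^-1 * (E * C2) * (2^-1 ^+ n / n%:R)) * (1 - r) =
 profile_constant * (1 - r) * C2.
 have en : (2^-1 : R) ^+ n = 2^-1 * 2^-1 ^+ n.-1 by rewrite -exprS prednK.
 by rewrite /profile_constant -/E en; ring.
rewrite ler_wpM2r ?(ltW C20)// ler_wpM2l ?(ltW c0)// ler_piMl//; lra.
Qed.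
(** The flux has derivative at least -C and vanishes at 1. Here C may depend on the solution: it
    serves to justify an integration by parts and enters no final constant. *)
Let upper1 : exists C : R, forall r, 0 < r < 1 -> Lam r <= C * (1 - r).
pose C := lam * (e1 * m) `^ (q - 1); have C0 : 0 <= C by rewrite mulr_ge0 ?powR_ge0.
exists C => r r01; have /andP[r0 r1] := r01; rewrite -subr_ge0 leNgt; apply/negP => h.
set c := (X in X < 0) in h.
apply: (@tail1 r (- c)); rewrite ?oppr_gt0// => s rs s1.
rewrite ler_normr; apply/orP; left.
have : Lam r + C * r <= Lam s + C * s.
 apply: (derive_mono (f := fun t => Lam t + C * t) (df := fun t => N t + C)) => // t.
 move=> /(in01 r0 s1) t01.
 by apply: (is_derive_eq (is_deriveD (DL t01) (is_deriveZ C (is_derive_id t (1 : R))))); rewrite scalerE mulr1.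
 move=> /andP[rt ts]; have t0 : 0 < t by lra.
 have t01 : 0 < t < 1 by apply/andP; split; lra.
 have h1 : t ^+ n.-1 * (lam * (t `^ alpha * F t `^ (q - 1))) <= C.
 rewrite -[leRHS]mul1r; apply: ler_pM; rewrite ?rn1 ?(ltW (rn t0)) ?mulr_ge0 ?powR_ge0//.
 rewrite ler_wpM2l// -[leRHS]mul1r ler_pM ?powR_ge0//.
 by rewrite powR_le_one ?(ltW al0) ?(ltW t0)//; lra.
 by rewrite ge0_ler_powR ?nnegrE ?F0 ?mulr_ge0 ?expR_ge0 ?F0 ?F_osc//; have := p2; have := pq; lra.
 have : 0 <= t ^+ n.-1 * F t `^ (p - 1) by rewrite mulr_ge0 ?powR_ge0// ltW// rn.
 rewrite /N mulrBr; lra.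
have : C * s <= C by rewrite ler_piMr// ltW.
rewrite /c; lra.
Qed.

Theorem profile_properties :
 [/\ forall r : R, 0 < r < 1 -> 0 < F r,
 forall r : R, 0 < r < 1 -> 0 <= g r <= F r,
 forall r s : R, 0 < r < 1 -> 0 < s < 1 -> F r <= expR 1 * F s &
 forall r : R, 0 < r < 1 -> profile_constant * (r * (1 - r)) * F r `^ (p - 1) <= g r `^ (p - 1)].
by split => // r r01; rewrite gpos ?g_le_F. Qed.

Theorem profile_flux_le (r : R) : 0 < r < 1 ->
 r ^+ n.-1 * g r `^ (p - 1) <= F r `^ (p - 1) * (r ^+ n / n%:R).
by move=> r01; rewrite -LamE// Lam_le. Qed.

Theorem profile_flux_boundary : exists C : R, forall r : R, 0 < r < 1 ->
 r ^+ n.-1 * g r `^ (p - 1) <= C * (1 - r).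
by have [C hC] := upper1; exists C => r r01; rewrite -LamE// hC. Qed.

End profile.

(** * Cauchy-Schwarz and a smoothed singular kernel *)

Lemma weighted_cauchy_schwarz d (T : measurableType d) (R : realType)
 (m : {measure set T -> \bar R}) (D : set T) (k f : T -> R) (K : R) :
 measurable D -> 0 < K -> (forall x, D x -> 0 < k x) ->
 m.-integrable D (EFin \o k) -> m.-integrable D (EFin \o f) ->
 m.-integrable D (EFin \o (fun x => f x ^+ 2 / k x)) ->
 \int[m]_(x in D) k x <= K ->
 (\int[m]_(x in D) f x) ^+ 2 <= K * \int[m]_(x in D) (f x ^+ 2 / k x).
move=> mD K0 k0 ik i_f i_q kK; set a := \int[m]_(x in D) f x; set b := \int[m]_(x in D) (f x ^+ 2 / k x).
have h c : 2 * c * a <= c ^+ 2 * \int[m]_(x in D) k x + b.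
 rewrite /a /b -!RintegralZl// -RintegralD//; last exact: intgZ.
 apply: le_Rintegral => //; [exact: intgZ|apply: intgD => //; exact: intgZ|].
 move=> x Dx; rewrite -subr_ge0 (_ : _ - _ = (c * k x - f x) ^+ 2 / k x).
 by rewrite divr_ge0 ?sqr_ge0// ltW// k0.
 by field; rewrite gt_eqF// k0.
(* The optimal parameter in the quadratic inequality when the integral of k is replaced by its bound
   K. *)
have := h (a / K).
have : (a / K) ^+ 2 * \int[m]_(x in D) k x <= (a / K) ^+ 2 * K by rewrite ler_wpM2l// sqr_ge0.
move=> h1 h2; rewrite -ler_pdivrMl//.
have E1 : (a / K) ^+ 2 * K = K^-1 * a ^+ 2 by field; rewrite gt_eqF.
have E2 : 2 * (a / K) * a = 2 * (K^-1 * a ^+ 2) by field; rewrite gt_eqF.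
move: h1 h2; rewrite E1 E2; lra.
Qed.

Section kernel.
Context (R : realType).
Variables (beta delta : R).
Hypotheses (b0 : 0 <= beta) (b1 : beta < 1) (d0 : 0 < delta) (d1 : delta <= 1).

(* The derivative of s * (s^2 + delta)^(- beta / 2): comparable with |s|^(- beta), but smooth. *)
Definition ker (s : R) : R :=
 (s ^+ 2 + delta) `^ (- (beta / 2)) * (1 - beta * s ^+ 2 / (s ^+ 2 + delta)).

Lemma ker_base (s : R) : 0 < s ^+ 2 + delta.
by rewrite ltr_wpDl ?sqr_ge0. Qed.

Lemma is_derive_ker (s : R) : is_derive s 1 (fun s => s * (s ^+ 2 + delta) `^ (- (beta / 2))) (ker s).
have D0 : is_derive s 1 (fun s : R => s ^+ 2 + delta) (2 * s).
 have D := is_deriveX 2 (is_derive_id s (1 : R)).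
 rewrite (_ : (fun s : R => _) = (@id R) ^+ 2 + cst delta); last by apply/funext => t; rewrite exprfctE.
 by apply: (is_derive_eq (is_deriveD D (is_derive_cst delta s 1))); rewrite !scalerE /= expr1 mulr1 addr0.
have D1 := is_derive1_comp (f := fun y => y `^ (- (beta / 2))) (g := fun s => s ^+ 2 + delta)
 (is_derive1_powR (- (beta / 2)) (ker_base s)) D0.
apply: (is_derive_eq (is_deriveM (is_derive_id s (1 : R)) D1)).
rewrite !scalerE /= /ker.
have -> : (s ^+ 2 + delta) `^ (- (beta / 2) - 1) = (s ^+ 2 + delta) `^ (- (beta / 2)) / (s ^+ 2 + delta).
 have h := ker_base s; rewrite powRB; last by rewrite (gt_eqF h) implybT.
 by rewrite powRr1// ltW.
field; rewrite gt_eqF ?ker_base//.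
Qed.

Lemma ker_ge (s : R) : (1 - beta) * (s ^+ 2 + delta) `^ (- (beta / 2)) <= ker s.
rewrite mulrC /ker ler_wpM2l ?powR_ge0// lerD2l lerN2 ler_pdivrMr ?ker_base//.
by rewrite ler_wpM2l// lerDl ltW.
Qed.

Lemma ker_gt0 (s : R) : 0 < ker s.
by apply: lt_le_trans (ker_ge s); rewrite mulr_gt0 ?powR_gt0 ?ker_base ?subr_gt0. Qed.

Lemma ker_continuous : continuous ker.
move=> s; have D0 : {for s, continuous (fun s : R => s ^+ 2 + delta)}.
 by apply: cvgD; [exact: exprn_continuous|exact: cvg_cst].
apply: cvgM.
 exact: (continuous_comp D0 (derive_continuous (is_derive1_powR (- (beta / 2)) (ker_base s)))).
apply: cvgB; first exact: cvg_cst.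
apply: cvgM; first by apply: cvgM; [exact: cvg_cst|exact: exprn_continuous].
by apply: cvgV D0; rewrite gt_eqF// ker_base.
Qed.

(** The antiderivative is bounded by 2 on [-1, 1], uniformly in delta, because |s| (s^2 +
    delta)^(-beta/2) is at most (s^2 + delta)^((1-beta)/2). The bound does not see how close the
    segment comes to 0. *)
Lemma ker_integral (c s : R) : -1 <= c -> 0 <= s -> s + c <= 1 ->
 \int[lebesgue_measure]_(t in `[0, s]) ker (t + c) <= 4.
move=> c1 s0 sc; pose P (s : R) := s * (s ^+ 2 + delta) `^ (- (beta / 2)).
have D (t : R) : is_derive t 1 (fun t => P (t + c)) (ker (t + c)).
 have Dc := is_deriveD (is_derive_id t (1 : R)) (is_derive_cst c t 1).
 apply: (is_derive_eq (is_derive1_comp (f := P) (g := fun t => t + c) (is_derive_ker (t + c)) Dc)).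
 by rewrite addr0 mulr1.
rewrite (FTC2_everywhere s0 D); last first.
 move=> t; apply: (continuous_comp (f := fun t => t + c) (g := ker)); last exact: ker_continuous.
 by apply: cvgD; [exact: cvg_id|exact: cvg_cst].
have H : forall s : R, -1 <= s -> s <= 1 -> `|P s| <= 2.
 move=> {s0 sc} {}s s1 s2; have ns : `|s| <= 1 by rewrite ler_norml s1.
 rewrite normrM (ger0_norm (powR_ge0 _ _)).
 have -> : `|s| = (s ^+ 2) `^ 2^-1 by rewrite powR12_sqrt ?sqr_ge0// sqrtr_sqr.
 have h : (s ^+ 2) `^ 2^-1 <= (s ^+ 2 + delta) `^ 2^-1.
 by apply: ge0_ler_powR; rewrite ?nnegrE ?invr_ge0 ?sqr_ge0 ?lerDl ?(ltW d0)// addr_ge0 ?sqr_ge0// ltW.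
 rewrite (le_trans (ler_wpM2r (powR_ge0 _ _) h))//.
 rewrite -powRD; last by rewrite (gt_eqF (ker_base s)) implybT.
 have h2 : s ^+ 2 + delta <= 2.
 by have : s ^+ 2 <= 1; [rewrite -[s ^+ 2]real_normK ?num_real// expr_le1|have := d1; lra].
 apply: (@le_trans _ _ (2 `^ (2^-1 - beta / 2))).
 apply: ge0_ler_powR; rewrite ?nnegrE ?(ltW (ker_base s))//; have := b1; lra.
 by rewrite -[leRHS]powRr1//; apply: ler_powR; have := b0; lra.
have h1 : -1 <= s + c by lra.
have h2 : 0 + c <= 1 by lra.
have := H (0 + c); have := H (s + c) h1 sc; rewrite !ler_norml => /andP[? ?] /(_ _ h2)/andP[|? ?]; lra.
Qed.

End kernel.

(** * Correlations and null hyperplanes *)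

Section translations.
Context (R : realType) (n : nat).
Local Notation leb := (lebesgue_rV R n).

Lemma ae_coord_neq0 (i : 'I_n) : {ae leb, forall x : 'rV[R]_n, x ord0 i != 0}.
pose A (j : 'I_n) : set R := if j == i then [set 0] else setT.
have mA j : measurable (A j) by rewrite /A; case: ifP => _ //; exact: measurable_set1.
have E : (fun x : 'rV[R]_n => x ord0 i) @^-1` [set 0] = [set x | forall j, A j (x ord0 j)].
 apply/seteqP; split => x /=; first by move=> x0 j; rewrite /A; case: eqP => // ->.
 by move=> /(_ i); rewrite /A eqxx.
exists ((fun x : 'rV[R]_n => x ord0 i) @^-1` [set 0]); split.
- exact: (meas_preimage (@measurable_coord R n i) (measurable_set1 0)).
- by rewrite E lebesgue_rV_box// (bigD1 i)//= /A eqxx lebesgue_measure_set1 mul0e.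
- by move=> x /= /negP; rewrite negbK => /eqP.
Qed.

Lemma measurable_addrV :
 measurable_fun setT (fun z : 'rV[R]_n * 'rV[R]_n => z.1 + z.2).
apply: measurable_fun_rV => i; under eq_fun do rewrite mxE.
apply: measurable_funD.
- exact: (mcompT (@measurable_coord R n i) measurable_fst).
- exact: (mcompT (@measurable_coord R n i) measurable_snd).
Qed.

Lemma integrable_correlation (a c : 'rV[R]_n -> R) :
 leb.-integrable setT (EFin \o a) -> leb.-integrable setT (EFin \o c) ->
 (leb \x leb)%E.-integrable setT (EFin \o (fun z => a z.2 * c (z.2 + z.1))).
move=> ia ic; have ma := integrable_mfun ia.
have mc := integrable_mfun ic.
have mf : measurable_fun setT (EFin \o (fun z : 'rV[R]_n * 'rV[R]_n => a z.2 * c (z.2 + z.1))).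
 apply/measurable_EFinP; apply: mfunM.
 exact: (mcompT ma measurable_snd).
 by apply: (mcompT mc); under eq_fun do rewrite addrC; exact: measurable_addrV.
apply/integrable21ltyP => //=.
have /integrableP[mEa alty] := ia; have /integrableP[mEc clty] := ic.
have E (x : 'rV[R]_n) : (\int[leb]_y `|(a x * c (x + y))%:E| = `|(a x)%:E| * \int[leb]_y `|(c y)%:E|)%E.
 rewrite -(ge0_integral_shift x (f := fun x => `|(c x)%:E|%E))//; last exact: mcompT.
 rewrite -ge0_integralZl//; last first.
 by apply: mcompT => //; exact: (mfun_shift _ mEc).
 by apply: eq_integral => y _; rewrite EFinM abseM addrC.
under eq_integral do rewrite E.
rewrite ge0_integralZr ?integral_ge0//; last exact: mcompT.
rewrite lte_mul_pinfty ?integral_ge0//.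
by rewrite ge0_fin_numE ?integral_ge0.
Qed.

(** Fubini and the substitution y = x + h: double integrals over pairs (x, y) become integrals over
    the increment h. *)
Lemma Rintegral_correlation (a c : 'rV[R]_n -> R) :
 leb.-integrable setT (EFin \o a) -> leb.-integrable setT (EFin \o c) ->
 \int[leb]_h \int[leb]_x (a x * c (x + h)) = \int[leb]_x a x * \int[leb]_x c x.
move=> ia ic; have mc := integrable_mfun ic.
rewrite (Rfubini (integrable_correlation ia ic))/=.
rewrite -RintegralZr//; apply: eq_Rintegral => x _.
rewrite -(Rintegral_shift x mc) -RintegralZl//; last first.
 exact: (integrable_shift x ic).
by apply: eq_Rintegral => y _; rewrite addrC.
Qed.

Lemma ae_le_Rintegral (f g : 'rV[R]_n -> R) :
 leb.-integrable setT (EFin \o f) -> leb.-integrable setT (EFin \o g) ->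
 {ae leb, forall x, f x <= g x} -> \int[leb]_x f x <= \int[leb]_x g x.
move=> i_f i_g fg; have mf := integrable_mfun i_f.
have mg := integrable_mfun i_g.
rewrite (ae_eq_Rint (g := fun x => Num.min (f x) (g x)))//.
- apply: le_Rintegral => //; last by move=> x _; rewrite ge_min lexx orbT.
 have ia := intgD measurableT (integrable_norm i_f) (integrable_norm i_g).
 apply: (intg_le measurableT _ ia); first exact: measurable_minr.
 by move=> x _; rewrite /= /Num.min; case: ifP => _; rewrite ?lerDl ?lerDr normr_ge0.
- exact: measurable_minr.
- by apply: filterS fg => x h _; rewrite (min_idPl h).
Qed.

(** The crude constant 2^k comes from iterating (x + y)^2 <= 2 x^2 + 2 y^2; a constant depending on
    n is all that is required. *)
Lemma sqr_sum_le (k : nat) (a : nat -> R) :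
 (\sum_(0 <= i < k) a i) ^+ 2 <= 2 ^+ k * \sum_(0 <= i < k) a i ^+ 2.
elim: k => [|k IH]; first by rewrite !big_geq// expr0n mulr0.
rewrite !big_nat_recr//= (exprS 2 k).
set x := \sum_(0 <= i < k) a i in IH *; set y := a k; set s := \sum_(0 <= i < k) _ in IH *.
have k1 : 1 <= 2 ^+ k :> R by rewrite exprn_ege1// ler1n.
have : (x + y) ^+ 2 <= 2 * x ^+ 2 + 2 * y ^+ 2.
 by rewrite -subr_ge0 (_ : _ - _ = (x - y) ^+ 2) ?sqr_ge0//; ring.
have : y ^+ 2 <= 2 ^+ k * y ^+ 2 by rewrite ler_peMl ?sqr_ge0.
rewrite -mulrA mulrDr; lra.
Qed.

End translations.

(** * A Poincare inequality on a cube with a kernel weight *)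

Section cube_poincare.
Context (R : realType) (n : nat).
Hypothesis n_gt0 : (0 < n)%N.
Local Notation leb := (lebesgue_rV R n).
Local Notation mu1 := (@lebesgue_measure R).
Local Notation Omega := (@unit_ball R n).
Let mO := @measurable_unit_ball R n.
Variables (phi : 'rV[R]_n -> R) (Phi : 'rV[R]_n -> 'rV[R]_n) (beta delta rho : R).
Hypotheses (b0 : 0 <= beta) (b1 : beta < 1) (d0 : 0 < delta) (d1 : delta <= 1).
Hypotheses (rho0 : 0 < rho) (rho1 : 2 * rho <= 1) (nrho : n%:R * rho ^+ 2 <= 1).
Hypotheses (iphi : int_ball R n phi) (iphi2 : int_ball R n (fun x => phi x ^+ 2)).
Hypothesis (iPhi : forall i, int_ball R n (fun x => Phi x ord0 i)).
Hypothesis (iPhi2 : forall i, int_ball R n (fun x => Phi x ord0 i ^+ 2)).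
Hypothesis (lphi : forall i, line_ftc phi (fun x => Phi x ord0 i) i).

Local Notation cube := (@box R n (fun=> - rho) (fun=> rho)).

Lemma cube_ball : cube `<=` Omega.
move=> x xQ; have h (i : 'I_n) : `|x ord0 i| < rho.
 by have := xQ i; rewrite in_itv/= ltr_norml.
have [c c0 hc] : exists2 c, c < rho & forall i, `|x ord0 i| <= c.
 exists (\big[Num.max/0]_i `|x ord0 i|); last by move=> i; exact: le_bigmax.
 by apply: bigmax_lt.
have c00 : 0 <= c by apply: le_trans (hc (Ordinal n_gt0)).
rewrite /unit_ball/= -(@expr_lt1 _ 2)// ?sqrtr_ge0//.
apply: le_lt_trans (sqr_enorm_le hc) _; apply: lt_le_trans nrho.
by rewrite ltr_pM2l ?ltr0n// ltr_pXn2r// nnegrE ltW.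
Qed.
(** The weight 1 / ker(x_i) depends on one coordinate. On a line in direction i, Cauchy-Schwarz then
    involves the integral of ker over a segment, bounded even for lines through the origin. *)
Let W (i : 'I_n) (x : 'rV[R]_n) := \1_cube x * (Phi x ord0 i ^+ 2 / ker beta delta (x ord0 i)).
Let mQ : measurable cube := measurable_box _ _.
Let mker (i : 'I_n) : measurable_fun setT (fun x : 'rV[R]_n => (ker beta delta (x ord0 i))^-1).
apply: measurable_funVr; apply: (@measurableT_comp _ _ _ _ _ _ (ker beta delta : measurableTypeR R -> R)).
 by apply: continuous_measurable_fun; exact: ker_continuous.
exact: measurable_coord.
Qed.
Let ker_inv_le (s : R) : -1 <= s -> s <= 1 -> `|(ker beta delta s)^-1| <= 2 / (1 - beta).
move=> s1 s2; have k0 := ker_gt0 b0 b1 d0 s.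
rewrite ger0_norm ?invr_ge0 ?(ltW k0)//.
have := ker_ge b0 d0 s; set y := (s ^+ 2 + delta) `^ _ => h.
have sd : s ^+ 2 + delta <= 2.
 by have : s ^+ 2 <= 1; [rewrite -[s ^+ 2]real_normK ?num_real// expr_le1// ler_norml s1|have := d1; lra].
have hy : 2^-1 <= y.
 rewrite /y powRN lef_pV2 ?posrE ?powR_gt0 ?ker_base//.
 apply: (@le_trans _ _ (2 `^ (beta / 2))).
 by apply: ge0_ler_powR; rewrite ?nnegrE ?(ltW (ker_base d0 s))// divr_ge0.
 by rewrite -[leRHS]powRr1//; apply: ler_powR; have := b1; lra.
rewrite -[2 / _]invrK invf_div lef_pV2 ?posrE// ?divr_gt0 ?subr_gt0//.
apply: le_trans h; rewrite ler_wpM2l// subr_ge0 ltW//.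
Qed.
Let iW (i : 'I_n) : leb.-integrable setT (EFin \o W i).
rewrite (_ : W i = (fun x => Phi x ord0 i ^+ 2 / ker beta delta (x ord0 i)) \_ cube); last first.
 by apply/funext => x; rewrite /W patchE indicE; case: ifP; rewrite ?mul1r ?mul0r.
apply: (intg_restrict leb _ mQ).1.
apply: (integrableMb (M := 2 / (1 - beta))) => //.
- exact: (integrableS mO _ cube_ball (iPhi2 i)).
- exact: mfunTS.
move=> x xQ; have := xQ i; rewrite in_itv/= => /andP[h1 h2]; apply: ker_inv_le; have := rho1; lra.
Qed.
Let W_ge0 (i : 'I_n) x : 0 <= W i x.
rewrite /W mulr_ge0// divr_ge0 ?sqr_ge0// ltW//; exact: ker_gt0.
Qed.
Let dist (i : 'I_n) (s : R) (x : 'rV[R]_n) : R :=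
 \1_cube x * \1_cube (x + s *: 'e_i) * (phi (x + s *: 'e_i) - phi x) ^+ 2.
Let cube_segment (i : 'I_n) (s t : R) x : 0 <= t <= s -> cube x -> cube (x + s *: 'e_i) ->
 cube (x + t *: 'e_i).
move=> /andP[t0 ts] xQ yQ j; have := xQ j; have := yQ j; rewrite !mxE !eqxx/= !in_itv/=.
case: eqP => _; rewrite ?mulr1n ?mulr0n ?mulr1 ?mulr0 ?addr0//.
by move=> /andP[a1 a2] /andP[a3 a4]; apply/andP; split; lra.
Qed.
Let dist_ge0 i s x : 0 <= dist i s x.
by rewrite /dist mulr_ge0 ?sqr_ge0// mulr_ge0. Qed.
(** Cauchy-Schwarz along the segment, with the bound 4 for the integral of the kernel. *)
Let dist_le (i : 'I_n) (s : R) : 0 < s ->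
 {ae leb, forall x, dist i s x <= 4 * \int[mu1]_(t in `[0, s]) W i (x + t *: 'e_i)}.
move=> s0; have H1 := ae_integrable_line i (ltW s0) (iPhi i).
have iWO : int_ball R n (W i) by apply: integrableS (iW i).
have H2 := ae_integrable_line i (ltW s0) iWO.
apply: (filterS3 _ _ H1 H2 (lphi i s0)) => x h1 h2 h3.
have rhs0 : 0 <= 4 * \int[mu1]_(t in `[0, s]) W i (x + t *: 'e_i).
 by rewrite mulr_ge0//; apply: Rintegral_ge0 => t _; exact: W_ge0.
have [xQ|xQ] := pselect (cube x); last by rewrite /dist indicE memNset// !mul0r.
have [yQ|yQ] := pselect (cube (x + s *: 'e_i)); last first.
 by rewrite /dist [X in _ * X * _]indicE memNset// mulr0 mul0r.
have xO := cube_ball xQ; have yO := cube_ball yQ.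
rewrite /dist !indicE !mem_set//= !mul1r h3//.
have xi : -1 <= x ord0 i /\ s + x ord0 i <= 1.
 have := xQ i; have := yQ i; rewrite !mxE !eqxx/= mulr1 !in_itv/= => /andP[? ?] /andP[? ?].
 by have := rho1; split; lra.
have kE (t : R) : t \in `[0, s] -> W i (x + t *: 'e_i) = Phi (x + t *: 'e_i) ord0 i ^+ 2 / ker beta delta (t + x ord0 i).
 rewrite in_itv/= => ts; rewrite /W indicE mem_set ?mul1r; last exact: (cube_segment ts xQ yQ).
 by rewrite !mxE !eqxx/= mulr1 [x ord0 i + t]addrC.
have -> : \int[mu1]_(t in `[0, s]) W i (x + t *: 'e_i) =
 \int[mu1]_(t in `[0, s]) (Phi (x + t *: 'e_i) ord0 i ^+ 2 / ker beta delta (t + x ord0 i)).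
 by apply: eq_Rintegral => t; rewrite inE => ts; exact: kE.
apply: weighted_cauchy_schwarz => //.
- by move=> t _; exact: ker_gt0.
- apply: intg_segment => t.
 apply: (continuous_comp (f := fun t => t + x ord0 i) (g := ker beta delta)); last exact: ker_continuous.
 by apply: cvgD; [exact: cvg_id|exact: cvg_cst].
- exact: h1.
- apply: eq_integrable (h2 xO yO) => // t; rewrite inE => ts; congr EFin; exact: kE.
- by apply: ker_integral => //; [exact: xi.1|exact: ltW|exact: xi.2].
Qed.
Let psi := phi \_ cube.
Let ipsi2 : leb.-integrable setT (EFin \o (fun x => psi x ^+ 2)).
rewrite (_ : (fun x => _) = (fun x => phi x ^+ 2) \_ cube); last first.
 by apply/funext => x; rewrite /psi !patchE; case: ifP => //; rewrite expr0n.
apply: (intg_restrict leb _ mQ).1; exact: (integrableS mO mQ cube_ball iphi2).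
Qed.
Let mpsi : measurable_fun setT psi.
have i0 := (intg_restrict leb phi mQ).1 (integrableS mO mQ cube_ball iphi).
exact: integrable_mfun i0.
Qed.
Let idist i s : leb.-integrable setT (EFin \o dist i s).
have i1 := intgD measurableT (integrable_shift (s *: 'e_i) ipsi2) ipsi2.
have i2 := intgZ 2 measurableT i1.
apply: (@intg_le _ _ _ leb setT (dist i s) _ measurableT _ i2).
 have m1 : measurable_fun setT (\1_cube : 'rV[R]_n -> R) by exact: measurable_indic.
 rewrite (_ : dist i s = (fun x => \1_cube x * \1_cube (x + s *: 'e_i) * (psi (x + s *: 'e_i) - psi x) ^+ 2)).
 apply: mfunM; first by apply: mfunM => //; exact: (mfun_shift _ m1).
 by apply: measurable_funX; apply: measurable_funB => //; exact: (mfun_shift _ mpsi).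
 apply/funext => x; rewrite /dist /psi !patchE !indicE; case: (x \in cube); last by rewrite !mul0r.
 by case: (_ \in cube); rewrite ?mulr0 ?mul0r.
move=> x _; rewrite ger0_norm ?dist_ge0// /dist /psi !patchE !indicE.
have sq (a b : R) : (a - b) ^+ 2 <= 2 * (a ^+ 2 + b ^+ 2).
 by rewrite -subr_ge0 (_ : _ - _ = (a + b) ^+ 2) ?sqr_ge0//; ring.
case: (x \in cube); case: (_ \in cube); rewrite ?mul0r ?mulr0 ?mul0r ?mul1r ?sq//.
all: by rewrite mulr_ge0// addr_ge0// sqr_ge0.
Qed.
Let dist_integral_pos (i : 'I_n) (s : R) : 0 < s -> s <= 1 -> \int[leb]_x dist i s x <= 4 * \int[leb]_x W i x.
move=> s0 s1; have iL := Rfubini_line i (ltW s0) (iW i).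
have H := ae_le_Rintegral (idist i s) (intgZ 4 measurableT iL) (dist_le i s0).
rewrite (le_trans H)//.
rewrite RintegralZl// ler_wpM2l//.
(* With psi = 1 the adjoint identity evaluates the integral of W over all segments as s times its
   integral. *)
have := Rintegral_line_swap i (ltW s0) (iW i) (measurable_cst (1 : R)) (fun x => _ : `|1 : R| <= 1).
under eq_Rintegral do rewrite mulr1.
move=> ->; last by rewrite normr1.
under eq_Rintegral do rewrite Rintegral_cst// mul1r lebesgue_segment ?(ltW s0)// .
rewrite RintegralZr//.
by rewrite ler_piMr//; apply: Rintegral_ge0 => x _; exact: W_ge0.
Qed.
Let dist_integral (i : 'I_n) (s : R) : `|s| <= 1 -> \int[leb]_x dist i s x <= 4 * \int[leb]_x W i x.
have W0 : 0 <= 4 * \int[leb]_x W i x by rewrite mulr_ge0//; apply: Rintegral_ge0 => x _; exact: W_ge0.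
rewrite ler_norml => /andP[s1 s2]; have [s0|s0|<-] := ltgtP 0 s.
- exact: dist_integral_pos.
- have md : measurable_fun setT (dist i (- s)).
 exact: integrable_mfun (idist i (- s)).
 rewrite (_ : dist i s = fun x => dist i (- s) (x + s *: 'e_i)).
 by rewrite Rintegral_shift//; apply: dist_integral_pos; lra.
 apply/funext => x; rewrite /dist scaleNr addrK [X in _ = X * _]mulrC; congr (_ * _).
 by rewrite -[RHS]sqrrN opprB.
- rewrite (_ : dist i 0 = fun=> 0); last by apply/funext => x; rewrite /dist scale0r addr0 subrr expr0n mulr0.
 by rewrite Rintegral_cst// mul0r.
Qed.
(** The path from x to x + h changes one coordinate at a time, and this is the displacement after k
    moves. A cube is a product, so it contains the whole path as soon as it contains both ends. *)
Let prefix (h : 'rV[R]_n) (k : nat) : 'rV[R]_n := \row_j (if (j < k)%N then h ord0 j else 0).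
Let prefixS h (i : 'I_n) : prefix h i.+1 = prefix h i + h ord0 i *: 'e_i.
apply/rowP => j; rewrite !mxE eqxx/= ltnS leq_eqVlt.
have [->|ji] := eqVneq j i; first by rewrite eqxx/= ltnn mulr1 add0r.
by rewrite (_ : (j == i :> nat) = false) ?orFb ?mulr0 ?addr0//; apply/negbTE.
Qed.
Let prefix0 h : prefix h 0 = 0. Proof. by apply/rowP => j; rewrite !mxE. Qed.
Let prefixn h : prefix h n = h. Proof. by apply/rowP => j; rewrite !mxE ltn_ord. Qed.
Let prefix_cube h k x : cube x -> cube (x + h) -> cube (x + prefix h k).
move=> xQ yQ j; have := xQ j; have := yQ j; rewrite !mxE; case: ifP => //.
by rewrite addr0.
Qed.

Variable B : set 'rV[R]_n.
Hypotheses (mB : measurable B) (BQ : B `<=` cube).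
Let pair (h x : 'rV[R]_n) : R := \1_B x * \1_B (x + h) * (phi (x + h) - phi x) ^+ 2.
Let pair_le h x : pair h x <= 2 ^+ n * \sum_(i < n) dist i (h ord0 i) (x + prefix h i).
have rhs0 : 0 <= 2 ^+ n * \sum_(i < n) dist i (h ord0 i) (x + prefix h i).
 by rewrite mulr_ge0 ?exprn_ge0// sumr_ge0// => i _; exact: dist_ge0.
have [xB|xB] := pselect (B x); last by rewrite /pair indicE memNset// !mul0r.
have [yB|yB] := pselect (B (x + h)); last first.
 by rewrite /pair [X in _ * X * _]indicE memNset// mulr0 mul0r.
rewrite /pair !indicE !mem_set//= !mul1r.
have := sqr_sum_le n (fun k => phi (x + prefix h k.+1) - phi (x + prefix h k)).
rewrite (telescope_sumr (fun k => phi (x + prefix h k)))// prefix0 prefixn addr0 => /le_trans; apply.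
rewrite ler_wpM2l ?exprn_ge0// big_mkord ler_sum// => i _.
rewrite /dist -addrA -prefixS !indicE !mem_set ?mul1r//; apply: prefix_cube; exact: BQ.
Qed.
Let imeas : leb.-integrable setT (EFin \o (\1_B : 'rV[R]_n -> R)).
rewrite (_ : (\1_B : 'rV[R]_n -> R) = (fun=> 1 : R) \_ B); last first.
 by apply/funext => x; rewrite patchE indicE; case: (x \in B).
apply: (intg_restrict leb _ mB).1; apply: (intg_bounded (M := 1)) => //.
 apply: le_lt_trans (lebesgue_box_lty (fun=> - rho) (fun=> rho)); apply: le_measure => //; exact: mem_set.
by move=> x _; rewrite normr1.
Qed.
Let chi := phi \_ B.
Let ichi : leb.-integrable setT (EFin \o chi).
apply: (intg_restrict leb _ mB).1; apply: (integrableS mO mB _ iphi) => x /BQ; exact: cube_ball. Qed.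
Let ichi2 : leb.-integrable setT (EFin \o (fun x => chi x ^+ 2)).
rewrite (_ : (fun x => _) = (fun x => phi x ^+ 2) \_ B); last first.
 by apply/funext => x; rewrite /chi !patchE; case: ifP => //; rewrite expr0n.
by apply: (intg_restrict leb _ mB).1; apply: (integrableS mO mB _ iphi2) => x /BQ; exact: cube_ball.
Qed.
Let pairE h x : pair h x = \1_B x * chi (x + h) ^+ 2 + chi x ^+ 2 * \1_B (x + h) - 2 * (chi x * chi (x + h)).
rewrite /pair /chi !patchE !indicE; case: (x \in B); case: (_ \in B);
 rewrite ?mul0r ?mulr0 ?mul1r ?mulr1 ?expr0n ?mulr0 ?addr0 ?subr0//=; ring.
Qed.
Let cst_W := 2 ^+ n * (4 * \sum_(i < n) \int[leb]_x W i x).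
Let ipair (h : 'rV[R]_n) : leb.-integrable setT (EFin \o pair h).
have i1 := intgD measurableT (integrable_shift h ichi2) ichi2.
have i2 := intgZ 2 measurableT i1.
apply: (@intg_le _ _ _ leb setT (pair h) _ measurableT _ i2).
 have m1 := integrable_mfun imeas.
 have m2 := integrable_mfun ichi.
 have m3 := integrable_mfun ichi2.
 rewrite (_ : pair h = fun x => \1_B x * chi (x + h) ^+ 2 + chi x ^+ 2 * \1_B (x + h) - 2 * (chi x * chi (x + h))); last first.
 by apply/funext => x; exact: pairE.
 apply: measurable_funB.
 apply: measurable_funD; apply: mfunM => //; first exact: (mfun_shift _ m3).
 exact: (mfun_shift _ m1).
 by apply: mfunM => //; apply: mfunM => //; exact: (mfun_shift _ m2).
move=> x _; rewrite ger0_norm /pair; last by rewrite mulr_ge0 ?sqr_ge0// mulr_ge0.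
rewrite /chi !patchE !indicE.
have sq (a b : R) : (a - b) ^+ 2 <= 2 * (a ^+ 2 + b ^+ 2).
 by rewrite -subr_ge0 (_ : _ - _ = (a + b) ^+ 2) ?sqr_ge0//; ring.
case: (x \in B); case: (_ \in B); rewrite ?mul0r ?mulr0 ?mul0r ?mul1r ?sq//.
all: by rewrite mulr_ge0// addr_ge0// sqr_ge0.
Qed.
Let pair_integral (h : 'rV[R]_n) : (forall j : 'I_n, `|h ord0 j| <= 1) -> \int[leb]_x pair h x <= cst_W.
move=> h1.
have id (i : 'I_n) := integrable_shift (prefix h i) (idist i (h ord0 i)).
apply: (@le_trans _ _ (\int[leb]_x (2 ^+ n * \sum_(i < n) dist i (h ord0 i) (x + prefix h i)))).
 apply: le_Rintegral => //.
 by apply: intgZ => //; exact: intg_bigsum.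
rewrite RintegralZl//; last exact: intg_bigsum.
rewrite Rintegral_bigsum// ler_wpM2l ?exprn_ge0// mulr_sumr ler_sum// => i _.
rewrite Rintegral_shift ?dist_integral//.
exact: integrable_mfun (idist i (h ord0 i)).
Qed.
Let cst_W_ge0 : 0 <= cst_W.
rewrite /cst_W !mulr_ge0 ?exprn_ge0// sumr_ge0// => i _; apply: Rintegral_ge0 => x _; exact: W_ge0.
Qed.

Local Notation H := (@box R n (fun=> -1) (fun=> 1)).

(** The left side is the integral of (phi(y) - phi(x))^2 over pairs of points of B, organized by the
    increment h = y - x. Coordinate paths between points of B may leave B but not the cube, hence
    the gradient is integrated over the cube. The box H contains all increments because 2 rho <=
    1. *)
Theorem poincare_pair :
 2 * (\int[leb]_x \1_B x) * \int[leb]_(x in B) phi x ^+ 2 - 2 * (\int[leb]_(x in B) phi x) ^+ 2 <=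
 (\int[leb]_x \1_H x) * (2 ^+ n * (4 * \sum_(i < n) \int[leb]_(x in cube) (Phi x ord0 i ^+ 2 / ker beta delta (x ord0 i)))).
have i1 := integrable_correlation imeas ichi2; have i2 := integrable_correlation ichi2 imeas.
have i3 := integrable_correlation ichi ichi.
pose P (z : 'rV[R]_n * 'rV[R]_n) := \1_B z.2 * chi (z.2 + z.1) ^+ 2 + chi z.2 ^+ 2 * \1_B (z.2 + z.1)
 - 2 * (chi z.2 * chi (z.2 + z.1)).
have i12 := intgD measurableT i1 i2.
have i3' := intgZ 2 measurableT i3.
have iP : (leb \x leb)%E.-integrable setT (EFin \o P) by exact: (intgB measurableT i12 i3').
have EP : \int[leb]_h \int[leb]_x pair h x = \int[(leb \x leb)%E]_z P z.
 by rewrite (Rfubini1 iP); apply: eq_Rintegral => h _; apply: eq_Rintegral => x _; rewrite pairE.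
have e1 : \int[leb]_x chi x ^+ 2 = \int[leb]_(x in B) phi x ^+ 2.
 rewrite -[RHS]Rintegral_restrict; apply: eq_Rintegral => x _.
 by rewrite /chi !patchE; case: ifP => //; rewrite expr0n.
have e2 : \int[leb]_x chi x = \int[leb]_(x in B) phi x by rewrite Rintegral_restrict.
have E : \int[leb]_h \int[leb]_x pair h x =
 2 * (\int[leb]_x \1_B x) * \int[leb]_(x in B) phi x ^+ 2 - 2 * (\int[leb]_(x in B) phi x) ^+ 2.
 rewrite EP /P RintegralB// RintegralD// RintegralZl//.
 rewrite (Rfubini1 i1) (Rfubini1 i2) (Rfubini1 i3)/=.
 rewrite (Rintegral_correlation imeas ichi2) (Rintegral_correlation ichi2 imeas) (Rintegral_correlation ichi ichi).
 rewrite e1 e2; ring.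
have iH : leb.-integrable setT (EFin \o (\1_H : 'rV[R]_n -> R)).
 have mH : measurable H by exact: measurable_box.
 rewrite (_ : (\1_H : 'rV[R]_n -> R) = (fun=> 1 : R) \_ H); last first.
 by apply/funext => x; rewrite patchE indicE; case: (x \in H).
 apply: (intg_restrict leb _ mH).1; apply: (intg_bounded (M := 1)) => //.
 exact: lebesgue_box_lty.
 by move=> x _; rewrite normr1.
have eW i : \int[leb]_x W i x = \int[leb]_(x in cube) (Phi x ord0 i ^+ 2 / ker beta delta (x ord0 i)).
 by rewrite [RHS]Rintegral_indicM.
rewrite -E; under eq_bigr do rewrite -eW.
rewrite -/cst_W -RintegralZr//; apply: le_Rintegral => //.
- have := integrable_Rintegral1 iP; apply: eq_integrable => // h _; congr EFin.
 by apply: eq_Rintegral => x _; rewrite pairE.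
- by rewrite (_ : (fun x => _) = (fun x => cst_W * \1_H x)); [exact: intgZ|apply/funext => x; rewrite mulrC].
move=> h _; have [hH|hH] := pselect (H h).
 rewrite indicE mem_set// mul1r; apply: pair_integral => j.
 by have := hH j; rewrite in_itv/= => /andP[? ?]; rewrite ler_norml !ltW.
rewrite indicE memNset// mul0r (@eq_Rintegral _ _ _ _ _ (cst 0)) ?Rintegral_cst ?mul0r// => x _.
have [xB|xB] := pselect (B x); last by rewrite /pair indicE memNset// !mul0r.
have [yB|yB] := pselect (B (x + h)); last first.
 by rewrite /pair [X in _ * X * _]indicE memNset// mulr0 mul0r.
exfalso; apply: hH => j; have := BQ xB j; have := BQ yB j; rewrite !mxE !in_itv/= => /andP[? ?] /andP[? ?].
by have rr := rho1; apply/andP; split; lra.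
Qed.

End cube_poincare.

(** * Weak gradients: uniqueness, sums, cutoffs, constants *)

Section weak_gradients.
Context (R : realType) (n : nat).
Hypothesis n_gt0 : (0 < n)%N.
Local Notation leb := (lebesgue_rV R n).
Local Notation mu1 := (@lebesgue_measure R).
Local Notation Omega := (@unit_ball R n).
Implicit Types u v w : 'rV[R]_n -> R.
Implicit Types G H : 'rV[R]_n -> 'rV[R]_n.
Let mO := @measurable_unit_ball R n.
Let Olty := ball_lty R n.

Lemma ae_forall_ord (P : 'I_n -> 'rV[R]_n -> Prop) :
 (forall i, {ae leb, forall x, P i x}) -> {ae leb, forall x, forall i, P i x}.
move=> aP; have H (k : nat) : {ae leb, forall x, forall i : 'I_n, val i = k -> P i x}.
 have [[i ik]|no] := pselect (exists i : 'I_n, val i = k).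
 by apply: filterS (aP i) => x Px j; rewrite -ik => /val_inj ->.
 by apply: aeW => x i ik; exfalso; apply: no; exists i.
by apply: filterS (ae_foralln H) => x Px i; exact: (Px (val i)).
Qed.

Lemma weak_gradient_ae u G H : weak_gradient u G -> weak_gradient u H ->
 {ae leb, forall x, Omega x -> G x = H x}.
move=> wG wH; apply: filterS (ae_forall_ord (fun i => weak_gradient_unique i wG wH)) => x h Ox.
by apply/rowP => i; exact: h.
Qed.

Lemma gradP u G : weak_gradient u G -> weak_gradient u (grad u).
by move=> wG; apply: (xgetPex (fun=> 0)); exists G. Qed.

Lemma integrable_powR_L1 (f : 'rV[R]_n -> R) (p : R) : 1 <= p -> measurable_fun Omega f ->
 int_ball R n (fun x => `|f x| `^ p) -> int_ball R n f.
move=> p1 mf fi.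
have i1 : int_ball R n (fun=> 1 : R).
 by apply: (intg_bounded (M := 1)) => // x _; rewrite normr1.
apply: (intg_le mO mf (intgD mO i1 fi)) => x _.
have [f1|f1] := leP `|f x| 1; first by rewrite (le_trans f1)// lerDl powR_ge0.
by rewrite -[leLHS]powRr1// (le_trans (ler_powR (ltW f1) p1))// lerDr.
Qed.

Lemma integrable_lty (f : 'rV[R]_n -> R) : measurable_fun Omega f -> (forall x, 0 <= f x) ->
 (\int[leb]_(x in Omega) (f x)%:E < +oo)%E -> int_ball R n f.
move=> mf f0 h; apply/integrableP; split; first exact/measurable_EFinP.
by under eq_integral do rewrite /= ger0_norm//.
Qed.

Lemma integral_lty (f : 'rV[R]_n -> R) : (forall x, 0 <= f x) ->
 int_ball R n f -> (\int[leb]_(x in Omega) (f x)%:E < +oo)%E.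
move=> f0 /integrableP[_]; rewrite (eq_integral (fun x => (f x)%:E))// => x _.
by rewrite /= ger0_norm.
Qed.

Lemma mfun_enorm_comp G : (forall i, measurable_fun Omega (fun x => G x ord0 i)) ->
 measurable_fun Omega (fun x => enorm (G x)).
by move=> mG; apply: (mcompT (@measurable_enorm R n)); exact: measurable_fun_rV. Qed.

(** [grad] is a chosen weak gradient; the integrability of some weak gradient passes to it by
    almost-everywhere uniqueness. Finite volume then turns p-integrability into integrability. *)
Lemma W1P p u : 1 <= p -> W1 p u -> [/\ measurable_fun Omega u,
 int_ball R n (fun x => `|u x| `^ p),
 int_ball R n u, weak_gradient u (grad u) &
 int_ball R n (fun x => enorm (grad u x) `^ p) /\
 forall i, int_ball R n (fun x => grad u x ord0 i)].
move=> p1 [mu iu [G wG iG]].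
have iup : int_ball R n (fun x => `|u x| `^ p).
 apply: (integrable_lty _ _ iu) => [|x]; last exact: powR_ge0.
 by apply: (mcompT (measurable_powR _)); exact: mcompT.
have wg := gradP wG; have [mG _ _] := wG; have [mg _ _] := wg.
have meg := mfun_enorm_comp mg; have meG := mfun_enorm_comp mG.
have igp : int_ball R n (fun x => enorm (grad u x) `^ p).
 apply: integrable_lty => [|x|]; [exact: (mcompT (measurable_powR _))|exact: powR_ge0|].
 rewrite (ge0_ae_eq_integral (g := fun x => (enorm (G x) `^ p)%:E))//.
 - mfun.
 - mfun.
 - by move=> x _; rewrite lee_fin powR_ge0.
 - by move=> x _; rewrite lee_fin powR_ge0.
 - by apply: filterS (weak_gradient_ae wg wG) => x h Ox; rewrite h.
have ig : int_ball R n (fun x => enorm (grad u x)).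
 apply: (integrable_powR_L1 p1) => //.
 by apply: eq_integrable igp => // x _; rewrite /= ger0_norm// sqrtr_ge0.
split => //; first exact: (integrable_powR_L1 p1).
split => // i.
by apply: (intg_le mO _ ig) => // x _; exact: coord_le_enorm.
Qed.

Lemma derive0_far (psi : 'rV[R]_n -> R) (i : 'I_n) (x : 'rV[R]_n) (e : R) : 0 < e ->
 (forall y, enorm (y - x) < e -> psi y = 0) -> 'D_'e_i psi x = 0.
move=> e0 psi0; suff : is_derive x 'e_i psi 0 by move=> [_].
apply/is_derive_line; apply: (is_derive_near0 e0) => h; rewrite subr0 => he.
by apply: psi0; rewrite addrK enormZ enorm_delta mulr1.
Qed.

Lemma test_function_facts phi : test_function phi -> [/\ continuous phi,
 class_C 1 phi, forall i : 'I_n, continuous (fun x => 'D_'e_i phi x) &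
 exists2 r : R, 0 < r < 1 & forall x, r <= enorm x -> phi x = 0 /\ forall i : 'I_n, 'D_'e_i phi x = 0].
move=> [Ck [K [cK KO K0]]]; split; [by case: (Ck 0%N)|exact: Ck|by move=> i; have [_ /(_ i)[_ []]] := Ck 1%N|].
have [r r01 Kr] : exists2 r : R, 0 < r < 1 & forall x, K x -> enorm x < r.
 have [->|/set0P ne] := eqVneq K set0.
 by exists 2^-1 => //; apply/andP; split; lra.
 have cs : {within K, continuous (@enorm R n)} by apply: continuous_subspaceT; exact: enorm_continuous.
 have [z zK zmax] := compact_EVT_max ne cK cs.
 have z1 : enorm z < 1 := KO _ (set_mem zK).
 have z0 : 0 <= enorm z by exact: sqrtr_ge0.
 exists ((enorm z + 1) / 2) => [|x xK]; first by apply/andP; split; lra.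
 by have := zmax x (mem_set xK); lra.
have /andP[r0 r1] := r01.
exists ((r + 1) / 2) => [|x rx]; first by apply/andP; split; lra.
have H y : r <= enorm y -> phi y = 0 by move=> ry; apply: K0 => /Kr; rewrite ltNge ry.
split; first by apply: H; lra.
move=> i; apply: (@derive0_far _ _ _ ((1 - r) / 2)); first lra.
move=> y yx; apply: H; have := enorm_dist y x; rewrite ler_norml => /andP[]; lra.
Qed.

Lemma weak_gradientD u G w H (t : R) :
 int_ball R n u -> (forall i, int_ball R n (fun x => G x ord0 i)) ->
 int_ball R n w -> (forall i, int_ball R n (fun x => H x ord0 i)) ->
 weak_gradient u G -> weak_gradient w H ->
 weak_gradient (fun x => u x + t * w x) (fun x => G x + t *: H x).
move=> iu iG iw iH [mG lG wG] [mH lH wH].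
have E i : (fun x => (G x + t *: H x) ord0 i) = (fun x => G x ord0 i + t * H x ord0 i).
 by apply/funext => x; rewrite !mxE.
split => [i|i K cK KO|i phi tphi].
- by rewrite E; apply: measurable_funD => //; exact: mfunM.
- have mK : measurable K.
 have /compact_closed cl := cK; rewrite -[K]setCK; apply: measurableC; apply: measurable_open_rV.
 by rewrite openC; apply: cl; exact: norm_hausdorff.
 rewrite [X in leb.-integrable _ X](_ : _ = EFin \o (fun x => G x ord0 i + t * H x ord0 i)); last first.
 by apply/funext => x; rewrite /= !mxE.
 apply: (@intgD _ _ _ _ K (fun x => G x ord0 i) (fun x => t * H x ord0 i)) => //; first exact: lG.
 by apply: (@intgZ _ _ _ _ K t (fun x => H x ord0 i)) => //; exact: lH.
have [cphi _ cD _] := test_function_facts tphi.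
have [M1 b1] := continuous_ball_bounded cphi; have [M2 b2] := continuous_ball_bounded (cD i).
have m1 := @measurable_funTS _ _ _ _ Omega _ (measurable_continuous_rV cphi).
have m2 := @measurable_funTS _ _ _ _ Omega _ (measurable_continuous_rV (cD i)).
have I1 f : int_ball R n f -> int_ball R n (fun x => f x * phi x).
 by move=> fi; exact: (integrableMb (M := M1)).
have I2 f : int_ball R n f -> int_ball R n (fun x => f x * 'D_'e_i phi x).
 by move=> fi; exact: (integrableMb (M := M2)).
transitivity (\int[leb]_(x in Omega) (u x * 'D_'e_i phi x) + t * \int[leb]_(x in Omega) (w x * 'D_'e_i phi x)).
 rewrite -RintegralZl//; last exact: I2.
 rewrite -RintegralD//; [|exact: I2|by apply: intgZ => //; exact: I2].
 by apply: eq_Rintegral => x _; ring.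
rewrite wG// wH//.
transitivity (- (\int[leb]_(x in Omega) (G x ord0 i * phi x) + t * \int[leb]_(x in Omega) (H x ord0 i * phi x))).
 by ring.
congr (- _).
rewrite -RintegralZl//; last exact: (I1 (fun x => H x ord0 i)).
rewrite -RintegralD//; last 2 first.
- exact: (I1 (fun x => G x ord0 i)).
- by apply: intgZ => //; exact: (I1 (fun x => H x ord0 i)).
by apply: eq_Rintegral => x _; rewrite !mxE; ring.
Qed.

(** A smooth cutoff, constant for t <= a and 0 for t >= b, with derivative minus a bump. Radially it
    is a test direction for the Euler-Lagrange equation, and it replaces the constant 1 where
    compact support is required. *)
Definition hat (eps a b : R) (t : R) : R := \int[mu1]_x bump eps a b x - primitive (bump eps a b) t.

Variable eps : R.
Hypothesis eps0 : 0 < eps.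

Lemma is_derive_hat a b (t : R) : is_derive t 1 (hat eps a b) (- bump eps a b t).
have d := is_derive_primitive t (bump_integrable a b eps0) (@bump_continuous R eps eps0 a b).
by apply: (is_derive_eq (is_deriveB (is_derive_cst _ t 1) d)); rewrite sub0r.
Qed.

Lemma hat_left a b t : t <= a -> hat eps a b t = \int[mu1]_x bump eps a b x.
by move=> ta; rewrite /hat (primitive_bump a b t eps0).1// subr0. Qed.

Lemma hat_right a b t : b <= t -> hat eps a b t = 0.
by move=> bt; rewrite /hat (primitive_bump a b t eps0).2// subrr. Qed.

Lemma hat_bounded a b : exists2 M, 1 <= M & forall t, `|hat eps a b t| <= M.
have ch : continuous (hat eps a b) by move=> t; exact: derive_continuous (is_derive_hat a b t).
have [M hM] := segment_bounded a b ch.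
exists (Num.max 1 (Num.max M `|\int[mu1]_x bump eps a b x|)); first by rewrite le_max lexx.
move=> t; rewrite !le_max; have [ta|ta] := leP t a; first by rewrite hat_left// lexx !orbT.
have [bt|tb] := leP b t; first by rewrite hat_right// normr0 ler01.
by rewrite hM ?orbT// in_itv/= !ltW.
Qed.

(** Here phi is the function being integrated along lines and the radial hat is the Lipschitz factor
    of [radial_ibp_coord]. *)
Lemma radial_test_dual (a b : R) (phi : 'rV[R]_n -> R) (i : 'I_n) : b < 1 -> test_function phi ->
 \int[leb]_(x in Omega) (hat eps a b (enorm x) * 'D_'e_i phi x) =
 - \int[leb]_(x in Omega) ((- bump eps a b (enorm x) * normalize x ord0 i) * phi x).
move=> b1 tphi; have [cphi C1 cD _] := test_function_facts tphi.
have [M M1 hM] := hat_bounded a b.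
have cb := @bump_continuous R eps eps0 a b.
apply/eqP; rewrite -eqr_oppLR; apply/eqP; apply/esym.
have ip := intg_ball cphi; have iD := intg_ball (cD i).
transitivity (\int[leb]_(x in Omega) (phi x * (- bump eps a b (enorm x) * normalize x ord0 i))).
 by apply: eq_Rintegral => x _; rewrite mulrC.
have H : \int[leb]_(x in Omega) (phi x * (- bump eps a b (enorm x) * normalize x ord0 i)) =
 - \int[leb]_(x in Omega) ('D_'e_i phi x * hat eps a b (enorm x)).
 apply: (@radial_ibp_coord R n n_gt0 phi (fun x => 'D_'e_i phi x) i (hat eps a b) (fun t => - bump eps a b t) M b) => //.
 - exact: class_C_line_ftc.
 - by move=> t; exact: is_derive_hat.
 - by apply: continuous_measurable_fun => t; apply: cvgN; exact: cb.
 - by move=> t; rewrite normrN ger0_norm ?bump_ge0// (le_trans _ M1)// bump_le1.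
 - by move=> t bt; apply: hat_right; exact: ltW.
by rewrite H; congr (- _); apply: eq_Rintegral => x _; rewrite mulrC.
Qed.

Lemma weak_gradient_bounded (w : 'rV[R]_n -> R) (H : 'rV[R]_n -> 'rV[R]_n) (M : R) :
 (forall i, measurable_fun setT (fun x => H x ord0 i)) -> (forall x i, `|H x ord0 i| <= M) ->
 (forall i phi, test_function phi -> \int[leb]_(x in Omega) (w x * 'D_'e_i phi x) =
 - \int[leb]_(x in Omega) (H x ord0 i * phi x)) ->
 weak_gradient w H /\ forall i, int_ball R n (fun x => H x ord0 i).
move=> mH HM wH.
have I i : int_ball R n (fun x => H x ord0 i).
 by apply: (intg_bounded (M := M)) => //; exact: mfunTS.
split => //; split => // [i|i K cK KO]; first exact: mfunTS.
apply: integrableS (I i) => //.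
rewrite -[K]setCK; apply: measurableC; apply: measurable_open_rV.
by rewrite openC; apply: compact_closed => //; exact: norm_hausdorff.
Qed.

Lemma weak_gradient_hat (a b : R) : b < 1 ->
 weak_gradient (fun x => hat eps a b (enorm x)) (fun x : 'rV[R]_n => - bump eps a b (enorm x) *: normalize x).
move=> b1; have cb := @bump_continuous R eps eps0 a b.
have mb : borel R (bump eps a b) by exact: continuous_measurable_fun.
apply: (weak_gradient_bounded (M := 1) _ _ _).1 => [i|x i|i phi tphi].
- under eq_fun do rewrite mxE; apply: mfunM; last exact: mfun_normalize.
 mfun.
- have b1' : `|bump eps a b (enorm x)| <= 1 by rewrite ger0_norm ?bump_ge0 ?bump_le1.
 rewrite mxE normrM normrN; apply: mulr_ile1; rewrite ?normr_ge0//.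
 exact: normalize_le1.
by rewrite radial_test_dual//; congr (- _); apply: eq_Rintegral => x _; congr (_ * _); rewrite [RHS]mxE.
Qed.

(** The integral of a derivative of phi vanishes: use a radial cutoff that is constant where phi
    lives and whose derivative is supported where phi is 0. *)
Lemma weak_gradient_cst (c : R) : weak_gradient (fun=> c) (fun=> 0 : 'rV[R]_n).
apply: (weak_gradient_bounded (M := 0) _ _ _).1 => [i|x i|i phi tphi].
- by under eq_fun do rewrite mxE; exact: measurable_cst.
- by rewrite mxE normr0.
have [cphi C1 cD [r /andP[r0 r1] phi0]] := test_function_facts tphi.
pose b := (r + 1) / 2; pose B := \int[mu1]_x bump eps r b x.
have rb : r < b by rewrite /b; lra.
have B0 : 0 < B by exact: bump_gt0.
have b1 : b < 1 by rewrite /b; lra.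
have := radial_test_dual r i b1 tphi.
rewrite [X in _ = - X](_ : _ = 0).
 rewrite oppr0 [X in X = _ -> _](_ : _ = B * \int[leb]_(x in Omega) ('D_'e_i phi x)).
 move=> /eqP; rewrite mulf_eq0 (gt_eqF B0)/= => /eqP E.
 rewrite RintegralZl ?E ?mulr0//; last exact: (intg_ball (cD i)).
 rewrite (@eq_Rintegral _ _ _ _ _ (cst 0)) ?Rintegral_cst ?mul0r ?oppr0// => x _.
 by rewrite mxE mul0r.
 rewrite -RintegralZl//; last exact: (intg_ball (cD i)).
 apply: eq_Rintegral => x _; have [rx|xr] := leP r (enorm x).
 by rewrite (phi0 x rx).2 !mulr0.
 by rewrite hat_left// ltW.
rewrite (@eq_Rintegral _ _ _ _ _ (cst 0)) ?Rintegral_cst ?mul0r// => x _.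
have [rx|xr] := leP r (enorm x); first by rewrite (phi0 x rx).1 mulr0.
by rewrite bump_eq0 ?oppr0 ?mul0r// in_itv/= [r < _]ltNge (ltW xr).
Qed.

End weak_gradients.

(** * The Euler-Lagrange equation in radial directions *)

Section euler_lagrange.
Context (R : realType) (n : nat).
Hypothesis n_gt0 : (0 < n)%N.
Local Notation leb := (lebesgue_rV R n).
Local Notation Omega := (@unit_ball R n).
Let mO := @measurable_unit_ball R n.
Let Olty := ball_lty R n.

Lemma norm_spow_le (p s : R) : 2 <= p -> `|spow p s| <= 1 + `|s| `^ p.
move=> p2; rewrite norm_spow//; have [s1|s1] := leP `|s| 1.
 by rewrite -[leLHS]addr0 lerD ?powR_ge0// powR_le_one//; lra.
by rewrite -[leLHS]add0r lerD// ler_powR ?ltW//; lra.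
Qed.

Lemma enorm_normalize (x : 'rV[R]_n) : x != 0 -> enorm (normalize x) = 1.
move=> x0; rewrite /normalize enormZ ger0_norm ?invr_ge0 ?sqrtr_ge0// mulVf// gt_eqF// enorm_gt0//.
Qed.

Lemma integrable_spow (p : R) (f : 'rV[R]_n -> R) : 2 <= p -> measurable_fun Omega f ->
 int_ball R n (fun x => `|f x| `^ p) ->
 int_ball R n (fun x => spow p (f x)).
move=> p2 mf fi.
have i1 : int_ball R n (fun=> 1 : R).
 by apply: (intg_bounded (M := 1)) => // x _; rewrite normr1.
apply: (intg_le mO _ (intgD mO i1 fi)) => [|x _]; last exact: norm_spow_le.
apply: mfunM => //.
by apply: (mcompT (measurable_powR _)); exact: mcompT.
Qed.

(** Raise the quotient inequality to the power q / p: A e(t)^(q/p) - j(t) is nonnegative and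
    vanishes at t = 0, so its derivative there is zero. This form makes sense also where j(t) =
    0. *)
Lemma quotient_critical (p q A d1 d3 : R) (e j : R -> R) : 0 < p -> 0 < q -> 0 < A ->
 is_derive (0 : R) 1 e d1 -> is_derive (0 : R) 1 j d3 -> e 0 = 1 -> j 0 = A ->
 (forall t, 0 <= e t) -> (forall t, 0 <= j t) ->
 (forall t, 0 < j t -> 1 / A `^ (p / q) <= e t / j t `^ (p / q)) ->
 A * (q / p * d1) = d3.
move=> p0 q0 A0 De Dj e0 j0 ege jge h.
have qp0 : 0 < q / p by rewrite divr_gt0.
have main t : 0 <= A * e t `^ (q / p) - j t.
 rewrite subr_ge0; have [/eqP->|jt] := boolP (j t == 0); first by rewrite mulr_ge0 ?powR_ge0// ltW.
 have jt0 : 0 < j t by rewrite lt_neqAle eq_sym jt jge.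
 have Apq : 0 < A `^ (p / q) by exact: powR_gt0.
 have jpq : 0 < j t `^ (p / q) by exact: powR_gt0.
 have := h t jt0; rewrite div1r ler_pdivlMr// mulrC ler_pdivrMr// => h'.
 have /(ge0_ler_powR (ltW qp0)) : j t `^ (p / q) <= e t * A `^ (p / q) by [].
 rewrite !nnegrE powR_ge0 mulr_ge0 ?ege ?powR_ge0// => /(_ isT isT).
 rewrite powRM ?ege ?powR_ge0// -!powRrM.
 have -> : p / q * (q / p) = 1 by field; rewrite !gt_eqF.
 by rewrite !powRr1 ?(ltW A0) ?jge// mulrC.
have Dpow : is_derive (e 0) 1 (fun s => s `^ (q / p)) (q / p * e 0 `^ (q / p - 1)).
 by apply: is_derive1_powR; rewrite e0.
have Dc := is_derive1_comp (f := fun s => s `^ (q / p)) (g := e) Dpow De.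
have D : is_derive (0 : R) 1 (fun t => A * e t `^ (q / p) - j t) (A * (q / p * d1) - d3).
 apply: (is_derive_eq (is_deriveB (is_deriveZ A Dc) Dj)).
 by rewrite e0 powR1 mulr1 scalerE.
have := derive_min0 D _ main; rewrite e0 powR1 mulr1 j0 subrr => /(_ erefl) /eqP.
by rewrite subr_eq0 => /eqP.
Qed.

Lemma nonzero_integral (rho w : 'rV[R]_n -> R) (q : R) : q != 0 ->
 measurable_fun Omega (fun x => rho x * `|w x| `^ q) ->
 0 < \int[leb]_(x in Omega) (rho x * `|w x| `^ q) -> nonzero w.
move=> q0 mw h aw; move: h; rewrite (ae_eq_Rint (g := cst 0))//.
 by rewrite Rintegral_cst// mul0r ltxx.
by apply: filterS aw => x h Ox; rewrite h// normr0 powR0 ?mulr0.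
Qed.

(** The competitors v + t z(|x|) remain radial. Bounded z and dz permit differentiation of the
    energies under the integral. *)
Theorem euler_lagrange (p q alpha M : R) (v : 'rV[R]_n -> R) (g z dz : R -> R) :
 2 <= p -> p < q -> 0 < alpha ->
 radial_minimizer p q alpha v -> W1_energy p v = 1 ->
 int_ball R n (fun x : 'rV[R]_n => enorm x `^ alpha * `|v x| `^ q) ->
 borel R g ->
 {ae leb, forall x : 'rV[R]_n, Omega x -> grad v x = g (enorm x) *: normalize x} ->
 borel R z -> borel R dz ->
 (forall t, `|z t| <= M) -> (forall t, `|dz t| <= M) ->
 weak_gradient (fun x : 'rV[R]_n => z (enorm x)) (fun x : 'rV[R]_n => dz (enorm x) *: normalize x) ->
 let A := \int[leb]_(x in Omega) (enorm x `^ alpha * `|v x| `^ q) in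
 0 < A /\
 int_ball R n (fun x : 'rV[R]_n => spow p (g (enorm x)) * dz (enorm x)) /\
 int_ball R n (fun x : 'rV[R]_n => spow p (v x) * z (enorm x)) /\
 int_ball R n (fun x : 'rV[R]_n => enorm x `^ alpha * (spow q (v x) * z (enorm x))) /\
 A * (\int[leb]_(x in Omega) (spow p (g (enorm x)) * dz (enorm x)) +
 \int[leb]_(x in Omega) (spow p (v x) * z (enorm x))) =
 \int[leb]_(x in Omega) (enorm x `^ alpha * (spow q (v x) * z (enorm x))).
move=> p2 pq a0 [[Wv [f vf]] nzv minv] E1 iJ mg Gv mz mdz zM dzM wz A.
have p1 : 1 <= p by lra.
have q2 : 2 <= q by lra.
have [mv ivp iv wgv [igp ig]] := W1P p1 Wv.
have men := @measurable_enorm R n.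
have mge := mfunTS (mcompT mg men) : measurable_fun Omega (fun x => g (enorm x)).
have mze := mfunTS (mcompT mz men) : measurable_fun Omega (fun x => z (enorm x)).
have mdze := mfunTS (mcompT mdz men) : measurable_fun Omega (fun x => dz (enorm x)).
have mrho : measurable_fun Omega (fun x => enorm x `^ alpha).
 mfun.
have irho : int_ball R n (fun x => enorm x `^ alpha).
 apply: (intg_bounded (M := 1)) => // x Ox; rewrite ger0_norm ?powR_ge0//.
 by apply: powR_le_one; rewrite ?sqrtr_ge0// ltW.
have i1 : int_ball R n (fun=> 1 : R).
 by apply: (intg_bounded (M := 1)) => // x _; rewrite normr1.
have igp' : int_ball R n (fun x => 1 * `|g (enorm x)| `^ p).
 apply: integrable_lty; [|move=> x|].
 - by apply: mfunM => //; apply: (mcompT (measurable_powR _)); exact: mcompT.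
 - by rewrite mul1r powR_ge0.
 rewrite (ge0_ae_eq_integral (g := fun x => (enorm (grad v x) `^ p)%:E))//.
 - by apply: (integral_lty _ igp) => x; exact: powR_ge0.
 - apply/measurable_EFinP; apply: mfunM => //.
 by apply: (mcompT (measurable_powR _)); exact: mcompT.
 - exact: measurable_int igp.
 - by move=> x _; rewrite lee_fin powR_ge0.
 - by apply: filterS2 (ae_neq0 R n_gt0) Gv => x x0 h Ox; rewrite h// enormZ enorm_normalize// mulr1 mul1r.
have ivp' : int_ball R n (fun x => 1 * `|v x| `^ p).
 by under [X in EFin \o X]eq_fun do rewrite mul1r.
pose e1 t := \int[leb]_(x in Omega) (1 * `|g (enorm x) + t * dz (enorm x)| `^ p).
pose e2 t := \int[leb]_(x in Omega) (1 * `|v x + t * z (enorm x)| `^ p).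
pose j t := \int[leb]_(x in Omega) (enorm x `^ alpha * `|v x + t * z (enorm x)| `^ q).
have m1 : measurable_fun Omega (fun=> 1 : R) by [].
have r1 (x : 'rV[R]_n) : Omega x -> 0 <= (1 : R) by [].
have rr (x : 'rV[R]_n) : Omega x -> 0 <= enorm x `^ alpha by rewrite powR_ge0.
have zM' (x : 'rV[R]_n) : Omega x -> `|z (enorm x)| <= M by [].
have dzM' (x : 'rV[R]_n) : Omega x -> `|dz (enorm x)| <= M by [].
have D1 := is_derive_power_integral mO m1 mge mdze r1 p2 dzM' igp' i1.
have D2 := is_derive_power_integral mO m1 mv mze r1 p2 zM' ivp' i1.
have D3 := is_derive_power_integral mO mrho mv mze rr q2 zM' iJ irho.
have I1 := integrable_power mO m1 mge mdze r1 p2 dzM' igp' i1.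
have I2 := integrable_power mO m1 mv mze r1 p2 zM' ivp' i1.
have I3 := integrable_power mO mrho mv mze rr q2 zM' iJ irho.
rewrite -/e1 in D1; rewrite -/e2 in D2; rewrite -/j in D3.
pose u t x := v x + t * z (enorm x).
have iz : int_ball R n (fun x => z (enorm x)).
 exact: (intg_bounded (M := M)).
have idz i : int_ball R n (fun x => (dz (enorm x) *: normalize x) ord0 i).
 apply: (intg_bounded (M := M)) => //.
 under eq_fun do rewrite mxE; apply: mfunM => //; apply: mfunTS; exact: mfun_normalize.
 move=> x _; rewrite mxE normrM -[leRHS]mulr1 ler_pM//; exact: normalize_le1.
have wu t := weak_gradientD t iv ig iz idz wgv wz.
(* Both gradients point along x / |x|, so the norm of the gradient of v + t z is |g + t dz| and the
   energy is a power integral in t. *)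
have gu t : {ae leb, forall x, Omega x -> enorm (grad (u t) x) = `|g (enorm x) + t * dz (enorm x)|}.
 apply: filter_app (weak_gradient_ae (gradP (wu t)) (wu t)).
 apply: filterS2 (ae_neq0 R n_gt0) Gv => x x0 Gx ux Ox.
 by rewrite ux// Gx// scalerA -scalerDl enormZ enorm_normalize// mulr1.
have mu t : measurable_fun Omega (u t) by apply: measurable_funD => //; exact: mfunM.
have mgu t : measurable_fun Omega (fun x => enorm (grad (u t) x)).
 by have [mG _ _] := gradP (wu t); exact: mfun_enorm_comp.
have meas1 t : measurable_fun Omega (fun x => `|g (enorm x) + t * dz (enorm x)| `^ p).
 apply: (mcompT (measurable_powR _)); apply: mcompT => //.
 by apply: measurable_funD => //; exact: mfunM.
have J1 t : int_ball R n (fun x => `|g (enorm x) + t * dz (enorm x)| `^ p).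
 by have := I1 t; under [X in EFin \o X]eq_fun do rewrite mul1r.
have J2 t : int_ball R n (fun x => `|u t x| `^ p).
 by have := I2 t; under [X in EFin \o X]eq_fun do rewrite mul1r.
have Wu t : W1_rad p (u t).
 split.
 split => //; first by apply: (integral_lty _ (J2 t)) => x; exact: powR_ge0.
 exists (grad (u t)); first exact: gradP (wu t).
 rewrite (ge0_ae_eq_integral (g := fun x => (`|g (enorm x) + t * dz (enorm x)| `^ p)%:E))//.
 - by apply: (integral_lty _ (J1 t)) => x; exact: powR_ge0.
 - by apply/measurable_EFinP; exact: (mcompT (measurable_powR _)).
 - mfun.
 - by move=> x _; rewrite lee_fin powR_ge0.
 - by apply: filterS (gu t) => x h Ox; rewrite h.
 by exists (fun r => f r + t * z r); apply: filterS vf => x h Ox; rewrite /u h.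
have Eu t : W1_energy p (u t) = e1 t + e2 t.
 rewrite /W1_energy /e1 /e2 -RintegralD//.
 apply: ae_eq_Rint => //.
 - apply: measurable_funD; first exact: (mcompT (measurable_powR _)).
 exact: integrable_mfun (J2 t).
 - apply: measurable_funD; first exact: integrable_mfun (I1 t).
 exact: integrable_mfun (I2 t).
 by apply: filterS (gu t) => x h Ox; rewrite h// !mul1r.
have e0 : e1 0 + e2 0 = 1.
 by rewrite -Eu -E1; congr W1_energy; apply/funext => x; rewrite /u mul0r addr0.
have j0 : j 0 = A by apply: eq_Rintegral => x _; rewrite mul0r addr0.
have jge t : 0 <= j t by apply: Rintegral_ge0 => x _; apply: mulr_ge0; exact: powR_ge0.
have ege t : 0 <= e1 t + e2 t.
 by apply: addr_ge0; apply: Rintegral_ge0 => x _; rewrite mul1r powR_ge0.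
(* If A were 0, v would vanish almost everywhere, because |x|^alpha is positive off the origin. *)
have A0 : 0 < A.
 rewrite lt_neqAle eq_sym -j0 jge andbT; apply/negP => /eqP jA; apply: nzv.
 have jE : (\int[leb]_(x in Omega) (enorm x `^ alpha * `|v x| `^ q)%:E = 0)%E.
 have <- : (A)%:E = 0%E by rewrite -j0 jA.
 by rewrite /A /Rintegral fineK; [reflexivity|exact: integrable_fin_num].
 have := (ae_eq_integral_abs leb mO (measurable_int _ iJ)).1.
 under eq_integral do rewrite /= (ger0_norm (mulr_ge0 (powR_ge0 _ _) (powR_ge0 _ _))).
 move=> /(_ jE); apply: filterS2 (ae_neq0 R n_gt0) => x x0 h Ox.
 have := h Ox; move=> /= -[] /eqP; rewrite mulf_eq0 !powR_eq0 -enorm_eq0 in x0 *.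
 by rewrite (negbTE x0)/= normr_eq0 => /andP[/eqP].
split; first exact: A0.
have q0 : q != 0 by apply: lt0r_neq0; lra.
have p0 : p != 0 by apply: lt0r_neq0; lra.
have crit t : 0 < j t -> 1 / A `^ (p / q) <= (e1 t + e2 t) / j t `^ (p / q).
 move=> jt; have mj := integrable_mfun (I3 t).
 by have := minv (u t) (Wu t) (nonzero_integral q0 mj jt); rewrite /Q E1 Eu.
have p0' : 0 < p by lra.
have q0' : 0 < q by lra.
have := quotient_critical p0' q0' A0 (is_deriveD D1 D2) D3 e0 j0 ege jge crit.
clear -p2 mO Olty mv mz mdz mg p1 q2 mge mze mdze mrho irho i1 igp' ivp' iJ zM dzM p0 q0 A0 n_gt0.
have mspow (r : R) (f : 'rV[R]_n -> R) : measurable_fun Omega f -> measurable_fun Omega (fun x => spow r (f x)).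
 move=> mf; apply: mfunM => //.
 by apply: (mcompT (measurable_powR _)); exact: mcompT.
have bd (r s t : R) : 2 <= r -> `|t| <= M -> `|spow r s * t| <= M * (1 + 1 * `|s| `^ r).
 by move=> r2 tM; rewrite normrM mulrC ler_pM// mul1r norm_spow_le.
have B1 : int_ball R n (fun x => spow p (g (enorm x)) * dz (enorm x)).
 apply: (intg_le mO _ (intgZ M mO (intgD mO i1 igp'))).
 by apply: mfunM => //; exact: mspow.
 by move=> x Ox; exact: bd.
have B2 : int_ball R n (fun x => spow p (v x) * z (enorm x)).
 apply: (intg_le mO _ (intgZ M mO (intgD mO i1 ivp'))).
 by apply: mfunM => //; exact: mspow.
 by move=> x Ox; exact: bd.
have B3 : int_ball R n (fun x => enorm x `^ alpha * (spow q (v x) * z (enorm x))).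
 apply: (intg_le mO _ (intgZ M mO (intgD mO irho iJ))).
 by apply: mfunM => //; apply: mfunM => //; exact: mspow.
 move=> x Ox; rewrite normrM (ger0_norm (powR_ge0 _ _)).
 rewrite (le_trans (ler_wpM2l (powR_ge0 _ _) (bd q (v x) (z (enorm x)) q2 (zM _))))// mul1r.
 by rewrite le_eqVlt; apply/orP; left; apply/eqP; ring.
move=> H; do 3!(split; first by []); apply: (mulfI q0).
have E1' : \int[leb]_(x in Omega) (p * (1 * (spow p (g (enorm x)) * dz (enorm x)))) =
 p * \int[leb]_(x in Omega) (spow p (g (enorm x)) * dz (enorm x)).
 by rewrite -RintegralZl//; apply: eq_Rintegral => x _; rewrite mul1r.
have E2' : \int[leb]_(x in Omega) (p * (1 * (spow p (v x) * z (enorm x)))) =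
 p * \int[leb]_(x in Omega) (spow p (v x) * z (enorm x)).
 by rewrite -RintegralZl//; apply: eq_Rintegral => x _; rewrite mul1r.
have E3' : \int[leb]_(x in Omega) (q * (enorm x `^ alpha * (spow q (v x) * z (enorm x)))) =
 q * \int[leb]_(x in Omega) (enorm x `^ alpha * (spow q (v x) * z (enorm x))).
 by rewrite -RintegralZl.
by rewrite -E3' -H E1' E2'; field.
Qed.

End euler_lagrange.

(** * Regularity of primitives and of the flux *)

Section primitives.
Context (R : realType).
Local Notation mu1 := (@lebesgue_measure R).

Lemma is_derive_prim (F h : R -> R) (r : R) : loc_int h ->
 (forall s t, 0 < s -> s <= t -> t < 1 -> F t - F s = \int[mu1]_(x in `[s, t]) h x) ->
 0 < r < 1 -> {for r, continuous h} -> is_derive r 1 F (h r).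
move=> lh FE /andP[r0 r1] ch; pose a := r / 2; pose b := (1 + r) / 2.
have a0 : 0 < a by rewrite /a; lra.
have ar : a < r by rewrite /a; lra.
have rb : r < b by rewrite /b; lra.
have b1 : b < 1 by rewrite /b; lra.
have [dI eI] := continuous_FTC1_closed rb (lh a b a0 b1) ar ch.
have DI : is_derive r 1 (fun x => \int[mu1]_(t in `[a, x]) h t) (h r).
 by apply: DeriveDef; [exact: dI|rewrite -derive1E].
have DF := is_deriveD (is_derive_cst (F a) r 1) DI.
rewrite add0r in DF.
have e0 : 0 < Num.min (r - a) (b - r) by rewrite lt_min !subr_gt0 ar rb.
apply: (is_derive_near_eq e0 _ DF) => s; rewrite lt_min !ltr_norml => /andP[/andP[h1 h2] /andP[h3 h4]].
have as' : a <= s by lra.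
have s1 : s < 1 by lra.
transitivity (F a + \int[mu1]_(t in `[a, s]) h t) => //.
by rewrite -(FE a s a0 as' s1) addrC subrK.
Qed.

Lemma continuous_prim (F h : R -> R) (r : R) : loc_int h ->
 (forall s t, 0 < s -> s <= t -> t < 1 -> F t - F s = \int[mu1]_(x in `[s, t]) h x) ->
 0 < r < 1 -> {for r, continuous F}.
move=> lh FE /andP[r0 r1]; pose a := r / 2; pose b := (1 + r) / 2.
have a0 : 0 < a by rewrite /a; lra.
have ar : a < r by rewrite /a; lra.
have rb : r < b by rewrite /b; lra.
have b1 : b < 1 by rewrite /b; lra.
have ab : a < b := lt_trans ar rb.
have := parameterized_integral_continuous (ltW ab) (lh a b a0 b1).
move=> /(continuous_within_itvP _ ab)[cI _ _].
have rab : r \in `]a, b[ by rewrite in_itv/= ar rb.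
have cI' : {for r, continuous (fun x => F a + \int[mu1]_(t in `[a, x]) h t)}.
 by apply: cvgD; [exact: cvg_cst|exact: cI].
have E (s : R) : a <= s -> s < 1 -> F a + \int[mu1]_(t in `[a, s]) h t = F s.
 by move=> as' s1; rewrite -(FE a s a0 as' s1) addrC subrK.
suff : F @ r --> F r by [].
rewrite -(E r (ltW ar) r1); apply: cvg_trans cI'; apply: near_eq_cvg.
have e0 : 0 < Num.min (r - a) (b - r) by rewrite lt_min !subr_gt0 ar rb.
exists (Num.min (r - a) (b - r)); first exact: e0.
move=> s; rewrite /ball_/= lt_min !ltr_norml => /andP[/andP[h1 h2] /andP[h3 h4]].
apply: E; lra.
Qed.

Lemma continuous_ae_ge0 (F : R -> R) : (forall r, 0 < r < 1 -> {for r, continuous F}) ->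
 {ae mu1, forall r, 0 < r < 1 -> 0 < F r} -> forall r, 0 < r < 1 -> 0 <= F r.
move=> cF aF r r01; have /andP[r0 r1] := r01; rewrite leNgt; apply/negP => Fr.
have /cvgrPdist_lt/(_ (- F r)) := cF r r01; rewrite oppr_gt0 => /(_ Fr)[e /= e0 he].
pose d := Num.min e (1 - r).
have d0 : 0 < d by rewrite lt_min e0 subr_gt0.
have d1 : d <= e by rewrite ge_min lexx.
have d2 : d <= 1 - r by rewrite ge_min lexx orbT.
have [||s /andP[rs sd] Fs] := ae_itv_exists (ltW r0) (_ : r < r + d) _ aF.
- by rewrite ltrDl.
- by lra.
have : `|F r - F s| < - F r by apply: he; rewrite /ball_/= ltr_norml; apply/andP; split; lra.
by rewrite ltr_norml => /andP[? ?]; lra.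
Qed.

(** The signed power, inverse to [spow p] when c = 1 / (p - 1); it recovers F' continuously from the
    flux. *)
Definition root (c s : R) : R := if 0 <= s then s `^ c else - (- s) `^ c.

Lemma norm_root c s : `|root c s| = `|s| `^ c.
rewrite /root; case: leP => s0; first by rewrite ger0_norm ?powR_ge0// ger0_norm.
by rewrite normrN ger0_norm ?powR_ge0// ltr0_norm.
Qed.

Lemma root_spow p s : 2 <= p -> root (p - 1)^-1 (spow p s) = s.
move=> p2; have p1 : p - 1 != 0 by rewrite gt_eqF//; lra.
have [s0|s0] := leP 0 s.
 by rewrite spowE// /root powR_ge0 -powRrM mulfV// powRr1.
have s0' : 0 <= - s by rewrite oppr_ge0 ltW.
have -> : spow p s = - (- s) `^ (p - 1) by rewrite -spowE// spowN opprK.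
rewrite /root oppr_ge0 leNgt powR_gt0/= ?oppr_gt0// opprK -powRrM mulfV// powRr1// opprK.
by [].
Qed.

Lemma spow_root p s : 2 <= p -> spow p (root (p - 1)^-1 s) = s.
move=> p2; have p1 : p - 1 != 0 by rewrite gt_eqF//; lra.
rewrite /root; case: leP => s0; first by rewrite spowE ?powR_ge0// -powRrM mulVf// powRr1.
by rewrite spowN spowE ?powR_ge0// -powRrM mulVf// powRr1 ?opprK// oppr_ge0 ltW.
Qed.

Lemma root_continuous c : 0 < c -> continuous (root c).
move=> c0 s; have [s0|s0|<-] := ltgtP 0 s.
- have cp := derive_continuous (is_derive1_powR c s0).
 suff : root c @ s --> root c s by [].
 rewrite {2}/root (ltW s0); apply: cvg_trans cp; apply: near_eq_cvg.
 exists s; first exact: s0.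
 move=> t; rewrite /ball_/= ltr_norml => /andP[h1 h2].
 by rewrite /root ifT//; lra.
- have s0' : 0 < - s by rewrite oppr_gt0.
 have cp := derive_continuous (is_derive1_powR c s0').
 have cn : {for s, continuous (fun t => - (- t) `^ c)}.
 apply: cvgN; apply: (continuous_comp (f := fun t : R => - t) (g := fun t => t `^ c)) => //.
 by apply: cvgN; exact: cvg_id.
 suff : root c @ s --> root c s by [].
 rewrite {2}/root leNgt s0/=; apply: cvg_trans cn; apply: near_eq_cvg.
 exists (- s); first exact: s0'.
 move=> t; rewrite /ball_/= ltr_norml => /andP[h1 h2].
 by rewrite /root ifF//; apply/negbTE; rewrite -ltNge; lra.
- suff : root c @ (0 : R) --> root c 0 by [].
 rewrite {2}/root lexx powR0 ?gt_eqF//; apply/cvgrPdist_lt => e e0.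
 exists (e `^ c^-1); first exact: powR_gt0.
 move=> t; rewrite /ball_/= !sub0r !normrN norm_root => h.
 have -> : e = (e `^ c^-1) `^ c by rewrite -powRrM mulVf ?gt_eqF// powRr1// ltW.
 by apply: gt0_ltr_powR; rewrite ?nnegrE ?powR_ge0.
Qed.

(** A hat is constant near 0 and has derivative minus a bump. Testing with hats therefore determines
    the flux itself and not only its derivative: no constant of integration is left. *)
Lemma ae_flux (Lm Nf : R -> R) :
 mu1.-integrable `]0, 1[ (EFin \o Lm) -> mu1.-integrable `]0, 1[ (EFin \o Nf) ->
 \int[mu1]_(r in `]0, 1[) Nf r = 0 ->
 (forall eps a b, 0 < eps -> 0 < a -> a < b -> b < 1 ->
 \int[mu1]_(r in `]0, 1[) (Lm r * bump eps a b r) = \int[mu1]_(r in `]0, 1[) (Nf r * hat eps a b r)) ->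
 {ae mu1, forall r, 0 < r < 1 -> Lm r = \int[mu1]_(x in `[0, r]) (Nf \_ `]0, 1[) x}.
move=> iL iN N0 H; pose N0' := Nf \_ `]0, 1[.
have iN0 : mu1.-integrable setT (EFin \o N0') by exact: (intg_restrict mu1 Nf (measurable_itv _)).1.
have iN1 : mu1.-integrable `[0, 1] (EFin \o N0') by exact: integrableS iN0.
pose T r := \int[mu1]_(x in `[0, r]) N0' x.
have cT := parameterized_integral_continuous (@ler01 R) iN1.
have iT : mu1.-integrable `[0, 1] (EFin \o T).
 by apply: continuous_compact_integrable => //; exact: segment_compact.
have sub (a b : R) : 0 < a -> b < 1 -> (`[a, b]%classic : set R) `<=` `]0, 1[%classic.
 move=> a0 b1 x /=; rewrite !in_itv/= => /andP[ax xb].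
 by rewrite (lt_le_trans a0 ax) (le_lt_trans xb b1).
have sub1 : (`]0, 1[%classic : set R) `<=` `[0, 1]%classic by apply: subset_itv; rewrite bnd_simp.
have iT' : mu1.-integrable `]0, 1[ (EFin \o T) by exact: integrableS iT.
suff : {ae mu1, forall r, 0 < r < 1 -> Lm r - T r = 0}.
 by apply: ae_imply => r h r01; apply/eqP; rewrite -subr_eq0; apply/eqP; exact: h.
apply: ae_eq0_bump => [a b a0 b1|eps a b e0 a0 ab b1].
 have iLT : mu1.-integrable `]0, 1[ (EFin \o (fun r : measurableTypeR R => Lm r - T r)).
 exact: (intgB _ iL iT').
 exact: (@integrableS _ (measurableTypeR R) R mu1 `]0%R, 1%R[%classic `[a, b]%classic (EFin \o (fun r => Lm r - T r)) (measurable_itv _) (measurable_itv _) (sub a b a0 b1) iLT).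
have cb := @bump_continuous R eps e0 a b.
have mb : borel R (bump eps a b) by exact: continuous_measurable_fun.
have bM (f : R -> R) (D : set R) : measurable D -> mu1.-integrable D (EFin \o f) ->
 mu1.-integrable D (EFin \o (fun x => f x * bump eps a b x)).
 move=> mD fi; apply: (integrableMb (M := 1)) => //; first exact: mfunTS.
 by move=> x _; rewrite ger0_norm ?bump_ge0 ?bump_le1.
rewrite -(@Rint_itv_supp _ `]0, 1[ `[a, b] (fun x => (Lm x - T x) * bump eps a b x)); last 2 first.
- exact: sub.
- move=> x _ xab; rewrite bump_eq0 ?mulr0//; apply/negP => h; apply: xab.
 by move: h; rewrite /= !in_itv/= => /andP[? ?]; rewrite !ltW.
have -> : \int[mu1]_(x in `]0, 1[) ((Lm x - T x) * bump eps a b x) =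
 \int[mu1]_(x in `]0, 1[) (Lm x * bump eps a b x - T x * bump eps a b x).
 by apply: eq_Rintegral => x _; rewrite mulrBl.
rewrite RintegralB//; [|exact: bM|exact: bM].
apply/eqP; rewrite subr_eq0 H//; apply/eqP.
have ib : mu1.-integrable `[0, 1] (EFin \o bump eps a b).
 by apply: integrableS (bump_integrable a b e0).
have PM := primitive_mul ler01 iN1 ib.
have E1 : \int[mu1]_(y in `[0, 1]) N0' y = 0.
 transitivity (\int[mu1]_(r in `]0, 1[) Nf r); last exact: N0.
 rewrite (@Rint_itv_supp _ `[0, 1] `]0, 1[ N0')//; last first.
 by move=> x _ xO; rewrite /N0' patchE memNset.
 by apply: eq_Rintegral => x xO; rewrite /N0' patchE xO.
have E2 : \int[mu1]_(t in `]0, 1[) (T t * bump eps a b t) = \int[mu1]_(t in `[0, 1]) (T t * bump eps a b t).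
 apply/esym; apply: Rint_itv_supp => // x _ xO.
 rewrite bump_eq0 ?mulr0//; apply/negP => h; apply: xO.
 by move: h; rewrite /= !in_itv/= => /andP[? ?]; apply/andP; split; lra.
rewrite E2; move: PM; rewrite E1 mul0r => /esym/eqP; rewrite addr_eq0 => /eqP ->.
have E3 : \int[mu1]_(r in `]0, 1[) (Nf r * hat eps a b r) = \int[mu1]_(r in `[0, 1]) (N0' r * hat eps a b r).
 rewrite (@Rint_itv_supp _ `[0, 1] `]0, 1[ (fun r => N0' r * hat eps a b r))//; last first.
 by move=> x _ xO; rewrite /N0' patchE memNset// mul0r.
 by apply: eq_Rintegral => x xO; rewrite /N0' patchE xO.
have E4 (t : R) : t \in `[0, 1] -> \int[mu1]_(y in `[0, t]) bump eps a b y = \int[mu1]_x bump eps a b x - hat eps a b t.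
 rewrite in_itv/= => /andP[t0 t1]; rewrite /hat subKr /primitive; apply/esym.
 apply: Rint_itv_supp => [|x xD xt].
 by apply: subset_itv; rewrite bnd_simp.
 rewrite bump_eq0//; apply/negP => h; apply: xt; move: h; rewrite /= !in_itv/= => /andP[ax xb].
 by move: xD; rewrite /= in_itv/= => ->; rewrite andbT; lra.
have [M M1 hM] := hat_bounded e0 a b.
have mh : borel R (hat eps a b).
 by apply: continuous_measurable_fun => t; exact: derive_continuous (is_derive_hat e0 a b t).
have ih : mu1.-integrable `[0, 1] (EFin \o (fun t => N0' t * hat eps a b t)).
 by apply: (integrableMb (M := M)) => //; exact: mfunTS.
have -> : \int[mu1]_(t in `[0, 1]) (\int[mu1]_(y in `[0, t]) bump eps a b y * N0' t) =
 \int[mu1]_(t in `[0, 1]) ((\int[mu1]_x bump eps a b x) * N0' t - N0' t * hat eps a b t).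
 by apply: eq_Rintegral => t; rewrite inE => ht; rewrite E4// mulrBl [hat _ _ _ _ * _]mulrC.
rewrite RintegralB//; last exact: intgZ.
by rewrite RintegralZl// E1 mulr0 sub0r opprK.
Qed.

End primitives.

(** * Integrals of radial functions *)

Section radial_reals.
Context (R : realType) (n : nat).
Hypothesis n_gt0 : (0 < n)%N.
Local Notation leb := (lebesgue_rV R n).
Local Notation mu1 := (@lebesgue_measure R).
Local Notation Omega := (@unit_ball R n).
Let mO := @measurable_unit_ball R n.

(** The area of the unit sphere. *)
Definition sphere_const : R := n%:R * fine (leb Omega).

Lemma sphere_const_gt0 : 0 < sphere_const.
by rewrite mulr_gt0 ?ltr0n// ball_volume_gt0. Qed.

Lemma radial_real (a : R -> R) : int_ball R n (fun x => a (enorm x)) ->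
 mu1.-integrable `]0, 1[ (EFin \o (fun r => r ^+ n.-1 * a r)) /\
 \int[leb]_(x in Omega) a (enorm x) = sphere_const * \int[mu1]_(r in `]0, 1[) (r ^+ n.-1 * a r).
move=> ia; have k0 := sphere_const_gt0.
have E (r : R) : r \in `]0, 1[ -> smean (fun x : 'rV[R]_n => a (enorm x)) r = sphere_const * (r ^+ n.-1 * a r).
 by rewrite in_itv/= => r01; rewrite smean_radial// /sphere_const; ring.
have i1 : mu1.-integrable `]0, 1[ (EFin \o (fun r => r ^+ n.-1 * a r)).
 have i0 : mu1.-integrable `]0, 1[ (EFin \o (fun r : measurableTypeR R => sphere_const^-1 * smean (fun x : 'rV[R]_n => a (enorm x)) r)).
 exact: (intgZ _ _ (integrable_smean n_gt0 ia)).
 apply: eq_integrable i0 => // r.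
 by rewrite inE => r01; rewrite /= E// mulKf// gt_eqF.
split => //; rewrite (polar n_gt0 ia) -RintegralZl//; apply: eq_Rintegral => r; rewrite inE; exact: E.
Qed.

End radial_reals.

(** * Surface measure and vanishing spherical means *)

Section surface.
Context (R : realType) (n : nat).
Hypothesis n_gt0 : (0 < n)%N.
Local Notation leb := (lebesgue_rV R n).
Local Notation mu1 := (@lebesgue_measure R).
Local Notation Omega := (@unit_ball R n).
Local Notation S := (@unit_sphere R n).
Let mO := @measurable_unit_ball R n.

Lemma measurable_unit_sphere : measurable S.
exact: (meas_preimage (@measurable_enorm R n) (measurable_set1 (1 : R))). Qed.

Lemma normalize_sphere (x : 'rV[R]_n) : S (normalize x) <-> x != 0.
split; last by move=> x0; exact: enorm_normalize.
move=> h; apply/eqP => x0; move: h; rewrite /unit_sphere/= x0 /normalize scaler0 enorm0.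
by move/eqP; rewrite eq_sym oner_eq0.
Qed.

(** On the sphere, the surface measure is n times the image of Lebesgue measure on the ball under
    normalization. The origin is sent to a point off the sphere, but it is null. *)
Lemma ge0_surface (h : 'rV[R]_n -> \bar R) : measurable_fun setT h -> (forall x, 0 <= h x)%E ->
 (\int[@surface_measure R n]_(t in S) h t = n%:R%:E * \int[leb]_(y in Omega) h (normalize y))%E.
move=> mh h0; have mS := measurable_unit_sphere; have mN := @measurable_normalize R n.
pose k : {nonneg R} := NngNum (ler0n R n).
have mNS : measurable (@normalize R n @^-1` S) by exact: meas_preimage.
have mhN : measurable_fun setT (fun y => h (@normalize R n y)) by exact: mcompT.
rewrite (eq_measure_integral (mscale k (pushforward (mrestr leb mO) (@normalize R n)))); last first.
 by move=> A mA AS; rewrite /= /mscale /pushforward /mrestr /surface_measure setIC.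
rewrite ge0_integral_mscale//; last exact: mfunTS.
congr (_ * _)%E; rewrite ge0_integral_pushforward//; try (exact: mfunTS); try (by move=> y _; exact: h0).
have mC : measurable (~` Omega) by exact: measurableC.
rewrite (@ge0_negligible_integral _ _ _ (mrestr leb mO) _ (~` Omega))//; last 3 first.
- exact: mfunTS.
- by move=> x _; exact: h0.
- transitivity (leb (~` Omega `&` Omega)); first by [].
 by rewrite setICl measure0.
rewrite (eq_measure_integral leb); last first.
 move=> A mA AS; transitivity (leb (A `&` Omega)); first by [].
 by rewrite setIidl// => x /AS [_ /contrapT].
rewrite [RHS](@ge0_negligible_integral _ _ _ leb _ [set 0])//; last 3 first.
- exact: measurable_rV0.
- exact: mfunTS.
- exact: lebesgue_set1_0.
congr (integral _ _ _); apply/seteqP; split => x /=.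
 by move=> [/normalize_sphere/eqP x0 /contrapT xO].
by move=> [xO /eqP x0]; split; [exact/normalize_sphere|exact].
Qed.

(** For almost every r the function is integrable on the sphere of radius r. Both parts of the
    extended integral are then finite, and its vanishing becomes a statement about real numbers. *)
Lemma smean_eq0 (g : 'rV[R]_n -> R) : int_ball R n g ->
 {ae mu1, forall r, 0 < r < 1 -> (\int[@surface_measure R n]_(t in S) (g (r *: t))%:E = 0)%E} ->
 {ae mu1, forall r, 0 < r < 1 -> smean g r = 0}.
move=> ig; apply: ae_imply2 (ae_integrable_polar n_gt0 ig) => r hi h r01.
have /andP[r0 r1] := r01; have {}h := h r01.
have mgO : measurable_fun setT (g \_ Omega).
 exact: integrable_mfun ((intg_restrict leb g mO).1 ig).
pose k (t : 'rV[R]_n) := (g \_ Omega) (r *: t).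
have mk : measurable_fun setT k.
 apply: (mcompT mgO); apply: measurable_fun_rV => i; under eq_fun do rewrite mxE.
 by apply: mfunM => //; exact: measurable_coord.
pose kn (y : 'rV[R]_n) := k (normalize y).
have mkn : measurable_fun setT kn by apply: mcompT => //; exact: measurable_normalize.
pose c := n%:R * r ^+ n.-1; have c0 : 0 < c by rewrite mulr_gt0 ?ltr0n// exprn_gt0.
have E y : polar_fun g (r, y) = c * (\1_Omega y * kn y).
 by rewrite /polar_fun/= indicE mem_set ?mul1r//= in_itv/= r0.
have ikn : int_ball R n kn.
 apply: (intg_restrict leb kn mO).2.
 have := intgZ c^-1 measurableT hi; apply: eq_integrable => // y _; congr EFin.
 by rewrite E mulKf ?gt_eqF// patchE indicE; case: ifP => _; rewrite ?mul1r ?mul0r.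
have h1 : (\int[@surface_measure R n]_(t in S) (EFin \o k) t = 0)%E.
 rewrite -h; apply: eq_integral => t; rewrite inE => tS; rewrite /= /k patchE mem_set//.
 by rewrite /unit_ball/= enormZ tS mulr1 ger0_norm// ltW.
move: h1; rewrite integralE ge0_surface//; last by apply: measurable_funepos; exact/measurable_EFinP.
rewrite ge0_surface//; last by apply: measurable_funeneg; exact/measurable_EFinP.
have Ep y : ((EFin \o kn)^\+ y = (EFin \o k)^\+ (normalize y))%E by rewrite unlock.
have En y : ((EFin \o kn)^\- y = (EFin \o k)^\- (normalize y))%E by rewrite unlock.
have Fn : (\int[leb]_(y in Omega) (EFin \o k)^\- (normalize y))%E \is a fin_num.
 by have := integrable_neg_fin_num mO ikn; under eq_integral do rewrite En.
rewrite -muleBr//; last by apply: fin_num_adde_defl; rewrite fin_numN.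
have E2 : (\int[leb]_(y in Omega) (EFin \o kn) y = \int[leb]_(y in Omega) (EFin \o k)^\+ (normalize y) - \int[leb]_(y in Omega) (EFin \o k)^\- (normalize y))%E.
 by rewrite integralE; congr (_ - _)%E; apply: eq_integral => y _; rewrite (Ep, En).
rewrite -E2 => /eqP; rewrite mule_eq0 eqe pnatr_eq0 -[n == 0%N]negbK -lt0n n_gt0/= => /eqP h2.
rewrite /smean; under eq_Rintegral do rewrite E.
rewrite (_ : \int[leb]_y _ = c * \int[leb]_(y in Omega) kn y).
 by rewrite /Rintegral h2 mulr0.
rewrite (Rintegral_indicM leb Omega kn) RintegralZl//.
have := (intg_restrict leb kn mO).1 ikn; apply: eq_integrable => // y _; congr EFin.
by rewrite patchE indicE; case: ifP => _; rewrite ?mul1r ?mul0r.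
Qed.

End surface.

(** * Radial functions along coordinate lines *)

Section radial_lines.
Context (R : realType) (n : nat).
Local Notation mu1 := (@lebesgue_measure R).
Let mO := @measurable_unit_ball R n.

(** Nothing is assumed about psi at 0. In dimension at least 2 almost every line in direction i
    avoids the origin, because another coordinate is non-zero on it. *)
Lemma radial_line_ftc (psi dpsi : R -> R) (i : 'I_n) : (1 < n)%N ->
 (forall r : R, 0 < r < 1 -> is_derive r 1 psi (dpsi r)) ->
 (forall r : R, 0 < r < 1 -> {for r, continuous dpsi}) ->
 line_ftc (fun x : 'rV[R]_n => psi (enorm x)) (fun x => dpsi (enorm x) * normalize x ord0 i) i.
move=> n1 D C s s0; have [j ji] : exists j : 'I_n, j != i.
 have n0 : (0 < n)%N := ltn_trans (ltn0Sn 0) n1.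
 have [i0|i0] := eqVneq (val i) 0%N.
 by exists (Ordinal n1); apply/eqP => /(congr1 val); rewrite i0.
 by exists (Ordinal n0); apply/eqP => h; move: i0; rewrite -h.
apply: filterS (ae_coord_neq0 R j) => x xj xO yO.
pose y (t : R) := x + t *: 'e_i.
have y0 t : y t != 0.
 apply/eqP => /rowP/(_ j); rewrite !mxE eqxx/= (negbTE ji) mulr0 addr0 => h.
 by rewrite h eqxx in xj.
have y01 t : 0 <= t <= s -> 0 < enorm (y t) < 1.
 by move=> ts; rewrite enorm_gt0 y0/=; exact: (unit_ball_segment ts xO yO).
have De (t : R) : is_derive t 1 (fun t => enorm (y t)) (normalize (y t) ord0 i).
 by apply: is_derive_line_at; apply: is_derive_enorm; exact: y0.
pose f (t : R) := psi (enorm (y t)); pose df (t : R) := dpsi (enorm (y t)) * normalize (y t) ord0 i.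
have Df (t : R) : 0 <= t <= s -> is_derive t 1 f (df t).
 by move=> ts; exact: (is_derive1_comp (f := psi) (g := fun t => enorm (y t)) (D _ (y01 t ts)) (De t)).
have cdf (t : R) : 0 <= t <= s -> {for t, continuous df}.
 move=> ts; have ce : {for t, continuous (fun t => enorm (y t))} by exact: (derive_continuous (De t)).
 apply: cvgM; first exact: (continuous_comp ce (C _ (y01 t ts))).
 rewrite (_ : (fun t => _) = (fun t => (enorm (y t))^-1 * (x ord0 i + t))); last first.
 by apply/funext => t'; rewrite !mxE !eqxx/= mulr1.
 rewrite (_ : nbhs (normalize (y t) ord0 i) = nbhs ((enorm (y t))^-1 * (x ord0 i + t))); last first.
 by congr nbhs; rewrite !mxE !eqxx/= mulr1.
 apply: cvgM; first by apply: cvgV ce; rewrite gt_eqF// enorm_gt0.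
 by apply: cvgD; [exact: cvg_cst|exact: cvg_id].
have mem (t : R) : t \in `]0, s[ -> 0 <= t <= s by rewrite in_itv/= => /andP[? ?]; rewrite !ltW.
have FTC : (\int[mu1]_(t in `[0%R, s]) (df t)%:E = (f s)%:E - (f 0)%:E)%E.
 apply: continuous_FTC2 => //.
 - by apply: continuous_in_subspaceT => t; rewrite inE/= in_itv/= => ts; exact: cdf.
 - split.
 + by move=> t /mem/Df[].
 + have c0 : {for 0, continuous f} by apply: derive_continuous (Df 0 _); rewrite lexx ltW.
 exact: cvg_at_right_filter.
 + have c0 : {for s, continuous f} by apply: derive_continuous (Df s _); rewrite lexx ltW.
 exact: cvg_at_left_filter.
 - by move=> t /mem/Df[dv e]; rewrite derive1E.
rewrite /Rintegral -[X in fine X]/(\int[mu1]_(t in `[0%R, s]) (df t)%:E)%E FTC /=.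
by rewrite /f /y scale0r addr0.
Qed.

End radial_lines.

(** * The weighted Poincare inequality on the ball *)

Section weighted_poincare.
Context (R : realType) (n : nat).
Hypothesis n3 : (3 <= n)%N.
Let n_gt0 : (0 < n)%N. Proof. exact: leq_trans n3. Qed.
Local Notation leb := (lebesgue_rV R n).
Local Notation Omega := (@unit_ball R n).
Let mO := @measurable_unit_ball R n.
Let Olty := ball_lty R n.
(** On the cube of half-side 1 / n one has |x|^2 <= n rho^2 = 1 / n <= 1/3, so it lies in the ball
    with 1 - |x| bounded below. *)
Let rho : R := n%:R^-1.
Let B : set 'rV[R]_n := [set x | enorm x < rho].
Local Notation cube := (@box R n (fun=> - rho) (fun=> rho)).
Let nR3 : 3 <= n%:R :> R. Proof. by rewrite (ler_nat R 3 n). Qed.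
Let nR0 : 0 < n%:R :> R. Proof. by rewrite ltr0n. Qed.
Let rho0 : 0 < rho. Proof. by rewrite /rho invr_gt0. Qed.
Let rho3 : rho <= 3^-1. Proof. by rewrite /rho lef_pV2 ?posrE. Qed.
Let nrho2 : n%:R * rho ^+ 2 = rho. Proof. by rewrite /rho expr2 mulrA mulfV ?mul1r// gt_eqF. Qed.
Let mB : measurable B.
rewrite (_ : B = @enorm R n @^-1` `]-oo, rho[%classic); last by apply/seteqP; split => x; rewrite /B/= in_itv.
exact: (meas_preimage (@measurable_enorm R n) (measurable_itv _)).
Qed.
Let BQ : B `<=` cube.
move=> x xB i; rewrite in_itv/= -ltr_norml; apply: le_lt_trans (coord_le_enorm x i) _; exact: xB.
Qed.
Let cube_enorm (x : 'rV[R]_n) : cube x -> enorm x ^+ 2 <= 3^-1.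
move=> xQ; apply: le_trans (sqr_enorm_le (c := rho) _) _; last by rewrite nrho2.
by move=> i; have := xQ i; rewrite in_itv/= -ltr_norml => /ltW.
Qed.
Let V : R := \int[leb]_x \1_B x.
Let V_gt0 : 0 < V.
have iB : leb.-integrable setT (EFin \o (\1_B : 'rV[R]_n -> R)).
 rewrite (_ : (\1_B : 'rV[R]_n -> R) = (fun=> 1 : R) \_ B); last first.
 by apply/funext => x; rewrite patchE indicE; case: (x \in B).
 apply: (intg_restrict leb _ mB).1; apply: (intg_bounded (M := 1)) => //.
 apply: le_lt_trans (lebesgue_box_lty (fun=> - rho) (fun=> rho)).
 by apply: le_measure => //; apply: mem_set => //; exact: measurable_box.
 by move=> x _; rewrite normr1.
rewrite lt_neqAle Rintegral_ge0// andbT eq_sym; apply/negP => /eqP V0.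
have h : (\int[leb]_x (\1_B x)%:E = 0)%E.
 by rewrite -[LHS]fineK ?[fine _]V0//; exact: integrable_fin_num iB.
have ae0 := ae_eq0_ge0 (f := fun x => (\1_B x)%:E) (measurable_int _ iB) (fun x => ltac:(by rewrite lee_fin)) h.
have : {ae leb, forall x : 'rV[R]_n, Omega x -> ~ (enorm x < rho)}.
 by apply: filterS ae0 => x [] + _ xB; rewrite indicE mem_set//= => /eqP; rewrite oner_eq0.
move=> /(@ae_radial_inv R n n_gt0 (fun r => ~ (r < rho))) H.
have [] := @ae_itv_exists R _ 0 rho (lexx 0) rho0 _ H; first by have := rho3; lra.
by move=> r /andP[_ r1]; apply.
Qed.

Variable beta : R.
Hypotheses (b0 : 0 <= beta) (b1 : beta < 1).
(** Since |x_i| <= |x|, the weight in one coordinate is dominated by the radial weight, up to an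
    error that vanishes with delta when beta > 0. *)
Let ker_bound delta (x : 'rV[R]_n) (i : 'I_n) : 0 < delta ->
 (ker beta delta (x ord0 i))^-1 <= 2 / (1 - beta) * (enorm x `^ beta + delta `^ (beta / 2)).
move=> d0; have k0 := ker_gt0 b0 b1 d0 (x ord0 i); have e0 : 0 <= enorm x by exact: sqrtr_ge0.
have c0 : 0 <= beta / 2 by rewrite divr_ge0.
set s := x ord0 i in k0 *.
have := ker_ge b0 d0 s; set y := s ^+ 2 + delta; have y0 : 0 < y by exact: ker_base.
rewrite powRN => h.
have : (ker beta delta s)^-1 <= (1 - beta)^-1 * y `^ (beta / 2).
 rewrite -[X in _ * X]invrK -invfM lef_pV2 ?posrE//.
 by rewrite mulr_gt0 ?subr_gt0// invr_gt0 powR_gt0.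
move=> /le_trans; apply; rewrite mulrAC mulrC ler_pM2r ?invr_gt0 ?subr_gt0//.
have sx : s ^+ 2 <= enorm x ^+ 2.
 by rewrite -[s ^+ 2]real_normK ?num_real// ler_pXn2r ?nnegrE//; exact: coord_le_enorm.
have xb : enorm x `^ beta = (enorm x ^+ 2) `^ (beta / 2).
 by rewrite -powR_mulrn// -powRrM; congr powR; field.
rewrite xb; set a := enorm x ^+ 2 in sx *; have a0 : 0 <= a by rewrite sqr_ge0.
have H (z : R) : 0 <= z -> y <= 2 * z -> y `^ (beta / 2) <= 2 * z `^ (beta / 2).
 move=> z0 yz; apply: (@le_trans _ _ ((2 * z) `^ (beta / 2))).
 by apply: ge0_ler_powR; rewrite ?nnegrE ?(ltW y0)// mulr_ge0.
 rewrite powRM// ler_wpM2r ?powR_ge0// -[leRHS]powRr1//; apply: ler_powR; have := b1; lra.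
have [ad|da] := leP a delta.
 apply: (le_trans (H delta (ltW d0) _)); first by rewrite /y; lra.
 by rewrite ler_wpM2l// lerDr powR_ge0.
apply: (le_trans (H a a0 _)); first by rewrite /y; lra.
by rewrite ler_wpM2l// lerDl powR_ge0.
Qed.
(** Lets delta tend to 0 through delta = t^(1/e), which makes the error linear in t. *)
Let vanish (a c d e : R) : 0 <= c -> 0 <= d ->
 (forall delta, 0 < delta -> delta <= 1 -> a <= d + c * delta `^ e) -> 0 < e -> a <= d.
move=> c0 d0 h e0; apply/ler_addgt0Pr => z z0.
pose t := Num.min 1 (z / (c + 1)).
have c1 : 0 < c + 1 by lra.
have t0 : 0 < t by rewrite lt_min ltr01 divr_gt0.
have t1 : t <= 1 by rewrite ge_min lexx.
have tz : t <= z / (c + 1) by rewrite ge_min lexx orbT.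
apply: (le_trans (h (t `^ e^-1) _ _)).
- exact: powR_gt0.
- by rewrite powR_le_one ?invr_ge0 ?(ltW t0) ?(ltW e0).
rewrite lerD2l -powRrM mulVf ?gt_eqF// powRr1 ?(ltW t0)//.
have : c * t <= c * (z / (c + 1)) by rewrite ler_wpM2l.
by move=> /le_trans; apply; rewrite mulrA ler_pdivrMr// mulrDr mulr1 mulrC lerDl (ltW z0).
Qed.

(** Its factors are the measure of the box of increments, the constants of [poincare_pair], the
    constant of [ker_bound], and the inverse volume of B. *)
Definition inner_const : R :=
 (\int[leb]_x \1_(@box R n (fun=> -1) (fun=> 1)) x) * (2 ^+ n * 4) * (2 / (1 - beta)) / V.

Lemma inner_const_ge0 : 0 <= inner_const.
rewrite /inner_const !mulr_ge0 ?exprn_ge0 ?invr_ge0 ?subr_ge0 ?(ltW b1) ?(ltW V_gt0)//.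
by apply: Rintegral_ge0 => x _.
Qed.

Variables (phi : 'rV[R]_n -> R) (Phi : 'rV[R]_n -> 'rV[R]_n).
Hypotheses (iphi : int_ball R n phi) (iphi2 : int_ball R n (fun x => phi x ^+ 2)).
Hypothesis (iPhi : forall i : 'I_n, int_ball R n (fun x => Phi x ord0 i)).
Hypothesis (iPhi2 : forall i : 'I_n, int_ball R n (fun x => Phi x ord0 i ^+ 2)).
Hypothesis (lphi : forall i : 'I_n, line_ftc phi (fun x => Phi x ord0 i) i).
Hypothesis (mean0 : \int[leb]_(x in B) phi x = 0).
Let iPhiE2 : int_ball R n (fun x => enorm (Phi x) ^+ 2).
rewrite (_ : (fun x => enorm (Phi x) ^+ 2) = (fun x => \sum_(i < n) Phi x ord0 i ^+ 2)); last first.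
 by apply/funext => x; rewrite sqr_enorm; apply: eq_bigr => i _; rewrite expr2.
exact: intg_bigsum.
Qed.
Let wfun (x : 'rV[R]_n) := (enorm x * (1 - enorm x)) `^ beta.
Let mw : measurable_fun setT wfun.
have me := @measurable_enorm R n.
apply: (mcompT (measurable_powR _)); apply: mfunM => //.
exact: measurable_funB.
Qed.
Let Oenorm (x : 'rV[R]_n) : Omega x -> 0 <= enorm x < 1.
by move=> xO; rewrite sqrtr_ge0. Qed.
Let w01 (x : 'rV[R]_n) : Omega x -> 0 <= wfun x <= 1.
move=> /Oenorm/andP[e0 e1]; rewrite powR_ge0 powR_le_one//; first by rewrite mulr_ge0//; lra.
by rewrite mulr_ile1//; lra.
Qed.
Let iwPhi : int_ball R n (fun x => wfun x * enorm (Phi x) ^+ 2).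
under [X in EFin \o X]eq_fun do rewrite mulrC.
apply: (integrableMb (M := 1)) => //; first exact: mfunTS.
by move=> x /w01/andP[w0 w1]; rewrite ger0_norm.
Qed.
Let cube_w (x : 'rV[R]_n) : cube x -> enorm x `^ beta <= 3 * wfun x.
move=> /cube_enorm h; have e0 : 0 <= enorm x by exact: sqrtr_ge0.
have e1 : enorm x <= 2 / 3.
 rewrite leNgt; apply/negP => h1.
 have : (2 / 3) ^+ 2 <= enorm x ^+ 2 by rewrite ler_pXn2r ?nnegrE ?divr_ge0// ltW.
 by lra.
have e2 : 3^-1 <= 1 - enorm x by lra.
rewrite /wfun powRM//; last by lra.
rewrite mulrCA ler_peMr ?powR_ge0//.
have h3 : (3^-1 : R) `^ beta <= (1 - enorm x) `^ beta.
 by apply: ge0_ler_powR; rewrite ?nnegrE//; lra.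
have h4 : 3^-1 <= (3^-1 : R) `^ beta.
 rewrite -[X in X <= _]powRr1//; apply: ger_powR; last by have := b1; lra.
 by apply/andP; split; lra.
have : 3^-1 <= (1 - enorm x) `^ beta by exact: le_trans h4 h3.
lra.
Qed.
Let D := \int[leb]_(x in Omega) (wfun x * enorm (Phi x) ^+ 2).
Let E := \int[leb]_(x in Omega) (enorm (Phi x) ^+ 2).
Let E0 : 0 <= E. Proof. by apply: Rintegral_ge0 => x _; exact: sqr_ge0. Qed.
Let D0 : 0 <= D. Proof. by apply: Rintegral_ge0 => x _; rewrite mulr_ge0 ?powR_ge0 ?sqr_ge0. Qed.
Let mQ : measurable cube := measurable_box _ _.
Let QO : cube `<=` Omega.
move=> x /cube_enorm h; rewrite /unit_ball/= -(@expr_lt1 _ 2)// ?sqrtr_ge0//.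
by apply: le_lt_trans h _; lra.
Qed.
(** The mean of phi on B is zero, so the subtracted square in [poincare_pair] disappears; the sum
    over coordinates is then compared with the radial weight. *)
Let inner_delta delta : 0 < delta -> delta <= 1 ->
 \int[leb]_(x in B) phi x ^+ 2 <= inner_const / 2 * (3 * D + delta `^ (beta / 2) * E).
move=> d0 d1; pose kap := 2 / (1 - beta); set de := delta `^ (beta / 2).
have kap0 : 0 <= kap by rewrite divr_ge0// subr_ge0 ltW.
have de0 : 0 <= de by exact: powR_ge0.
have rho1 : 2 * rho <= 1 by have := rho3; lra.
have nrho : n%:R * rho ^+ 2 <= 1 by rewrite nrho2; have := rho3; lra.
have := @poincare_pair R n n_gt0 phi Phi beta delta rho b0 b1 d0 d1 rho0 rho1 nrho iphi iphi2 iPhi iPhi2 lphi B mB BQ.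
rewrite mean0 expr0n mulr0 subr0 -/V => P.
pose f (i : 'I_n) (x : 'rV[R]_n) := kap * (3 * (wfun x * Phi x ord0 i ^+ 2) + de * Phi x ord0 i ^+ 2).
have iwi (i : 'I_n) : int_ball R n (fun x => wfun x * Phi x ord0 i ^+ 2).
 under [X in EFin \o X]eq_fun do rewrite mulrC.
 apply: (integrableMb (M := 1)) => //; first exact: mfunTS.
 by move=> x /w01/andP[w0 w1]; rewrite ger0_norm.
have i_f (i : 'I_n) : int_ball R n (f i).
 by apply: intgZ => //; apply: intgD => //; exact: intgZ.
have ifQ (i : 'I_n) : leb.-integrable cube (EFin \o f i) by exact: (integrableS mO mQ QO (i_f i)).
have pw (i : 'I_n) (x : 'rV[R]_n) : cube x -> Phi x ord0 i ^+ 2 / ker beta delta (x ord0 i) <= f i x.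
 move=> xQ; have k1 := ker_bound x i d0; have k2 := cube_w xQ.
 have k3 : (ker beta delta (x ord0 i))^-1 <= kap * (3 * wfun x + de).
 by apply: le_trans k1 _; rewrite ler_wpM2l// lerD2r.
 have := ler_wpM2l (sqr_ge0 (Phi x ord0 i)) k3 => /le_trans; apply.
 by rewrite /f le_eqVlt; apply/orP; left; apply/eqP; ring.
have mker (i : 'I_n) : measurable_fun setT (fun x : 'rV[R]_n => (ker beta delta (x ord0 i))^-1).
 apply: measurable_funVr; apply: (@measurableT_comp _ _ _ _ _ _ (ker beta delta : measurableTypeR R -> R)).
 by apply: continuous_measurable_fun; exact: ker_continuous.
 exact: measurable_coord.
have iker (i : 'I_n) : leb.-integrable cube (EFin \o (fun x => Phi x ord0 i ^+ 2 / ker beta delta (x ord0 i))).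
 apply: (intg_le mQ _ (ifQ i)).
 apply: mfunM; last exact: mfunTS.
 apply: measurable_funS mO QO _.
 exact: integrable_mfun (iPhi2 i).
 move=> x xQ; rewrite ger0_norm; first exact: pw.
 by rewrite divr_ge0 ?sqr_ge0// ltW// ker_gt0.
have S1 : \sum_(i < n) \int[leb]_(x in cube) (Phi x ord0 i ^+ 2 / ker beta delta (x ord0 i)) <= kap * (3 * D + de * E).
 apply: (@le_trans _ _ (\sum_(i < n) \int[leb]_(x in Omega) f i x)).
 apply: ler_sum => i _; apply: (@le_trans _ _ (\int[leb]_(x in cube) f i x)).
 by apply: le_Rintegral => // x; exact: pw.
 apply: Rintegral_subset => // x _.
 by rewrite /f mulr_ge0// addr_ge0// mulr_ge0// ?sqr_ge0// mulr_ge0 ?powR_ge0 ?sqr_ge0.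
 rewrite -Rintegral_bigsum//.
 rewrite (_ : \int[leb]_(x in Omega) _ = \int[leb]_(x in Omega) (kap * (3 * (wfun x * enorm (Phi x) ^+ 2) + de * enorm (Phi x) ^+ 2))).
 rewrite RintegralZl//; last by apply: intgD => //; exact: intgZ.
 by rewrite RintegralD ?RintegralZl//; exact: intgZ.
 apply: eq_Rintegral => x _; rewrite /f -mulr_sumr big_split/= -!mulr_sumr sqr_enorm /dotp.
 by do ![congr (_ * _)|congr (_ + _)]; apply: eq_bigr => i _; rewrite expr2.
set H := \int[leb]_x _ in P; have H0 : 0 <= H by apply: Rintegral_ge0.
have c1 : 0 <= H * (2 ^+ n * 4) by rewrite !mulr_ge0 ?exprn_ge0.
have := ler_wpM2l c1 S1; rewrite -!mulrA => S2.
have {}P := le_trans P S2.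
rewrite -(ler_pM2l V_gt0) -(ler_pM2l (ltr0n R 2)) mulrA; apply: le_trans P _.
rewrite /inner_const -/H -/kap le_eqVlt; apply/orP; left; apply/eqP; field.
by apply/andP; split; apply: lt0r_neq0; rewrite ?V_gt0 ?subr_gt0.
Qed.
(** For beta > 0 the term with delta is sent to 0. For beta = 0 it does not decay, but the weight is
    then 1 and E = D. *)
Let inner : \int[leb]_(x in B) phi x ^+ 2 <= 4 * inner_const * D.
have I0 := inner_const_ge0; have ID : 0 <= inner_const * D by rewrite mulr_ge0.
have := b0; rewrite le_eqVlt => /orP[/eqP be|bpos].
 have := inner_delta ltr01 (lexx 1); rewrite -be mul0r powRr0 mul1r.
 have -> : E = D by apply: eq_Rintegral => x _; rewrite /wfun -be powRr0 mul1r.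
 lra.
apply: (@le_trans _ _ (inner_const / 2 * (3 * D))); last by lra.
apply: (@vanish _ (inner_const / 2 * E) _ (beta / 2)).
- by rewrite mulr_ge0// divr_ge0.
- by have := ID; lra.
- by move=> de d0 d1; have := inner_delta d0 d1; rewrite mulrDr [_ `^ _ * E]mulrC [inner_const / 2 * (E * _)]mulrA.
- by rewrite divr_gt0.
Qed.
Let K : R := n%:R ^+ 2.
Let c : R := expR (- K) / n%:R.
Let c_gt0 : 0 < c. Proof. by rewrite /c divr_gt0// expR_gt0. Qed.
(** Integrate phi^2 by parts against the field h(|x|) x with h = -(1 - r) e^(-K r), which vanishes
    on the sphere. Its divergence e^(-K r) (r + (1 - r) (K r - n)) is at least c for r >= 1 / n,
    since K = n^2, and at least -n inside B. The cross term carries r (1 - r), whose square is at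
    most its power beta. *)
Let hardy : c / 2 * \int[leb]_(x in Omega) phi x ^+ 2 <=
 (n%:R + c) * \int[leb]_(x in B) phi x ^+ 2 + 2 / c * D.
pose ex r := expR (- (K * r)); pose h r := - ((1 - r) * ex r).
pose dh r := ex r + K * ((1 - r) * ex r).
have K0 : 0 <= K by rewrite sqr_ge0.
have mid : measurable_fun setT (fun r : measurableTypeR R => r : R) by exact: measurable_id.
have mex : borel R ex.
 apply: continuous_measurable_fun => t.
 apply: (continuous_comp (f := fun t => - (K * t)) (g := expR)); last exact: continuous_expR.
 by apply: cvgN; apply: cvgM; [exact: cvg_cst|exact: cvg_id].
have m1 : borel R (fun r => (1 - r) * ex r).
 by apply: mfunM => //; exact: measurable_funB.
have Dh (r : R) : is_derive r 1 h (dh r).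
 have D1 : is_derive r 1 (fun t : R => 1 - t) (- 1).
 by apply: (is_derive_eq (is_deriveB (is_derive_cst (1 : R) r 1) (is_derive_id r (1 : R)))); rewrite sub0r.
 have D2 : is_derive r 1 (fun t : R => - (K * t)) (- K).
 by apply: (is_derive_eq (is_deriveN (is_deriveZ K (is_derive_id r (1 : R))))); rewrite scalerE mulr1.
 have D3 := is_derive1_comp (f := expR) (g := fun t : R => - (K * t)) (is_derive_expR _) D2.
 apply: (is_derive_eq (is_deriveN (is_deriveM D1 D3))).
 by rewrite !scalerE /dh /ex /=; ring.
have ex01 (r : R) : 0 <= r -> 0 < ex r <= 1.
 by move=> r0; rewrite expR_gt0/= -expR0 ler_expR oppr_le0 mulr_ge0.
have iphiPhi (i : 'I_n) : int_ball R n (fun x => phi x * Phi x ord0 i).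
 have mp := integrable_mfun iphi.
 have mP := integrable_mfun (iPhi i).
 apply: (intg_le mO _ (intgD mO iphi2 (iPhi2 i))); first exact: mfunM.
 move=> x _; rewrite ler_norml; apply/andP; split.
 by have := sqr_ge0 (phi x + Phi x ord0 i); have := sqr_ge0 (phi x); have := sqr_ge0 (Phi x ord0 i); lra.
 by have := sqr_ge0 (phi x - Phi x ord0 i); have := sqr_ge0 (phi x); have := sqr_ge0 (Phi x ord0 i); lra.
pose W (x : 'rV[R]_n) := (2 * phi x) *: Phi x.
have iWi (i : 'I_n) : int_ball R n (fun x => W x ord0 i).
 rewrite (_ : (fun x => W x ord0 i) = (fun x => 2 * (phi x * Phi x ord0 i))); first exact: intgZ.
 by apply/funext => x; rewrite mxE mulrA.
have lW (i : 'I_n) : line_ftc (fun x => phi x ^+ 2) (fun x => W x ord0 i) i.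
 have mp := integrable_mfun iphi.
 have := line_ftc_mul mp mp (iPhi i) (iPhi i) (lphi i) (lphi i).
 rewrite (_ : (fun x => phi x * phi x) = (fun x => phi x ^+ 2)); last by apply/funext => x; rewrite expr2.
 rewrite (_ : (fun x => W x ord0 i) = (fun x => phi x * Phi x ord0 i + phi x * Phi x ord0 i))//.
 by apply/funext => x; rewrite mxE; ring.
have EQ := @radial_ibp R n n_gt0 (fun x => phi x ^+ 2) W h dh (1 + K + n%:R) iphi2 iWi lW (fun r _ => Dh r).
have {}EQ : \int[leb]_(x in Omega) (phi x ^+ 2 * (enorm x * dh (enorm x) + n%:R * h (enorm x))) =
 - \int[leb]_(x in Omega) (dotp (W x) x * h (enorm x)).
 apply: EQ.
 - exact: measurable_funN.
 - by apply: measurable_funD => //; exact: mfunM.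
 - move=> r /andP[r0 r1]; have /andP[x0 x1] := ex01 r (ltW r0).
 have hh : `|h r| = (1 - r) * ex r by rewrite /h normrN ger0_norm// mulr_ge0 ?(ltW x0)//; lra.
 rewrite hh mulrC; apply: ler_wpM2r; first lra.
 by apply: le_trans x1 _; rewrite -addrA lerDl addr_ge0 ?(ltW nR0).
 move=> r /andP[r0 r1]; have /andP[x0 x1] := ex01 r (ltW r0).
 have y0 : 0 <= (1 - r) * ex r by rewrite mulr_ge0 ?(ltW x0)//; lra.
 have y1 : (1 - r) * ex r <= 1 by rewrite mulr_ile1 ?(ltW x0)//; lra.
 have Ky : 0 <= K * ((1 - r) * ex r) <= K by rewrite mulr_ge0//= ler_piMr.
 have ny : 0 <= n%:R * ((1 - r) * ex r) <= n%:R by rewrite mulr_ge0 ?(ltW nR0)//= ler_piMr// ltW.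
 have d0 : 0 <= r * dh r <= 1 + K.
 rewrite mulr_ge0 ?(ltW r0) ?addr_ge0 ?(ltW x0)//=; last by case/andP: Ky.
 rewrite (@le_trans _ _ (dh r))//; last by rewrite /dh lerD//; case/andP: Ky.
 by rewrite ler_piMl ?(ltW r1)// addr_ge0 ?(ltW x0)//; case/andP: Ky.
 rewrite /h mulrN ler_norml; move: d0 ny => /andP[? ?] /andP[? ?]; apply/andP; split; lra.
have iD := iwPhi.
have ibdy : int_ball R n (fun x => phi x ^+ 2 * (enorm x * dh (enorm x) + n%:R * h (enorm x))).
 apply: (integrableMb (M := 1 + K + K + n%:R)) => //.
 have me := @measurable_enorm R n.
 apply: mfunTS; apply: measurable_funD; apply: mfunM => //.
 apply: measurable_funD; first exact: (mcompT mex me).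
 by apply: mfunM => //; exact: (mcompT m1 me).
 by apply: measurable_funN; exact: (mcompT m1 me).
 move=> x /Oenorm/andP[r0 r1]; have /andP[x0 x1] := ex01 _ r0; set r := enorm x in r0 r1 x0 x1 *.
 have y0 : 0 <= (1 - r) * ex r by rewrite mulr_ge0 ?(ltW x0)//; lra.
 have y1 : (1 - r) * ex r <= 1 by rewrite mulr_ile1 ?(ltW x0)//; lra.
 have Ky : 0 <= K * ((1 - r) * ex r) <= K by rewrite mulr_ge0//= ler_piMr.
 have ny : 0 <= n%:R * ((1 - r) * ex r) <= n%:R by rewrite mulr_ge0 ?(ltW nR0)//= ler_piMr// ltW.
 have d0 : 0 <= r * dh r <= 1 + K.
 rewrite mulr_ge0 ?addr_ge0 ?(ltW x0)//=; last by case/andP: Ky.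
 rewrite (@le_trans _ _ (dh r))//; last by rewrite /dh lerD//; case/andP: Ky.
 by rewrite ler_piMl ?(ltW r1)// addr_ge0 ?(ltW x0)//; case/andP: Ky.
 rewrite /h mulrN ler_norml; move: d0 ny => /andP[? ?] /andP[? ?]; apply/andP; split; lra.
have mPhi (i : 'I_n) := integrable_mfun (iPhi i).
have mphi := integrable_mfun iphi.
(* g1 bounds phi^2 times the divergence from below; g2 bounds the cross term from above, half of c
   phi^2 being left to absorb. *)
pose g1 x := c * phi x ^+ 2 - (n%:R + c) * (\1_B x * phi x ^+ 2).
pose g2 x := c / 2 * phi x ^+ 2 + 2 / c * (wfun x * enorm (Phi x) ^+ 2).
have iB : int_ball R n (fun x => \1_B x * phi x ^+ 2).
 under [X in EFin \o X]eq_fun do rewrite mulrC.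
 apply: (integrableMb (M := 1)) => // x _.
 by rewrite indicE; case: (_ \in _); rewrite ?normr1 ?normr0.
have ig1 : int_ball R n g1 by apply: intgB => //; exact: intgZ.
have ig2 : int_ball R n g2 by apply: intgD => //; exact: intgZ.
have L1 : \int[leb]_(x in Omega) g1 x <= \int[leb]_(x in Omega) (phi x ^+ 2 * (enorm x * dh (enorm x) + n%:R * h (enorm x))).
 apply: le_Rintegral => // x /Oenorm/andP[r0 r1]; rewrite /g1; set r := enorm x in r0 r1 *.
 have /andP[x0 x1] := ex01 _ r0.
 have -> : r * dh r + n%:R * h r = ex r * (r + (1 - r) * (K * r - n%:R)) by rewrite /dh /h; ring.
 set b := r + _; rewrite [leRHS]mulrC.
 have [rr|rr] := ltP r rho.
 rewrite indicE mem_set//= mul1r -mulrBl ler_wpM2r ?sqr_ge0//.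
 rewrite (_ : c - (n%:R + c) = - n%:R); last by ring.
 have bn : - n%:R <= b.
 have h1 : 0 <= (1 - r) * (K * r) by rewrite !mulr_ge0//; lra.
 have h2 : 0 <= r * n%:R by rewrite mulr_ge0// ltW.
 rewrite /b mulrBr; lra.
 have [b0'|b0'] := leP 0 b; first by rewrite (@le_trans _ _ 0) ?oppr_le0 ?(ltW nR0)// mulr_ge0// ltW.
 by rewrite (le_trans bn)// -subr_ge0 -[X in _ - X]mul1r -mulrBl mulr_le0// ?subr_le0// ltW.
 rewrite indicE memNset; last by rewrite /B/= ltNge rr.
 rewrite mul0r mulr0 subr0 ler_wpM2r ?sqr_ge0//.
 have bn : n%:R^-1 <= b.
 apply: le_trans (rr) _; rewrite /b lerDl mulr_ge0 ?subr_ge0 ?(ltW r1)// /K expr2 -mulrA ler_peMr ?(ltW nR0)//.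
 by rewrite -ler_pdivrMl// mulr1; exact: rr.
 rewrite /c; apply: ler_pM => //; rewrite ?expR_ge0 ?invr_ge0 ?(ltW nR0)//.
 by rewrite /ex ler_expR lerN2 ler_piMr// ltW.
have P2 (x : 'rV[R]_n) : Omega x -> `|dotp (W x) x * h (enorm x)| <= g2 x.
 move=> /Oenorm/andP[r0 r1]; rewrite /g2 /W /wfun dotpZl; set r := enorm x in r0 r1 *.
 have /andP[x0 x1] := ex01 _ r0.
 pose t := `|dotp (Phi x) x| * ((1 - r) * ex r).
 have t0 : 0 <= t by rewrite !mulr_ge0 ?(ltW x0)//; lra.
 have -> : `|2 * phi x * dotp (Phi x) x * h r| = 2 * `|phi x| * t.
 rewrite /h /t !normrM normrN normrM (gtr0_norm x0) (ger0_norm (_ : 0 <= 1 - r)); last by lra.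
 by rewrite ger0_norm// !mulrA.
 have tT : t <= enorm (Phi x) * (r * (1 - r)).
 rewrite mulrA; apply: ler_pM => //; rewrite ?mulr_ge0 ?(ltW x0)//; try lra.
 exact: dotp_le.
 by rewrite ler_piMr//; lra.
 have y01 : 0 <= r * (1 - r) <= 1 by rewrite mulr_ge0 ?mulr_ile1//; lra.
 have /andP[y0 y1] := y01.
 have yb : (r * (1 - r)) ^+ 2 <= (r * (1 - r)) `^ beta.
 have [->|yn] := eqVneq (r * (1 - r)) 0; first by rewrite expr0n powR_ge0.
 rewrite -powR_mulrn//; apply: ger_powR; last by have := b1; lra.
 by rewrite lt_neqAle eq_sym yn y0 y1.
 have tt : t ^+ 2 <= (r * (1 - r)) `^ beta * enorm (Phi x) ^+ 2.
 apply: (@le_trans _ _ ((enorm (Phi x) * (r * (1 - r))) ^+ 2)).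
 by rewrite ler_pXn2r ?nnegrE// mulr_ge0// sqrtr_ge0.
 by rewrite exprMn mulrC ler_wpM2r ?sqr_ge0.
 have c0 := c_gt0.
 have := ler_wpM2l (_ : 0 <= 2 / c) tt; rewrite divr_ge0 ?(ltW c0)// => /(_ isT) h3.
 rewrite (@le_trans _ _ (c / 2 * phi x ^+ 2 + 2 / c * t ^+ 2))//; last by rewrite lerD2l.
 (* Young's inequality 2 |phi| t <= c/2 phi^2 + 2/c t^2, displayed as a square. *)
 rewrite -subr_ge0 (_ : _ - _ = c / 2 * (`|phi x| - 2 / c * t) ^+ 2).
 by rewrite mulr_ge0 ?sqr_ge0// divr_ge0// ltW.
 by rewrite -[phi x ^+ 2]real_normK ?num_real//; field; rewrite gt_eqF.
have iL2 : int_ball R n (fun x => dotp (W x) x * h (enorm x)).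
 apply: (intg_le mO _ ig2) => //.
 apply: mfunM.
 rewrite /dotp; apply: measurable_sum => i; apply: mfunM.
 exact: integrable_mfun (iWi i).
 by apply: mfunTS; exact: measurable_coord.
 by apply: mfunTS; apply: measurable_funN; exact: (mcompT m1 (@measurable_enorm R n)).
have L2 : - (\int[leb]_(x in Omega) (dotp (W x) x * h (enorm x))) <= \int[leb]_(x in Omega) g2 x.
 rewrite -mulN1r -RintegralZl//; apply: le_Rintegral => //; first exact: intgZ.
 by move=> x xO; rewrite mulN1r (le_trans _ (P2 x xO))// -normrN ler_norm.
have E1 : \int[leb]_(x in Omega) g1 x = c * \int[leb]_(x in Omega) phi x ^+ 2 - (n%:R + c) * \int[leb]_(x in B) phi x ^+ 2.
 rewrite RintegralB// ?RintegralZl//; try exact: intgZ.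
 congr (_ - _ * _).
 rewrite (@Rintegral_support _ _ _ leb Omega B); first by apply: eq_Rintegral => x; rewrite inE => xB; rewrite indicE mem_set// mul1r.
 by move=> x /BQ; exact: QO.
 by move=> x _ xB; rewrite indicE memNset// mul0r.
have E2 : \int[leb]_(x in Omega) g2 x = c / 2 * \int[leb]_(x in Omega) phi x ^+ 2 + 2 / c * D.
 by rewrite RintegralD// ?RintegralZl//; exact: intgZ.
have := le_trans L1 (_ : _ <= \int[leb]_(x in Omega) g2 x); rewrite EQ => /(_ L2).
rewrite E1 E2; lra.
Qed.

Definition poincare_const : R :=
 2 * n%:R / expR (- n%:R ^+ 2) *
 ((n%:R + expR (- n%:R ^+ 2) / n%:R) * (4 * inner_const) + 2 * n%:R / expR (- n%:R ^+ 2)).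

(** The small ball, where the mean vanishes, is controlled by [inner]; [hardy] propagates the
    control outwards to the sphere. *)
Theorem weighted_poincare :
 \int[leb]_(x in Omega) phi x ^+ 2 <=
 poincare_const * \int[leb]_(x in Omega) ((enorm x * (1 - enorm x)) `^ beta * enorm (Phi x) ^+ 2).
have c0 : 0 < c by rewrite /c divr_gt0// expR_gt0.
rewrite -/wfun -/D; have h1 := inner.
have h2 : (n%:R + c) * \int[leb]_(x in B) phi x ^+ 2 <= (n%:R + c) * (4 * inner_const * D).
 by rewrite ler_wpM2l// addr_ge0// ltW.
have c20 : 0 < c / 2 by rewrite divr_gt0.
have := hardy; rewrite -(ler_pdivlMl _ _ c20) => /le_trans; apply.
rewrite (_ : poincare_const * D = (c / 2)^-1 * ((n%:R + c) * (4 * inner_const * D) + 2 / c * D)).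
 by apply: ler_wpM2l; [rewrite invr_ge0 ltW|rewrite lerD2r].
rewrite /poincare_const /c /K; field.
by rewrite !gt_eqF// expR_gt0.
Qed.

End weighted_poincare.

(** * Bounds on minimizers with explicit dependence on alpha *)

Section bounds.
Context (R : realType) (n : nat).
Hypothesis n_gt0 : (0 < n)%N.
Local Notation leb := (lebesgue_rV R n).
Local Notation mu1 := (@lebesgue_measure R).
Local Notation Omega := (@unit_ball R n).
Let mO := @measurable_unit_ball R n.
Let Olty := ball_lty R n.

Definition shell (a b : R) (x : 'rV[R]_n) : R := \1_(`]a, b[%classic : set R) (enorm x).

Lemma integrable_shell a b : int_ball R n (shell a b).
apply: (intg_bounded (M := 1)) => //.
 apply: mfunTS; apply: (mcompT _ (@measurable_enorm R n)).
 by apply: measurable_indic; exact: measurable_itv.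
by move=> x _; rewrite /shell indicE; case: (_ \in _); rewrite ?normr1 ?normr0.
Qed.

Definition shell_volume (a b : R) : R := \int[leb]_(x in Omega) shell a b x.

Lemma shell_volume_gt0 a b : 0 <= a -> a < b -> b <= 1 -> 0 < shell_volume a b.
move=> a0 ab b1; have ish := integrable_shell a b.
have s0 x : 0 <= shell a b x by rewrite /shell indicE.
rewrite lt_neqAle Rintegral_ge0// andbT eq_sym; apply/negP => /eqP V0.
have h : (\int[leb]_(x in Omega) `|(shell a b x)%:E| = 0)%E.
 rewrite (eq_integral (fun x => (shell a b x)%:E)); last by move=> x _; rewrite /= ger0_norm.
 by rewrite -[LHS]fineK ?[fine _]V0//; exact: integrable_fin_num ish.
have := (ae_eq_integral_abs leb mO (measurable_int _ ish)).1 h.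
move=> /(@filterS _ _ _ _ (fun x : 'rV[R]_n => Omega x -> ~ (a < enorm x < b))) H.
have /(@ae_radial_inv R n n_gt0 (fun r => ~ (a < r < b))) H2 : {ae leb, forall x : 'rV[R]_n, Omega x -> ~ (a < enorm x < b)}.
 apply: H => x hx xO xab; have := hx xO.
 by rewrite /= /shell indicE mem_set ?in_itv//= => -[] /eqP; rewrite oner_eq0.
by have [r rab] := ae_itv_exists a0 ab b1 H2; apply.
Qed.

(** Some radius in (1/2, 3/4) has |F| <= K1, otherwise the L^1 norm would exceed M0. From there F is
    recovered by integrating g, with r^(n-1) |g| of bounded integral. The constant is chosen before
    F, hence does not see alpha. *)
Lemma radial_bound (M0 : R) : 0 <= M0 -> exists2 K : R, 0 < K &
 forall F g : R -> R, loc_int g ->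
 (forall s t, 0 < s -> s <= t -> t < 1 -> F t - F s = \int[mu1]_(x in `[s, t]) g x) ->
 int_ball R n (fun x => F (enorm x)) ->
 int_ball R n (fun x => g (enorm x)) ->
 \int[leb]_(x in Omega) `|F (enorm x)| <= M0 ->
 \int[leb]_(x in Omega) `|g (enorm x)| <= M0 ->
 forall r, 0 < r < 1 -> `|F r| <= K * r^-1 ^+ n.-1.
move=> M00; pose sg := shell_volume 2^-1 (3 / 4).
have sg0 : 0 < sg by apply: shell_volume_gt0; lra.
have k0 := sphere_const_gt0 R n_gt0; set kap := sphere_const R n in k0 *.
pose K1 := (M0 + 1) / sg; pose K2 := M0 / kap.
have K10 : 0 < K1 by rewrite divr_gt0//; lra.
have K20 : 0 <= K2 by rewrite divr_ge0// ltW.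
exists (K1 + 2 ^+ n.-1 * K2); first by rewrite ltr_pwDl// mulr_ge0// exprn_ge0.
move=> F g lg FE iF ig F1 g1 r /andP[r0 r1].
have [s /andP[s0 s1] Fs] : exists2 s, 2^-1 < s < 3 / 4 & `|F s| <= K1.
 apply: contrapT => no; have H s : 2^-1 < s < 3 / 4 -> K1 <= `|F s|.
 by move=> hs; rewrite leNgt; apply/negP => h; apply: no; exists s => //; exact: ltW.
 have : \int[leb]_(x in Omega) (K1 * shell 2^-1 (3 / 4) x) <= \int[leb]_(x in Omega) `|F (enorm x)|.
 apply: le_Rintegral => //; first by apply: intgZ => //; exact: integrable_shell.
 exact: integrable_norm.
 move=> x _; rewrite /shell indicE; case: (boolP (_ \in _)); rewrite ?mulr0// mulr1 inE/= in_itv/= => h.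
 exact: H.
 rewrite RintegralZl//; last exact: integrable_shell.
 rewrite -/(shell_volume _ _) -/sg /K1 divfK ?gt_eqF//; lra.
have [i1 e1] := radial_real n_gt0 (a := fun r => `|g r|) (integrable_norm ig).
have gab (a b : R) : 0 < a -> a <= b -> b < 1 -> \int[mu1]_(x in `[a, b]) `|g x| <= a^-1 ^+ n.-1 * K2.
 move=> a0 ab b1.
 have sub : (`[a, b]%classic : set R) `<=` `]0, 1[%classic.
 by move=> x /=; rewrite !in_itv/= => /andP[ax xb]; rewrite (lt_le_trans a0 ax) (le_lt_trans xb b1).
 have i2 : mu1.-integrable `[a, b] (EFin \o (fun r => r ^+ n.-1 * `|g r|)).
 exact: (@integrableS _ (measurableTypeR R) R mu1 `]0%R, 1%R[%classic `[a, b]%classic (EFin \o (fun r => r ^+ n.-1 * `|g r|)) (measurable_itv _) (measurable_itv _) sub i1).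
 apply: (@le_trans _ _ (\int[mu1]_(x in `[a, b]) (a^-1 ^+ n.-1 * (x ^+ n.-1 * `|g x|)))).
 apply: le_Rintegral => //.
 - by apply: integrable_norm; exact: lg.
 - exact: intgZ.
 move=> x /=; rewrite in_itv/= => /andP[ax xb]; rewrite mulrA -exprMn ler_peMl//.
 by rewrite exprn_ege1// mulrC ler_pdivlMr// mul1r.
 rewrite RintegralZl// ler_wpM2l ?exprn_ge0 ?invr_ge0 ?(ltW a0)//.
 rewrite /K2 ler_pdivlMr// mulrC.
 apply: (@le_trans _ _ (kap * \int[mu1]_(x in `]0, 1[) (x ^+ n.-1 * `|g x|))); last by rewrite -e1.
 rewrite ler_wpM2l ?(ltW k0)//; apply: Rintegral_subset => //.
 by move=> x /=; rewrite in_itv/= => /andP[x0 _]; rewrite mulr_ge0// exprn_ge0// ltW.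
have rn1 : 1 <= r^-1 ^+ n.-1 by rewrite exprn_ege1// invf_ge1// ltW.
have tri (a b : R) : 0 < a -> a <= b -> b < 1 -> `|F b - F a| <= a^-1 ^+ n.-1 * K2.
 move=> a0 ab b1; rewrite FE//; apply: le_trans (gab a b a0 ab b1).
 by apply: le_normr_Rintegral => //; exact: lg.
have s00 : 0 < s by lra.
have s11 : s < 1 by lra.
have FK : `|F r| <= K1 + `|F r - F s|.
 by have := ler_normD (F s) (F r - F s); rewrite addrC subrK => /le_trans; apply; rewrite lerD2r.
apply: le_trans FK _; rewrite mulrDl lerD//; first by rewrite ler_peMr// ltW.
have p1 : 1 <= 2 ^+ n.-1 :> R by rewrite exprn_ege1// ler1n.
have [rs|sr] := leP r s.
 rewrite distrC (le_trans (tri r s r0 rs s11))// mulrC ler_wpM2r ?exprn_ge0 ?invr_ge0 ?(ltW r0)//.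
 by rewrite ler_peMl.
rewrite (le_trans (tri s r s00 (ltW sr) r1))// mulrAC ler_wpM2r//.
rewrite (@le_trans _ _ (2 ^+ n.-1))//; last by rewrite ler_peMr// exprn_ge0.
rewrite lerXn2r ?nnegrE ?invr_ge0 ?(ltW s00)//.
by rewrite invf_ple ?posrE// ltW.
Qed.

Lemma nonzero_one : nonzero (fun _ : 'rV[R]_n => 1 : R).
move=> H; have H2 : {ae leb, forall x : 'rV[R]_n, Omega x -> (fun _ : R => False) (enorm x)}.
 by apply: filterS H => x h xO; have /eqP := h xO; rewrite oner_eq0.
by have [r _] := ae_itv_exists (lexx 0) ltr01 (lexx 1) (@ae_radial_inv R n n_gt0 (fun=> False) H2).
Qed.

(** Compare with the constant function 1, whose denominator is at least (3/4)^alpha times the volume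
    of the shell from 3/4 to 1. So 1 / A grows at most like (4/3)^alpha, which loses against the
    factor 2^(-alpha) of the weight on r <= 1/2. *)
Lemma minimizer_lower_bound (p q : R) : 2 <= p -> p < q -> exists2 C0 : R, 0 < C0 &
 forall alpha v, 0 < alpha -> radial_minimizer p q alpha v -> W1_energy p v = 1 ->
 let A := \int[leb]_(x in Omega) (enorm x `^ alpha * `|v x| `^ q) in
 0 < A -> A^-1 <= C0 * (4 / 3) `^ alpha.
move=> p2 pq; pose vol := \int[leb]_(x in Omega) (1 : R).
have i1 : int_ball R n (fun=> 1 : R).
 by apply: (intg_bounded (M := 1)) => // x _; rewrite normr1.
have vol0 : 0 < vol by rewrite /vol Rintegral_cst// mul1r ball_volume_gt0.
pose sg := shell_volume (3 / 4) 1.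
have sg0 : 0 < sg by apply: shell_volume_gt0; lra.
have p0 : 0 < p by lra.
have q0 : 0 < q by lra.
exists (vol `^ (q / p) / sg); first by rewrite divr_gt0// powR_gt0.
move=> alpha v al0 [_ _ vmin] E1 A A0.
have wg1 := weak_gradient_cst n_gt0 ltr01 (1 : R).
have W1one : W1 p (fun _ : 'rV[R]_n => 1 : R).
 split => //; first by rewrite normr1 powR1; apply: (integral_lty _ i1).
 exists (fun=> 0) => //; rewrite enorm0 powR0 ?gt_eqF//.
 by rewrite integral_cst// mul0e ltry.
have Wr1 : W1_rad p (fun _ : 'rV[R]_n => 1 : R).
 by split => //; exists (fun=> 1); apply: aeW.
have p1 : 1 <= p by lra.
have [_ _ _ wg [ig _]] := W1P p1 W1one.
have E1' : W1_energy p (fun _ : 'rV[R]_n => 1 : R) = vol.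
 rewrite /W1_energy; apply: ae_eq_Rint => //.
 apply: measurable_funD; first exact: integrable_mfun ig.
 by [].
 apply: filterS (weak_gradient_ae wg wg1) => x h xO.
 by rewrite h// enorm0 powR0 ?gt_eqF// add0r normr1 powR1.
pose J := \int[leb]_(x in Omega) (enorm x `^ alpha * `|1 : R| `^ q).
have iJ : int_ball R n (fun x => enorm x `^ alpha * `|1 : R| `^ q).
 apply: (intg_bounded (M := 1)) => //.
 mfun.
 move=> x xO; rewrite normr1 powR1 mulr1 ger0_norm ?powR_ge0//.
 by apply: powR_le_one; rewrite ?sqrtr_ge0// ltW.
have J1 : (3 / 4) `^ alpha * sg <= J.
 have -> : (3 / 4) `^ alpha * sg = \int[leb]_(x in Omega) ((3 / 4) `^ alpha * shell (3 / 4) 1 x).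
 by rewrite RintegralZl//; exact: integrable_shell.
 apply: le_Rintegral => //; first by apply: intgZ => //; exact: integrable_shell.
 move=> x xO; rewrite normr1 powR1 mulr1 /shell indicE; case: (boolP (_ \in _)); last by rewrite mulr0 powR_ge0.
 rewrite inE/= in_itv/= mulr1 => /andP[h _].
 by apply: ge0_ler_powR; rewrite ?nnegrE ?sqrtr_ge0 ?(ltW al0) ?(ltW h)//; lra.
have := vmin _ Wr1 nonzero_one; rewrite /Q E1 E1' -/A -/J => H.
clear vmin Wr1 W1one wg wg1 ig E1' iJ i1; clearbody J A vol sg.
have c0 : 0 < (3 / 4 : R) `^ alpha by rewrite powR_gt0//; lra.
have J0 : 0 < J by apply: lt_le_trans J1; rewrite mulr_gt0.
have pq0 : 0 < q / p by rewrite divr_gt0.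
have cancel z : 0 <= z -> (z `^ (p / q)) `^ (q / p) = z.
 move=> z0; rewrite -powRrM (_ : p / q * (q / p) = 1) ?powRr1//.
 by field; rewrite !gt_eqF.
have Ap : 0 < A `^ (p / q) by exact: powR_gt0.
have Jp : 0 < J `^ (p / q) by exact: powR_gt0.
have H2 : J `^ (p / q) <= vol * A `^ (p / q).
 by move: H; rewrite div1r ler_pdivlMr// mulrC ler_pdivrMr.
have H3 : J <= vol `^ (q / p) * A.
 have := ge0_ler_powR (ltW pq0) _ _ H2; rewrite !nnegrE (ltW Jp) mulr_ge0 ?(ltW vol0) ?(ltW Ap)// => /(_ isT isT).
 by rewrite powRM ?(ltW vol0) ?(ltW Ap)// !cancel// ltW.
have H4 : (3 / 4) `^ alpha * sg <= vol `^ (q / p) * A := le_trans J1 H3.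
have h : (4 / 3 : R) `^ alpha * (3 / 4) `^ alpha = 1.
 by rewrite -powRM ?divr_ge0// (_ : 4 / 3 * (3 / 4) = 1 :> R) ?powR1//; field.
have := ler_wpM2l (powR_ge0 (4 / 3) alpha) H4; rewrite mulrA h mul1r => h5.
rewrite -[A^-1]mul1r ler_pdivrMr//.
rewrite (_ : _ * A = ((4 / 3) `^ alpha * (vol `^ (q / p) * A)) / sg).
 by rewrite ler_pdivlMr// mul1r.
by field; rewrite gt_eqF.
Qed.

End bounds.

Lemma ae_integrable d (T : measurableType d) (R : realType) (m : {measure set T -> \bar R})
 (D : set T) (f h : T -> R) : measurable D -> m.-integrable D (EFin \o f) ->
 measurable_fun D h -> {ae m, forall x, D x -> f x = h x} -> m.-integrable D (EFin \o h).
move=> mD i_f mh fh; have /integrableP[mf fi] := i_f.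
apply/integrableP; split; first exact/measurable_EFinP.
rewrite -(ge0_ae_eq_integral (f := fun x => `|(EFin \o f) x|%E))//.
- exact: mcompT.
- by apply: mcompT => //; exact/measurable_EFinP.
- by apply: ae_imply fh => x h' Dx; rewrite /= h'.
Qed.

(** * Cutting functions off outside (0, 1) *)

Section patch.
Context (R : realType).

Lemma patch01 (f : R -> R) (r : R) : 0 < r < 1 -> (f \_ `]0, 1[) r = f r.
by move=> r01; rewrite patchE mem_set//= in_itv. Qed.

Lemma continuous_patch01 (f : R -> R) (r : R) : 0 < r < 1 -> {for r, continuous f} ->
 {for r, continuous (f \_ `]0, 1[)}.
move=> r01 cf; have /andP[r0 r1] := r01.
suff : (f \_ `]0, 1[) @ r --> (f \_ `]0, 1[) r by [].
rewrite patch01//; apply: cvg_trans cf; apply: near_eq_cvg.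
have e0 : 0 < Num.min r (1 - r) by rewrite lt_min r0 subr_gt0.
exists (Num.min r (1 - r)); first exact: e0.
move=> s; rewrite /ball_/= lt_min !ltr_norml => /andP[/andP[h1 h2] /andP[h3 h4]].
by rewrite patch01//; apply/andP; split; lra.
Qed.

Lemma measurable_patch01 (f : R -> R) : (forall r, 0 < r < 1 -> {for r, continuous f}) ->
 borel R (f \_ `]0, 1[).
move=> cf; apply/(measurable_restrict (f : measurableTypeR R -> R)) => //; rewrite setTI.
apply: open_continuous_measurable_fun; first exact: interval_open.
by move=> r; rewrite inE/= in_itv/=; exact: cf.
Qed.

Lemma spow_rootE (p s : R) : 2 <= p -> spow p s = root (p - 1) s.
move=> p2; rewrite /root; case: leP => s0; first by rewrite spowE.
by rewrite -{1}[s]opprK spowN spowE// oppr_ge0 ltW.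
Qed.

Lemma spow_continuous (p : R) : 2 <= p -> continuous (spow p).
move=> p2; rewrite (_ : spow p = root (p - 1)); last by apply/funext => s; exact: spow_rootE.
by apply: root_continuous; lra.
Qed.

End patch.

(** What the second variation uses of the minimizer: F and g = F' represent v and its gradient, and
    lam = 1 / A is the multiplier in the equation for v of norm 1. *)
Record is_profile (R : realType) (n : nat) (p q alpha lam : R) (v : 'rV[R]_n -> R) (F g : R -> R) : Prop := {
 profile_lam : 0 < lam ;
 profile_int : int_ball R n (fun x => enorm x `^ alpha * `|v x| `^ q) ;
 profile_A : \int[lebesgue_rV R n]_(x in @unit_ball R n) (enorm x `^ alpha * `|v x| `^ q) = lam^-1 ;
 profile_mF : borel R F ;
 profile_mg : borel R g ;
 profile_v : {ae lebesgue_rV R n, forall x : 'rV[R]_n, unit_ball x -> v x = F (enorm x)} ;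
 profile_grad : {ae lebesgue_rV R n, forall x : 'rV[R]_n, unit_ball x -> grad v x = g (enorm x) *: normalize x} ;
 profile_DF : forall r : R, 0 < r < 1 -> is_derive r 1 F (g r) ;
 profile_cg : forall r : R, 0 < r < 1 -> {for r, continuous g} ;
 profile_DL : forall r : R, 0 < r < 1 -> is_derive r 1 (fun r => r ^+ n.-1 * spow p (g r))
 (r ^+ n.-1 * (F r `^ (p - 1) - lam * (r `^ alpha * F r `^ (q - 1)))) ;
 profile_pos : forall r : R, 0 < r < 1 -> 0 < F r ;
 profile_g : forall r : R, 0 < r < 1 -> 0 <= g r <= F r ;
 profile_osc : forall r s : R, 0 < r < 1 -> 0 < s < 1 -> F r <= expR 1 * F s ;
 profile_lower : forall r : R, 0 < r < 1 ->
 profile_constant n p * (r * (1 - r)) * F r `^ (p - 1) <= g r `^ (p - 1) ;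
 profile_flux : forall r : R, 0 < r < 1 ->
 r ^+ n.-1 * g r `^ (p - 1) <= F r `^ (p - 1) * (r ^+ n / n%:R) ;
 profile_boundary : exists C : R, forall r : R, 0 < r < 1 -> r ^+ n.-1 * g r `^ (p - 1) <= C * (1 - r) }.

(** * The radial profile for large alpha *)

Section profile_existence.
Context (R : realType) (n : nat).
Hypothesis n_gt0 : (0 < n)%N.
Local Notation leb := (lebesgue_rV R n).
Local Notation mu1 := (@lebesgue_measure R).
Local Notation Omega := (@unit_ball R n).
Let mO := @measurable_unit_ball R n.
Let Olty := ball_lty R n.

Lemma decay_exists (C : R) : exists a0 : R, forall a, a0 < a -> C * (2 / 3) `^ a <= 2^-1.
have l0 : 0 < ln (3 / 2 : R) by rewrite ln_gt0//; lra.
pose C1 := 2 * `|C| + 1; have C10 : 0 < C1 by rewrite /C1; have := normr_ge0 C; lra.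
exists (ln C1 / ln (3 / 2)) => a; rewrite ltr_pdivrMr// => h.
have h1 : C1 <= (3 / 2) `^ a.
 rewrite /powR ifF; last by apply/negbTE; rewrite gt_eqF//; lra.
 by rewrite -[C1]lnK ?posrE// ler_expR ltW.
have h0 : 0 < (3 / 2 : R) `^ a := lt_le_trans C10 h1.
have -> : (2 / 3 : R) `^ a = ((3 / 2) `^ a)^-1.
 apply: (mulIf (lt0r_neq0 h0)); rewrite mulVf ?gt_eqF// -powRM ?divr_ge0//.
 by rewrite (_ : 2 / 3 * (3 / 2) = 1 :> R) ?powR1//; field.
rewrite ler_pdivrMr//; have := ler_norm C; rewrite /C1 in h1; lra.
Qed.

Lemma powR_bound (K x r s b : R) : 0 < K -> 0 < r < 1 -> 0 <= s -> 0 <= x ->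
 x <= K * r^-1 ^+ n.-1 -> b >= n.-1%:R * s ->
 r `^ b * x `^ s <= K `^ s * r `^ (b - n.-1%:R * s).
move=> K0 /andP[r0 r1] s0 x0 xK bs.
have E : r^-1 ^+ n.-1 = r `^ (- n.-1%:R) by rewrite powRN powR_mulrn ?ltW// exprVn.
have h : x `^ s <= K `^ s * r `^ (- n.-1%:R * s).
 rewrite powRrM -powRM ?(ltW K0) ?powR_ge0//; apply: ge0_ler_powR; rewrite ?nnegrE//.
 by rewrite mulr_ge0 ?powR_ge0// ltW.
 by rewrite -E.
apply: (le_trans (ler_wpM2l (powR_ge0 r b) h)).
rewrite mulrCA ler_wpM2l ?powR_ge0// -powRD; first by rewrite mulNr.
by rewrite (gt_eqF r0) implybT.
Qed.

Theorem radial_profile (p q : R) : 2 <= p -> p < q -> exists a0 : R,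
 forall alpha, 0 < alpha -> a0 < alpha -> forall v : 'rV[R]_n -> R,
 normalized_positive_minimizer p q alpha v ->
 exists lam F g, is_profile p q alpha lam v F g.
move=> p2 pq; pose vol := \int[leb]_(x in Omega) (1 : R).
have i1 : int_ball R n (fun=> 1 : R).
 by apply: (intg_bounded (M := 1)) => // x _; rewrite normr1.
have vol0 : 0 <= vol by apply: Rintegral_ge0.
(* This bounds the L^1 norms of v and of its gradient: s <= 1 + s^p, and the energy is 1. *)
have M00 : 0 <= vol + 1 by rewrite addr_ge0.
have [K K0 hK] := radial_bound n_gt0 M00.
have [C0 C00 hC0] := minimizer_lower_bound n_gt0 p2 pq.
pose b : R := n.-1%:R; have b0 : 0 <= b by rewrite ler0n.
(* On r <= 1/2 the bounds on lam and F give lam r^alpha F^(q-p) <= C0 (4/3)^alpha K^(q-p) r^(alpha -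
   b (q-p)), and the last power is at most 2^(b (q-p)) 2^(-alpha): altogether C (2/3)^alpha. *)
pose C := C0 * K `^ (q - p) * 2 `^ (b * (q - p)).
have [a1 ha1] := decay_exists C.
(* The three entries give a bounded weight |x|^alpha F^q, the condition [large] on the profile, and
   C (2/3)^alpha <= 1/2. *)
pose a0 := Num.max (Num.max (b * q) (2 ^+ n.-1 * (q - p))) a1.
exists a0 => alpha al0; rewrite !gt_max => /andP[/andP[abq alarge] aa1] v [vrm vpos vnorm].
have p1 : 1 <= p by lra.
have pq0 : 0 < q - p by lra.
have q2 : 2 <= q by lra.
have E1 : W1_energy p v = 1.
 have Eg : 0 <= W1_energy p v by apply: Rintegral_ge0 => x _; rewrite addr_ge0 ?powR_ge0.
 have p0 : p != 0 by rewrite gt_eqF//; lra.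
 by have := congr1 (fun z => z `^ p) vnorm; rewrite /W1_norm -powRrM mulVf// powRr1// powR1.
have [[Wv [f vf]] _ _] := vrm.
have [mv ivp iv wg [igp ig]] := W1P p1 Wv.
have [F0 [g0 [lg mg FE0 vF0]]] := radial_representative n_gt0 iv ig wg vf.
have Gv : {ae leb, forall x : 'rV[R]_n, Omega x -> grad v x = g0 (enorm x) *: normalize x}.
 have H i := radial_gradient n_gt0 i iv ig wg lg FE0 vF0.
 by apply: filterS (ae_forall_ord H) => x h xO; apply/rowP => i; rewrite [RHS]mxE h.
(* F0 is controlled only inside (0, 1); cutting it off makes it Borel on the whole line. *)
pose Fc := F0 \_ `]0, 1[.
have FcE (r : R) : 0 < r < 1 -> Fc r = F0 r by exact: patch01.
have cF0 (r : R) : 0 < r < 1 -> {for r, continuous F0} by exact: (continuous_prim lg FE0).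
have cF (r : R) : 0 < r < 1 -> {for r, continuous Fc}.
 by move=> r01; apply: continuous_patch01 => //; exact: cF0.
have mF : borel R Fc by exact: measurable_patch01.
have FE (s t : R) : 0 < s -> s <= t -> t < 1 -> Fc t - Fc s = \int[mu1]_(x in `[s, t]) g0 x.
 move=> s0 st t1; rewrite !FcE; [exact: FE0|by rewrite s0 (le_lt_trans st)|by rewrite (lt_le_trans s0)].
have men := @measurable_enorm R n.
have mFe : measurable_fun Omega (fun x => Fc (enorm x)) by mfun.
have mge : measurable_fun Omega (fun x => g0 (enorm x)) by mfun.
have vF : {ae leb, forall x : 'rV[R]_n, Omega x -> v x = Fc (enorm x)}.
 by apply: filterS2 (ae_neq0 R n_gt0) vF0 => x x0 h xO; rewrite h// FcE// enorm_gt0 x0.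
have aFpos : {ae mu1, forall r, 0 < r < 1 -> 0 < Fc r}.
 apply: (ae_radial_inv n_gt0 (P := fun r => 0 < Fc r)).
 by apply: filterS2 vF vpos => x h1 h2 xO; rewrite -h1// h2.
have Fge : forall r, 0 < r < 1 -> 0 <= Fc r by exact: continuous_ae_ge0.
have iF : int_ball R n (fun x => Fc (enorm x)) by exact: (ae_integrable mO iv mFe vF).
have mpow (s : R) (h : 'rV[R]_n -> R) : measurable_fun Omega h -> measurable_fun Omega (fun x => `|h x| `^ s).
 by move=> mh; apply: (mcompT (measurable_powR _)); exact: mcompT.
have gG : {ae leb, forall x : 'rV[R]_n, Omega x -> enorm (grad v x) = `|g0 (enorm x)|}.
 by apply: filterS2 (ae_neq0 R n_gt0) Gv => x x0 h xO; rewrite h// enormZ enorm_normalize// mulr1.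
have ig0p : int_ball R n (fun x => `|g0 (enorm x)| `^ p).
 by apply: (ae_integrable mO igp (mpow _ _ mge)); apply: filterS gG => x h xO; rewrite h.
have ig0 : int_ball R n (fun x => g0 (enorm x)) by exact: (integrable_powR_L1 p1).
have iE := intgD mO igp ivp.
have le1p (s : R) : 0 <= s -> s <= 1 + s `^ p.
 move=> s0; have [s1|s1] := leP s 1; first by rewrite (le_trans s1)// lerDl powR_ge0.
 by rewrite -[leLHS]powRr1// (le_trans (ler_powR (ltW s1) p1))// lerDr.
have iE1 := intgD mO i1 iE.
have E2 : \int[leb]_(x in Omega) (1 + (enorm (grad v x) `^ p + `|v x| `^ p)) = vol + 1.
 by rewrite RintegralD//; congr (_ + _); rewrite -E1.
have bF : \int[leb]_(x in Omega) `|Fc (enorm x)| <= vol + 1.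
 rewrite -E2 (ae_eq_Rint (g := fun x => `|v x|))//.
 - apply: le_Rintegral => //; first exact: integrable_norm.
 move=> x _; rewrite (le_trans (le1p _ (normr_ge0 _)))// lerD2l lerDr powR_ge0//.
 - exact: mcompT.
 - exact: mcompT.
 - by apply: filterS vF => x h xO; rewrite h.
have bg : \int[leb]_(x in Omega) `|g0 (enorm x)| <= vol + 1.
 have [mgr _ _] := wg; have meg := mfun_enorm_comp mgr.
 rewrite -E2 (ae_eq_Rint (g := fun x => enorm (grad v x)))//.
 - apply: le_Rintegral => //.
 apply: (ae_integrable mO (integrable_norm ig0) meg).
 by apply: filterS gG => x h xO; rewrite /= h.
 by move=> x _; rewrite (le_trans (le1p _ _)) ?sqrtr_ge0// lerD2l lerDl powR_ge0.
 - exact: mcompT.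
 - by apply: filterS gG => x h xO; rewrite h.
have Fbd := hK Fc g0 lg FE iF ig0 bF bg.
have mrho : measurable_fun Omega (fun x => enorm x `^ alpha).
 mfun.
(* As alpha exceeds (n - 1) q, the growth r^(-(n-1) q) of F^q is compensated by the weight. *)
have iJF : int_ball R n (fun x => enorm x `^ alpha * `|Fc (enorm x)| `^ q).
 apply: (intg_bounded (M := K `^ q)) => //; first by apply: mfunM => //; exact: mpow.
 move=> x xO; have [e0|e0] := eqVneq (enorm x) 0.
 by rewrite e0 powR0 ?gt_eqF// mul0r normr0 powR_ge0.
 have r01 : 0 < enorm x < 1 by rewrite lt_neqAle eq_sym e0 sqrtr_ge0.
 rewrite ger0_norm ?mulr_ge0 ?powR_ge0//.
 have := powR_bound K0 r01 (_ : 0 <= q) (normr_ge0 (Fc (enorm x))) (Fbd _ r01) (ltW abq).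
 move=> /(_ _)/le_trans; apply; first lra.
 apply: ler_piMr; first exact: powR_ge0.
 by apply: powR_le_one; [rewrite subr_ge0 ltW|exact: sqrtr_ge0|case/andP: r01 => _ /ltW].
have iJ : int_ball R n (fun x => enorm x `^ alpha * `|v x| `^ q).
 apply: (ae_integrable mO iJF); first by apply: mfunM => //; exact: mpow.
 by apply: filterS vF => x h xO; rewrite h.
have EL := euler_lagrange n_gt0 p2 pq al0 vrm E1 iJ mg Gv.
set A := \int[leb]_(x in Omega) (enorm x `^ alpha * `|v x| `^ q) in EL.
have wg1 := weak_gradient_cst n_gt0 ltr01 (1 : R).
have n1 (t : R) : `|cst (1 : R) t| <= 1 :> R by rewrite normr1.
have n0 (t : R) : `|cst (0 : R) t| <= 1 :> R by rewrite normr0.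
have wz1 : weak_gradient (fun x : 'rV[R]_n => cst 1 (enorm x)) (fun x : 'rV[R]_n => cst 0 (enorm x) *: normalize x).
 rewrite (_ : (fun x : 'rV[R]_n => _ *: normalize x) = (fun=> 0)) => //.
 by apply/funext => x; rewrite scale0r.
have [A0 [_ [iS1 [iS2 _]]]] := EL 1 (cst (1 : R)) (cst (0 : R)) (measurable_cst _) (measurable_cst _)
 n1 n0 wz1.
pose lam := A^-1; have lam0 : 0 < lam by rewrite invr_gt0.
pose a r := spow p (Fc r) - lam * (r `^ alpha * spow q (Fc r)).
pose Nf r := r ^+ n.-1 * a r; pose Lm r := r ^+ n.-1 * spow p (g0 r).
have mspow (s : R) (h : 'rV[R]_n -> R) : measurable_fun Omega h -> measurable_fun Omega (fun x => spow s (h x)).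
 by move=> mh; apply: mfunM => //; exact: mpow.
have iSF : int_ball R n (fun x => spow p (Fc (enorm x))).
 apply: (ae_integrable mO iS1); first exact: mspow.
 by apply: filterS vF => x h xO; rewrite /= mulr1 h.
have iSF2 : int_ball R n (fun x => enorm x `^ alpha * spow q (Fc (enorm x))).
 apply: (ae_integrable mO iS2); first by apply: mfunM => //; exact: mspow.
 by apply: filterS vF => x h xO; rewrite /= mulr1 h.
have ia : int_ball R n (fun x => a (enorm x)).
 by apply: intgB => //; exact: intgZ.
have isg : int_ball R n (fun x => spow p (g0 (enorm x))) by exact: integrable_spow.
have [iL _] := radial_real n_gt0 (a := fun r => spow p (g0 r)) isg.
have [iN eN] := radial_real n_gt0 (a := a) ia.
have k0 := sphere_const_gt0 R n_gt0.
(* The Euler-Lagrange equation in the radial variable; the area of the sphere cancels. *)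
have key z dz M : borel R z -> borel R dz ->
 (forall t, `|z t| <= M) -> (forall t, `|dz t| <= M) ->
 weak_gradient (fun x : 'rV[R]_n => z (enorm x)) (fun x : 'rV[R]_n => dz (enorm x) *: normalize x) ->
 \int[mu1]_(r in `]0, 1[) (Lm r * - dz r) = \int[mu1]_(r in `]0, 1[) (Nf r * z r).
 move=> mz mdz zM dzM wz; have [_ [j1 [j2 [j3 e]]]] := EL M z dz mz mdz zM dzM wz.
 have mze : measurable_fun Omega (fun x : 'rV[R]_n => z (enorm x)) by mfun.
 have mdze : measurable_fun Omega (fun x : 'rV[R]_n => - dz (enorm x)).
 mfun.
 have i1' : int_ball R n (fun x => spow p (g0 (enorm x)) * - dz (enorm x)).
 by apply: (integrableMb (M := M)) => // x _; rewrite normrN.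
 have i2' : int_ball R n (fun x => a (enorm x) * z (enorm x)).
 exact: (integrableMb (M := M)).
 have [_ r1] := radial_real n_gt0 (a := fun r => spow p (g0 r) * - dz r) i1'.
 have [_ r2] := radial_real n_gt0 (a := fun r => a r * z r) i2'.
 apply: (mulfI (lt0r_neq0 k0)).
 have -> : \int[mu1]_(r in `]0, 1[) (Lm r * - dz r) = \int[mu1]_(r in `]0, 1[) (r ^+ n.-1 * (spow p (g0 r) * - dz r)).
 by apply: eq_Rintegral => r _; rewrite mulrA.
 have -> : \int[mu1]_(r in `]0, 1[) (Nf r * z r) = \int[mu1]_(r in `]0, 1[) (r ^+ n.-1 * (a r * z r)).
 by apply: eq_Rintegral => r _; rewrite mulrA.
 rewrite -r1 -r2.
 have -> : \int[leb]_(x in Omega) (spow p (g0 (enorm x)) * - dz (enorm x)) =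
 - \int[leb]_(x in Omega) (spow p (g0 (enorm x)) * dz (enorm x)).
 by rewrite -mulN1r -RintegralZl//; apply: eq_Rintegral => x _; rewrite mulrN mulN1r.
 have -> : \int[leb]_(x in Omega) (a (enorm x) * z (enorm x)) =
 \int[leb]_(x in Omega) (spow p (v x) * z (enorm x)) -
 lam * \int[leb]_(x in Omega) (enorm x `^ alpha * (spow q (v x) * z (enorm x))).
 rewrite -RintegralZl// -RintegralB//; last exact: intgZ.
 apply: ae_eq_Rint => //.
 - mfun.
 - mfun.
 - by apply: filterS vF => x h xO; rewrite /a h//; ring.
 rewrite -e /lam mulKf ?gt_eqF//; ring.
(* The constant direction z = 1 is admissible, as v is free on the sphere. It yields the Neumann
   condition, namely that the flux returns to 0 at r = 1. *)
have Nf0 : \int[mu1]_(r in `]0, 1[) Nf r = 0.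
 have := key (cst 1) (cst 0) 1 (measurable_cst _) (measurable_cst _) n1 n0 wz1.
 have -> : \int[mu1]_(r in `]0, 1[) (Lm r * - cst 0 r) = 0.
 have -> : \int[mu1]_(r in `]0, 1[) (Lm r * - cst 0 r) = \int[mu1]_(r in `]0, 1[) cst 0 r.
 by apply: eq_Rintegral => r _; rewrite /= oppr0 mulr0.
 by rewrite Rintegral_cst// mul0r.
 move=> e; transitivity (\int[mu1]_(r in `]0, 1[) (Nf r * cst 1 r)); last by rewrite -e.
 by apply: eq_Rintegral => r _; rewrite /= mulr1.
have hats eps s t : 0 < eps -> 0 < s -> s < t -> t < 1 ->
 \int[mu1]_(r in `]0, 1[) (Lm r * bump eps s t r) = \int[mu1]_(r in `]0, 1[) (Nf r * hat eps s t r).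
 move=> e0 s0 st t1; have [M M1 hM] := hat_bounded e0 s t.
 have cb := @bump_continuous R eps e0 s t.
 have mh : borel R (hat eps s t).
 by apply: continuous_measurable_fun => x; exact: derive_continuous (is_derive_hat e0 s t x).
 have mdh : borel R (fun r => - bump eps s t r).
 by apply: continuous_measurable_fun => x; apply: cvgN; exact: cb.
 rewrite -(key (hat eps s t) (fun r => - bump eps s t r) M mh mdh hM)//.
 - by apply: eq_Rintegral => r _; rewrite opprK.
 - by move=> r; rewrite normrN ger0_norm ?bump_ge0// (le_trans _ M1)// bump_le1.
 - exact: weak_gradient_hat.
have aL := ae_flux iL iN Nf0 hats.
pose N0 := Nf \_ `]0, 1[; pose T (r : R) := \int[mu1]_(x in `[0, r]) N0 x.
have iN0 : mu1.-integrable setT (EFin \o N0) by exact: (intg_restrict mu1 Nf (measurable_itv _)).1.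
have iN1 : mu1.-integrable `[0, 1] (EFin \o N0) by exact: integrableS iN0.
have cT (r : R) : 0 < r < 1 -> {for r, continuous T}.
 move=> r01; have /(continuous_within_itvP _ ltr01)[cI _ _] := parameterized_integral_continuous ler01 iN1.
 by apply: cI; rewrite in_itv.
pose c := (p - 1)^-1; have c0 : 0 < c by rewrite invr_gt0; clear -n_gt0 mO Olty men p2; lra.
(* Solving for the derivative in the flux identity gives a continuous version of it, so F is
   differentiable at every point of (0, 1). *)
pose g1 (r : R) := root c (T r / r ^+ n.-1).
have cg1 (r : R) : 0 < r < 1 -> {for r, continuous g1}.
 move=> r01; have /andP[r0 r1] := r01.
 apply: (continuous_comp (f := fun r => T r / r ^+ n.-1) (g := root c)); last exact: root_continuous.
 apply: cvgM; first exact: cT.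
 by apply: cvgV; [rewrite expf_neq0// gt_eqF|exact: exprn_continuous].
pose g2 := g1 \_ `]0, 1[.
have aeg : {ae mu1, forall r, 0 < r < 1 -> g0 r = g2 r}.
 apply: ae_imply aL => r h r01; have /andP[r0 r1] := r01.
 rewrite /g2 patch01// /g1 /T /N0 -(h r01) /Lm mulrC mulKf ?root_spow//.
 by rewrite expf_neq0// gt_eqF.
have mg2 : borel R g2 by exact: measurable_patch01.
have cg2 (r : R) : 0 < r < 1 -> {for r, continuous g2}.
 by move=> r01; apply: continuous_patch01 => //; exact: cg1.
have in01 (s t r : R) : 0 < s -> t < 1 -> r \in `[s, t] -> 0 < r < 1.
 by move=> s0 t1; rewrite in_itv/= => /andP[sr rt]; rewrite (lt_le_trans s0 sr) (le_lt_trans rt t1).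
have lg2 : loc_int g2.
 move=> s t s0 t1; apply: (@ae_integrable _ (measurableTypeR R) R mu1 `[s, t]%classic g0 g2 (measurable_itv _) (lg s t s0 t1)).
 mfun.
 by apply: ae_imply aeg => r h rst; apply: h; exact: (in01 s t r).
have FE2 (s t : R) : 0 < s -> s <= t -> t < 1 -> Fc t - Fc s = \int[mu1]_(x in `[s, t]) g2 x.
 move=> s0 st t1; rewrite FE//.
 apply: (@ae_eq_Rint _ (measurableTypeR R) R mu1 `[s, t]%classic g0 g2 (measurable_itv _)).
 - mfun.
 - mfun.
 - by apply: ae_imply aeg => r h rst; apply: h; exact: (in01 s t r).
have DF (r : R) : 0 < r < 1 -> is_derive r 1 Fc (g2 r).
 by move=> r01; apply: (is_derive_prim lg2 FE2) => //; exact: cg2.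
have Gv2 : {ae leb, forall x : 'rV[R]_n, Omega x -> grad v x = g2 (enorm x) *: normalize x}.
 by apply: filterS2 Gv (ae_radial n_gt0 aeg) => x h1 h2 xO; rewrite h1// h2.
have cN (r : R) : 0 < r < 1 -> {for r, continuous N0}.
 move=> r01; have /andP[r0 r1] := r01; apply: continuous_patch01 => //.
 apply: cvgM; first exact: exprn_continuous.
 apply: cvgB; first exact: (continuous_comp (f := Fc) (g := spow p) (cF r r01) (@spow_continuous R p p2 (Fc r))).
 apply: cvgM; first exact: cvg_cst.
 apply: cvgM; first exact: (derive_continuous (is_derive1_powR alpha r0)).
 exact: (continuous_comp (f := Fc) (g := spow q) (cF r r01) (@spow_continuous R q q2 (Fc r))).
have dT (r : R) : 0 < r < 1 -> is_derive r 1 T (N0 r).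
 move=> r01; have /andP[r0 r1] := r01.
 have [dI eI] := continuous_FTC1_closed r1 iN1 r0 (cN r r01).
 by apply: DeriveDef; [exact: dI|rewrite -derive1E].
have LE (r : R) : 0 < r < 1 -> r ^+ n.-1 * spow p (g2 r) = T r.
 move=> r01; have /andP[r0 r1] := r01.
 by rewrite /g2 patch01// spow_root// mulrC divfK// expf_neq0// gt_eqF.
have DL (r : R) : 0 < r < 1 -> is_derive r 1 (fun r => r ^+ n.-1 * spow p (g2 r))
 (r ^+ n.-1 * (Fc r `^ (p - 1) - lam * (r `^ alpha * Fc r `^ (q - 1)))).
 move=> r01; have /andP[r0 r1] := r01.
 have <- : N0 r = r ^+ n.-1 * (Fc r `^ (p - 1) - lam * (r `^ alpha * Fc r `^ (q - 1))).
 by rewrite /N0 patch01// /Nf /a !spowE// Fge.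
 have e0 : 0 < Num.min r (1 - r) by rewrite lt_min r0 subr_gt0.
 apply: (is_derive_near_eq e0 _ (dT r r01)) => s; rewrite lt_min !ltr_norml => /andP[/andP[h1 h2] /andP[h3 h4]].
 have s01 : 0 < s < 1 by clear -n_gt0 mO Olty men h1 h2 h3 h4; apply/andP; split; lra.
 by rewrite (LE s s01).
(* The flux is the integral T, continuous with T(0) = 0. *)
have L0 (e : R) : 0 < e -> exists2 d : R, 0 < d < 1 & forall r : R, 0 < r < d -> `|r ^+ n.-1 * spow p (g2 r)| <= e.
 move=> e0; have /cvgrPdist_le/(_ e e0)[d /= d0 hd] := parameterized_integral_cvg_left ltr01 iN1.
 have m0 : 0 < Num.min d 2^-1 by rewrite lt_min; apply/andP; split; [exact: d0|rewrite invr_gt0 ltr0n].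
 have m1 : Num.min d 2^-1 <= d by rewrite ge_min lexx.
 have m2 : Num.min d 2^-1 <= 2^-1 by rewrite ge_min lexx orbT.
 exists (Num.min d 2^-1) => [|r /andP[r0 rd]]; first by clear -n_gt0 mO Olty men m0 m2; apply/andP; split; lra.
 have r1 : r < 1 by clear -n_gt0 mO Olty men rd m2; lra.
 rewrite (LE r _) ?r0 ?r1//; have := hd r; rewrite !sub0r !normrN; apply.
 by rewrite /ball_/= sub0r normrN gtr0_norm//; clear -n_gt0 mO Olty men rd m1; lra.
have T1 : \int[mu1]_(x in `[0, 1]) N0 x = 0.
 transitivity (\int[mu1]_(r in `]0, 1[) Nf r); last exact: Nf0.
 rewrite (@Rint_itv_supp _ `[0, 1] `]0, 1[ N0)//.
 - by apply: eq_Rintegral => x xO; rewrite /N0 patchE xO.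
 - by apply: subset_itv; rewrite bnd_simp.
 - by move=> x _ xO; rewrite /N0 patchE memNset.
have L1 (e : R) : 0 < e -> exists2 d : R, 0 < d < 1 & forall r : R, d < r < 1 -> `|r ^+ n.-1 * spow p (g2 r)| <= e.
 move=> e0; have h := parameterized_integral_cvg_at_left ltr01 iN1.
 have E : parameterized_integral mu1 0 1 N0 = 0 by exact: T1.
 move: h; rewrite E.
 move=> /cvgrPdist_le/(_ e e0)[d /= d0 hd].
 have m0 : 0 < Num.min d 2^-1 by rewrite lt_min; apply/andP; split; [exact: d0|rewrite invr_gt0 ltr0n].
 have m1 : Num.min d 2^-1 <= d by rewrite ge_min lexx.
 have m2 : Num.min d 2^-1 <= 2^-1 by rewrite ge_min lexx orbT.
 exists (1 - Num.min d 2^-1) => [|r /andP[rd r1]]; first by clear -n_gt0 mO Olty men m0 m2; apply/andP; split; lra.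
 have r0 : 0 < r by clear -n_gt0 mO Olty men rd m2; lra.
 rewrite (LE r _) ?r0 ?r1//; have := hd r; rewrite !sub0r !normrN; apply => //.
 by rewrite /ball_/= gtr0_norm; clear -n_gt0 mO Olty men rd r1 m1; lra.
have Fpos (r : R) : 0 < r < 1 -> exists2 s : R, 0 < s < r & 0 < Fc s.
 by move=> /andP[r0 r1]; exact: (ae_itv_exists (lexx 0) r0 (ltW r1) aFpos).
have small (r : R) : 0 < r <= 2^-1 -> lam * (r `^ alpha * Fc r `^ (q - p)) <= 2^-1.
 move=> /andP[r0 r2]; have r01 : 0 < r < 1 by rewrite r0; clear -n_gt0 mO Olty men r2; lra.
 have bb : b * (q - p) <= alpha.
 by rewrite (le_trans _ (ltW abq))// ler_wpM2l//; clear -n_gt0 mO Olty men p2; lra.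
 have h1 := powR_bound K0 r01 (ltW pq0) (Fge r r01) (_ : Fc r <= _) bb.
 have {}h1 := h1 (le_trans (ler_norm _) (Fbd r r01)).
 have h2 : r `^ (alpha - b * (q - p)) <= 2^-1 `^ (alpha - b * (q - p)).
 by apply: ge0_ler_powR; rewrite ?nnegrE ?subr_ge0 ?(ltW r0)// invr_ge0.
 have h3 : 2^-1 `^ (alpha - b * (q - p)) = 2 `^ (b * (q - p)) * 2^-1 `^ alpha :> R.
 rewrite powRD; last by apply/implyP => _; rewrite gt_eqF// invr_gt0.
 by rewrite mulrC; congr (_ * _); rewrite -powR_inv1// -powRrM mulN1r opprK.
 have h4 : lam <= C0 * (4 / 3) `^ alpha := hC0 alpha v al0 vrm E1 A0.
 apply: le_trans (ha1 alpha aa1).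
 have h5 : r `^ alpha * Fc r `^ (q - p) <= K `^ (q - p) * (2 `^ (b * (q - p)) * 2^-1 `^ alpha).
 by apply: (le_trans h1); rewrite ler_wpM2l ?powR_ge0// -h3.
 apply: (@le_trans _ _ ((C0 * (4 / 3) `^ alpha) * (K `^ (q - p) * (2 `^ (b * (q - p)) * 2^-1 `^ alpha)))).
 by apply: ler_pM => //; [exact: ltW|rewrite mulr_ge0 ?powR_ge0].
 have -> : (2 / 3 : R) `^ alpha = (4 / 3) `^ alpha * 2^-1 `^ alpha.
 by rewrite -powRM ?invr_ge0 ?divr_ge0//; congr powR; field.
 by rewrite /C le_eqVlt; apply/orP; left; apply/eqP; ring.
have large : 2 ^+ n.-1 * (q - p) <= alpha by exact: ltW.
have [P1 P2 P3 P4] := @profile_properties R n p q alpha lam Fc g2 n_gt0 p2 pq (ltW lam0) DF DL Fge Fpos L0 L1 small large.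
exists lam, Fc, g2; split => //.
- by rewrite /lam invrK.
- exact: (@profile_flux_le R n p q alpha lam Fc g2 n_gt0 p2 pq (ltW lam0) DF DL Fge Fpos L0 L1 small large).
- exact: (@profile_flux_boundary R n p q alpha lam Fc g2 n_gt0 p2 pq al0 (ltW lam0) DF DL Fge Fpos L0 L1 small large).
Qed.

End profile_existence.

Lemma powR_mul_id (R : realType) (a c d : R) : 0 < a -> d = c + 1 -> a `^ c * a = a `^ d.
move=> a0 ->; rewrite powRD; last by rewrite (gt_eqF a0) implybT.
by rewrite powRr1// ltW.
Qed.

Lemma powR_mul_sqr (R : realType) (a c d : R) : 0 < a -> d = c + 2 -> a `^ c * a ^+ 2 = a `^ d.
move=> a0 ->; rewrite powRD; last by rewrite (gt_eqF a0) implybT.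
by rewrite powR_mulrn// ltW.
Qed.

Lemma ae_le_Rintegral_in d (T : measurableType d) (R : realType) (m : {measure set T -> \bar R})
 (D : set T) (f g : T -> R) : measurable D ->
 m.-integrable D (EFin \o f) -> m.-integrable D (EFin \o g) ->
 {ae m, forall x, D x -> f x <= g x} -> \int[m]_(x in D) f x <= \int[m]_(x in D) g x.
move=> mD i_f i_g fg; have mf := integrable_mfun i_f.
have mg := integrable_mfun i_g.
rewrite (ae_eq_Rint (g := fun x => Num.min (f x) (g x)))//.
- apply: le_Rintegral => //; last by move=> x _; rewrite ge_min lexx orbT.
 have ia := intgD mD (integrable_norm i_f) (integrable_norm i_g).
 apply: (intg_le mD _ ia); first exact: measurable_minr.
 by move=> x _; rewrite /= /Num.min; case: ifP => _; rewrite ?lerDl ?lerDr normr_ge0.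
- exact: measurable_minr.
- by apply: filterS fg => x h Dx; rewrite (min_idPl (h Dx)).
Qed.

Lemma Rintegral_eq0_ae d (T : measurableType d) (R : realType) (m : {measure set T -> \bar R})
 (D : set T) (f : T -> R) : measurable D -> m.-integrable D (EFin \o f) ->
 (forall x, 0 <= f x) -> \int[m]_(x in D) f x = 0 -> {ae m, forall x, D x -> f x = 0}.
move=> mD i_f f0 V0.
have h : (\int[m]_(x in D) `|(f x)%:E| = 0)%E.
 rewrite (eq_integral (fun x => (f x)%:E)); last by move=> x _; rewrite /= ger0_norm.
 by rewrite -[LHS]fineK ?[fine _]V0//; exact: integrable_fin_num i_f.
have := (ae_eq_integral_abs m mD (measurable_int _ i_f)).1 h.
by apply: filterS => x hx Dx; have [] := hx Dx.
Qed.

(** The integrand of the second variation for u = F phi, with the gradient split along x / |x|: k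
    and k4 stand for the powers p - 2 and p - 4 of g, N for |grad phi|^2 and phir for the radial
    derivative of phi. *)
Lemma second_variation_integrand (R : realType) (p k k4 F g phi phir N : R) : g != 0 ->
 k = k4 * g ^+ 2 ->
 (p - 2) * k4 * (g * (F * phir + phi * g)) ^+ 2 +
 k * (F ^+ 2 * N + 2 * F * phi * g * phir + phi ^+ 2 * g ^+ 2) =
 k * F ^+ 2 * N + (p - 2) * (k * F ^+ 2 * phir ^+ 2) +
 (p - 1) * (k * g ^+ 2 * phi ^+ 2 + 2 * (phi * phir) * (k * g * F)).
by move=> g0 ->; ring. Qed.

Lemma frame_dotp (R : realType) (n : nat) (a b : R) (x y : 'rV[R]_n) : dotp y y = 1 ->
 (dotp y (a *: x + b *: y) = a * dotp x y + b) *
 (dotp (a *: x + b *: y) (a *: x + b *: y) = a ^+ 2 * dotp x x + 2 * a * b * dotp x y + b ^+ 2).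
move=> y1; rewrite !dotpDl !dotpDr !dotpZl !dotpZr y1 (dotpC y x).
by split; ring.
Qed.

(** * The second variation through the quotient phi = u / F *)

Section quotient.
Context (R : realType) (n : nat).
Hypothesis n3 : (3 <= n)%N.
Let n_gt0 : (0 < n)%N. Proof. exact: leq_trans n3. Qed.
Local Notation leb := (lebesgue_rV R n).
Local Notation mu1 := (@lebesgue_measure R).
Local Notation Omega := (@unit_ball R n).
Let mO := @measurable_unit_ball R n.
Let men := @measurable_enorm R n.
Variables (p q alpha lam : R) (v : 'rV[R]_n -> R) (F g : R -> R).
Hypotheses (p2 : 2 <= p) (pq : p < q) (al0 : 0 < alpha).
Hypothesis hP : is_profile p q alpha lam v F g.
Variables (u : 'rV[R]_n -> R) (G : 'rV[R]_n -> 'rV[R]_n).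
Hypotheses (iu : int_ball R n u) (iu2 : int_ball R n (fun x => u x ^+ 2)).
Hypothesis (wG : weak_gradient u G).
Hypothesis (iG : forall i : 'I_n, int_ball R n (fun x => G x ord0 i)).
Hypothesis (iG2 : forall i : 'I_n, int_ball R n (fun x => G x ord0 i ^+ 2)).
Hypothesis (mean_u : {ae mu1, forall r, 0 < r < 1 -> smean u r = 0}).

(** A lower bound of F from its oscillation about F(1/2); the upper bound e F(1/2) is [ceil_value].
    Only their ratio e^2 survives in the final constant. *)
Definition floor_value : R := expR (-1) * F 2^-1.
Local Notation m := floor_value.
Definition ceil_value : R := expR 2 * m.
Local Notation M := ceil_value.
Let half01 : 0 < (2^-1 : R) < 1. Proof. by apply/andP; split; lra. Qed.

Lemma floor_gt0 : 0 < m.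
by rewrite mulr_gt0 ?expR_gt0// (profile_pos hP). Qed.

Lemma ceil_gt0 : 0 < M. Proof. by rewrite mulr_gt0 ?expR_gt0// floor_gt0. Qed.

Lemma profile_bounds (r : R) : 0 < r < 1 -> m <= F r <= M.
move=> r01; apply/andP; split.
 have := profile_osc hP half01 r01; rewrite /m -ler_pdivrMl ?expR_gt0// => h.
 by rewrite expRN.
rewrite /M /m mulrA -expRD (_ : 2 + -1 = 1 :> R); last by ring.
exact: (profile_osc hP r01 half01).
Qed.

(** Positivity of F' makes powers such as g^(p-4) genuine even when the exponent is negative. *)
Lemma profile_g_gt0 (r : R) : 0 < r < 1 -> 0 < g r.
move=> r01; have /andP[r0 r1] := r01; have /andP[g0 _] := profile_g hP r01.
have F0 := profile_pos hP r01; rewrite lt_neqAle g0 andbT eq_sym; apply/negP => /eqP gz.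
have := profile_lower hP r01; rewrite gz powR0; last by rewrite gt_eqF//; have := p2; lra.
have c0 : 0 < profile_constant n p.
 by rewrite /profile_constant divr_gt0 ?ltr0n// !mulr_gt0 ?exprn_gt0 ?powR_gt0 ?expR_gt0// invr_gt0.
have c1 : 0 < profile_constant n p * (r * (1 - r)) * F r `^ (p - 1).
 by apply: mulr_gt0; [apply: mulr_gt0 => //; apply: mulr_gt0; rewrite ?subr_gt0|exact: powR_gt0].
by move=> /(lt_le_trans c1); rewrite ltxx.
Qed.
Let mF := profile_mF hP.
Let mg := profile_mg hP.
Let mFV : borel R (fun r => (F r)^-1) := measurable_funVr mF.
Let mdpsi : borel R (fun r => - (g r * (F r)^-1 * (F r)^-1)).
mfun. Qed.
Let mcomp (a : R -> R) : borel R a ->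
 measurable_fun Omega (fun x => a (enorm x)).
by move=> ma; apply: mfunTS; exact: (mcompT ma men). Qed.

Definition phi (x : 'rV[R]_n) : R := u x * (F (enorm x))^-1.
(** The gradient of u / F by the quotient rule. *)
Definition Phi (x : 'rV[R]_n) : 'rV[R]_n :=
 (F (enorm x))^-1 *: (G x - (phi x * g (enorm x)) *: normalize x).
Let O01 (x : 'rV[R]_n) : Omega x -> x != 0 -> 0 < enorm x < 1.
by move=> xO x0; rewrite enorm_gt0 x0. Qed.

Lemma ae_ball : {ae leb, forall x : 'rV[R]_n, Omega x -> 0 < enorm x < 1}.
by apply: filterS (ae_neq0 R n_gt0) => x x0 xO; exact: O01. Qed.

Lemma intg_radial_mul (f : 'rV[R]_n -> R) (a : R -> R) (C : R) :
 int_ball R n f -> borel R a ->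
 (forall r, 0 < r < 1 -> `|a r| <= C) ->
 int_ball R n (fun x => f x * a (enorm x)).
move=> i_f ma aC.
have mf := integrable_mfun i_f.
(* The bound on a holds only inside (0, 1); at the origin, a null set, a is replaced by 0. *)
have i1 : int_ball R n (fun x => f x * (if 0 < enorm x then a (enorm x) else 0)).
 apply: (integrableMb (M := `|C|)) => //.
 apply: (mcomp (a := fun r => if 0 < r then a r else 0)).
 apply: measurable_fun_ifT => //; exact: measurable_fun_ltr.
 move=> x xO; case: ifP => x0; last by rewrite normr0.
 by rewrite (le_trans (aC _ _)) ?x0// ler_norm.
apply: (ae_integrable mO i1); first by apply: mfunM => //; exact: mcomp.
by apply: filterS ae_ball => x h xO; have /andP[-> _] := h xO.
Qed.
Let FVC (r : R) : 0 < r < 1 -> `|(F r)^-1| <= m^-1.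
move=> r01; have /andP[h _] := profile_bounds r01; have m0 := floor_gt0.
by rewrite ger0_norm ?invr_ge0 ?(le_trans (ltW m0) h)// lef_pV2 ?posrE// (lt_le_trans m0).
Qed.
Let gC (r : R) : 0 < r < 1 -> `|g r| <= M.
move=> r01; have /andP[g0 g1] := profile_g hP r01; have /andP[_ h] := profile_bounds r01.
by rewrite ger0_norm// (le_trans g1).
Qed.

Lemma integrable_phi : int_ball R n phi.
exact: (@intg_radial_mul u (fun r => (F r)^-1) m^-1 iu mFV FVC). Qed.

Lemma integrable_phi2 : int_ball R n (fun x => phi x ^+ 2).
rewrite (_ : (fun x => _) = (fun x => u x ^+ 2 * ((F (enorm x))^-1 * (F (enorm x))^-1))); last first.
 by apply/funext => x; rewrite /phi; ring.
apply: (@intg_radial_mul _ (fun r => (F r)^-1 * (F r)^-1) (m^-1 * m^-1)) => //; first exact: mfunM.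
by move=> r r01; rewrite normrM ler_pM// FVC.
Qed.
Let PhiE (x : 'rV[R]_n) (i : 'I_n) : Phi x ord0 i =
 u x * (- (g (enorm x) * (F (enorm x))^-1 * (F (enorm x))^-1) * normalize x ord0 i) + (F (enorm x))^-1 * G x ord0 i.
by rewrite /Phi /normalize !mxE /phi; ring. Qed.
Let mu : measurable_fun Omega u := integrable_mfun iu.
Let mG (i : 'I_n) : measurable_fun Omega (fun x => G x ord0 i) := integrable_mfun (iG i).
Let dpsiC (r : R) : 0 < r < 1 -> `|- (g r * (F r)^-1 * (F r)^-1)| <= M * m^-1 * m^-1.
by move=> r01; rewrite normrN !normrM ler_pM ?mulr_ge0// ?FVC// ler_pM// ?gC ?FVC. Qed.

Lemma integrable_Phi (i : 'I_n) : int_ball R n (fun x => Phi x ord0 i).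
rewrite (_ : (fun x => _) = (fun x => u x * (- (g (enorm x) * (F (enorm x))^-1 * (F (enorm x))^-1)) * normalize x ord0 i + G x ord0 i * (F (enorm x))^-1)); last first.
 by apply/funext => x; rewrite PhiE; ring.
apply: intgD => //; last exact: (@intg_radial_mul (fun x => G x ord0 i) (fun r => (F r)^-1) m^-1 (iG i) mFV FVC).
apply: (integrableMb (M := 1)) => //.
- exact: (@intg_radial_mul _ (fun r => - (g r * (F r)^-1 * (F r)^-1)) (M * m^-1 * m^-1)).
- mfun.
- by move=> x _; exact: normalize_le1.
Qed.

Lemma integrable_Phi2 (i : 'I_n) : int_ball R n (fun x => Phi x ord0 i ^+ 2).
pose C2 := (M * m^-1 * m^-1) ^+ 2; pose C3 := m^-1 ^+ 2.
have mPhi := integrable_mfun (integrable_Phi i).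
have i1 := intgD mO (intgZ (2 * C2) mO iu2) (intgZ (2 * C3) mO (iG2 i)).
have i2 : int_ball R n (fun x => (if 0 < enorm x then 1 else 0) * Phi x ord0 i ^+ 2).
 apply: (intg_le mO _ i1).
 apply: mfunM; last exact: measurable_funX.
 apply: (mcomp (a := fun r => if 0 < r then 1 else 0)).
 by apply: measurable_fun_ifT => //; exact: measurable_fun_ltr.
 move=> x xO; case: ifP => x0; last first.
 by rewrite mul0r normr0 addr_ge0// mulr_ge0 ?sqr_ge0// mulr_ge0// sqr_ge0.
 have r01 : 0 < enorm x < 1 by rewrite x0.
 rewrite mul1r ger0_norm ?sqr_ge0// PhiE.
 have dC := dpsiC r01; set a := - (g (enorm x) / F (enorm x) / F (enorm x)) in dC *; set nx := normalize x ord0 i; set f := (F (enorm x))^-1.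
 have ha : (a * nx) ^+ 2 <= C2.
 rewrite -[(a * nx) ^+ 2]real_normK ?num_real// ler_pXn2r ?nnegrE ?normr_ge0//; last first.
 have m0 : 0 <= m^-1 by rewrite invr_ge0 ltW// floor_gt0.
 by apply: mulr_ge0 => //; apply: mulr_ge0 => //; exact/ltW/ceil_gt0.
 rewrite normrM -[leRHS]mulr1 ler_pM//; exact: normalize_le1.
 have hf : f ^+ 2 <= C3.
 rewrite -[f ^+ 2]real_normK ?num_real// ler_pXn2r ?nnegrE ?normr_ge0 ?invr_ge0 ?(ltW floor_gt0)//.
 exact: (FVC r01).
 have h1 : u x ^+ 2 * (a * nx) ^+ 2 <= C2 * u x ^+ 2 by rewrite [leRHS]mulrC ler_wpM2l ?sqr_ge0.
 have h2 : f ^+ 2 * G x ord0 i ^+ 2 <= C3 * G x ord0 i ^+ 2 by rewrite ler_wpM2r ?sqr_ge0.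
 have := sqr_ge0 (u x * (a * nx) - f * G x ord0 i); lra.
apply: (ae_integrable mO i2); first exact: measurable_funX.
by apply: filterS ae_ball => x h xO; have /andP[-> _] := h xO; rewrite mul1r.
Qed.

(** Product rule along lines for u and the radial function 1 / F; Phi is used only in this
    integrated sense. *)
Lemma line_ftc_phi (i : 'I_n) : line_ftc phi (fun x => Phi x ord0 i) i.
have lu := weak_gradient_line_ftc iu wG (iG i).
have D (r : R) : 0 < r < 1 -> is_derive r 1 (fun r => (F r)^-1) (- (g r * (F r)^-1 * (F r)^-1)).
 move=> r01; have F0 := profile_pos hP r01.
 have E : is_derive (F r) 1 (fun s : R => s^-1) (- F r ^- 2 *: (1 : R)).
 by exact: (@is_deriveV _ (fun s : R => s) _ _ _ (lt0r_neq0 F0)).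
 have D1 : is_derive r 1 (fun r => (F r)^-1) ((- F r ^- 2 *: (1 : R)) * g r).
 exact: (is_derive1_comp (f := fun s => s^-1) (g := F) E (profile_DF hP r01)).
 apply: (is_derive_eq D1); rewrite !scalerE /=; field; exact: lt0r_neq0.
have C (r : R) : 0 < r < 1 -> {for r, continuous (fun r => - (g r * (F r)^-1 * (F r)^-1))}.
 move=> r01; have F0 := profile_pos hP r01.
 have cV : {for r, continuous (fun r => (F r)^-1)} by exact: derive_continuous (D r r01).
 by apply: cvgN; apply: cvgM => //; apply: cvgM => //; exact: (profile_cg hP r01).
have lF := radial_line_ftc i (leq_trans (ltnW (ltnSn 2)) n3) D C.
have iV : int_ball R n (fun x => - (g (enorm x) * (F (enorm x))^-1 * (F (enorm x))^-1) * normalize x ord0 i).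
 under [X in EFin \o X]eq_fun do rewrite mulrC.
 apply: (@intg_radial_mul _ (fun r => - (g r * (F r)^-1 * (F r)^-1)) (M * m^-1 * m^-1)) => //.
 apply: (intg_bounded (M := 1)) => //; first exact: ball_lty.
 mfun.
 by move=> x _; exact: normalize_le1.
have := line_ftc_mul mu (mcomp mFV) (iG i) iV lu lF.
rewrite (_ : (fun x => Phi x ord0 i) = (fun x => u x * (- (g (enorm x) * (F (enorm x))^-1 * (F (enorm x))^-1) * normalize x ord0 i) + (F (enorm x))^-1 * G x ord0 i)) //.
by apply/funext => x; exact: PhiE.
Qed.

(** 1 / F is radial, so phi inherits the vanishing spherical means of u and has mean zero on every
    centred ball. *)
Lemma mean_phi (rho : R) : \int[leb]_(x in [set x : 'rV[R]_n | enorm x < rho] `&` Omega) phi x = 0.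
pose a (r : R) := \1_(`]-oo, rho[%classic : set R) r * (F r)^-1.
have ma : borel R a.
 by apply: mfunM => //; apply: measurable_indic; exact: measurable_itv.
have aC (r : R) : 0 < r < 1 -> `|a r| <= m^-1.
 move=> r01; rewrite /a indicE normrM; case: (_ \in _); last by rewrite normr0 mul0r invr_ge0 ltW// floor_gt0.
 by rewrite normr1 mul1r FVC.
have ia := intg_radial_mul iu ma aC.
have E := polar_mul n_gt0 iu ma ia.
have Z : \int[mu1]_(r in `]0, 1[) (smean u r * a r) = 0.
 have ism := integrable_smean n_gt0 iu.
 have ms := integrable_mfun ism.
 rewrite (@ae_eq_Rint _ (measurableTypeR R) R mu1 `]0%R, 1%R[%classic _ (cst 0) (measurable_itv _)).
 - by rewrite Rintegral_cst// mul0r.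
 - mfun.
 - mfun.
 - by apply: ae_imply mean_u => r h; rewrite /= in_itv/= => r01; rewrite h// mul0r.
transitivity (\int[leb]_(x in Omega) (u x * a (enorm x))); last by rewrite E.
rewrite (@Rintegral_support _ _ _ leb Omega ([set x | enorm x < rho] `&` Omega)).
- by apply: eq_Rintegral => x; rewrite inE => -[/= xr _]; rewrite /a indicE mem_set ?mul1r//= in_itv.
- by move=> x [].
- move=> x xO nx; rewrite /a indicE memNset ?mul0r ?mulr0//= in_itv/= => h; exact: nx.
Qed.
Let powM (c r : R) : 0 <= c -> 0 < r < 1 -> F r `^ c <= M `^ c.
move=> c0 r01; have /andP[_ h] := profile_bounds r01.
by apply: ge0_ler_powR => //; rewrite nnegrE ltW// ?ceil_gt0// (profile_pos hP).
Qed.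
Let powF (c r : R) : 0 <= c -> 0 < r < 1 -> g r `^ c <= F r `^ c.
move=> c0 r01; have /andP[g0 h] := profile_g hP r01.
by apply: ge0_ler_powR => //; rewrite nnegrE ltW// (profile_pos hP).
Qed.
Let mP (a : R -> R) (c : R) : borel R a ->
 borel R (fun r => a r `^ c).
by move=> ma; exact: (mcompT (measurable_powR c) ma). Qed.
Let mid : borel R (fun r : R => r).
mfun. Qed.
Let mphi : measurable_fun Omega phi := integrable_mfun integrable_phi.
Let mPhi (i : 'I_n) : measurable_fun Omega (fun x => Phi x ord0 i) :=
 integrable_mfun (integrable_Phi i).

Local Notation phir x := (dotp (Phi x) (normalize x)).
Let mphir : measurable_fun Omega (fun x : 'rV[R]_n => phir x).
rewrite /dotp; apply: measurable_sum => i; apply: mfunM => //.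
mfun.
Qed.
Let iPhiN : int_ball R n (fun x => enorm (Phi x) ^+ 2).
rewrite (_ : (fun x => enorm (Phi x) ^+ 2) = (fun x => \sum_(i < n) Phi x ord0 i ^+ 2)); last first.
 by apply/funext => x; rewrite sqr_enorm; apply: eq_bigr => i _; rewrite expr2.
by apply: intg_bigsum => // i; exact: integrable_Phi2.
Qed.
Let normalize1 (x : 'rV[R]_n) : enorm (normalize x) <= 1.
have [->|x0] := eqVneq x 0; last by rewrite enorm_normalize.
by rewrite /normalize scaler0 enorm0.
Qed.
Let phir_sqr (x : 'rV[R]_n) : phir x ^+ 2 <= enorm (Phi x) ^+ 2.
rewrite -[phir x ^+ 2]real_normK ?num_real// ler_pXn2r ?nnegrE ?normr_ge0 ?enorm_ge0//.
rewrite (le_trans (dotp_le _ _))// -[leRHS]mulr1 ler_wpM2l ?enorm_ge0//.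
Qed.
Let iphir2 : int_ball R n (fun x => phir x ^+ 2).
apply: (intg_le mO _ iPhiN); first exact: measurable_funX.
by move=> x _; rewrite ger0_norm ?sqr_ge0.
Qed.
Let iphiphir : int_ball R n (fun x => phi x * phir x).
apply: (intg_le mO _ (intgD mO integrable_phi2 iphir2)).
 mfun.
move=> x _; rewrite ler_norml; have h1 := sqr_ge0 (phi x - phir x); have h2 := sqr_ge0 (phi x + phir x).
have h3 := sqr_ge0 (phi x); have h4 := sqr_ge0 (phir x).
by apply/andP; split; rewrite /=; nra.
Qed.
(** The field hh(|x|) x is F |grad v|^(p-2) grad v, so hh = g^(p-1) F / r. It is written through the
    flux, whose derivative is known from the equation. *)
Let hh (r : R) := (r ^+ n.-1 * spow p (g r)) * (F r * r `^ (- n%:R)).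
Let dhh (r : R) := (r ^+ n.-1 * spow p (g r)) * (F r * (- n%:R * r `^ (- n%:R - 1)) + r `^ (- n%:R) * g r) +
 (F r * r `^ (- n%:R)) * (r ^+ n.-1 * (F r `^ (p - 1) - lam * (r `^ alpha * F r `^ (q - 1)))).
Let dhhP (r : R) : 0 < r < 1 -> is_derive r 1 hh (dhh r).
move=> r01; have /andP[r0 _] := r01.
have D3 : is_derive r 1 (fun r => F r * r `^ (- n%:R)) (F r * (- n%:R * r `^ (- n%:R - 1)) + r `^ (- n%:R) * g r).
 by apply: (is_derive_eq (is_deriveM (profile_DF hP r01) (is_derive1_powR (- n%:R) r0))); rewrite !scalerE.
by apply: (is_derive_eq (is_deriveM (profile_DL hP r01) D3)); rewrite !scalerE.
Qed.
Let mspow : borel R (fun r => spow p (g r)).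
have ms : borel R (spow p).
 by apply: continuous_measurable_fun; exact: spow_continuous.
mfun.
Qed.
Let mhh : borel R hh.
apply: mfunM; first by apply: mfunM => //; exact: measurable_funX.
by apply: mfunM => //; exact: mP.
Qed.
Let mdhh : borel R dhh.
apply: measurable_funD.
 apply: mfunM; first by apply: mfunM => //; exact: measurable_funX.
 apply: measurable_funD; last by apply: mfunM => //; exact: mP.
 by apply: mfunM => //; apply: mfunM => //; exact: mP.
apply: mfunM; first by apply: mfunM => //; exact: mP.
apply: mfunM; first exact: measurable_funX.
apply: measurable_funB; first exact: mP.
by apply: mfunM => //; apply: mfunM; exact: mP.
Qed.
Let Frn (r : R) : 0 < r -> r `^ (- n%:R) = (r ^+ n.-1 * r)^-1.
by move=> r0; rewrite powRN powR_mulrn ?(ltW r0)// -exprSr prednK. Qed.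
Let hhE (r : R) : 0 < r < 1 -> hh r = g r `^ (p - 1) * F r * r^-1.
move=> r01; have /andP[r0 _] := r01; have /andP[g0 _] := profile_g hP r01.
rewrite /hh Frn// spowE//; field.
by rewrite (gt_eqF r0) expf_neq0// gt_eqF.
Qed.
(** The divergence of this field: the equation contributes F^p - lam r^alpha F^q, the gradient of F
    contributes g^p. *)
Let dhhE (r : R) : 0 < r < 1 -> r * dhh r + n%:R * hh r =
 (F r `^ p + g r `^ p) - lam * (r `^ alpha * F r `^ q).
move=> r01; have /andP[r0 _] := r01; have /andP[g0 _] := profile_g hP r01.
have F0 := profile_pos hP r01; have gg0 := profile_g_gt0 r01.
have -> : F r `^ p = F r `^ (p - 1) * F r by rewrite (@powR_mul_id _ _ _ p)//; ring.
have -> : g r `^ p = g r `^ (p - 1) * g r by rewrite (@powR_mul_id _ _ _ p)//; ring.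
have -> : F r `^ q = F r `^ (q - 1) * F r by rewrite (@powR_mul_id _ _ _ q)//; ring.
have E : r `^ (- n%:R - 1) = r `^ (- n%:R) * r^-1.
 rewrite powRD; last by rewrite (gt_eqF r0) implybT.
 by rewrite powR_inv1// ltW.
rewrite /dhh /hh E Frn// spowE//.
have L0 : r ^+ n.-1 != 0 by rewrite expf_neq0// gt_eqF.
by field; rewrite L0 gt_eqF.
Qed.
Let i1 : int_ball R n (fun x => phi x ^+ 2 * (F (enorm x) `^ p + g (enorm x) `^ p)).
apply: (@intg_radial_mul _ (fun r => F r `^ p + g r `^ p) (M `^ p + M `^ p)); first exact: integrable_phi2.
 mfun.
move=> r r01; rewrite ger0_norm ?addr_ge0 ?powR_ge0//.
have p0 : 0 <= p by have := p2; lra.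
by apply: lerD; [exact: powM|exact: le_trans (powF p0 r01) (powM p0 r01)].
Qed.
Let i2 : int_ball R n (fun x => phi x ^+ 2 * (enorm x `^ alpha * F (enorm x) `^ q)).
apply: (@intg_radial_mul _ (fun r => r `^ alpha * F r `^ q) (M `^ q)); first exact: integrable_phi2.
 mfun.
move=> r r01; have /andP[r0 r1] := r01; rewrite ger0_norm ?mulr_ge0 ?powR_ge0// -[leRHS]mul1r.
have q0 : 0 <= q by have := p2; have := pq; lra.
apply: ler_pM; rewrite ?powR_ge0 ?powM//.
by apply: powR_le_one; rewrite ltW.
Qed.
Let i3 : int_ball R n (fun x => phi x * phir x * (2 * (g (enorm x) `^ (p - 1) * F (enorm x)))).
apply: (@intg_radial_mul _ (fun r => 2 * (g r `^ (p - 1) * F r)) (2 * M `^ p)); first exact: iphiphir.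
 mfun.
move=> r r01; have F0 := profile_pos hP r01; have p1 : 0 <= p - 1 by have := p2; lra.
have p0 : 0 <= p by have := p2; lra.
rewrite ger0_norm ?mulr_ge0 ?powR_ge0 ?(ltW F0)// ler_wpM2l// (le_trans _ (powM p0 r01))//.
have -> : F r `^ p = F r `^ (p - 1) * F r by rewrite (@powR_mul_id _ _ _ p)//; ring.
by rewrite ler_wpM2r ?(ltW F0)// powF.
Qed.
Let iT : int_ball R n (fun x => enorm (Phi x) ^+ 2 * (g (enorm x) `^ (p - 2) * F (enorm x) ^+ 2)).
have p0 : 0 <= p - 2 by have := p2; lra.
apply: (@intg_radial_mul _ (fun r => g r `^ (p - 2) * F r ^+ 2) (M `^ (p - 2) * M ^+ 2)) => //.
 mfun.
move=> r r01; have F0 := ltW (profile_pos hP r01); have /andP[_ FM] := profile_bounds r01.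
rewrite ger0_norm ?mulr_ge0 ?powR_ge0 ?sqr_ge0//; apply: ler_pM; rewrite ?powR_ge0 ?sqr_ge0//.
 exact: le_trans (powF p0 r01) (powM p0 r01).
by rewrite ler_pXn2r ?nnegrE// ltW// ceil_gt0.
Qed.
Let iTr : int_ball R n (fun x => phir x ^+ 2 * (g (enorm x) `^ (p - 2) * F (enorm x) ^+ 2)).
apply: (intg_le mO _ iT).
 apply: mfunM; first exact: measurable_funX.
 apply: (mcomp (a := fun r => g r `^ (p - 2) * F r ^+ 2)).
 by apply: mfunM; [exact: mP|exact: measurable_funX].
move=> x _; rewrite ger0_norm ?ler_wpM2r ?phir_sqr//; first by rewrite mulr_ge0 ?powR_ge0 ?sqr_ge0.
by rewrite mulr_ge0 ?sqr_ge0// mulr_ge0 ?powR_ge0 ?sqr_ge0.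
Qed.
(** Near 0 the estimate [profile_flux] compensates 1 / r; near 1 the hypothesis on C, a quantitative
    Neumann condition, supplies the factor 1 - r. *)
Let bound_hh (C r : R) : (forall r : R, 0 < r < 1 -> r ^+ n.-1 * g r `^ (p - 1) <= C * (1 - r)) -> 0 < r < 1 ->
 `|hh r| <= (2 * M `^ p + 2 ^+ n * `|C| * M + lam * M `^ q) * (1 - r).
move=> hC r01; have /andP[r0 r1] := r01; have F0 := profile_pos hP r01.
have /andP[_ FM] := profile_bounds r01; have lam0 := profile_lam hP.
have p1 : 0 <= p - 1 by have := p2; lra.
have p0 : 0 <= p by have := p2; lra.
have L0 : 0 < r ^+ n.-1 by rewrite exprn_gt0.
have Ln : r ^+ n = r ^+ n.-1 * r by rewrite -exprSr prednK.
have e1 : 0 <= 2 * M `^ p * (1 - r) by rewrite !mulr_ge0 ?powR_ge0// subr_ge0 ltW.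
have e2 : 0 <= 2 ^+ n * `|C| * M * (1 - r).
 apply: mulr_ge0; last by rewrite subr_ge0 ltW.
 by apply: mulr_ge0; [rewrite mulr_ge0 ?exprn_ge0|exact: ltW ceil_gt0].
have e3 : 0 <= lam * M `^ q * (1 - r) by rewrite mulr_ge0 ?subr_ge0 ?(ltW r1)// mulr_ge0 ?powR_ge0// ltW.
rewrite hhE// ger0_norm; last by rewrite !mulr_ge0 ?powR_ge0 ?invr_ge0 ?(ltW F0) ?(ltW r0).
have [rh|rh] := leP r 2^-1.
 have gF : g r `^ (p - 1) <= F r `^ (p - 1) * r.
 rewrite -(ler_pM2l L0) (le_trans (profile_flux hP r01))// Ln [leRHS]mulrCA ler_wpM2l ?powR_ge0//.
 by rewrite ler_piMr ?mulr_ge0 ?(ltW L0) ?(ltW r0)// invf_le1 ?ltr0n// ler1n.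
 have : g r `^ (p - 1) * F r * r^-1 <= M `^ p.
 rewrite (le_trans _ (powM p0 r01))// ler_pdivrMr//.
 have -> : F r `^ p = F r `^ (p - 1) * F r by rewrite (@powR_mul_id _ _ _ p)//; ring.
 by rewrite mulrAC ler_wpM2r ?(ltW F0).
 have : M `^ p <= 2 * M `^ p * (1 - r).
 by rewrite mulrAC -[leLHS]mul1r ler_wpM2r ?powR_ge0//; lra.
 lra.
have h1 := hC r r01.
have rn : (r ^+ n)^-1 <= 2 ^+ n.
 rewrite -exprVn lerXn2r ?nnegrE ?invr_ge0 ?(ltW r0)//.
 by rewrite -[leRHS]invrK lef_pV2 ?posrE ?invr_gt0// ltW.
have -> : g r `^ (p - 1) * F r * r^-1 = (r ^+ n.-1 * g r `^ (p - 1)) * F r * (r ^+ n)^-1.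
 by rewrite Ln; field; rewrite !gt_eqF.
have h2 : (r ^+ n.-1 * g r `^ (p - 1)) * F r * (r ^+ n)^-1 <= (`|C| * (1 - r)) * M * 2 ^+ n.
 apply: ler_pM => //; rewrite ?mulr_ge0 ?invr_ge0 ?powR_ge0 ?exprn_ge0 ?(ltW r0) ?(ltW F0)//.
 apply: ler_pM => //; rewrite ?mulr_ge0 ?powR_ge0 ?(ltW L0) ?(ltW F0)//.
 by rewrite (le_trans h1)// ler_wpM2r ?ler_norm// subr_ge0 ltW.
apply: le_trans h2 _; lra.
Qed.
Let bound_dhh (C r : R) : 0 < r < 1 ->
 `|r * dhh r + n%:R * hh r| <= 2 * M `^ p + 2 ^+ n * `|C| * M + lam * M `^ q.
move=> r01; have /andP[r0 r1] := r01; have lam0 := profile_lam hP.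
have p0 : 0 <= p by have := p2; lra.
have q0 : 0 <= q by have := p2; have := pq; lra.
have e2 : 0 <= 2 ^+ n * `|C| * M.
 by apply: mulr_ge0; [rewrite mulr_ge0 ?exprn_ge0|exact: ltW ceil_gt0].
rewrite dhhE//; have h1 := powM p0 r01; have h2 := powF p0 r01.
have h3 : r `^ alpha * F r `^ q <= M `^ q.
 rewrite -[leRHS]mul1r; apply: ler_pM; rewrite ?powR_ge0 ?powM//.
 by apply: powR_le_one; rewrite ltW.
have h4 : lam * (r `^ alpha * F r `^ q) <= lam * M `^ q by rewrite ler_wpM2l// ltW.
have h5 : 0 <= lam * (r `^ alpha * F r `^ q) by rewrite mulr_ge0 ?(ltW lam0)// mulr_ge0 ?powR_ge0.
have h6 := powR_ge0 (F r) p; have h7 := powR_ge0 (g r) p.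
rewrite ler_norml; apply/andP; split; lra.
Qed.
Let WE (x : 'rV[R]_n) (i : 'I_n) :
 ((2 * phi x) *: Phi x) ord0 i = phi x * Phi x ord0 i + phi x * Phi x ord0 i.
by rewrite mxE; ring. Qed.
Let iW (i : 'I_n) : int_ball R n (fun x => ((2 * phi x) *: Phi x) ord0 i).
rewrite (_ : (fun x => _) = (fun x => phi x * Phi x ord0 i + phi x * Phi x ord0 i)); last first.
 by apply/funext => x; exact: WE.
apply: (intg_le mO _ (intgD mO integrable_phi2 (integrable_Phi2 i))).
 mfun.
move=> x _; rewrite ler_norml; have h1 := sqr_ge0 (phi x - Phi x ord0 i); have h2 := sqr_ge0 (phi x + Phi x ord0 i).
by apply/andP; split; rewrite /=; lra.
Qed.
Let lW (i : 'I_n) : line_ftc (fun x => phi x ^+ 2) (fun x => ((2 * phi x) *: Phi x) ord0 i) i.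
rewrite (_ : (fun x => ((2 * phi x) *: Phi x) ord0 i) =
 (fun x => phi x * Phi x ord0 i + phi x * Phi x ord0 i)); last first.
 by apply/funext => x; exact: WE.
exact: (line_ftc_mul mphi mphi (integrable_Phi i) (integrable_Phi i) (line_ftc_phi i) (line_ftc_phi i)).
Qed.

(** The equation tested with F phi^2, carried out as an integration by parts of phi^2 against the
    field hh(|x|) x. *)
Lemma energy_identity :
 lam * \int[leb]_(x in Omega) (phi x ^+ 2 * (enorm x `^ alpha * F (enorm x) `^ q)) =
 \int[leb]_(x in Omega) (phi x ^+ 2 * (F (enorm x) `^ p + g (enorm x) `^ p)) +
 \int[leb]_(x in Omega) (phi x * phir x * (2 * (g (enorm x) `^ (p - 1) * F (enorm x)))).
have [C hC] := profile_boundary hP.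
have ibp := radial_ibp n_gt0 integrable_phi2 iW lW dhhP mhh mdhh (fun r => bound_hh hC (r := r)) (bound_dhh C).
have menO : measurable_fun Omega (@enorm R n) by mfun.
have E1 : \int[leb]_(x in Omega) (phi x ^+ 2 * (enorm x * dhh (enorm x) + n%:R * hh (enorm x))) =
 \int[leb]_(x in Omega) (phi x ^+ 2 * (F (enorm x) `^ p + g (enorm x) `^ p) -
 lam * (phi x ^+ 2 * (enorm x `^ alpha * F (enorm x) `^ q))).
 apply: ae_eq_Rint => //.
 - apply: mfunM; first exact: measurable_funX.
 apply: measurable_funD; first by apply: mfunM => //; exact: (mcomp mdhh).
 by apply: mfunM => //; exact: (mcomp mhh).
 - mfun.
 - by apply: filterS ae_ball => x h xO; rewrite dhhE ?h//; ring.
have E2 : \int[leb]_(x in Omega) (dotp ((2 * phi x) *: Phi x) x * hh (enorm x)) =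
 \int[leb]_(x in Omega) (phi x * phir x * (2 * (g (enorm x) `^ (p - 1) * F (enorm x)))).
 apply: ae_eq_Rint => //.
 - apply: mfunM; last exact: (mcomp mhh).
 rewrite /dotp; apply: measurable_sum => i; apply: mfunM.
 exact: integrable_mfun (iW i).
 by apply: mfunTS; exact: measurable_coord.
 - mfun.
 - apply: filterS ae_ball => x h xO; have /andP[x0 _] := h xO.
 rewrite hhE ?h// dotpZl.
 have -> : dotp (Phi x) x = enorm x * phir x.
 by rewrite /normalize dotpZr mulrA mulfV ?mul1r// gt_eqF.
 by field; rewrite gt_eqF.
move: ibp; rewrite E1 E2 RintegralB//; last exact: intgZ.
rewrite RintegralZl//; lra.
Qed.

Local Notation tau x := (enorm (Phi x) ^+ 2 * (g (enorm x) `^ (p - 2) * F (enorm x) ^+ 2)).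
Let T := \int[leb]_(x in Omega) tau x.
(** This exponent converts the lower bound on g^(p-1) into one on g^(p-2), the weight of T. *)
Let beta := (p - 2) / (p - 1).
Let c0 := profile_constant n p.
Let c0_gt0 : 0 < c0.
by rewrite /c0 /profile_constant divr_gt0 ?ltr0n// !mulr_gt0 ?exprn_gt0 ?powR_gt0 ?expR_gt0// invr_gt0.
Qed.
Let beta01 : 0 <= beta < 1.
have p1 : 0 < p - 1 by have := p2; lra.
rewrite /beta divr_ge0 ?(ltW p1) ?subr_ge0//= ltr_pdivrMr// mul1r; lra.
Qed.
Let weight_le (r : R) : 0 < r < 1 ->
 c0 `^ beta * m `^ p * (r * (1 - r)) `^ beta <= g r `^ (p - 2) * F r ^+ 2.
move=> r01; have /andP[r0 r1] := r01; have F0 := profile_pos hP r01.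
have /andP[g0 _] := profile_g hP r01; have /andP[mF' _] := profile_bounds r01.
have p1 : 0 < p - 1 by have := p2; lra.
have /andP[b0 _] := beta01.
have rr : 0 <= r * (1 - r) by rewrite mulr_ge0 ?subr_ge0 ?(ltW r0) ?(ltW r1).
have bE : (p - 1) * beta = p - 2 by rewrite /beta; field; rewrite gt_eqF.
have h : (c0 * (r * (1 - r)) * F r `^ (p - 1)) `^ beta <= (g r `^ (p - 1)) `^ beta.
 apply: ge0_ler_powR => //; rewrite ?nnegrE ?powR_ge0//; last exact: (profile_lower hP r01).
 by rewrite mulr_ge0 ?powR_ge0// mulr_ge0// ltW.
have E : (c0 * (r * (1 - r)) * F r `^ (p - 1)) `^ beta = c0 `^ beta * (r * (1 - r)) `^ beta * F r `^ (p - 2).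
 by rewrite (@powRM R _ _ beta (mulr_ge0 (ltW c0_gt0) rr) (powR_ge0 _ _)) (@powRM R _ _ beta (ltW c0_gt0) rr) -powRrM bE.
have {}h : c0 `^ beta * (r * (1 - r)) `^ beta * F r `^ (p - 2) <= g r `^ (p - 2).
 by move: h; rewrite E -[X in _ <= X -> _]powRrM bE.
apply: (@le_trans _ _ (c0 `^ beta * (r * (1 - r)) `^ beta * F r `^ (p - 2) * F r ^+ 2)); last first.
 by rewrite ler_wpM2r ?sqr_ge0.
have -> : c0 `^ beta * (r * (1 - r)) `^ beta * F r `^ (p - 2) * F r ^+ 2 = c0 `^ beta * (r * (1 - r)) `^ beta * F r `^ p.
 by rewrite -mulrA (@powR_mul_sqr _ _ _ p)//; ring.
rewrite mulrAC ler_wpM2l ?mulr_ge0 ?powR_ge0//.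
by apply: ge0_ler_powR => //; rewrite ?nnegrE ?(ltW F0) ?(ltW floor_gt0)//; have := p2; lra.
Qed.
Let K2 := `|poincare_const n beta| / (c0 `^ beta * m `^ p).
(** [weighted_poincare] for phi, whose mean vanishes on the ball of radius 1 / n, followed by the
    comparison [weight_le] of the weights. *)
Let phi_T : \int[leb]_(x in Omega) phi x ^+ 2 <= K2 * T.
have /andP[b0 b1] := beta01.
have k0 : 0 < c0 `^ beta * m `^ p by rewrite mulr_gt0 ?powR_gt0// floor_gt0.
have mean0 : \int[leb]_(x in [set x : 'rV[R]_n | enorm x < n%:R^-1]) phi x = 0.
 rewrite -(mean_phi n%:R^-1); congr (Rintegral _ _ _); apply/esym/setIidPl => x /= xn.
 by rewrite /unit_ball/= (lt_le_trans xn)// invf_le1 ?ltr0n// ler1n.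
have WP := weighted_poincare n3 b0 b1 integrable_phi integrable_phi2 integrable_Phi integrable_Phi2 line_ftc_phi mean0.
have iw : int_ball R n (fun x => enorm (Phi x) ^+ 2 * (enorm x * (1 - enorm x)) `^ beta).
 apply: (@intg_radial_mul _ (fun r => (r * (1 - r)) `^ beta) 1) => //.
 mfun.
 move=> r /andP[r0 r1]; rewrite ger0_norm ?powR_ge0//.
 apply: powR_le_one => //; first by rewrite mulr_ge0 ?subr_ge0 ?(ltW r0) ?(ltW r1).
 by rewrite -[leRHS]mulr1 ler_pM ?subr_ge0 ?(ltW r0) ?(ltW r1)// lerBlDr lerDl ltW.
set X := \int[leb]_(x in Omega) ((enorm x * (1 - enorm x)) `^ beta * enorm (Phi x) ^+ 2) in WP.
have X0 : 0 <= X by apply: Rintegral_ge0 => x _; rewrite mulr_ge0 ?powR_ge0 ?sqr_ge0.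
have XT : c0 `^ beta * m `^ p * X <= T.
 have -> : X = \int[leb]_(x in Omega) (enorm (Phi x) ^+ 2 * (enorm x * (1 - enorm x)) `^ beta).
 by apply: eq_Rintegral => x _; rewrite mulrC.
 rewrite -RintegralZl//; apply: ae_le_Rintegral_in => //; first exact: intgZ.
 apply: filterS ae_ball => x h xO; rewrite mulrCA ler_wpM2l ?sqr_ge0//.
 exact: weight_le (h xO).
apply: (le_trans WP); apply: (@le_trans _ _ (`|poincare_const n beta| * X)).
 by rewrite ler_wpM2r ?ler_norm.
rewrite /K2 mulrAC -mulrA ler_wpM2l// mulrC ler_pdivlMl//.
Qed.

(** This is 3 M^p K2 + 1 after cancelling the powers of m, as M = e^2 m: the solution has
    disappeared from it. *)
Definition gap_constant : R :=
 3 * expR 2 `^ p * `|poincare_const n beta| / c0 `^ beta + 1.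

(** In [energy_identity], Young's inequality bounds the cross term by g^p phi^2 + g^(p-2) F^2
    phi_r^2. The Poincare inequality then bounds the three terms with phi^2, each at most M^p
    phi^2. *)
Lemma energy_le :
 lam * \int[leb]_(x in Omega) (phi x ^+ 2 * (enorm x `^ alpha * F (enorm x) `^ q)) <= gap_constant * T.
have p0 : 0 <= p by have := p2; lra.
have Mp0 := powR_ge0 M p.
have i4 := intgZ (3 * M `^ p) mO integrable_phi2.
have i5 := intgD mO i4 iT.
have h1 : lam * \int[leb]_(x in Omega) (phi x ^+ 2 * (enorm x `^ alpha * F (enorm x) `^ q)) <=
 3 * M `^ p * \int[leb]_(x in Omega) phi x ^+ 2 + T.
 rewrite energy_identity -(RintegralD mO i1 i3).
 have <- : \int[leb]_(x in Omega) (3 * M `^ p * phi x ^+ 2 + tau x) = 3 * M `^ p * \int[leb]_(x in Omega) phi x ^+ 2 + T.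
 by rewrite RintegralD// RintegralZl// integrable_phi2.
 apply: ae_le_Rintegral_in => //; first exact: intgD.
 apply: filterS ae_ball => x h xO; have r01 := h xO.
 have Fp := powM p0 r01; have gp := le_trans (powF p0 r01) Fp; have gg0 := profile_g_gt0 r01.
 have F0 := profile_pos hP r01.
 have k0 := powR_ge0 (g (enorm x)) (p - 2).
 have E1 : g (enorm x) `^ (p - 1) = g (enorm x) `^ (p - 2) * g (enorm x).
 by rewrite (@powR_mul_id _ _ _ (p - 1))//; ring.
 have E2 : g (enorm x) `^ p = g (enorm x) `^ (p - 2) * g (enorm x) ^+ 2.
 by rewrite (@powR_mul_sqr _ _ _ p)//; ring.
 have h2 : phi x ^+ 2 * F (enorm x) `^ p <= phi x ^+ 2 * M `^ p by rewrite ler_wpM2l ?sqr_ge0.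
 have h3 : phi x ^+ 2 * g (enorm x) `^ p <= phi x ^+ 2 * M `^ p by rewrite ler_wpM2l ?sqr_ge0.
 have h4 := mulr_ge0 k0 (sqr_ge0 (g (enorm x) * phi x - F (enorm x) * phir x)).
 have h5 : phir x ^+ 2 * (g (enorm x) `^ (p - 2) * F (enorm x) ^+ 2) <= tau x.
 by rewrite ler_wpM2r ?phir_sqr// mulr_ge0 ?sqr_ge0.
 rewrite E2 in h3; rewrite E1 E2.
 move: h2 h3 h4 h5; set k := g _ `^ _; set a := g _; set b := F _; set f := phi x; set f' := phir x.
 set c := _ `^ p; set d := M `^ p; set N := enorm _ ^+ 2; clearbody k a b f f' c d N => h2 h3 h4 h5.
 lra.
have h2 : 3 * M `^ p * \int[leb]_(x in Omega) phi x ^+ 2 <= 3 * M `^ p * (K2 * T).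
 by rewrite ler_wpM2l// ?mulr_ge0//; exact: phi_T.
apply: (le_trans h1); apply: (@le_trans _ _ (3 * M `^ p * (K2 * T) + T)); first by rewrite lerD2r.
have m0 : m `^ p != 0 by rewrite gt_eqF// powR_gt0// floor_gt0.
have cb0 : c0 `^ beta != 0 by rewrite gt_eqF// powR_gt0.
rewrite /gap_constant /K2 /ceil_value powRM ?expR_ge0 ?(ltW floor_gt0)//.
rewrite le_eqVlt; apply/orP; left; apply/eqP; field.
by rewrite m0 cb0.
Qed.

Lemma gap_constant_gt0 : 0 < gap_constant.
by rewrite ltr_wpDl// divr_ge0 ?powR_ge0// mulr_ge0// mulr_ge0 ?powR_ge0. Qed.
(** If T vanished, the Poincare inequality would force phi, hence u, to vanish almost everywhere. *)
Let phi_neq0 : nonzero u -> 0 < T.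
move=> nu; rewrite lt_neqAle; apply/andP; split; last first.
 by apply: Rintegral_ge0 => x _; rewrite mulr_ge0 ?sqr_ge0// mulr_ge0 ?powR_ge0 ?sqr_ge0.
rewrite eq_sym; apply/negP => /eqP TZ; apply: nu.
have Z0 : 0 <= \int[leb]_(x in Omega) phi x ^+ 2 by apply: Rintegral_ge0 => x _; exact: sqr_ge0.
have Z : \int[leb]_(x in Omega) phi x ^+ 2 = 0.
 by apply/eqP; rewrite eq_le Z0 andbT; have := phi_T; rewrite TZ mulr0.
have az := Rintegral_eq0_ae mO integrable_phi2 (fun x => sqr_ge0 (phi x)) Z.
apply: filterS2 az ae_ball => x h1 h2 xO; have F0 := profile_pos hP (h2 xO).
by have /eqP := h1 xO; rewrite sqrf_eq0 /phi mulf_eq0 invr_eq0 (gt_eqF F0) orbF => /eqP.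
Qed.

Hypothesis mv : measurable_fun Omega v.
Hypothesis mGv : forall i : 'I_n, measurable_fun Omega (fun x => grad v x ord0 i).
Let mpowO (f : 'rV[R]_n -> R) (c : R) : measurable_fun Omega f -> measurable_fun Omega (fun x => f x `^ c).
by move=> mf; exact: (mcompT (measurable_powR c) mf). Qed.
Let menO : measurable_fun Omega (@enorm R n). Proof. mfun. Qed.
Let AE : \int[leb]_(x in Omega) (enorm x `^ alpha * v x `^ q) = lam^-1.
rewrite -(profile_A hP); apply: ae_eq_Rint => //.
- mfun.
- exact: integrable_mfun (profile_int hP).
- apply: filterS2 (profile_v hP) ae_ball => x h1 h2 xO; rewrite h1// ger0_norm// ltW//.
 exact: (profile_pos hP (h2 xO)).
Qed.
Let I3 : \int[leb]_(x in Omega) (enorm x `^ alpha * v x `^ (q - 2) * u x ^+ 2) =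
 \int[leb]_(x in Omega) (phi x ^+ 2 * (enorm x `^ alpha * F (enorm x) `^ q)).
apply: ae_eq_Rint => //.
- mfun.
- mfun.
- apply: filterS2 (profile_v hP) ae_ball => x h1 h2 xO; rewrite h1//.
 have F0 := profile_pos hP (h2 xO).
 have -> : F (enorm x) `^ q = F (enorm x) `^ (q - 2) * F (enorm x) ^+ 2.
 by rewrite (@powR_mul_sqr _ _ _ q)//; ring.
 by rewrite /phi; field; rewrite gt_eqF.
Qed.
Let mdot (H K : 'rV[R]_n -> 'rV[R]_n) : (forall i, measurable_fun Omega (fun x => H x ord0 i)) ->
 (forall i, measurable_fun Omega (fun x => K x ord0 i)) -> measurable_fun Omega (fun x => dotp (H x) (K x)).
by move=> mH mK; rewrite /dotp; apply: measurable_sum => i; exact: mfunM. Qed.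
Let GxE (x : 'rV[R]_n) : 0 < F (enorm x) ->
 G x = F (enorm x) *: Phi x + (phi x * g (enorm x)) *: normalize x.
by move=> F0; rewrite /Phi scalerA mulfV ?gt_eqF// scale1r subrK. Qed.
(** Pointwise this is [second_variation_integrand]; the group with factor p - 1 is the right side of
    [energy_identity]. *)
Let I1 : \int[leb]_(x in Omega)
 ((p - 2) * enorm (grad v x) `^ (p - 4) * dotp (grad v x) (G x) ^+ 2
 + enorm (grad v x) `^ (p - 2) * enorm (G x) ^+ 2
 + (p - 1) * v x `^ (p - 2) * u x ^+ 2) =
 \int[leb]_(x in Omega) (tau x + (p - 2) * (phir x ^+ 2 * (g (enorm x) `^ (p - 2) * F (enorm x) ^+ 2))
 + (p - 1) * (phi x ^+ 2 * (F (enorm x) `^ p + g (enorm x) `^ p) +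
 phi x * phir x * (2 * (g (enorm x) `^ (p - 1) * F (enorm x))))).
have mgv : measurable_fun Omega (fun x => enorm (grad v x)) by exact: mfun_enorm_comp.
have mGe : measurable_fun Omega (fun x => enorm (G x)) by exact: mfun_enorm_comp.
apply: ae_eq_Rint => //.
- apply: measurable_funD; last first.
 by apply: mfunM; [apply: mfunM => //; exact: mpowO|exact: measurable_funX].
 apply: measurable_funD.
 apply: mfunM; first by apply: mfunM => //; exact: mpowO.
 by apply: measurable_funX; exact: mdot.
 by apply: mfunM; [exact: mpowO|exact: measurable_funX].
- have j1 := intgD mO iT (intgZ (p - 2) mO iTr).
 have j2 := intgZ (p - 1) mO (intgD mO i1 i3).
 mfun.
- apply: filterS3 (profile_v hP) (profile_grad hP) ae_ball => x h1 h2 h3 xO.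
 have r01 := h3 xO; have F0 := profile_pos hP r01; have g0 := profile_g_gt0 r01.
 have x0 : x != 0 by have /andP[] := r01; rewrite enorm_gt0.
 have n1 : dotp (normalize x) (normalize x) = 1 by rewrite -sqr_enorm enorm_normalize// expr1n.
 rewrite h1// h2//.
 have -> : enorm (g (enorm x) *: normalize x) = g (enorm x).
 by rewrite enormZ enorm_normalize// mulr1 ger0_norm// ltW.
 have -> : dotp (g (enorm x) *: normalize x) (G x) =
 g (enorm x) * (F (enorm x) * phir x + phi x * g (enorm x)).
 by rewrite dotpZl GxE// (frame_dotp _ _ (Phi x) n1).1.
 have -> : enorm (G x) ^+ 2 = F (enorm x) ^+ 2 * enorm (Phi x) ^+ 2 +
 2 * F (enorm x) * phi x * g (enorm x) * phir x + phi x ^+ 2 * g (enorm x) ^+ 2.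
 by rewrite [in LHS]sqr_enorm GxE// (frame_dotp _ _ (Phi x) n1).2 -sqr_enorm; ring.
 have E1 : g (enorm x) `^ (p - 2) = g (enorm x) `^ (p - 4) * g (enorm x) ^+ 2.
 by rewrite (@powR_mul_sqr _ _ _ (p - 2))//; ring.
 have E2 : g (enorm x) `^ (p - 1) = g (enorm x) `^ (p - 2) * g (enorm x).
 by rewrite (@powR_mul_id _ _ _ (p - 1))//; ring.
 have E3 : g (enorm x) `^ p = g (enorm x) `^ (p - 2) * g (enorm x) ^+ 2.
 by rewrite (@powR_mul_sqr _ _ _ p)//; ring.
 have E4 : F (enorm x) `^ p = F (enorm x) `^ (p - 2) * F (enorm x) ^+ 2.
 by rewrite (@powR_mul_sqr _ _ _ p)//; ring.
 have uE : u x = phi x * F (enorm x) by rewrite /phi divfK// gt_eqF.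
 rewrite (second_variation_integrand _ _ _ _ _ (lt0r_neq0 g0) E1) E4 E3 E2 uE; ring.
Qed.

Theorem second_variation_gt0 : q < p + gap_constant^-1 -> grad u = G -> nonzero u ->
 0 < D2Q p q alpha v u.
move=> qgap GE nu; have T0 := phi_neq0 nu; have lam0 := profile_lam hP.
have p0 : 0 < p by have := p2; lra.
rewrite /D2Q; cbv zeta; rewrite GE I1 I3 AE.
have Tr0 : 0 <= \int[leb]_(x in Omega) (phir x ^+ 2 * (g (enorm x) `^ (p - 2) * F (enorm x) ^+ 2)).
 by apply: Rintegral_ge0 => x _; rewrite mulr_ge0 ?sqr_ge0// mulr_ge0 ?powR_ge0 ?sqr_ge0.
have j1 := intgZ (p - 2) mO iTr.
have j2 := intgZ (p - 1) mO (intgD mO i1 i3).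
rewrite (RintegralD mO (intgD mO iT j1) j2) (RintegralD mO iT j1).
rewrite (RintegralZl _ mO iTr) (RintegralZl _ mO (intgD mO i1 i3)) (RintegralD mO i1 i3).
rewrite -energy_identity -/T.
have JT := energy_le.
move: JT Tr0; set J := \int[leb]_(x in Omega) (phi x ^+ 2 * _).
set Tr := \int[leb]_(x in Omega) (phir x ^+ 2 * _); set S := \int[leb]_(x in Omega) _ => JT Tr0.
have -> : lam^-1 `^ (- (p / q) - 1) = lam^-1 `^ (- (p / q)) * lam.
 rewrite powRD; last by rewrite invr_eq0 (gt_eqF lam0) implybT.
 by rewrite powR_inv1 ?invrK// invr_ge0 ltW.
have P0 : 0 < lam^-1 `^ (- (p / q)) by rewrite powR_gt0// invr_gt0.
(* The squared integral enters through its sign alone. *)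
have S0 : 0 <= (q - p) * lam^-1 `^ (- (p / q) - 2) * S ^+ 2.
 by rewrite mulr_ge0 ?sqr_ge0// mulr_ge0 ?powR_ge0// subr_ge0 ltW.
have gap0 := gap_constant_gt0.
have h1 : (q - p) * (lam * J) < T.
 apply: (@le_lt_trans _ _ ((q - p) * (gap_constant * T))).
 by rewrite ler_wpM2l// subr_ge0 ltW.
 rewrite mulrA -[ltRHS]mul1r ltr_pM2r// -ltr_pdivlMr// mul1r ltrBlDl.
 exact: qgap.
rewrite mulr_gt0//.
have h2 : 0 <= (p - 2) * Tr by rewrite mulr_ge0// subr_ge0.
have h3 : 0 < lam^-1 `^ (- (p / q)) * (T + (p - 2) * Tr - (q - p) * (lam * J)).
 by rewrite mulr_gt0//; lra.
move: h3 S0; set P := _ `^ (- (p / q)); set S2 := (q - p) * _ * _ ^+ 2 => h3 S0.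
(* The terms (p - 1) lam J and -(q - 1) lam J combine to -(q - p) lam J, which T dominates for q
   close to p. *)
have -> : P * (T + (p - 2) * Tr + (p - 1) * (lam * J)) + S2 - (q - 1) * (P * lam) * J =
 P * (T + (p - 2) * Tr - (q - p) * (lam * J)) + S2 by ring.
by rewrite ltr_pwDl.
Qed.

End quotient.

Theorem theorem3 (R : realType) (n : nat) (p : R) :
  (3 <= n)%N -> 2 <= p -> p < n%:R ->
  exists2 q_loc : R, p < q_loc &
    forall q : R, p < q -> q < q_loc ->
    exists alpha0 : R, forall alpha : R, 0 < alpha -> alpha0 < alpha ->
    forall v : 'rV[R]_n -> R, normalized_positive_minimizer p q alpha v ->
    forall g : 'rV[R]_n -> R, space_W g -> nonzero g ->
      0 < D2Q p q alpha v g.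
Proof.
move=> n3 p2 pn; have n_gt0 : (0 < n)%N by exact: leq_trans n3.
have mO := @measurable_unit_ball R n.
exists (p + (gap_constant n p)^-1); first by rewrite ltrDl invr_gt0 gap_constant_gt0.
move=> q pq qg; have [a0 ha] := radial_profile n_gt0 p2 pq.
exists a0 => alpha al0 aa v npm u [Wu mean_u] nu.
have [lam [F [g hP]]] := ha alpha al0 aa v npm.
have [[[Wv _] _ _] _ _] := npm.
have p1 : 1 <= p by lra.
have le12 : 1 <= 2 :> R by lra.
have [mv _ _ [mGv _ _] _] := W1P p1 Wv.
have [mu iu2 iu wu [iG2 iG]] := W1P le12 Wu.
have sqrE (a : R) : `|a| `^ 2 = a ^+ 2 by rewrite powR_mulrn ?normr_ge0// real_normK// num_real.
have {}iu2 : int_ball R n (fun x => u x ^+ 2).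
 by rewrite (_ : (fun x => _) = (fun x => `|u x| `^ 2))//; apply/funext => x; rewrite sqrE.
have {}iG2 (i : 'I_n) : int_ball R n (fun x => grad u x ord0 i ^+ 2).
 apply: (intg_le mO _ iG2).
 by apply: measurable_funX; exact: integrable_mfun (iG i).
 move=> x _; rewrite ger0_norm ?sqr_ge0// -sqrE powR_mulrn ?normr_ge0// powR_mulrn ?enorm_ge0//.
 by rewrite ler_pXn2r ?nnegrE ?enorm_ge0// coord_le_enorm.
exact: (second_variation_gt0 n3 p2 pq al0 hP iu iu2 wu iG iG2 (smean_eq0 n_gt0 iu mean_u) mv mGv qg erefl nu).
Qed.
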